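(* Let $\zeta^W_{SU(3)}(s)=\sum_{\rho\in\widehat{SU(3)}}\deg(\rho)^{-s}$ be the Witten zeta function of $SU(3)$, continued meromorphically to $\mathbf C$. Then $\zeta^W_{SU(3)}(s)=0$ for $s=-1,-2,-3,\dots$.
   Context: $\widehat{SU(3)}$ denotes the set of equivalence classes of irreducible (finite-dimensional, complex) unitary representations of the compact Lie group $SU(3)$ and $\deg(\rho)$ is the dimension of $\rho$. Equivalently, for $\Re(s)$ large, $\zeta^W_{SU(3)}(s)=2^s\sum_{m,n\ge1}m^{-s}n^{-s}(m+n)^{-s}$; this series has a meromorphic continuation to the whole complex plane, and the values at negative integers refer to this continuation. *)

(* Defs.v *)
From HB Require Import structures.
From mathcomp Require Import all_boot all_order all_algebra finmap complex.
From mathcomp Require Import all_classical all_reals all_analysis.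

Set Implicit Arguments.
Unset Strict Implicit.
Unset Printing Implicit Defensive.

Import Order.TTheory GRing.Theory Num.Theory.
Import numFieldNormedType.Exports.

Local Open Scope classical_set_scope.
Local Open Scope ring_scope.
Local Open Scope quotient_scope.

Section ComplexAnalysis.
Variable K : numFieldType.
Implicit Types (f g : K -> K) (z : K).

(* [derivable f w 1] is the existence of the limit of (f (w + h) - f w) / h as
   h tends to 0 in K, i.e. complex differentiability when K = R[i]. *)
Definition holomorphic_at f z : Prop := \forall w \near z, derivable f w 1.

(* The value of f at z itself is unconstrained. *)
Definition meromorphic_at f z : Prop :=
  exists k : nat, exists2 g : K -> K, holomorphic_at g z &
    \forall w \near z^', f w = g w / (w - z) ^+ k.

Definition meromorphic f : Prop := forall z, meromorphic_at f z.

(* Unordered summation: convergence along the finite subsets of I. *)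
Definition has_sum (I : choiceType) (u : I -> K) (l : K) : Prop :=
  forall e : K, 0 < e -> exists A0 : {fset I},
    forall A : {fset I}, (A0 `<=` A)%fset -> `|\sum_(i <- A) u i - l| < e.

End ComplexAnalysis.

Section Representations.
Variable C : numClosedFieldType.

Definition SU3 : set 'M[C]_3 := [set g | g \is unitarymx /\ \det g = 1].

(* A function on all 3 x 3 matrices, of which only the restriction to SU3 is
   meaningful; the representation space is C^d with its standard Hermitian
   product, on which rho g acts by v |-> rho g *m v. *)
Record unitary_rep (d : nat) (rho : 'M[C]_3 -> 'M[C]_d) : Prop := UnitaryRep {
  unitary_rep_unitary : forall g, SU3 g -> rho g \is unitarymx;
  unitary_repM : forall g h, SU3 g -> SU3 h -> rho (g *m h) = rho g *m rho h;
  unitary_rep_continuous : {within SU3, continuous rho} }.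

Definition irreducible_rep (d : nat) (rho : 'M[C]_3 -> 'M[C]_d) : Prop :=
  (0 < d)%N /\
  forall W : {vspace 'cV[C]_d},
    (forall g v, SU3 g -> v \in W -> rho g *m v \in W) ->
    W = 0%VS \/ W = fullv.

Record irrep : Type := Irrep {
  degree : nat;
  irrep_fun :> 'M[C]_3 -> 'M[C]_degree;
  irrep_unitary : unitary_rep irrep_fun;
  irrep_irreducible : irreducible_rep irrep_fun }.

HB.instance Definition _ := gen_eqMixin irrep.
HB.instance Definition _ := gen_choiceMixin irrep.

(* Existence of an invertible intertwiner P, with inverse Q. *)
Definition irrep_equiv (r1 r2 : irrep) : Prop :=
  exists P : 'M[C]_(degree r1, degree r2),
  exists Q : 'M[C]_(degree r2, degree r1),
    [/\ P *m Q = 1%:M, Q *m P = 1%:M &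
        forall g, SU3 g -> r1 g *m P = P *m r2 g].

Lemma irrep_equiv_refl r : irrep_equiv r r.
Proof.
exists 1%:M, 1%:M; split; rewrite ?mulmx1// => g _.
by rewrite mulmx1 mul1mx.
Qed.

Lemma irrep_equiv_sym r1 r2 : irrep_equiv r1 r2 -> irrep_equiv r2 r1.
Proof.
move=> [P [Q [PQ QP PE]]]; exists Q, P; split=> // g Gg.
by rewrite -[LHS]mul1mx -QP -mulmxA (mulmxA P) -PE// -mulmxA PQ mulmx1.
Qed.

Lemma irrep_equiv_trans r2 r1 r3 :
  irrep_equiv r1 r2 -> irrep_equiv r2 r3 -> irrep_equiv r1 r3.
Proof.
move=> [P [Q [PQ QP PE]]] [P' [Q' [PQ' QP' PE']]].
exists (P *m P'), (Q' *m Q); split.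
- by rewrite mulmxA -(mulmxA P) PQ' mulmx1.
- by rewrite mulmxA -(mulmxA Q') QP mulmx1.
- by move=> g Gg; rewrite mulmxA PE// -mulmxA PE'// mulmxA.
Qed.

Lemma irrep_equiv_degree r1 r2 : irrep_equiv r1 r2 -> degree r1 = degree r2.
Proof.
move=> [P [Q [PQ QP _]]]; apply/eqP.
by rewrite eqn_leq (mulmx1_min PQ) (mulmx1_min QP).
Qed.

Definition irrep_equivb (r1 r2 : irrep) : bool := `[< irrep_equiv r1 r2 >].

Lemma irrep_equivb_is_equiv : equiv_class_of irrep_equivb.
Proof.
split=> [r|r1 r2|r2 r1 r3]; rewrite /irrep_equivb.
- exact/asboolP/irrep_equiv_refl.
- by apply/asboolP/asboolP; apply: irrep_equiv_sym.
- by move=> /asboolP h /asboolP h'; apply/asboolP; apply: irrep_equiv_trans h'.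
Qed.

Canonical irrep_equiv_rel := EquivRelPack irrep_equivb_is_equiv.

Definition SU3_dual : choiceType := {eq_quot irrep_equivb}.

Definition deg (c : SU3_dual) : nat := degree (repr c).

Lemma deg_pi (r : irrep) : deg (\pi_SU3_dual r) = degree r.
Proof.
apply: irrep_equiv_degree; apply/asboolP; rewrite -/(irrep_equivb _ _).
by apply/eqmodP; rewrite reprK.
Qed.

End Representations.

Section WittenZeta.
Variable R : realType.

Definition expC (z : R[i]) : R[i] :=
  let: Complex x y := z in Complex (expR x * cos y) (expR x * sin y).

(* n ^ s for an integer n > 0, through the real logarithm of n. *)
Definition natpowC (n : nat) (s : R[i]) : R[i] :=
  expC (s * (ln n%:R)%:C%C).

(* F is the meromorphic continuation to the whole plane of the Dirichlet series
   attached to the degrees; by the identity theorem F is unique away from its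
   poles and removable singularities. *)
Definition is_witten_zeta_SU3 (F : R[i] -> R[i]) : Prop :=
  @meromorphic R[i] F /\
  exists a : R, forall s : R[i], a < complex.Re s ->
    @has_sum R[i] (SU3_dual R[i]) (fun rho => natpowC (deg rho) (- s)) (F s).

End WittenZeta.

(* Main.v *)
(** Averages over finite subsets of SU(3), weighted by powers of the class function (3 + Re tr g) / 6 that
    peaks at 1, show that every irreducible representation rho occurs in a tensor product of copies of C^3
    and of its dual. The projection onto rho then commutes with GL_3, so the diagonal coefficient of rho at
    a vector of lowest height is polynomial in g and determined by the LDU decomposition: up to a scalar it
    is g00^p conj(g22)^q. Hence rho is determined by (p, q), and its degree (p + 1)(q + 1)(p + q + 2) / 2 is
    the number of monomials of bidegree (p, q) modulo x0 y0 + x1 y1 + x2 y2.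

    Write P x = |x|^-s for integers x <> 0, and P 0 = 0. Sorting by parity, for Re s >= 2,
      sum_(h > 0) sum_(x in Z) (-1)^x P (2h) P x P (2h - x)
        = (2^(2 - 3s) - 1) sum_(m, n > 0) (m n (m + n))^-s.
    The alternating sum over x exists as an Abel sum for every s. Subtracting from P x P (2h - x) the first
    terms of its expansions at x = 0 and x = 2h leaves a function theta whose Abel sum decays in h, so that
    its sum over h is analytic; the subtracted terms contribute finitely many products
    2 c_2j(s) H_2j(s) Z(2s + 2j), where c_k(s) is a binomial coefficient, H_k(s) is the Abel sum of x^k P x,
    and Z continues the sum of (2h)^-z. This continues the left-hand side to C.

    At s = -N, theta is the polynomial -(x (2h - x))^N, whose Abel sum is 0. If N is even, x^2j P x is a
    polynomial too, so H_2j(-N) = 0; if N is odd, either 2j > N and c_2j(-N) = 0, or 2N - 2j is positive and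
    even and Z(2j - 2N) = 0 for the same reason. *)

Require Import Defs.
From mathcomp Require Import all_boot all_order all_algebra all_solvable all_field finmap complex.
From mathcomp Require Import all_classical all_reals all_analysis.
From mathcomp Require Import ring lra zify.

Set Implicit Arguments.
Unset Strict Implicit.
Unset Printing Implicit Defensive.

Import Order.TTheory GRing.Theory Num.Theory.
Import numFieldNormedType.Exports ComplexField.Normc.

Local Open Scope classical_set_scope.
Local Open Scope ring_scope.
Local Open Scope quotient_scope.
Local Open Scope sesquilinear_scope.

(** * Finite averages over SU(3) *)

(** The sign (-1)^x keeps the poles few: differencing multiplies an alternating sum over the
    integers by a constant and makes the terms summable, so growth at infinity does no harm and
    every H_k is entire. Poles can come only from the explicit denominators 2^(2 - 3s) - 1 and 2 -
    2^(2s + 2j). Restricting to even 2h makes the sign invariant under x -> 2h - x, so that the two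
    singular points x = 0 and x = 2h contribute equally, and the H_k with k odd vanish by parity.
    The price is the factor 2^(2 - 3s) - 1. The number of subtracted terms has to grow with |s|, so
    the continuation is patched from formulas on growing discs that agree where several apply. A
    zero is meaningful only where the function is holomorphic, hence the check that no denominator
    vanishes at -N: 4 * 8^N is not 1, and 2 is not a power of 4. On the group side, one diagonal
    coefficient at a nonzero vector determines an irreducible representation up to equivalence,
    because it determines all inner products along the orbit of that vector. *)

Section CColumns.
Variable R : realType.
Local Notation C := R[i].
Local Notation Re := (@complex.Re R).

Lemma normcE' (z : C) : `|z| = (normc z)%:C%C.
Proof. by case: z. Qed.

Lemma normc_ge0 (z : C) : 0 <= normc z.
Proof. by case: z => a b; rewrite sqrtr_ge0. Qed.

Lemma normcD (z w : C) : normc (z + w) <= normc z + normc w.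
Proof. exact: le_normcD. Qed.

Lemma normc_sum (I : Type) (r : seq I) (P : pred I) (F : I -> C) :
  normc (\sum_(i <- r | P i) F i) <= \sum_(i <- r | P i) normc (F i).
Proof.
elim/big_rec2: _ => [|i x y _ le]; first by rewrite normc0.
by rewrite (le_trans (normcD _ _))// lerD2l.
Qed.

Lemma normcX (z : C) n : normc (z ^+ n) = normc z ^+ n.
Proof. by elim: n => [|n IH]; rewrite ?expr0 ?normc1// !exprS normcM IH. Qed.

Lemma normc_real (x : R) : normc x%:C%C = `|x|.
Proof. by rewrite /= expr0n addr0 sqrtr_sqr. Qed.

Lemma normc_nat n : normc (n%:R : C) = n%:R.
Proof. by rewrite -(rmorph_nat (real_complex R)) normc_real ger0_norm. Qed.

Lemma normc_conj (z : C) : normc z^* = normc z.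
Proof. by case: z => a b /=; rewrite sqrrN. Qed.

Lemma normcN' (z : C) : normc (- z) = normc z.
Proof. exact: normcN. Qed.

Lemma normc_eq0 (z : C) : (normc z == 0) = (z == 0).
Proof. by apply/eqP/eqP => [/eq0_normc//|->]; rewrite normc0. Qed.

Lemma sqr_normcE (z : C) : z^* * z = ((normc z) ^+ 2)%:C%C.
Proof. by rewrite rmorphXn /= -normcE' mulrC -sqr_normc. Qed.

Lemma Re_le_normc (z : C) : `|Re z| <= normc z.
Proof. by rewrite -lecR -normcE' normc_ge_Re. Qed.

Definition nsq n (v : 'cV[C]_n) : R := \sum_i normc (v i 0) ^+ 2.

Definition dotc n (v u : 'cV[C]_n) : C := (v^t* *m u) 0 0.

Lemma dotcE n (v u : 'cV[C]_n) : dotc v u = \sum_i (v i 0)^* * u i 0.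
Proof. by rewrite /dotc mxE; apply: eq_bigr => i _; rewrite !mxE. Qed.

Lemma dotcvv n (v : 'cV[C]_n) : dotc v v = (nsq v)%:C%C.
Proof.
rewrite dotcE /nsq rmorph_sum; apply: eq_bigr => i _ /=; exact: sqr_normcE.
Qed.

Lemma nsq_ge0 n (v : 'cV[C]_n) : 0 <= nsq v.
Proof. by apply: sumr_ge0 => i _; rewrite exprn_ge0 ?normc_ge0. Qed.

Lemma nsq0P n (v : 'cV[C]_n) : nsq v = 0 -> v = 0.
Proof.
move/eqP; rewrite psumr_eq0 => [/allP h|i _]; last by rewrite exprn_ge0 ?normc_ge0.
apply/colP => i; rewrite mxE; apply/eqP; rewrite -normc_eq0 -sqrf_eq0.
by apply: h; rewrite mem_index_enum.
Qed.

Lemma nsq0 n : nsq (0 : 'cV[C]_n) = 0.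
Proof. by rewrite /nsq big1// => i _; rewrite mxE normc0 expr0n. Qed.

Lemma nsqZ n (c : C) (v : 'cV[C]_n) : nsq (c *: v) = normc c ^+ 2 * nsq v.
Proof. by rewrite /nsq big_distrr; apply: eq_bigr => i _; rewrite mxE normcM exprMn. Qed.

Lemma nsqE n (v : 'cV[C]_n) : nsq v = Re (dotc v v).
Proof. by rewrite dotcvv. Qed.

Lemma dotcDl n (u v w : 'cV[C]_n) : dotc (u + v) w = dotc u w + dotc v w.
Proof. by rewrite /dotc linearD /= map_mxD mulmxDl mxE. Qed.
Lemma dotcDr n (u v w : 'cV[C]_n) : dotc w (u + v) = dotc w u + dotc w v.
Proof. by rewrite /dotc mulmxDr mxE. Qed.
Lemma dotcZl n a (u v : 'cV[C]_n) : dotc (a *: u) v = a^* * dotc u v.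
Proof. by rewrite /dotc linearZ /= map_mxZ -scalemxAl mxE. Qed.
Lemma dotcZr n a (u v : 'cV[C]_n) : dotc u (a *: v) = a * dotc u v.
Proof. by rewrite /dotc -scalemxAr mxE. Qed.
Lemma dotcNl n (u v : 'cV[C]_n) : dotc (- u) v = - dotc u v.
Proof. by rewrite -scaleN1r dotcZl rmorphN1 mulN1r. Qed.
Lemma dotcNr n (u v : 'cV[C]_n) : dotc u (- v) = - dotc u v.
Proof. by rewrite -scaleN1r dotcZr mulN1r. Qed.
Lemma dotcC n (u v : 'cV[C]_n) : dotc u v = (dotc v u)^*.
Proof.
rewrite !dotcE rmorph_sum; apply: eq_bigr => i _.
by rewrite rmorphM /= conjCK mulrC.
Qed.
Lemma dotc0r n (u : 'cV[C]_n) : dotc u 0 = 0.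
Proof. by rewrite /dotc mulmx0 mxE. Qed.

Lemma dotcMr n m (A : 'M[C]_(n, m)) u v : dotc u (A *m v) = dotc (A^t* *m u) v.
Proof. by rewrite /dotc trmx_mul map_mxM trmxCK mulmxA. Qed.

Lemma dotcMl n m (A : 'M[C]_(n, m)) u v : dotc (A *m u) v = dotc u (A^t* *m v).
Proof. by rewrite dotcMr trmxCK. Qed.

Lemma dotc_delta n (i : 'I_n) (v : 'cV[C]_n) : dotc (delta_mx i 0) v = v i 0.
Proof.
rewrite dotcE (bigD1 i)//= big1 ?addr0 => [|j ji]; rewrite !mxE eqxx.
  by rewrite eqxx rmorph1 mul1r.
by rewrite (negbTE ji) rmorph0 mul0r.
Qed.

Lemma unitary_mulVmx n (A : 'M[C]_n) : A \is unitarymx -> A^t* *m A = 1%:M.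
Proof. by move=> /unitarymxP h; apply: mulmx1C. Qed.

Lemma dotc_unitary n (A : 'M[C]_n) u v : A \is unitarymx ->
  dotc (A *m u) (A *m v) = dotc u v.
Proof. by move=> Au; rewrite dotcMr mulmxA unitary_mulVmx// mul1mx. Qed.

Lemma nsq_unitary n (A : 'M[C]_n) v : A \is unitarymx -> nsq (A *m v) = nsq v.
Proof. by move=> Au; rewrite !nsqE dotc_unitary. Qed.

Lemma nsq_parallelogram n (u v : 'cV[C]_n) :
  nsq (u + v) + nsq (u - v) = 2 * nsq u + 2 * nsq v.
Proof.
rewrite !nsqE !(dotcDl, dotcDr, dotcNl, dotcNr) !raddfD /=.
have ReN z : Re (- z : C) = - Re z by case: z.
by rewrite !ReN; move: (Re (dotc u u)) (Re (dotc u v)) (Re (dotc v u)) (Re (dotc v v)) => a b c d; lra.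
Qed.

Lemma nsqD_le n (u v : 'cV[C]_n) : nsq (u + v) <= 2 * (nsq u + nsq v).
Proof.
by have := nsq_parallelogram u v; have := nsq_ge0 (u - v); lra.
Qed.

Lemma sqr_sum_le (I : Type) (r : seq I) (F : I -> R) :
  (\sum_(i <- r) F i) ^+ 2 <= (size r)%:R * \sum_(i <- r) F i ^+ 2.
Proof.
elim: r => [|x r IH]; first by rewrite !big_nil expr0n mul0r.
rewrite !big_cons /= -natr1.
set S := \sum_(j <- r) F j in IH *; set T := \sum_(j <- r) _ in IH *.
have [r0|r0] := eqVneq (size r) 0%N.
  by move: r0 @S @T IH => /size0nil -> /=; rewrite !big_nil; nra.
have n0 : 0 < (size r)%:R :> R by rewrite ltr0n lt0n.
move: (size r)%:R n0 IH => m m0 IH.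
(* After multiplication by [m] the gap in the inductive step is the square of [m * F x - S]. *)
rewrite -(ler_pM2l m0); have := sqr_ge0 (m * F x - S); nra.
Qed.

Lemma sum_const_seq (V : pzRingType) (I : Type) (r : seq I) (x : V) :
  \sum_(i <- r) x = (size r)%:R * x.
Proof. by rewrite big_const_seq count_predT iter_addr_0 mulr_natl. Qed.

Lemma nsq_sum_le n (I : Type) (r : seq I) (F : I -> 'cV[C]_n) :
  nsq (\sum_(i <- r) F i) <= (size r)%:R * \sum_(i <- r) nsq (F i).
Proof.
rewrite /nsq exchange_big /= big_distrr /= ; apply: ler_sum => k _.
rewrite summxE (le_trans _ (sqr_sum_le _ _))//.
by rewrite lerXn2r ?nnegrE ?normc_ge0 ?sumr_ge0 ?normc_sum// => ? _; rewrite normc_ge0.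
Qed.

Lemma nsq_mul_le m n (A : 'M[C]_(m, n)) :
  exists2 K, 0 <= K & forall v, nsq (A *m v) <= K * nsq v.
Proof.
exists (n%:R * \sum_j nsq (col j A)).
  by rewrite mulr_ge0// sumr_ge0// => *; rewrite nsq_ge0.
move=> v; have -> : A *m v = \sum_j (v j 0) *: col j A.
  by apply/colP => i; rewrite mxE summxE; apply: eq_bigr => j _; rewrite !mxE mulrC.
rewrite (le_trans (nsq_sum_le _ _))// -mulrA.
rewrite {1}/index_enum -enumT size_enum_ord ler_wpM2l//.
rewrite big_distrl /=; apply: ler_sum => j _; rewrite nsqZ mulrC ler_wpM2l ?nsq_ge0//.
by rewrite /nsq (bigD1 j)//= lerDl sumr_ge0// => k _; rewrite exprn_ge0 ?normc_ge0.
Qed.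

Lemma nsq_entry n (v : 'cV[C]_n) i : normc (v i 0) ^+ 2 <= nsq v.
Proof.
by rewrite /nsq (bigD1 i)//= lerDl sumr_ge0// => k _; rewrite exprn_ge0 ?normc_ge0.
Qed.

End CColumns.

Lemma expr_small (R : realType) (q e : R) : 0 <= q < 1 -> 0 < e -> exists n, q ^+ n <= e.
Proof.
move=> /andP[q0 q1] e0.
have /cvgrPdist_le/(_ e e0)[n _ h] := @cvg_expr R q ltac:(by rewrite ger0_norm).
by exists n; have := h n (leqnn n); rewrite sub0r normrN ger0_norm// exprn_ge0.
Qed.

Section Averaging.
Variable R : realType.
Local Notation C := R[i].
Implicit Types g h : 'M[C]_3.

Lemma SU3_1 : SU3 (1%:M : 'M[C]_3).
Proof. by split; rewrite ?det1//; apply/unitarymxP; rewrite trmx1 map_mx1 mulmx1. Qed.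

Lemma SU3M g h : SU3 g -> SU3 h -> SU3 (g *m h).
Proof.
move=> [gu gd] [hu hd]; split; first exact: mul_unitarymx.
by rewrite det_mulmx gd hd mulr1.
Qed.

Lemma SU3V g : SU3 g -> SU3 (g^t*).
Proof.
move=> [gu gd]; split; first by rewrite trmxC_unitary.
by rewrite det_map_mx det_tr gd rmorph1.
Qed.

Lemma SU3_mulV g : SU3 g -> g *m g^t* = 1%:M.
Proof. by move=> [/unitarymxP]. Qed.

Lemma SU3_Vmul g : SU3 g -> g^t* *m g = 1%:M.
Proof. by move=> [gu _]; rewrite unitary_mulVmx. Qed.

Variable (D : nat) (E : 'M[C]_3 -> 'M[C]_D).
(** The average over an empty list is zero, so a bound on [avgop] has content only for nonempty
    lists. *)
Definition avgop (l : seq 'M[C]_3) : 'M[C]_D := (size l)%:R^-1 *: \sum_(g <- l) E g.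

(** Ranks are bounded by [m], so some list attains the maximum. Enlarging that list cannot raise the
    rank any more, which lets a finite list stand in for the whole set [S]. *)
Lemma max_rank_list (m n : nat) (S : set 'M[C]_3) (M : seq 'M[C]_3 -> 'M[C]_(m, n)) :
  exists2 l, (forall g, g \in l -> S g) &
    forall l', (forall g, g \in l' -> S g) -> (\rank (M l') <= \rank (M l))%N.
Proof.
pose P k := `[< exists2 l, (forall g, g \in l -> S g) & \rank (M l) = k >].
have exP : exists k, P k by exists (\rank (M [::])); apply/asboolP; exists [::].
have ubP k : P k -> (k <= m)%N by move=> /asboolP[l _ <-]; rewrite rank_leq_row.
have [k /asboolP[l lS lk] kmax] := ex_maxnP exP ubP.
by exists l => // l' l'S; rewrite lk; apply: kmax; apply/asboolP; exists l'.
Qed.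

Hypothesis EM : forall g h, SU3 g -> SU3 h -> E (g *m h) = E g *m E h.
Hypothesis EU : forall g, SU3 g -> E g \is unitarymx.

Lemma unit_E1 : E 1%:M = 1%:M.
Proof.
have h := EM SU3_1 SU3_1; rewrite mulmx1 in h.
have := congr1 (mulmx ((E 1%:M)^t*)) h.
by rewrite mulmxA unitary_mulVmx ?mul1mx//; apply: EU; apply: SU3_1.
Qed.

Lemma unit_EV g : SU3 g -> E (g^t*) = (E g)^t*.
Proof.
move=> Sg; have := EM (SU3V Sg) Sg; rewrite SU3_Vmul// unit_E1.
move/(congr1 (mulmx^~ ((E g)^t*))); rewrite mul1mx -mulmxA => ->.
by move/unitarymxP: (EU Sg) => ->; rewrite mulmx1.
Qed.

Lemma avgopM l l' : (forall g, g \in l -> SU3 g) -> (forall g, g \in l' -> SU3 g) ->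
  avgop [seq g *m h | g <- l, h <- l'] = avgop l *m avgop l'.
Proof.
move=> lS l'S; rewrite /avgop size_allpairs natrM invfM.
rewrite -scalemxAl -scalemxAr scalerA; congr (_ *: _).
rewrite big_allpairs_dep mulmx_suml big_seq [RHS]big_seq; apply: eq_bigr => g gl.
rewrite mulmx_sumr big_seq [RHS]big_seq; apply: eq_bigr => h hl.
by rewrite EM//; [apply: lS | apply: l'S].
Qed.

Lemma nsq_avgop_le l v : (forall g, g \in l -> SU3 g) -> nsq (avgop l *m v) <= nsq v.
Proof.
move=> lS; case: (eqVneq (size l) 0%N) => [/size0nil ->|l0].
  by rewrite /avgop big_nil scaler0 mul0mx nsq0 nsq_ge0.
rewrite /avgop -scalemxAl nsqZ mulmx_suml normcV normc_nat.
rewrite exprVn ler_pdivrMl ?exprn_gt0 ?ltr0n ?lt0n//.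
rewrite (le_trans (nsq_sum_le _ _))//.
rewrite big_seq (eq_bigr (fun=> nsq v)); last first.
  by move=> g gl; rewrite nsq_unitary//; apply: EU; apply: lS.
by rewrite -big_seq sum_const_seq expr2 mulrA.
Qed.

Hypothesis E0 : forall v : 'cV[C]_D, (forall g, SU3 g -> E g *m v = v) -> v = 0 :> 'cV[C]_D.

(** The row space condition writes [A] as a combination of the [F g], and the parallelogram
    inequality bounds the combination. Taking [K] at least 1 allows division by it later. *)
Lemma sum_sub_nsq_bound (F : 'M[C]_3 -> 'M[C]_D) (l : seq 'M[C]_3) (A : 'M[C]_D) :
  (A <= \sum_(g <- l) <<F g>>)%MS ->
  exists2 K, 1 <= K & forall v : 'cV[C]_D, nsq (A *m v) <= K * \sum_(g <- l) nsq (F g *m v).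
Proof.
elim: l A => [|g l IH] A.
  rewrite big_nil submx0 => /eqP ->; exists 1 => // v.
  by rewrite mul0mx nsq0 mul1r big_nil.
rewrite big_cons => /sub_addsmxP [[u1 u2] /= ->].
have [B AB] : exists B, u1 *m <<F g>>%MS = B *m F g.
  have /submxP[B ->] : (u1 *m <<F g>> <= F g)%MS by rewrite (submx_trans (submxMl _ _))// genmxE.
  by exists B.
rewrite AB; have [K2 K20 K2v] := IH _ (submxMl u2 _).
have [K1 K10 K1v] := nsq_mul_le B.
exists (2 * (K1 + K2)); first by lra.
have {}K20 : 0 <= K2 by lra.
move=> v; rewrite mulmxDl (le_trans (nsqD_le _ _))// -mulrA ler_wpM2l//.
rewrite big_cons -mulmxA.
have := K1v (F g *m v); have := K2v v.
have : 0 <= \sum_(j <- l) nsq (F j *m v) by apply: sumr_ge0 => *; rewrite nsq_ge0.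
have := nsq_ge0 (F g *m v).
move: (nsq (F g *m v)) (\sum_(j <- l) _) => a b a0 b0 h1 h2.
have -> : (K1 + K2) * (a + b) = K1 * a + K1 * b + (K2 * a + K2 * b) by ring.
have := mulr_ge0 K10 b0; have := mulr_ge0 K20 a0; lra.
Qed.

(** The common kernel of all [E g - 1] is zero, so finitely many of them already have full joint row
    space. This is a spectral gap for a finite set of group elements. *)
Lemma no_fixed_bound : exists l : seq 'M[C]_3, exists K, [/\ forall g, g \in l -> SU3 g, 1 <= K &
  forall v, nsq v <= K * \sum_(g <- l) nsq (E g *m v - v)].
Proof.
pose M (l : seq 'M[C]_3) := (\sum_(g <- l) <<E g - 1%:M>>)%MS.
have [l lS lmax] := max_rank_list (@SU3 _) M.
have Mfull : row_full (M l).
  rewrite -cokermx_eq0; apply/eqP/matrixP => i j; rewrite mxE.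
  (* By maximality of the rank the rows of [E g - 1] lie in [M l] for every [g], so each column of
     the cokernel matrix is a fixed vector. *)
  suff : col j (cokermx (M l)) = 0 by move/colP/(_ i); rewrite !mxE.
  apply: E0 => g Sg; apply/eqP; rewrite -subr_eq0 -[X in _ - X]mul1mx -mulmxBl.
  have sub : (E g - 1%:M <= M l)%MS.
    have Mc : M (g :: l) = (<<E g - 1%:M>> + M l)%MS by rewrite /M big_cons.
    have le : (M l <= M (g :: l))%MS by rewrite Mc addsmxSr.
    have := mxrank_leqif_sup le; case=> le1 eq1.
    have gl : forall h, h \in g :: l -> SU3 h by move=> h; rewrite inE => /predU1P[->|/lS].
    have := lmax _ gl => le2.
    have : (M (g :: l) <= M l)%MS by rewrite -eq1 eqn_leq le1 le2.
    by apply: submx_trans; rewrite Mc (submx_trans _ (addsmxSl _ _))// genmxE.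
  by move/submxP: sub => [u ->]; rewrite colE mulmxA -(mulmxA u) mulmx_coker mulmx0 mul0mx.
have sub1 : (1%:M <= M l)%MS by rewrite sub1mx.
have [K K0 Kv] := sum_sub_nsq_bound sub1.
exists l, K; split=> // v; have := Kv v; rewrite mul1mx; congr (_ <= K * _).
by apply: eq_bigr => g _; rewrite mulmxBl mul1mx.
Qed.

(* Finite averages over the group take the place of Haar integration. *)
Lemma averaging (e : R) : 0 < e ->
  exists l : seq 'M[C]_3, [/\ forall g, g \in l -> SU3 g, l != [::] &
    forall v, nsq (avgop l *m v) <= e * nsq v].
Proof.
move=> e0; have [l [K [lS K1 Kv]]] := no_fixed_bound.
have K0 : 0 < K by lra.
(* The extra leading 1 keeps the list nonempty even when [l] is empty. *)
pose l1 := 1%:M :: flatten [seq [:: 1%:M; g] | g <- l].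
have l1S g : g \in l1 -> SU3 g.
  rewrite inE => /predU1P[->|/flatten_mapP[h hl]]; first exact: SU3_1.
  by rewrite !inE => /orP[/eqP ->|/eqP ->]; [exact: SU3_1|exact: lS].
have sz : size l1 = (size l).*2.+1.
  by rewrite /= ; congr _.+1; elim: (l) => //= x s ->; rewrite doubleS.
(* By the parallelogram law, each pair (1, g) gains |g v - v|^2. *)
have sumE v : \sum_(g <- l1) E g *m v = v + \sum_(g <- l) (v + E g *m v).
  rewrite big_cons unit_E1 mul1mx; congr (_ + _).
  by elim: (l) => [|g s IH]; rewrite /= ?big_nil// !big_cons IH unit_E1 mul1mx addrA.
(* The pairs lose half the sum of the |g v - v|^2, which is at least |v|^2 / (2 K); division by the
   list length N gives the contraction factor 1 - 1 / (2 N K). *)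
pose q : R := 1 - ((size l).*2.+1)%:R^-1 * K^-1 / 2.
have contr v : nsq (avgop l1 *m v) <= q * nsq v.
  rewrite /avgop -scalemxAl nsqZ mulmx_suml sumE normcV normc_nat sz.
  set N : R := _.*2.+1%:R; have N0 : 0 < N by rewrite ltr0n.
  rewrite exprVn ler_pdivrMl ?exprn_gt0//.
  pose F (x : option 'M[C]_3) := if x is Some g then v + E g *m v else v.
  (* Each pair is replaced by two copies of its mean. The sum then has N terms of comparable norm,
     and Cauchy-Schwarz over N terms does not waste the gain. *)
  have -> : v + \sum_(g <- l) (v + E g *m v) = v + \sum_(g <- l) ((2:C)^-1 *: (v + E g *m v) + (2:C)^-1 *: (v + E g *m v)).
    congr (_ + _); apply: eq_bigr => g _; rewrite -scalerDl.
    by rewrite -[X in (X + X) *: _]mul1r -mulrDl -mulr2n mulfV ?scale1r// pnatr_eq0.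
  pose s : seq 'cV[C]_D := v :: flatten [seq [:: (2:C)^-1 *: (v + E g *m v); (2:C)^-1 *: (v + E g *m v)] | g <- l].
  have <- : \sum_(x <- s) x = v + \sum_(g <- l) ((2:C)^-1 *: (v + E g *m v) + (2:C)^-1 *: (v + E g *m v)).
    rewrite big_cons; congr (_ + _).
    by elim: (l) => [|g t IH]; rewrite /= ?big_nil// !big_cons IH addrA.
  rewrite (le_trans (nsq_sum_le _ _))//.
  have -> : (size s)%:R = N.
    by congr (_%:R); congr _.+1; elim: (l) => //= x t ->; rewrite doubleS.
  rewrite expr2 -mulrA ler_wpM2l ?(ltW N0)// big_cons.
  have -> : \sum_(j <- flatten [seq [:: (2:C)^-1 *: (v + E g *m v); (2:C)^-1 *: (v + E g *m v)] | g <- l]) nsq j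
     = (size l)%:R * (2 * nsq v) - 2^-1 * \sum_(g <- l) nsq (E g *m v - v).
    elim: (l) lS => [|g t IH] lS; first by rewrite /= !big_nil mul0r mulr0 subr0.
    rewrite /= !big_cons IH; last by move=> h ht; apply: lS; rewrite inE ht orbT.
    rewrite !nsqZ normcV normc_nat -[(size t).+1%:R]natr1.
    have := nsq_parallelogram (E g *m v) v.
    have -> : nsq (E g *m v) = nsq v by rewrite nsq_unitary//; apply: EU; apply: lS; rewrite mem_head.
    rewrite [E g *m v + v]addrC; move: (nsq (v + _)) (nsq (E g *m v - v)) (nsq v) (\sum_(i <- t) _) (size t)%:R => a b c d x h.
    have -> : a = 4 * c - b by lra.
    rewrite expr2; lra.
  have -> : N * (q * nsq v) = N * nsq v - K^-1 * nsq v / 2.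
    by rewrite /q -/N; field; rewrite !gt_eqF.
  have NE : N = 2 * (size l)%:R + 1 by rewrite /N -natr1 -mul2n natrM.
  rewrite NE.
  have := Kv v; rewrite -ler_pdivrMl//.
  move: (\sum_(i <- l) _) (nsq v) (size l)%:R (K^-1 * _) => a b x y; lra.
have q0 : 0 <= q.
  have : ((size l).*2.+1)%:R^-1 * K^-1 <= 1 by rewrite mulr_ile1 ?invr_ge0 ?ler0n ?invf_le1 ?ler1n// ltW.
  rewrite /q; move: (_ * K^-1) => x; lra.
have q1 : q < 1 by rewrite ltrBlDr ltrDl !mulr_gt0 ?invr_gt0 ?ltr0n.
(* Averaging over a product list is the product of the averages, so the contraction can be
   iterated. *)
have qn n : exists l : seq 'M[C]_3, [/\ forall g, g \in l -> SU3 g, l != [::] &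
    forall v, nsq (avgop l *m v) <= q ^+ n * nsq v].
  elim: n => [|n [l2 [l2S l20 l2v]]].
    exists [:: 1%:M]; split=> // [g|v]; first by rewrite inE => /eqP ->; exact: SU3_1.
    by rewrite expr0 mul1r nsq_avgop_le// => g; rewrite inE => /eqP ->; exact: SU3_1.
  exists [seq g *m h | g <- l1, h <- l2]; split.
  - by move=> g /allpairsP[[x y] /= [/l1S xS /l2S yS ->]]; exact: SU3M.
  - by rewrite -size_eq0 size_allpairs muln_eq0 negb_or !size_eq0 l20.
  - move=> v; rewrite avgopM// -mulmxA (le_trans (contr _))// exprS -mulrA.
    by rewrite ler_wpM2l.
have [n qe] : exists n, q ^+ n <= e.
  by apply: expr_small => //; rewrite q0.
have [l2 [l2S l20 l2v]] := qn n; exists l2; split=> // v.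
by rewrite (le_trans (l2v v))// ler_wpM2r ?nsq_ge0.
Qed.
End Averaging.

Section FinMatrix.
Variables (R : pzRingType) (X : finType).
Definition fmx (A : X -> X -> R) : 'M[R]_#|X| :=
  \matrix_(i, j) A (enum_val i) (enum_val j).

Lemma fmxM (A B : X -> X -> R) :
  fmx A *m fmx B = fmx (fun x z => \sum_y A x y * B y z).
Proof.
apply/matrixP => i j; rewrite !mxE.
rewrite (reindex (@enum_val X X)) /=; last exact: onW_bij (@enum_val_bij _).
by apply: eq_bigr => k _; rewrite !mxE.
Qed.

Lemma fmx1 : fmx (fun x y => (x == y)%:R) = 1%:M.
Proof. by apply/matrixP => i j; rewrite !mxE (inj_eq enum_val_inj). Qed.

Lemma eq_fmx A B : (forall x y, A x y = B x y) -> fmx A = fmx B.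
Proof. by move=> AB; apply/matrixP => i j; rewrite !mxE AB. Qed.
End FinMatrix.

(** * Tensor products of copies of C^3 and of its dual *)

Section Slots.
Variable R : realType.
Local Notation C := R[i].
Local Notation Re := (@complex.Re R).
Implicit Types g h : 'M[C]_3.

(* [cof g] is the conjugate of g on SU3, but also makes sense, and is multiplicative, on GL_3. *)
Definition cof g : 'M[C]_3 := (\adj g)^T.
Definition slot (b : bool) g : 'M[C]_3 := if b then cof g else g.

Lemma cofE g : g \in unitmx -> cof g = \det g *: (invmx g)^T.
Proof.
move=> gU; by rewrite /cof /invmx gU linearZ /= scalerA mulfV ?scale1r// -unitfE -unitmxE.
Qed.

Lemma cofM g h : g \in unitmx -> h \in unitmx -> cof (g *m h) = cof g *m cof h.
Proof.
move=> gU hU; rewrite !cofE ?unitmx_mul ?gU ?hU// det_mulmx.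
have -> : invmx (g *m h) = invmx h *m invmx g.
  apply: (@row_full_inj _ _ _ _ (g *m h)); first by rewrite row_full_unit unitmx_mul gU.
  by rewrite mulmxV ?unitmx_mul ?gU// mulmxA -(mulmxA g) mulmxV// mulmx1 mulmxV.
by rewrite trmx_mul -scalemxAl -scalemxAr scalerA.
Qed.

Lemma slotM b g h : g \in unitmx -> h \in unitmx -> slot b (g *m h) = slot b g *m slot b h.
Proof. by case: b => //; exact: cofM. Qed.

Lemma slot1 b : slot b 1%:M = 1%:M.
Proof. by case: b => //; rewrite /slot cofE ?unitmx1// det1 scale1r invmx1 trmx1. Qed.

Lemma cof_tr g : cof (g^t*) = (cof g)^t*.
Proof. by rewrite /cof -map_mx_adj -trmx_adj map_trmx. Qed.

Lemma slot_tr b g : slot b (g^t*) = (slot b g)^t*.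
Proof. by case: b => //; exact: cof_tr. Qed.

Lemma SU3_unit g : SU3 g -> g \in unitmx.
Proof. by move=> [gu _]; exact: unitarymx_unit. Qed.

Lemma cof_SU3 g : SU3 g -> cof g = g ^ Num.conj.
Proof.
move=> Sg; rewrite cofE ?SU3_unit//; case: Sg => gu ->.
by rewrite scale1r invmx_unitary// map_trmx trmxK.
Qed.

Definition word m := {ffun 'I_m -> 'I_3}.
Definition pattern m := {ffun 'I_m -> bool}.

Lemma word_neq m (I J : word m) : I != J -> exists k, I k != J k.
Proof.
move=> IJ; apply/existsP; rewrite -[X in is_true X]negbK negb_exists.
by apply: contraNN IJ => /forallP e; apply/eqP/ffunP => k; apply/eqP; rewrite -[_ == _]negbK.
Qed.

(** Matrix entry of [g] on an m-fold tensor product, whose k-th factor is the dual of C^3 when [s k]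
    is true. A word is a basis vector of that product. *)
Definition tens m (s : pattern m) g (I J : word m) : C :=
  \prod_k slot (s k) g (I k) (J k).

Lemma tens_mul m (s : pattern m) g h I K : g \in unitmx -> h \in unitmx ->
  tens s (g *m h) I K = \sum_J tens s g I J * tens s h J K.
Proof.
move=> gU hU; rewrite /tens.
under eq_bigr do rewrite slotM// mxE.
rewrite bigA_distr_bigA /=; apply: eq_bigr => J _; exact: big_split.
Qed.

Lemma tens1 m (s : pattern m) I J : tens s 1%:M I J = (I == J)%:R.
Proof.
rewrite /tens; under eq_bigr do rewrite slot1 mxE.
have [->|IJ] := eqVneq I J; first by rewrite big1// => k _; rewrite eqxx.
have [k Ik] := word_neq IJ.
by rewrite (bigD1 k)//= (negbTE Ik) mul0r.
Qed.

Lemma tens_tr m (s : pattern m) g I J : tens s (g^t*) I J = (tens s g J I)^*.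
Proof.
by rewrite /tens rmorph_prod; apply: eq_bigr => k _; rewrite slot_tr !mxE.
Qed.

End Slots.

Lemma nsq_delta (R : realType) n (j : 'I_n) : nsq (delta_mx j 0 : 'cV[R[i]]_n) = 1.
Proof.
rewrite /nsq (bigD1 j)//= big1 ?addr0 => [|k kj]; first by rewrite mxE !eqxx normc1 expr1n.
by rewrite mxE (negbTE kj) normc0 expr0n.
Qed.

Lemma nsqB (R : realType) n (u v : 'cV[R[i]]_n) :
  nsq (u - v) = nsq u + nsq v - 2 * complex.Re (dotc v u).
Proof.
have ReN (z : R[i]) : complex.Re (- z) = - complex.Re z by case: z.
have ReJ (z : R[i]) : complex.Re (z^*) = complex.Re z by case: z.
have ReD (z w : R[i]) : complex.Re (z + w) = complex.Re z + complex.Re w by case: z; case: w.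
rewrite !nsqE dotcDl !dotcDr !dotcNl !dotcNr opprK [dotc u v]dotcC !ReD !ReN ReJ.
by move: (complex.Re (dotc v u)) (complex.Re (dotc u u)) (complex.Re (dotc v v)) => a b c; lra.
Qed.

(** * Occurrence of a representation in a tensor product *)

Section Occurs.
Variable R : realType.
Local Notation C := R[i].
Local Notation Re := (@complex.Re R).
Implicit Types g h : 'M[C]_3.
Variables (d : nat) (rho : 'M[C]_3 -> 'M[C]_d).
Hypothesis d_gt0 : (0 < d)%N.
Hypothesis rhoU : unitary_rep rho.

Let rhoM g h : SU3 g -> SU3 h -> rho (g *m h) = rho g *m rho h.
Proof. exact: (unitary_repM rhoU). Qed.

Let rho_unitary g : SU3 g -> rho g \is unitarymx.
Proof. exact: (unitary_rep_unitary rhoU). Qed.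

Let rhoV g : SU3 g -> rho (g^t*) = (rho g)^t*.
Proof. exact: (unit_EV rhoM rho_unitary). Qed.

(** The conjugate of [rho g] is the matrix of the dual representation. Hence a fixed vector of this
    tensor product is the same thing as an intertwiner from [rho] to [tens s]. *)
Definition tensrep m (s : pattern m) g : 'M[C]_#|{: word m * 'I_d}| :=
  fmx (fun x y : word m * 'I_d => tens s g x.1 y.1 * (rho g x.2 y.2)^*).

Lemma tensrepM m (s : pattern m) g h : SU3 g -> SU3 h ->
  tensrep s (g *m h) = tensrep s g *m tensrep s h.
Proof.
move=> Sg Sh; rewrite /tensrep fmxM; apply: eq_fmx => -[I i] [K k] /=.
rewrite rhoM// tens_mul ?SU3_unit// mxE rmorph_sum big_distrlr /= pair_bigA /=.
by apply: eq_bigr => -[J j] _ /=; rewrite rmorphM /= mulrACA.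
Qed.

Lemma tensrep1 m (s : pattern m) : tensrep s 1%:M = 1%:M.
Proof.
rewrite /tensrep -fmx1; apply: eq_fmx => -[I i] [K k] /=.
rewrite tens1 (unit_E1 rhoM rho_unitary) mxE rmorph_nat -natrM mulnb.
by rewrite -xpair_eqE.
Qed.

Lemma tensrepU m (s : pattern m) g : SU3 g -> tensrep s g \is unitarymx.
Proof.
move=> Sg; apply/unitarymxP; transitivity (tensrep s (g *m g^t*)); last by rewrite SU3_mulV// tensrep1.
rewrite (tensrepM s Sg (SU3V Sg)).
congr (_ *m _); apply/matrixP => i j; rewrite !mxE rmorphM /= conjCK tens_tr.
by rewrite rhoV// !mxE conjCK.
Qed.

Definition intertw m (s : pattern m) (t : word m -> 'I_d -> C) :=
  forall g, SU3 g -> forall I i,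
    \sum_J tens s g I J * t J i = \sum_j t I j * rho g j i.

(** The fixed-point equation is multiplied by [rho g] on the right, and orthonormality of the
    columns of [rho g] removes the conjugate factor. *)
Lemma tensrep_fixed m (s : pattern m) (v : 'cV_#|{: word m * 'I_d}|) :
  (forall g, SU3 g -> tensrep s g *m v = v) ->
  intertw s (fun I i => v (enum_rank (I, i)) 0).
Proof.
move=> vE g Sg I i.
have e J j : v (enum_rank (J, j)) 0 = \sum_K \sum_k tens s g J K * (rho g j k)^* * v (enum_rank (K, k)) 0.
  rewrite -[in LHS](vE _ Sg) mxE (reindex enum_rank) /=; last exact: onW_bij (enum_rank_bij _).
  by rewrite pair_bigA; apply: eq_bigr => -[K k] _; rewrite !mxE !enum_rankK.
under [RHS]eq_bigr do rewrite e mulr_suml.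
rewrite exchange_big /=; apply: eq_bigr => J _.
under [RHS]eq_bigr do rewrite mulr_suml.
rewrite exchange_big /= (bigD1 i)//= [X in _ + X]big1 ?addr0 => [|k ki].
  have : \sum_j (rho g j i)^* * rho g j i = 1.
    have := unitary_mulVmx (rho_unitary Sg) => /matrixP/(_ i i); rewrite !mxE eqxx mulr1n => <-.
    by apply: eq_bigr => j _; rewrite !mxE.
  move=> e1; rewrite -[LHS]mulr1 -e1 mulr_sumr; apply: eq_bigr => j _; ring.
have : \sum_j (rho g j k)^* * rho g j i = 0.
  have /matrixP/(_ k i) h := unitary_mulVmx (rho_unitary Sg).
  rewrite !mxE (negbTE ki) mulr0n in h; rewrite -[RHS]h.
  by apply: eq_bigr => j _; rewrite !mxE.
move=> e1; transitivity (tens s g I J * v (enum_rank (J, k)) 0 * \sum_j (rho g j k)^* * rho g j i).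
  by rewrite mulr_sumr; apply: eq_bigr => j _; ring.
by rewrite e1 mulr0.
Qed.

Hypothesis not_occurs : forall m (s : pattern m) t, intertw s t -> forall I i, t I i = 0.

(** Averages of unitaries never increase the norm, so multiplying the lists found for the single
    members gives one list that is good for all of them. *)
Lemma averaging_family (L : seq {m & pattern m}) (e : R) : 0 < e ->
  exists l : seq 'M[C]_3, [/\ forall g, g \in l -> SU3 g, l != [::] &
   forall x, x \in L -> forall v, nsq (avgop (tensrep (projT2 x)) l *m v) <= e * nsq v].
Proof.
move=> e0; elim: L => [|[m s] L [l2 [l2S l20 l2v]]].
  by exists [:: 1%:M]; split=> // g; rewrite inE => /eqP ->; exact: SU3_1.
have [|l1 [l1S l10 l1v]] := averaging (@tensrepM m s) (@tensrepU m s) _ e0.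
  move=> v /tensrep_fixed/not_occurs v0; apply/colP => i; rewrite mxE.
  by have := v0 (enum_val i).1 (enum_val i).2; rewrite -surjective_pairing enum_valK.
exists [seq g *m h | g <- l1, h <- l2]; split.
- by move=> g /allpairsP[[x y] /= [/l1S xS /l2S yS ->]]; exact: SU3M.
- by rewrite -size_eq0 size_allpairs muln_eq0 negb_or !size_eq0 l10.
- move=> x; rewrite inE => /predU1P[->|xL] v; rewrite avgopM//; try by [|apply: tensrepM].
    rewrite -mulmxA (le_trans (l1v _))// ler_wpM2l ?(ltW e0)//.
    by apply: nsq_avgop_le => //; exact: tensrepU.
  rewrite -mulmxA (le_trans _ (l2v _ xL v))//.
  by apply: nsq_avgop_le => //; exact: tensrepU.
Qed.

(* On SU3 the function [peak] takes its maximum 1 only at the identity, where its powers concentrate. *)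
Definition peak g : R := (3 + Re (\tr g)) / 6.
Definition rchar g : R := Re (\tr (rho g)).

Lemma peakE g : SU3 g -> (peak g)%:C%C = (6 + \tr g + \tr (cof g)) / 12.
Proof.
move=> Sg; rewrite cof_SU3// trace_map_mx /= -addrA.
have -> : \tr g + (\tr g)^* = 2 * (Re (\tr g))%:C%C by rewrite -addcJ.
rewrite /peak fmorph_div /= rmorphD /= !rmorph_nat; field; rewrite ?pnatr_eq0//.
Qed.

(** Powers of the sum of the two traces are sums of characters of tensor products. This is what
    makes powers of [peak] accessible to the hypothesis [not_occurs]. *)
Lemma expand_traces n (a : C) g : (a + \tr g + \tr (cof g)) ^+ n =
  \sum_(m < n.+1) \sum_(s : pattern m) \sum_I (a ^+ (n - m) *+ 'C(n, m)) * tens s g I I.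
Proof.
rewrite -addrA exprDn; apply: eq_bigr => m _.
under eq_bigr do rewrite -mulr_sumr.
rewrite -mulr_sumr -mulrnAl; congr (_ * _).
have -> : \tr g + \tr (cof g) = \sum_b \tr (slot b g) by rewrite big_bool /= addrC.
rewrite -[in LHS](card_ord m) -prodr_const bigA_distr_bigA /=; apply: eq_bigr => s _.
by rewrite /mxtrace bigA_distr_bigA.
Qed.

(** The summand is the real part of a combination of matrix coefficients of the [tensrep s], whose
    averages are small. Translation by [h] multiplies by a unitary matrix, so the bound is uniform
    in [h]. *)
Lemma averaging_peak n (e : R) : 0 < e -> exists l : seq 'M[C]_3,
  [/\ forall g, g \in l -> SU3 g, l != [::] & forall h, SU3 h ->
   \sum_(g <- l) peak (h *m g) ^+ n * rchar (h *m g) <= e * (size l)%:R].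
Proof.
move=> e0.
(* Weight of the tensor products of length [m] in the n-th power of [peak]; [K - 1] below is the
   total weight of all the coefficients that occur. *)
pose coef m : R := 12 ^- n * (6 ^+ (n - m) *+ 'C(n, m)).
have coef0 m : 0 <= coef m by rewrite mulr_ge0 ?mulrn_wge0 ?exprn_ge0 ?invr_ge0 ?exprn_ge0.
pose K := 1 + \sum_(m < n.+1) \sum_(s : pattern m) \sum_(I : word m) \sum_(i < d) coef m.
have K0 : 0 < K by rewrite ltr_wpDr// !sumr_ge0// => ? _; rewrite !sumr_ge0// => ? _; rewrite !sumr_ge0// => ? _; rewrite sumr_ge0.
have eK0 : 0 < (e / K) ^+ 2 by rewrite exprn_gt0// divr_gt0.
pose L : seq {m & pattern m} := flatten [seq [seq existT pattern m s | s <- enum {: pattern m}] | m <- iota 0 n.+1].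
have [l [lS l0 lv]] := averaging_family L eK0.
exists l; split=> // h Sh.
have entry (m : 'I_n.+1) (s : pattern m) i j :
    normc ((\sum_(g <- l) tensrep s (h *m g)) i j) <= (size l)%:R * (e / K).
  have sL : existT pattern (m : nat) s \in L.
    apply/flatten_mapP; exists (m : nat); first by rewrite mem_iota ltn_ord.
    by apply: map_f; rewrite mem_enum.
  have sl : 0 < (size l)%:R :> R by rewrite ltr0n lt0n size_eq0.
  have -> : \sum_(g <- l) tensrep s (h *m g) = (size l)%:R *: (tensrep s h *m avgop (tensrep s) l).
    rewrite /avgop -scalemxAr scalerA mulfV ?scale1r; last by rewrite pnatr_eq0 size_eq0.
    rewrite mulmx_sumr big_seq [RHS]big_seq; apply: eq_bigr => g /lS Sg; exact: tensrepM.
  rewrite mxE normcM normc_nat ler_pM2l//.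
  have := lv _ sL (delta_mx j 0) => /=.
  rewrite -(nsq_unitary _ (tensrepU s Sh)) mulmxA -colE => le.
  rewrite -(@ler_pXn2r _ 2) ?nnegrE ?normc_ge0 ?divr_ge0 ?(ltW e0) ?(ltW K0)//.
  have := nsq_entry (col j (tensrep s h *m avgop (tensrep s) l)) i.
  by rewrite [X in normc X]mxE => le2; rewrite (le_trans le2)// (le_trans le)// nsq_delta mulr1.
pose S := \sum_(g <- l) ((6 + \tr (h *m g) + \tr (cof (h *m g))) / 12) ^+ n * (\tr (rho (h *m g)))^*.
have -> : \sum_(g <- l) peak (h *m g) ^+ n * rchar (h *m g) = Re S.
  rewrite /S raddf_sum big_seq [RHS]big_seq; apply: eq_bigr => g /lS Sg.
  rewrite -peakE; last exact: SU3M.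
  rewrite -rmorphXn /rchar /=; case: (\tr (rho _)) => x y /=; ring.
have -> : S = \sum_(m < n.+1) \sum_(s : pattern m) \sum_(I : word m) \sum_(i < d)
    (coef m)%:C%C * (\sum_(g <- l) tensrep s (h *m g)) (enum_rank (I, i)) (enum_rank (I, i)).
  transitivity (\sum_(g <- l) \sum_(m < n.+1) \sum_(s : pattern m) \sum_(I : word m) \sum_(i < d)
    (coef m)%:C%C * tensrep s (h *m g) (enum_rank (I, i)) (enum_rank (I, i))).
    apply: eq_bigr => g _; rewrite expr_div_n expand_traces mulrAC !mulr_suml; apply: eq_bigr => m _.
    rewrite !mulr_suml; apply: eq_bigr => s _; rewrite !mulr_suml; apply: eq_bigr => I _.
    rewrite /mxtrace rmorph_sum mulr_sumr mulr_suml; apply: eq_bigr => i _.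
    rewrite mxE !enum_rankK /= /coef rmorphM rmorphMn rmorphXn fmorphV /= rmorphXn !rmorph_nat.
    ring.
  rewrite exchange_big; apply: eq_bigr => m _; rewrite exchange_big; apply: eq_bigr => s _.
  rewrite exchange_big; apply: eq_bigr => I _; rewrite exchange_big; apply: eq_bigr => i _.
  by rewrite summxE mulr_sumr.
rewrite (le_trans (le_trans (ler_norm _) (Re_le_normc _)))//.
have sl : 0 <= (size l)%:R * (e / K) by rewrite mulr_ge0 ?ler0n ?divr_ge0 ?(ltW e0) ?(ltW K0).
suff : normc (\sum_(m < n.+1) \sum_(s : pattern m) \sum_(I : word m) \sum_(i < d)
    (coef m)%:C%C * (\sum_(g <- l) tensrep s (h *m g)) (enum_rank (I, i)) (enum_rank (I, i)))
    <= (K - 1) * ((size l)%:R * (e / K)).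
  move=> h1; rewrite (le_trans h1)//.
  have -> : e * (size l)%:R = K * ((size l)%:R * (e / K)) by field; rewrite gt_eqF.
  by rewrite ler_wpM2r// gerBl.
have -> : K - 1 = \sum_(m < n.+1) \sum_(s : pattern m) \sum_(I : word m) \sum_(i < d) coef m by rewrite /K addrC addKr.
rewrite (le_trans (normc_sum _ _ _))// mulr_suml ler_sum// => m _.
rewrite (le_trans (normc_sum _ _ _))// mulr_suml ler_sum// => s _.
rewrite (le_trans (normc_sum _ _ _))// mulr_suml ler_sum// => I _.
rewrite (le_trans (normc_sum _ _ _))// mulr_suml ler_sum// => i _.
by rewrite normcM normc_real ger0_norm// ler_wpM2l// entry.
Qed.

(* |g - 1|^2 = 6 - 2 Re tr g *)
Lemma nsq_sub1_peak g : SU3 g ->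
  \sum_j nsq (col j (g - 1%:M)) = 12 * (1 - peak g).
Proof.
move=> Sg.
have e j : nsq (col j (g - 1%:M)) = 2 - 2 * Re (g j j).
  have -> : col j (g - 1%:M) = g *m delta_mx j 0 - delta_mx j 0.
    by rewrite colE mulmxBl mul1mx.
  rewrite nsqB nsq_unitary ?nsq_delta; last by case: Sg.
  by rewrite dotc_delta -colE mxE -[1 + 1]/(2).
under eq_bigr do rewrite e.
rewrite sumrB sumr_const card_ord -mulr_sumr /peak /mxtrace raddf_sum /=.
by move: (\sum_(i < 3) _) => x; field.
Qed.

Lemma SU3_entry_le g i j : SU3 g -> normc (g i j) <= 1.
Proof.
move=> [gu _]; have := nsq_entry (col j g) i.
rewrite mxE colE nsq_unitary// nsq_delta -[X in _ <= X](expr1n _ 2).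
by rewrite ler_pXn2r ?nnegrE ?normc_ge0.
Qed.

Lemma peak_ge0 g : SU3 g -> 0 <= peak g.
Proof.
move=> Sg; rewrite divr_ge0//.
have : `|Re (\tr g)| <= 3.
  rewrite (le_trans (Re_le_normc _))// (le_trans (normc_sum _ _ _))//.
  rewrite (le_trans (ler_sum _ (fun i _ => SU3_entry_le i i Sg)))//.
  by rewrite sumr_const card_ord.
by rewrite ler_norml => /andP[]; lra.
Qed.

(** Total boundedness of the group by pigeonhole: the entries have modulus at most 1, so a grid has
    finitely many cells, and one group element is kept from each cell that contains any. Closeness
    of [g] and [h] is measured by [peak], since |g - h|^2 is 12 times 1 - peak of the quotient. *)
Lemma SU3_net (e : R) : 0 < e -> exists hs : seq 'M[C]_3, (forall h, h \in hs -> SU3 h) /\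
  forall g, SU3 g -> exists2 h, h \in hs & peak (h^t* *m g) > 1 - e.
Proof.
move=> e0.
pose M := (Num.truncn (6 / e)).+2.
(* Real and imaginary parts are shifted from [-1, 1] to [0, 2], which gives grid indices from 0 to
   [M.*2]. *)
pose cell (g : 'M[C]_3) : {ffun 'I_3 * 'I_3 * bool -> 'I_(M.*2).+1} :=
  [ffun x => inord (Num.truncn (M%:R * (1 + (if x.2 then @complex.Re R else @complex.Im R) (g x.1.1 x.1.2))))].
pose pick_cell c : option 'M[C]_3 :=
  if pselect (exists2 g, SU3 g & cell g = c) is left e then Some (projT1 (cid2 e)) else None.
exists (pmap pick_cell (enum {: {ffun 'I_3 * 'I_3 * bool -> 'I_(M.*2).+1}})).
split=> [h|g Sg].
  rewrite mem_pmap => /mapP[c _]; rewrite /pick_cell; case: pselect => // ex [->].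
  by case: cid2.
have [h [ch Sh hg]] : exists h, [/\ pick_cell (cell g) = Some h, SU3 h & cell h = cell g].
  rewrite /pick_cell; case: pselect => [ex|[]]; last by exists g.
  by exists (projT1 (cid2 ex)); case: cid2.
exists h.
  by rewrite mem_pmap -ch map_f// mem_enum.
rewrite ltrBlDl -ltrBlDr -(@ltr_pM2l _ 12)// -nsq_sub1_peak; last by apply: SU3M => //; exact: SU3V.
have eq j : nsq (col j (h^t* *m g - 1%:M)) = nsq (col j (g - h)).
  have hu : h^t* \is unitarymx by rewrite trmxC_unitary; case: Sh.
  by rewrite -(nsq_unitary (col j (g - h)) hu) !colE mulmxA mulmxBr SU3_Vmul.
under eq_bigr do rewrite eq.
have M0 : 0 < M%:R :> R by rewrite ltr0n.
have close (a b : R) : `|a| <= 1 -> `|b| <= 1 ->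
    (inord (Num.truncn (M%:R * (1 + a))) : 'I_(M.*2).+1) = inord (Num.truncn (M%:R * (1 + b))) ->
    (a - b) ^+ 2 <= M%:R^-1 ^+ 2.
  have bd (u : R) : `|u| <= 1 -> 0 <= M%:R * (1 + u) /\ (Num.truncn (M%:R * (1 + u)) < (M.*2).+1)%N.
    rewrite ler_norml => /andP[ul uu].
    have u0 : 0 <= M%:R * (1 + u) by rewrite mulr_ge0 ?ler0n//; lra.
    split=> //; rewrite truncn_lt_nat// -addn1 natrD -mul2n natrM.
    have := ler_wpM2l (ltW M0) uu; lra.
  move=> /bd[a0 ab] /bd[b0 bb].
  move/(congr1 val); rewrite /= !inordK// => eqt.
  have /andP[a1 a2] := truncn_itv a0; have /andP[b1 b2] := truncn_itv b0.
  rewrite eqt in a1 a2.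
  have h1 : `|M%:R * (a - b)| <= 1 by rewrite ler_norml; move: b1 b2 a1 a2; rewrite -natr1; lra.
  rewrite -(ger0_norm (sqr_ge0 (a - b))) normrX lerXn2r ?nnegrE ?invr_ge0 ?ler0n//.
  by rewrite -[leRHS]mul1r ler_pdivlMr// mulrC -[X in X * _](gtr0_norm M0) -normrM.
have cellE i j : (Re ((g - h) i j)) ^+ 2 <= M%:R^-1 ^+ 2 /\ (complex.Im ((g - h) i j)) ^+ 2 <= M%:R^-1 ^+ 2.
  have nb (f : 'M[C]_3) b : SU3 f -> `|(if b then @complex.Re R else @complex.Im R) (f i j)| <= 1.
    move=> Sf; have le1 := SU3_entry_le i j Sf; rewrite (le_trans _ le1)//.
    case: b; first exact: Re_le_normc.
    rewrite -sqrtr_sqr; case: (f i j) => x y /=.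
    by rewrite ler_wsqrtr// lerDr sqr_ge0.
  have cb b : cell h (i, j, b) = cell g (i, j, b) by rewrite hg.
  have := cb true; have := cb false; rewrite !ffunE /= => c1 c2.
  have := close _ _ (nb g false Sg) (nb h false Sh) (esym c1).
  have := close _ _ (nb g true Sg) (nb h true Sh) (esym c2).
  by rewrite !mxE /=; case: (g i j) => x y; case: (h i j) => x' y'.
rewrite /nsq; apply: (@le_lt_trans _ _ (\sum_(j < 3) \sum_(i < 3) (2 * M%:R^-1 ^+ 2))).
  apply: ler_sum => j _; apply: ler_sum => i _; rewrite [X in normc X]mxE.
  have [] := cellE i j; case: ((g - h) i j) => x y /= c1 c2.
  by rewrite sqr_sqrtr ?addr_ge0 ?sqr_ge0//; lra.
rewrite !sumr_const !card_ord.
have Me : 6 / e < M%:R by rewrite (lt_trans (truncnS_gt _))// ltr_nat.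
have M2 : 2 <= M%:R :> R by rewrite ler_nat.
have : M%:R^-1 < e / 6 by rewrite -[e / 6]invf_div ltf_pV2 ?posrE ?divr_gt0.
have : M%:R^-1 <= 2^-1 :> R by rewrite lef_pV2 ?posrE.
have : 0 < M%:R^-1 :> R by rewrite invr_gt0.
move: (M%:R^-1) => x x0 x1 x2.
have -> : 2 * x ^+ 2 *+ 3 *+ 3 = 18 * x ^+ 2 by ring.
have : x ^+ 2 <= x * 2^-1 by rewrite expr2 ler_wpM2l// ltW.
by rewrite expr2; lra.
Qed.

Lemma rchar_le g : SU3 g -> `|rchar g| <= d%:R.
Proof.
move=> Sg; rewrite (le_trans (Re_le_normc _))// (le_trans (normc_sum _ _ _))//.
rewrite -[X in _ <= X%:R]card_ord -sumr_const; apply: ler_sum => i _.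
have := nsq_entry (col i (rho g)) i.
rewrite mxE colE nsq_unitary ?nsq_delta ?rho_unitary// -[X in _ <= X](expr1n _ 2).
by rewrite ler_pXn2r ?nnegrE ?normc_ge0.
Qed.

(** By continuity the diagonal entries of [rho g] are within 1/2 of those of the identity when [g]
    is near 1. *)
Lemma rchar_near1 : exists2 e, 0 < e < 1 & forall g, SU3 g -> peak g > 1 - e -> rchar g >= d%:R / 2.
Proof.
have /subspace_continuousP/(_ _ (@SU3_1 R)) cont := unitary_rep_continuous rhoU.
pose A : set 'M[C]_d := [set N | forall i j, normc (N i j - rho 1%:M i j) < 1 / 2].
have := cont A; case=> [|P nP PA].
  exists (fun i j => [set z | `|rho 1%:M i j - z| < (1 / 2)%:C%C]).
    move=> i j; apply/nbhs_ballP; exists (1 / 2)%:C%C; first by rewrite /= ltcR; lra.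
    by [].
  by move=> N NA i j; have := NA i j; rewrite /= normcE' ltcR -normcN' opprB.
have [r r0 rP] : exists2 r : R, 0 < r & forall g, (forall i j, normc (g i j - (1%:M : 'M[C]_3) i j) < r) ->
    forall i j, P i j (g i j).
  have eP i j : exists r : R, 0 < r /\ forall z, normc (z - (1%:M : 'M[C]_3) i j) < r -> P i j z.
    have /nbhs_ballP[e e0 eP] := nP i j; exists (Re e).
    have eE : e = (Re e)%:C%C by rewrite RRe_real// gtr0_real.
    split; first by move: e0; rewrite /= eE ltcR.
    by move=> z zr; apply: eP; rewrite /ball/= eE normcE' ltcR -normcN' opprB.
  pose f (x : 'I_3 * 'I_3) := sval (cid (eP x.1 x.2)).
  have fP x : 0 < f x /\ forall z, normc (z - (1%:M : 'M[C]_3) x.1 x.2) < f x -> P x.1 x.2 z.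
    by rewrite /f; case: cid.
  exists (\big[Num.min/1]_x f x).
    by elim/big_ind: _ => // [a b a0 b0|x _]; [rewrite lt_min a0|case: (fP x)].
  move=> g gr i j; have [_] := fP (i, j); apply; rewrite (lt_le_trans (gr i j))//.
  exact: (bigmin_le_cond _ (j := (i, j))).
(* The 12 is that of [nsq_sub1_peak]: [peak g > 1 - e] then gives |g - 1|^2 < r^2. *)
pose e := Num.min (1 / 2) (r ^+ 2 / 12).
have e0 : 0 < e by rewrite lt_min divr_gt0//= divr_gt0// exprn_gt0.
exists e; first by rewrite e0/= gt_min; apply/orP; left; lra.
move=> g Sg pg.
have : A (rho g).
  apply: PA => //; apply: rP => i j.
  have ij : normc (g i j - (1%:M : 'M[C]_3) i j) ^+ 2 < r ^+ 2.
    apply: (@le_lt_trans _ _ (\sum_j nsq (col j (g - 1%:M)))).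
      rewrite (bigD1 j)//=; apply: (@le_trans _ _ (nsq (col j (g - 1%:M)))).
        by have := nsq_entry (col j (g - 1%:M)) i; rewrite !mxE.
      by rewrite lerDl sumr_ge0// => k _; exact: nsq_ge0.
    rewrite nsq_sub1_peak//.
    have : e <= r ^+ 2 / 12 by rewrite /e ge_min lexx orbT.
    lra.
  by move: ij; rewrite ltr_pXn2r ?nnegrE ?normc_ge0// ltW.
move=> Ag; rewrite /rchar /mxtrace raddf_sum /=.
have -> : d%:R / 2 = \sum_(i < d) (1 / 2 : R).
  by rewrite sumr_const card_ord -[RHS]mulr_natr mul1r mulrC.
apply: ler_sum => i _; have := Ag i i.
rewrite (unit_E1 rhoM rho_unitary) mxE eqxx.
move=> /(le_lt_trans (Re_le_normc _)); case: (rho g i i) => x y /=.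
by rewrite ltr_norml => /andP[]; lra.
Qed.

(** The sum over a net of translates of [peak ^+ n * rchar] is estimated at each [g]. Some translate
    lies well inside the peak and contributes a definite positive amount, while negative
    contributions are exponentially smaller in [n]. The sum is thus bounded below, whereas the
    average of every translate is as small as desired. *)
Lemma occurs_contradiction : False.
Proof.
have [e /andP[e0 e1] rnear] := rchar_near1.
have e20 : 0 < e / 2 by rewrite divr_gt0.
have [hs [hsS hsnet]] := SU3_net e20.
have dd : 0 < d%:R :> R by rewrite ltr0n.
(* The ratio of 1 - e to 1 - e/2 is below 1, so [n] can be taken so large that all the negative
   terms together cost at most half of the one positive term. *)
have [n hn] : exists n, (size hs)%:R * (1 - e) ^+ n <= (1 - e / 2) ^+ n / 4.
  have J0 : 0 < (size hs)%:R + 1 :> R by rewrite ltr_wpDl.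
  have [||n hn] := @expr_small R ((1 - e) / (1 - e / 2)) (((size hs)%:R + 1)^-1 / 4).
  - rewrite divr_ge0 ?ltr_pdivrMr ?mul1r /=; lra.
  - by rewrite divr_gt0// invr_gt0.
  exists n; have p0 : 0 < (1 - e / 2) ^+ n by rewrite exprn_gt0//; lra.
  move: hn; rewrite expr_div_n ler_pdivrMr// => hn.
  rewrite (le_trans (ler_wpM2l _ hn))//; move: ((1 - e / 2) ^+ n) p0 => p p0.
  have -> : (size hs)%:R * (((size hs)%:R + 1)^-1 / 4 * p) = (size hs)%:R / ((size hs)%:R + 1) * (p / 4) by ring.
  rewrite ler_piMl ?divr_ge0 ?(ltW p0)//.
  by rewrite ler_pdivrMr// mul1r lerDl.
(* The guaranteed term (1 - e/2)^n d / 2 less the possible loss (1 - e/2)^n d / 4. *)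
pose kappa := (1 - e / 2) ^+ n * d%:R / 4.
have kappa0 : 0 < kappa by rewrite divr_gt0// mulr_gt0// exprn_gt0//; lra.
have J0 : 0 < (size hs)%:R + 1 :> R by rewrite ltr_wpDl.
have [l [lS l0 lle]] := averaging_peak n (divr_gt0 kappa0 J0).
have le1 : \sum_(h <- hs) \sum_(g <- l) peak (h^t* *m g) ^+ n * rchar (h^t* *m g)
   <= \sum_(h <- hs) kappa / ((size hs)%:R + 1) * (size l)%:R.
  rewrite big_seq [leRHS]big_seq; apply: ler_sum => h hhs.
  by apply: lle; apply: SU3V; apply: hsS.
have le2 : \sum_(h <- hs) \sum_(g <- l) peak (h^t* *m g) ^+ n * rchar (h^t* *m g) >= \sum_(g <- l) kappa.
  rewrite exchange_big /= big_seq [leRHS]big_seq; apply: ler_sum => g /lS Sg.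
  have [h hhs hp] := hsnet g Sg.
  (* Negative values of [rchar] can occur only where [peak] is at most 1 - e. *)
  have low k : k \in hs -> - ((1 - e) ^+ n * d%:R) <= peak (k^t* *m g) ^+ n * rchar (k^t* *m g).
    move=> /hsS Sk; have Skg : SU3 (k^t* *m g) by apply: SU3M => //; exact: SU3V.
    have [le|lt] := lerP (peak (k^t* *m g)) (1 - e).
      have := rchar_le Skg; rewrite ler_norml => /andP[rl _].
      have pn : 0 <= peak (k^t* *m g) ^+ n by rewrite exprn_ge0 ?peak_ge0.
      rewrite (le_trans _ (ler_wpM2l pn rl))// mulrN lerN2 ler_wpM2r ?ler0n//.
      by rewrite lerXn2r ?nnegrE ?peak_ge0//; lra.
    rewrite (@le_trans _ _ 0)//; first by rewrite oppr_le0 mulr_ge0 ?exprn_ge0//; lra.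
    rewrite mulr_ge0 ?exprn_ge0 ?peak_ge0// (le_trans _ (rnear _ Skg lt))//; lra.
  have Shg : SU3 (h^t* *m g) by apply: SU3M => //; apply: SU3V; apply: hsS.
  rewrite (big_rem h)//=.
  have high : (1 - e / 2) ^+ n * (d%:R / 2) <= peak (h^t* *m g) ^+ n * rchar (h^t* *m g).
    rewrite ler_pM ?exprn_ge0 ?divr_ge0//; try lra.
      by rewrite lerXn2r ?nnegrE ?peak_ge0 ?(ltW hp)//; lra.
    apply: rnear => //; lra.
  have rest : - ((size hs)%:R * ((1 - e) ^+ n * d%:R)) <=
      \sum_(k <- rem h hs) peak (k^t* *m g) ^+ n * rchar (k^t* *m g).
    apply: (@le_trans _ _ (\sum_(k <- rem h hs) - ((1 - e) ^+ n * d%:R))).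
      rewrite sum_const_seq mulrN lerN2.
      rewrite ler_wpM2r ?mulr_ge0 ?exprn_ge0 ?ler0n//; first lra.
      by rewrite ler_nat size_rem// leq_pred.
    rewrite big_seq [leRHS]big_seq; apply: ler_sum => k /mem_rem; exact: low.
  have := ler_wpM2r (ltW dd) hn; rewrite /kappa.
  move: high rest; rewrite !mulrA.
  move: (peak (h^t* *m g) ^+ n * rchar _) (\sum_(y <- _) _) ((1 - e / 2) ^+ n) ((1 - e) ^+ n) => X Y a b; lra.
have sl : 0 < (size l)%:R :> R by rewrite ltr0n lt0n size_eq0.
have := le_trans le2 le1.
rewrite !sum_const_seq.
have -> : (size hs)%:R * (kappa / ((size hs)%:R + 1) * (size l)%:R) = (size l)%:R * (kappa * ((size hs)%:R / ((size hs)%:R + 1))).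
  by field; rewrite gt_eqF.
rewrite ler_pM2l// -[X in X <= _]mulr1 ler_pM2l// ler_pdivlMr// mul1r.
by rewrite leNgt ltrDl ltr01.
Qed.

End Occurs.

Lemma irrep_occurs (R : realType) (d : nat) (rho : 'M[R[i]]_3 -> 'M[R[i]]_d) :
  (0 < d)%N -> unitary_rep rho ->
  exists m, exists s : pattern m, exists2 t, intertw rho s t & exists I, exists i, t I i != 0.
Proof.
move=> d0 rhoU; apply: contrapT => nex; apply: (@occurs_contradiction R d rho d0 rhoU).
move=> m s t ti I i; apply/eqP; apply: contrapT => /negP ne.
by apply: nex; exists m, s, t => //; exists I, i.
Qed.

(** * Highest weights *)

Section PolyFun.
Variable F : numFieldType.

Lemma poly_vanish (p : {poly F}) : (forall n : nat, p.[n%:R] = 0) -> p = 0.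
Proof.
move=> p0; apply/eqP; apply: contraT => pn0.
have := @max_poly_roots _ p [seq n%:R | n <- iota 0 (size p)] pn0.
rewrite size_map size_iota ltnn; apply.
  by apply/allP => _ /mapP[n _ ->]; apply/eqP.
rewrite map_inj_uniq ?iota_uniq// => a b /eqP.
by rewrite eqr_nat => /eqP.
Qed.

Definition polyfun (f : F -> F) := exists p : {poly F}, forall z, f z = p.[z].

Lemma polyfun_ext f g : (forall z, f z = g z) -> polyfun f -> polyfun g.
Proof. by move=> fg [p fp]; exists p => z; rewrite -fg. Qed.
Lemma polyfun_cst c : polyfun (fun=> c).
Proof. by exists c%:P => z; rewrite hornerC. Qed.
Lemma polyfun_id : polyfun id.
Proof. by exists 'X => z; rewrite hornerX. Qed.
Lemma polyfunD f g : polyfun f -> polyfun g -> polyfun (fun z => f z + g z).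
Proof. by move=> [p fp] [q gq]; exists (p + q) => z; rewrite hornerD fp gq. Qed.
Lemma polyfunM f g : polyfun f -> polyfun g -> polyfun (fun z => f z * g z).
Proof. by move=> [p fp] [q gq]; exists (p * q) => z; rewrite hornerM fp gq. Qed.
Lemma polyfunN f : polyfun f -> polyfun (fun z => - f z).
Proof. by move=> [p fp]; exists (- p) => z; rewrite hornerN fp. Qed.
Lemma polyfunX f n : polyfun f -> polyfun (fun z => f z ^+ n).
Proof. by move=> [p fp]; exists (p ^+ n) => z; rewrite horner_exp fp. Qed.
Lemma polyfun_sum (I : Type) (r : seq I) (f : I -> F -> F) :
  (forall i, polyfun (f i)) -> polyfun (fun z => \sum_(i <- r) f i z).
Proof.
move=> fp; elim: r => [|i r IH].
  by apply: polyfun_ext (polyfun_cst 0) => z; rewrite big_nil.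
by apply: polyfun_ext (polyfunD (fp i) IH) => z; rewrite big_cons.
Qed.
Lemma polyfun_prod (I : Type) (r : seq I) (f : I -> F -> F) :
  (forall i, polyfun (f i)) -> polyfun (fun z => \prod_(i <- r) f i z).
Proof.
move=> fp; elim: r => [|i r IH].
  by apply: polyfun_ext (polyfun_cst 1) => z; rewrite big_nil.
by apply: polyfun_ext (polyfunM (fp i) IH) => z; rewrite big_cons.
Qed.

(** A polynomial identity that holds off the zeros of a nonzero polynomial holds everywhere. It
    carries formulas from the set of matrices with nonzero leading minors to all matrices. *)
Lemma polyfun_generic f d z0 : polyfun f -> polyfun d -> d z0 != 0 ->
  (forall z, d z != 0 -> f z = 0) -> forall z, f z = 0.
Proof.
move=> [p fp] [q dq] d0 h.
have : p * q = 0.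
  apply: poly_vanish => n; rewrite hornerM -fp -dq.
  by have [->|/h ->] := eqVneq (d n%:R) 0; rewrite ?mulr0 ?mul0r.
move/eqP; rewrite mulf_eq0 => /orP[/eqP p0 z|/eqP q0]; first by rewrite fp p0 horner0.
by move: d0; rewrite dq q0 horner0 eqxx.
Qed.

Lemma polyfunM_neq0 f g : polyfun f -> polyfun g -> (exists z, f z != 0) ->
  (exists z, g z != 0) -> exists z, f z * g z != 0.
Proof.
move=> pf pg [z fz] [w gw]; apply: contrapT => h.
have : forall u, f u = 0.
  apply: (polyfun_generic pf pg gw) => u gu; apply/eqP; apply: contrapT => /negP fu.
  by apply: h; exists u; rewrite mulf_neq0.
by move/(_ z)/eqP; rewrite (negbTE fz).
Qed.
End PolyFun.

Notation o0 := (@Ordinal 3 0 isT).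
Notation o1 := (@Ordinal 3 1 isT).
Notation o2 := (@Ordinal 3 2 isT).

Lemma ord3P (P : 'I_3 -> Prop) : P o0 -> P o1 -> P o2 -> forall i, P i.
Proof.
move=> P0 P1 P2 [[|[|[|//]]] i]; [move: P0|move: P1|move: P2].
- by congr P; apply: val_inj.
- by congr P; apply: val_inj.
- by congr P; apply: val_inj.
Qed.

Lemma big_ord3 (T : Type) (idx : T) (op : Monoid.law idx) (F : 'I_3 -> T) :
  \big[op/idx]_(i < 3) F i = op (op (F o0) (F o1)) (F o2).
Proof.
rewrite !big_ord_recl big_ord0 Monoid.mulm1 Monoid.mulmA.
by congr (op (op (F _) (F _)) (F _)); apply: val_inj.
Qed.

(** * Explicit 3 x 3 matrices and their LDU decomposition *)

Section Mx3.
Variable F : fieldType.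
Definition mx3 (l : seq (seq F)) : 'M[F]_3 := \matrix_(i, j) nth 0 (nth [::] l i) j.
Implicit Types g : 'M[F]_3.
Definition minor2 g := g o0 o0 * g o1 o1 - g o0 o1 * g o1 o0.
Definition det3 g := g o0 o0 * (g o1 o1 * g o2 o2 - g o1 o2 * g o2 o1)
  - g o0 o1 * (g o1 o0 * g o2 o2 - g o1 o2 * g o2 o0)
  + g o0 o2 * (g o1 o0 * g o2 o1 - g o1 o1 * g o2 o0).

(** The indices run cyclically, which absorbs the signs of the cofactors. *)
Definition cof3 g : 'M[F]_3 := mx3
 [:: [:: g o1 o1 * g o2 o2 - g o1 o2 * g o2 o1; g o1 o2 * g o2 o0 - g o1 o0 * g o2 o2; g o1 o0 * g o2 o1 - g o1 o1 * g o2 o0];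
     [:: g o2 o1 * g o0 o2 - g o2 o2 * g o0 o1; g o2 o2 * g o0 o0 - g o2 o0 * g o0 o2; g o2 o0 * g o0 o1 - g o2 o1 * g o0 o0];
     [:: g o0 o1 * g o1 o2 - g o0 o2 * g o1 o1; g o0 o2 * g o1 o0 - g o0 o0 * g o1 o2; g o0 o0 * g o1 o1 - g o0 o1 * g o1 o0] ].

Lemma det22 (A : 'M[F]_2) :
  \det A = A ord0 ord0 * A ord_max ord_max - A ord0 ord_max * A ord_max ord0.
Proof.
rewrite (expand_det_row _ ord0) !big_ord_recl big_ord0 addr0 /cofactor !det_mx11 !mxE /=.
rewrite !expr0 ?expr1 mul1r mulN1r mulrN.
by congr (A _ _ * A _ _ - A _ _ * A _ _); apply: val_inj.
Qed.

Lemma lift3E : (lift o0 (ord0 : 'I_2) = o1) * (lift o0 (ord_max : 'I_2) = o2) *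
  (lift o1 (ord0 : 'I_2) = o0) * (lift o1 (ord_max : 'I_2) = o2) *
  (lift o2 (ord0 : 'I_2) = o0) * (lift o2 (ord_max : 'I_2) = o1).
Proof. by do !split; apply: val_inj. Qed.

Lemma cofactor3 g i j : cofactor g i j = cof3 g i j.
Proof.
rewrite /cofactor det22 !mxE.
elim/ord3P: i; elim/ord3P: j; rewrite !lift3E /=; ring.
Qed.

Lemma adj3 g : (\adj g)^T = cof3 g.
Proof. by apply/matrixP => i j; rewrite !mxE cofactor3 mxE. Qed.

Lemma det3E g : \det g = det3 g.
Proof.
rewrite (expand_det_row _ o0) big_ord3 /= !cofactor3 !mxE /= /det3; ring.
Qed.

Definition lowmx (a b c : F) := mx3 [:: [:: 1; 0; 0]; [:: a; 1; 0]; [:: b; c; 1] ].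
Definition upmx (a b c : F) := mx3 [:: [:: 1; a; b]; [:: 0; 1; c]; [:: 0; 0; 1] ].
Definition dgmx (z : 'I_3 -> F) : 'M[F]_3 := diag_mx (\row_i z i).
Definition pivots g (i : 'I_3) : F :=
  nth 0 [:: g o0 o0; minor2 g / g o0 o0; det3 g / minor2 g] i.

(** Elimination without row exchanges: the pivots are quotients of successive leading minors, of
    which only the first two appear as divisors. *)
Lemma LDU g : g o0 o0 != 0 -> minor2 g != 0 ->
  g = lowmx (g o1 o0 / g o0 o0) (g o2 o0 / g o0 o0)
        ((g o0 o0 * g o2 o1 - g o0 o1 * g o2 o0) / minor2 g)
    *m dgmx (pivots g)
    *m upmx (g o0 o1 / g o0 o0) (g o0 o2 / g o0 o0)
        ((g o0 o0 * g o1 o2 - g o1 o0 * g o0 o2) / minor2 g).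
Proof.
move=> d1 d2; apply/matrixP; elim/ord3P; elim/ord3P;
  rewrite !mxE !big_ord3 /= !mxE !big_ord3 /= !mxE /= /pivots /det3 /= ;
  move: d1 d2; rewrite /minor2 => d1 d2; field; rewrite ?d1 ?d2//.
Qed.

Lemma lowmx_unit a b c : lowmx a b c \in unitmx.
Proof. by rewrite unitmxE det3E /det3 !mxE /= !(mul0r, mulr0, mul1r, mulr1, subr0, addr0) unitr1. Qed.
Lemma upmx_unit a b c : upmx a b c \in unitmx.
Proof. by rewrite unitmxE det3E /det3 !mxE /= !(mul0r, mulr0, mul1r, mulr1, subr0, addr0) unitr1. Qed.
Lemma dgmx_unit z : (forall i, z i != 0) -> dgmx z \in unitmx.
Proof.
move=> z0; rewrite unitmxE unitfE det_diag prodf_seq_neq0.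
by apply/allP => i _; rewrite mxE z0.
Qed.

End Mx3.

(** * The diagonal coefficient at a word of lowest height *)

Section HighestWeight.
Variable R : realType.
Local Notation C := R[i].
Local Notation Re := (@complex.Re R).
Implicit Types g h : 'M[C]_3.

Lemma cofE3 g : cof g = cof3 g.
Proof. exact: adj3. Qed.

(* The slot of type [true] carries the dual weights, so its order is reversed. *)
Definition hgt1 (b : bool) (i : 'I_3) : nat := if b then (2 - i)%N else i.
Definition hgt m (s : pattern m) (I : word m) : nat := (\sum_k hgt1 (s k) (I k))%N.

Lemma slot_up b a x c i j : slot b (upmx a x c : 'M[C]_3) i j != 0 ->
  (i = j) \/ (hgt1 b i < hgt1 b j)%N.
Proof.
case: b; rewrite /slot ?cofE3 mxE; elim/ord3P: i; elim/ord3P: j => /=;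
 rewrite ?mxE /= ?(mul0r, mulr0, subr0, addr0, eqxx)//; by [left|right].
Qed.
Lemma slot_up1 b a x c i : slot b (upmx a x c : 'M[C]_3) i i = 1.
Proof.
by case: b; rewrite /slot ?cofE3 mxE; elim/ord3P: i => /=;
 rewrite ?mxE /= ?(mul0r, mulr0, subr0, addr0, mul1r).
Qed.
Lemma slot_low b a x c i j : slot b (lowmx a x c : 'M[C]_3) i j != 0 ->
  (i = j) \/ (hgt1 b j < hgt1 b i)%N.
Proof.
case: b; rewrite /slot ?cofE3 mxE; elim/ord3P: i; elim/ord3P: j => /=;
 rewrite ?mxE /= ?(mul0r, mulr0, subr0, addr0, eqxx)//; by [left|right].
Qed.
Lemma slot_low1 b a x c i : slot b (lowmx a x c : 'M[C]_3) i i = 1.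
Proof.
by case: b; rewrite /slot ?cofE3 mxE; elim/ord3P: i => /=;
 rewrite ?mxE /= ?(mul0r, mulr0, subr0, addr0, mul1r).
Qed.

Variables (m : nat) (s : pattern m).

(** No slot can lower the height from [I] to [J], and a slot where the words differ raises it
    strictly. *)
Lemma tens_hgt g I J :
  (forall b i j, slot b g i j != 0 -> i = j \/ (hgt1 b i < hgt1 b j)%N) ->
  tens s g I J != 0 -> I = J \/ (hgt s I < hgt s J)%N.
Proof.
move=> gs; rewrite /tens prodf_seq_neq0 => /allP h.
have {}h k : I k = J k \/ (hgt1 (s k) (I k) < hgt1 (s k) (J k))%N.
  by apply: gs; apply: h; rewrite mem_index_enum.
have [->|IJ] := eqVneq I J; [by left|right].
have [k Ik] := word_neq IJ.
rewrite /hgt (bigD1 k)//= [ltnRHS](bigD1 k)//= -addSn leq_add//.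
  by have [e|//] := h k; rewrite e eqxx in Ik.
by apply: leq_sum => l _; have [->//|/ltnW] := h l.
Qed.

Lemma tens_low g I J :
  (forall b i j, slot b g i j != 0 -> i = j \/ (hgt1 b j < hgt1 b i)%N) ->
  tens s g I J != 0 -> I = J \/ (hgt s J < hgt s I)%N.
Proof.
move=> gs; rewrite /tens prodf_seq_neq0 => /allP h.
have {}h k : I k = J k \/ (hgt1 (s k) (J k) < hgt1 (s k) (I k))%N.
  by apply: gs; apply: h; rewrite mem_index_enum.
have [->|IJ] := eqVneq I J; [by left|right].
have [k Ik] := word_neq IJ.
rewrite /hgt (bigD1 k)//= [ltnRHS](bigD1 k)//= -addSn leq_add//.
  by have [e|//] := h k; rewrite e eqxx in Ik.
by apply: leq_sum => l _; have [->//|/ltnW] := h l.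
Qed.

(* Exponent of z_l in the weight of the word I under diag(z). *)
Definition wexp (I : word m) (l : 'I_3) : nat :=
  (\sum_k (if s k then I k != l else I k == l))%N.

Lemma tens_diag (z : 'I_3 -> C) I J : (forall i, z i != 0) ->
  tens s (dgmx z) I J = (I == J)%:R * \prod_l z l ^+ wexp I l.
Proof.
move=> z0.
have slotE b i j : slot b (dgmx z) i j = (i == j)%:R * \prod_l z l ^+ (if b then i != l else i == l).
  rewrite big_ord3.
  by case: b; rewrite /slot ?cofE3 mxE; elim/ord3P: i; elim/ord3P: j => /=;
   rewrite ?mxE /= ?(mul0r, mulr0, subr0, addr0, mul1r, mulr1, expr0, expr1, mulr1n)// mulrC.
rewrite /tens; under eq_bigr do rewrite slotE.
rewrite big_split /=; have [->|IJ] := eqVneq I J.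
  rewrite big1 ?mul1r => [|k _]; last by rewrite eqxx.
  by rewrite exchange_big; apply: eq_bigr => l _; rewrite prodrXr.
have [k Ik] := word_neq IJ.
by rewrite mul0r (bigD1 k)//= (negbTE Ik) !mul0r.
Qed.

Variables (d : nat) (rho : 'M[C]_3 -> 'M[C]_d) (t : word m -> 'I_d -> C).
Hypothesis rhoU : unitary_rep rho.
Hypothesis t_intertw : intertw rho s t.

(** The intertwiner times its adjoint, a Hermitian operator on the tensor product that commutes with
    the group and whose image is the copy of [rho] there. *)
Definition Pi (K J : word m) : C := \sum_i t K i * (t J i)^*.
Definition commutes g := forall I K,
  \sum_J tens s g I J * Pi J K = \sum_J Pi I J * tens s g J K.

Lemma Pi_herm I J : Pi J I = (Pi I J)^*.
Proof.
by rewrite /Pi rmorph_sum; apply: eq_bigr => i _; rewrite rmorphM /= conjCK mulrC.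
Qed.

Lemma commutes_SU3 g : SU3 g -> commutes g.
Proof.
move=> Sg I K.
have e1 J i : \sum_L (t L i)^* * tens s g L J = \sum_j (t J j)^* * rho g i j.
  have := congr1 Num.conj (t_intertw (SU3V Sg) J i).
  rewrite !rmorph_sum (unit_EV (unitary_repM rhoU) (unitary_rep_unitary rhoU) Sg) => h.
  transitivity (\sum_L (tens s (g^t*) J L * t L i)^*).
    by apply: eq_bigr => L _; rewrite rmorphM /= tens_tr conjCK mulrC.
  by rewrite h; apply: eq_bigr => j _; rewrite !mxE rmorphM /= conjCK.
transitivity (\sum_i \sum_j t I j * rho g j i * (t K i)^*).
  under eq_bigr => J _ do rewrite mulr_sumr.
  rewrite exchange_big /=; apply: eq_bigr => i _.
  by rewrite -mulr_suml -t_intertw// mulr_suml; apply: eq_bigr => J _; rewrite mulrA.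
under [RHS]eq_bigr => J _ do rewrite mulr_suml.
rewrite exchange_big [RHS]exchange_big /=; apply: eq_bigr => j _.
under [RHS]eq_bigr => J _ do rewrite -mulrA.
by rewrite -mulr_sumr e1 mulr_sumr; apply: eq_bigr => i _; rewrite -mulrA [_ * (t K i)^*]mulrC.
Qed.

Lemma commutesM g h : g \in unitmx -> h \in unitmx ->
  commutes g -> commutes h -> commutes (g *m h).
Proof.
move=> gU hU cg ch I K.
transitivity (\sum_L tens s g I L * \sum_J tens s h L J * Pi J K).
  under eq_bigr => J _ do rewrite tens_mul// mulr_suml.
  rewrite exchange_big /=; apply: eq_bigr => L _; rewrite mulr_sumr.
  by apply: eq_bigr => J _; rewrite mulrA.
under eq_bigr => L _ do rewrite ch mulr_sumr.
rewrite exchange_big /=.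
transitivity (\sum_J (\sum_L tens s g I L * Pi L J) * tens s h J K).
  by apply: eq_bigr => J _; rewrite mulr_suml; apply: eq_bigr => L _; rewrite mulrA.
transitivity (\sum_J (\sum_L Pi I L * tens s g L J) * tens s h J K).
  by apply: eq_bigr => J _; rewrite cg.
transitivity (\sum_J \sum_L Pi I L * (tens s g L J * tens s h J K)).
  by apply: eq_bigr => J _; rewrite mulr_suml; apply: eq_bigr => L _; rewrite mulrA.
by rewrite exchange_big; apply: eq_bigr => J _; rewrite tens_mul// mulr_sumr.
Qed.

(** A scalar acts on the whole tensor product by a scalar: [c] from each ordinary slot, and [c ^+ 2]
    from each dual one because cofactors are quadratic. *)
Lemma commutesZ c g : commutes g -> commutes (c *: g).
Proof.
move=> cg I K.
have tZ J L : tens s (c *: g) J L = c ^+ (\sum_k (s k).+1) * tens s g J L.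
  rewrite /tens -prodrXr -big_split /=; apply: eq_bigr => k _.
  case: (s k); rewrite /slot ?cofE3 ?mxE ?expr1//.
  by elim/ord3P: (J k); elim/ord3P: (L k); rewrite /= ?mxE; ring.
under eq_bigr => J _ do rewrite tZ -mulrA.
rewrite -mulr_sumr cg mulr_sumr; apply: eq_bigr => J _; rewrite tZ; ring.
Qed.

(** Division by a cube root of the determinant, which has modulus 1. *)
Lemma unitary_scale_SU3 g : g \is unitarymx -> exists c, exists2 h, SU3 h & g = c *: h.
Proof.
move=> gu.
have dn : `|\det g| = 1.
  move/unitarymxP: (gu) => /(congr1 determinant); rewrite det_mulmx det_map_mx det_tr det1.
  by rewrite -normCK => /eqP; rewrite sqrp_eq1// => /eqP.
have d0 : \det g != 0 by rewrite -normr_gt0 dn ltr01.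
pose c := 3.-root (\det g).
have c3 : c ^+ 3 = \det g by rewrite rootCK.
have c0 : c != 0 by apply: contraNneq d0 => c0; rewrite -c3 c0 expr0n.
have cn : c * c^* = 1.
  rewrite -normCK; apply/eqP; rewrite sqrp_eq1//; apply/eqP.
  apply/(@pexpIrn _ 3); rewrite ?nnegrE ?normr_ge0 ?ler01//.
  by rewrite -normrX c3 dn expr1n.
exists c, (c^-1 *: g); last by rewrite scalerA mulfV ?scale1r.
split; last by rewrite detZ exprVn c3 mulVf.
apply/unitarymxP; rewrite linearZ /= map_mxZ -scalemxAl -scalemxAr (elimT unitarymxP gu) scalerA.
by rewrite fmorphV /= -invfM cn invr1 scale1r.
Qed.

Lemma commutes_unitary g : g \is unitarymx -> commutes g.
Proof. by move=> /unitary_scale_SU3[c [h Sh ->]]; apply/commutesZ/commutes_SU3. Qed.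

(* The points (1 + i n) / (1 - i n) of the unit circle are pairwise distinct. *)
Lemma circle_poly (p : {poly C}) : (forall x : C, `|x| = 1 -> p.[x] = 0) -> p = 0.
Proof.
move=> h; apply/eqP; apply: contraT => pn0.
pose z (n : nat) : C := 1 + 'i * n%:R.
have zJ n : (z n)^* = 1 - 'i * n%:R.
  by rewrite /z rmorphD rmorphM rmorph1 /= conjCi rmorph_nat mulNr.
have i2 : 'i ^+ 2 = -1 :> C by exact: sqrCi.
have zz n : z n * (z n)^* = (1 + n ^ 2)%:R.
  rewrite zJ /z natrD natrX; have -> : (1 + 'i * n%:R) * (1 - 'i * n%:R) = 1 - 'i ^+ 2 * n%:R ^+ 2 :> C by ring.
  by rewrite i2 mulN1r opprK.
have z0 n : z n != 0.
  apply/eqP => zn; have := zz n; rewrite zn mul0r => /esym/eqP.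
  by rewrite pnatr_eq0 addn_eq0.
pose w n := z n / (z n)^*.
have wn n : `|w n| = 1 by rewrite normf_div norm_conjC divff// normr_eq0.
have winj : injective w.
  move=> n k /eqP; rewrite /w eqr_div ?conjC_eq0// !zJ /z => /eqP e.
  have i0 : 2 * 'i != 0 :> C by rewrite mulf_neq0 ?neq0Ci// pnatr_eq0.
  have : (2 * 'i) * (n%:R - k%:R) = 0 :> C.
    have -> : (2 * 'i) * (n%:R - k%:R) = (1 + 'i * n%:R) * (1 - 'i * k%:R) - (1 + 'i * k%:R) * (1 - 'i * n%:R) :> C by ring.
    by rewrite e subrr.
  move/eqP; rewrite mulf_eq0 (negbTE i0) subr_eq0 eqr_nat => /eqP//.
have := @max_poly_roots _ _ [seq w n | n <- iota 0 (size p)] pn0.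
rewrite size_map size_iota ltnn => -> //.
  by apply/allP => _ /mapP[n _ ->]; rewrite /root (h _ (wn n)).
by rewrite map_inj_uniq ?iota_uniq.
Qed.

Lemma circle_exp_inj a b : (forall x : C, `|x| = 1 -> x ^+ a = x ^+ b) -> a = b.
Proof.
move=> h; have : 'X^a - 'X^b = 0 :> {poly C}.
  by apply: circle_poly => x x1; rewrite hornerD hornerN !hornerXn h// subrr.
move=> /polyP/(_ a)/eqP; rewrite coefB !coefXn eqxx coef0 subr_eq0.
by case: (a =P b) => //= _; rewrite oner_eq0.
Qed.

(** Commutation with unitary diagonal matrices forces nonzero entries of [Pi] to join words of equal
    weight. Equality of weights no longer involves |z| = 1, so commutation follows for every
    invertible diagonal matrix. *)
Lemma Pi_weight I J : Pi I J != 0 -> wexp I =1 wexp J.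
Proof.
move=> PIJ l; apply: circle_exp_inj => x x1.
have x0 : x != 0 by rewrite -normr_gt0 x1.
pose z i : C := if i == l then x else 1.
have z0 i : z i != 0 by rewrite /z; case: ifP; rewrite ?oner_eq0.
have zn i : z i * (z i)^* = 1.
  by rewrite -normCK /z; case: ifP; rewrite ?x1 ?normr1 expr1n.
have zu : dgmx z \is unitarymx.
  apply/unitarymxP; rewrite tr_diag_mx map_diag_mx mulmx_diag.
  apply/matrixP => i j; rewrite !mxE zn; by [].
have := commutes_unitary zu I J.
have pw K : \prod_i z i ^+ wexp K i = x ^+ wexp K l.
  rewrite (bigD1 l)//= big1 ?mulr1 /z ?eqxx// => i il.
  by rewrite (negbTE il) expr1n.
rewrite (bigD1 I)//= big1 ?addr0 => [|K KI]; last first.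
  by rewrite tens_diag// eq_sym (negbTE KI) !mul0r.
rewrite (bigD1 J)//= [in RHS]big1 ?addr0 => [|K KJ]; last first.
  by rewrite tens_diag// (negbTE KJ) mul0r mulr0.
rewrite !tens_diag// !eqxx !mul1r !pw mulrC => /(mulfI PIJ) //.
Qed.

Lemma commutes_diag (z : 'I_3 -> C) : (forall i, z i != 0) -> commutes (dgmx z).
Proof.
move=> z0 I K; rewrite (bigD1 I)//= big1 ?addr0 => [|J JI]; last first.
  by rewrite tens_diag// eq_sym (negbTE JI) !mul0r.
rewrite (bigD1 K)//= [in RHS]big1 ?addr0 => [|J JK]; last first.
  by rewrite tens_diag// (negbTE JK) mul0r mulr0.
rewrite !tens_diag// !eqxx !mul1r mulrC.
have [->|PIK] := eqVneq (Pi I K) 0; first by rewrite !mul0r.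
by congr (_ * _); apply: eq_bigr => l _; rewrite (Pi_weight PIK).
Qed.

(* Polar decomposition: g = u diag(sqrt sigma) P with g^* g = P^* diag(sigma) P. *)
Lemma commutes_unit g : g \in unitmx -> commutes g.
Proof.
move=> gU.
pose A := g^t* *m g.
have AH : A^t* = A by rewrite /A trmx_mul map_mxM trmxCK.
have An : A \is normalmx by apply/normalmxP; rewrite AH.
have /orthomx_spectralP := An.
set P := spectralmx A; set sp := spectral_diag A => AE.
have Pu : P \is unitarymx := spectral_unitarymx A.
have DE : diag_mx sp = (g *m P^t*)^t* *m (g *m P^t*).
  rewrite trmx_mul map_mxM trmxCK !mulmxA -(mulmxA P) -/A AE invmx_unitary// !mulmxA.
  by rewrite (elimT unitarymxP Pu) mul1mx -mulmxA (elimT unitarymxP Pu) mulmx1.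
have hU : g *m P^t* \in unitmx.
  have PtU : P^t* \in unitmx by apply: unitarymx_unit; rewrite trmxC_unitary.
  by rewrite unitmx_mul gU PtU.
have sp_gt0 i : 0 < sp 0 i.
  have /matrixP/(_ i i) := DE; rewrite !mxE eqxx mulr1n => ->.
  have : (g *m P^t*) *m delta_mx i 0 != 0 :> 'cV_3.
    apply/negP => /eqP h0; have := congr1 (mulmx (invmx (g *m P^t*))) h0.
    rewrite mulmx0 mulKmx// => /colP/(_ i); rewrite !mxE !eqxx => /eqP.
    by rewrite oner_eq0.
  move=> h0; have : nsq ((g *m P^t*) *m delta_mx i 0) != 0.
    by apply: contraNN h0 => /eqP/nsq0P ->.
  rewrite -colE => n0; have -> : \sum_j ((g *m P^t*) ^t*) i j * (g *m P^t*) j i = (nsq (col i (g *m P^t*)))%:C%C.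
    by rewrite -dotcvv dotcE; apply: eq_bigr => j _; rewrite !mxE.
  by rewrite ltcR lt_neqAle eq_sym n0 nsq_ge0.
pose z i := sqrtC (sp 0 i).
have z_gt0 i : 0 < z i by rewrite sqrtC_gt0.
have z0 i : z i != 0 by rewrite gt_eqF.
pose zi i := (z i)^-1.
have zi0 i : zi i != 0 by rewrite invr_eq0.
pose u := g *m P^t* *m dgmx zi.
have uu : u \is unitarymx.
  rewrite -trmxC_unitary; apply/unitarymxP; rewrite trmxCK /u trmx_mul map_mxM.
  set B := g *m P^t* in DE *.
  have -> : (dgmx zi)^t* *m B^t* *m (B *m dgmx zi) = (dgmx zi)^t* *m (B^t* *m B) *m dgmx zi by rewrite !mulmxA.
  rewrite -DE tr_diag_mx map_diag_mx !mulmx_diag.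
  apply/matrixP => i j; rewrite !mxE; congr (_ *+ _).
  have zi_conj : (zi i)^* = zi i by rewrite conj_Creal// gtr0_real// invr_gt0.
  rewrite [X in X * _ * _]zi_conj; have -> : sp 0 i = z i ^+ 2 by rewrite sqrtCK.
  by rewrite /zi; field.
have -> : g = u *m dgmx z *m P.
  rewrite /u -(mulmxA _ _ (dgmx z)) mulmx_diag -[LHS]mulmx1 -(unitary_mulVmx Pu) mulmxA; congr (_ *m _).
  rewrite -[LHS]mulmx1; congr (_ *m _); apply/matrixP => i j; rewrite !mxE.
  by rewrite /zi mulVf.
have uU := unitarymx_unit uu; have PU := unitarymx_unit Pu.
have zU := dgmx_unit z0.
have uzU : u *m dgmx z \in unitmx by rewrite unitmx_mul uU zU.
exact: (commutesM uzU PU (commutesM uU zU (commutes_unitary uu) (commutes_diag z0)) (commutes_unitary Pu)).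
Qed.

Variable J : word m.
Hypothesis J_low : forall K, (hgt s K < hgt s J)%N -> forall i, t K i = 0.

Definition coefF g : C := \sum_K tens s g J K * Pi K J.

(** Commuted past [Pi], the upper factor leads from [J] only to lower words, where [Pi] vanishes;
    the lower factor likewise. Only the diagonal factor survives, and it acts by the weight of
    [J]. *)
Lemma coefF_LDU a b c (z : 'I_3 -> C) a' b' c' : (forall i, z i != 0) ->
  coefF (lowmx a b c *m dgmx z *m upmx a' b' c') =
  Pi J J * \prod_l z l ^+ wexp J l.
Proof.
move=> z0.
have Pi_low K : (hgt s K < hgt s J)%N -> forall I, Pi I K = 0.
  by move=> KJ I; rewrite /Pi big1// => i _; rewrite (J_low KJ) rmorph0 mulr0.
have Pi_low' K : (hgt s K < hgt s J)%N -> forall I, Pi K I = 0.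
  by move=> KJ I; rewrite Pi_herm Pi_low// rmorph0.
have dU := dgmx_unit z0; have lU := lowmx_unit a b c; have nU := upmx_unit a' b' c'.
have ldU : lowmx a b c *m dgmx z \in unitmx by rewrite unitmx_mul lU dU.
have up_fix K : \sum_L tens s (upmx a' b' c') K L * Pi L J = Pi K J.
  rewrite commutes_unit// (bigD1 J)//= big1 ?addr0 => [|L LJ].
    by rewrite /tens big1 ?mulr1// => k _; rewrite slot_up1.
  have [->|/(tens_hgt (fun b i j => @slot_up b a' b' c' i j))[]] := eqVneq (tens s (upmx a' b' c') L J) 0.
  - by rewrite mulr0.
  - by move/eqP; rewrite (negbTE LJ).
  - by move/Pi_low => ->; rewrite mul0r.
have dg_fix K : \sum_L tens s (dgmx z) K L * Pi L J = Pi K J * \prod_l z l ^+ wexp J l.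
  rewrite commutes_diag// (bigD1 J)//= big1 ?addr0 => [|L LJ].
    by rewrite tens_diag// eqxx mul1r.
  by rewrite tens_diag// (negbTE LJ) mul0r mulr0.
rewrite /coefF.
transitivity (\sum_K \sum_L tens s (lowmx a b c *m dgmx z) J K * tens s (upmx a' b' c') K L * Pi L J).
  rewrite exchange_big; apply: eq_bigr => K _ /=.
  by rewrite (tens_mul s _ _ ldU nU) mulr_suml.
transitivity (\sum_K tens s (lowmx a b c *m dgmx z) J K * Pi K J).
  by apply: eq_bigr => K _; rewrite -[in RHS]up_fix mulr_sumr; apply: eq_bigr => L _; rewrite mulrA.
transitivity (\sum_K \sum_L tens s (lowmx a b c) J K * tens s (dgmx z) K L * Pi L J).
  rewrite exchange_big; apply: eq_bigr => K _ /=.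
  by rewrite (tens_mul s _ _ lU dU) mulr_suml.
transitivity (\sum_K tens s (lowmx a b c) J K * (Pi K J * \prod_l z l ^+ wexp J l)).
  by apply: eq_bigr => K _; rewrite -dg_fix mulr_sumr; apply: eq_bigr => L _; rewrite mulrA.
set w := \prod_l _; rewrite (bigD1 J)//= big1 ?addr0 => [|K KJ].
  have -> : tens s (lowmx a b c) J J = 1 by rewrite /tens big1// => k _; rewrite slot_low1.
  by rewrite mul1r.
have [->|/(tens_low (fun e i j => @slot_low e a b c i j))[]] := eqVneq (tens s (lowmx a b c) J K) 0.
- by rewrite mul0r.
- by move/esym/eqP; rewrite (negbTE KJ).
- by move/Pi_low' => ->; rewrite mul0r mulr0.
Qed.

Lemma polyfun_tens (g : C -> 'M[C]_3) I K :
  (forall i j, polyfun (fun z => g z i j)) -> polyfun (fun z => tens s (g z) I K).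
Proof.
move=> gp; apply: polyfun_prod => k; case: (s k) => //=.
have cp i j : polyfun (fun z => cof3 (g z) i j).
  elim/ord3P: i; elim/ord3P: j; (apply: polyfun_ext => [z|]; first by rewrite [RHS]mxE /=; reflexivity);
   by apply: polyfunD; [|apply: polyfunN]; apply: polyfunM.
by apply: polyfun_ext (cp _ _) => z; rewrite /slot cofE3.
Qed.

Lemma polyfun_coefF (g : C -> 'M[C]_3) :
  (forall i j, polyfun (fun z => g z i j)) -> polyfun (fun z => coefF (g z)).
Proof.
move=> gp; apply: polyfun_sum => K; apply: polyfunM; [exact: polyfun_tens|exact: polyfun_cst].
Qed.

Lemma polyfun_minor2 (g : C -> 'M[C]_3) :
  (forall i j, polyfun (fun z => g z i j)) -> polyfun (fun z => minor2 (g z)).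
Proof.
by move=> gp; apply: polyfunD; try apply: polyfunN; apply: polyfunM.
Qed.

Lemma polyfun_det3 (g : C -> 'M[C]_3) :
  (forall i j, polyfun (fun z => g z i j)) -> polyfun (fun z => det3 (g z)).
Proof.
by move=> gp; do ?[apply: polyfunD|apply: polyfunN|apply: polyfunM].
Qed.

Lemma coefF_big_cell g : g o0 o0 != 0 -> minor2 g != 0 -> det3 g != 0 ->
  coefF g * g o0 o0 ^+ wexp J o1 * minor2 g ^+ wexp J o2 =
  Pi J J * g o0 o0 ^+ wexp J o0 * minor2 g ^+ wexp J o1 * det3 g ^+ wexp J o2.
Proof.
move=> d1 d2 d3; rewrite [in coefF g](LDU d1 d2) coefF_LDU; last first.
  by elim/ord3P; rewrite /pivots //= mulf_neq0 ?invr_eq0.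
rewrite big_ord3 /= /pivots /= !expr_div_n.
have := expf_neq0 (wexp J o1) d1; have := expf_neq0 (wexp J o2) d2 => h1 h2.
by field; rewrite h1 h2.
Qed.

Hypothesis J_nz : Pi J J != 0.

(** If [b] exceeded [a], the polynomial [coefF (g z) * z ^+ (b - a)] would be the nonzero constant
    [Pi J J] for z != 0 and hence at 0, where it vanishes. *)
Lemma monomial_exp_le (g : C -> 'M[C]_3) a b : (forall i j, polyfun (fun z => g z i j)) ->
  (forall z, z != 0 -> coefF (g z) * z ^+ b = Pi J J * z ^+ a) -> (b <= a)%N.
Proof.
move=> gp h; rewrite leqNgt; apply/negP => lt.
have : coefF (g 0) * 0 ^+ (b - a) - Pi J J = 0.
  apply: (@polyfun_generic _ (fun z => coefF (g z) * z ^+ (b - a) - Pi J J) id 1).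
  - apply: polyfunD; last exact: polyfun_cst.
    by apply: polyfunM; [exact: polyfun_coefF|apply: polyfunX; exact: polyfun_id].
  - exact: polyfun_id.
  - exact: oner_neq0.
  - move=> z z0; apply/eqP; rewrite subr_eq0; apply/eqP/(mulIf (expf_neq0 a z0)).
    by rewrite -mulrA -exprD subnK ?(ltnW lt)// h.
rewrite expr0n subn_eq0 leqNgt lt /= mulr0 sub0r => /eqP.
by rewrite oppr_eq0 (negbTE J_nz).
Qed.

(** Along this curve the leading entry is [z] while the leading minor and the determinant stay 1; a
    polynomial coefficient cannot be a negative power of [z]. The next lemma does the same with the
    leading minor as parameter. *)
Lemma wexp10 : (wexp J o1 <= wexp J o0)%N.
Proof.
pose g (z : C) := mx3 [:: [:: z; 1; 0]; [:: -1; 0; 0]; [:: 0; 0; 1] ].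
have gp i j : polyfun (fun z => g z i j).
  elim/ord3P: i; elim/ord3P: j; (apply: polyfun_ext => [z|]; first by rewrite [RHS]mxE /=; reflexivity);
   (exact: polyfun_cst || exact: polyfun_id).
apply: (monomial_exp_le gp) => z z0.
have e1 : g z o0 o0 = z by rewrite mxE.
have e2 : minor2 (g z) = 1 by rewrite /minor2 !mxE /=; ring.
have e3 : det3 (g z) = 1 by rewrite /det3 !mxE /=; ring.
have := @coefF_big_cell (g z); rewrite e1 e2 e3 !expr1n !mulr1.
by move=> /(_ z0 (oner_neq0 _) (oner_neq0 _)).
Qed.

Lemma wexp21 : (wexp J o2 <= wexp J o1)%N.
Proof.
pose g (z : C) := mx3 [:: [:: 1; 0; 0]; [:: 0; z; 1]; [:: 0; -1; 0] ].
have gp i j : polyfun (fun z => g z i j).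
  elim/ord3P: i; elim/ord3P: j; (apply: polyfun_ext => [z|]; first by rewrite [RHS]mxE /=; reflexivity);
   (exact: polyfun_cst || exact: polyfun_id).
apply: (monomial_exp_le gp) => z z0.
have e1 : g z o0 o0 = 1 by rewrite mxE.
have e2 : minor2 (g z) = z by rewrite /minor2 !mxE /=; ring.
have e3 : det3 (g z) = 1 by rewrite /det3 !mxE /=; ring.
have := @coefF_big_cell (g z); rewrite e1 e2 e3 !expr1n !mulr1.
by move=> /(_ (oner_neq0 _) z0 (oner_neq0 _)).
Qed.

Lemma coefFE g : coefF g = Pi J J * g o0 o0 ^+ (wexp J o0 - wexp J o1) *
  minor2 g ^+ (wexp J o1 - wexp J o2) * det3 g ^+ wexp J o2.
Proof.
(* All leading minors of [g + z] are nonzero for all but finitely many [z], so the formula extends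
   to z = 0 as a polynomial identity. *)
pose G (z : C) := g + z%:M.
have GE z i j : G z i j = g i j + (i == j)%:R * z by rewrite !mxE mulr_natl.
have Gp i j : polyfun (fun z => G z i j).
  apply: polyfun_ext => [z|]; first by rewrite [RHS]GE; reflexivity.
  by apply: polyfunD; [|apply: polyfunM; [|exact: polyfun_id]]; exact: polyfun_cst.
pose D z := G z o0 o0 * minor2 (G z) * det3 (G z).
have p00 := Gp o0 o0; have pm := polyfun_minor2 Gp; have pd := polyfun_det3 Gp.
have pD : polyfun D by apply: polyfunM => //; exact: polyfunM.
(* The k-th finite difference of a monic polynomial of degree k is k!. *)
have [z0 Dz0] : exists z, D z != 0.
  apply: polyfunM_neq0 => //; first exact: polyfunM; [apply: polyfunM_neq0 => //|].
  - by exists (1 - g o0 o0); rewrite GE eqxx mul1r addrC subrK oner_neq0.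
  - apply: contrapT => h.
    have {}h z : minor2 (G z) = 0 by apply/eqP; apply: contrapT => /negP ne; apply: h; exists z.
    have : minor2 (G 2) - 2 * minor2 (G 1) + minor2 (G 0) = 2 by rewrite /minor2 !GE /=; ring.
    by rewrite !h => /eqP; rewrite !(subr0, mulr0, addr0) eq_sym pnatr_eq0.
  - apply: contrapT => h.
    have {}h z : det3 (G z) = 0 by apply/eqP; apply: contrapT => /negP ne; apply: h; exists z.
    have : det3 (G 3) - 3 * det3 (G 2) + 3 * det3 (G 1) - det3 (G 0) = 6 by rewrite /det3 !GE /=; ring.
    by rewrite !h => /eqP; rewrite !(subr0, mulr0, addr0) eq_sym pnatr_eq0.
have G0 : G 0 = g by apply/matrixP => i j; rewrite GE mulr0 addr0.
pose f z := coefF (G z) - Pi J J * G z o0 o0 ^+ (wexp J o0 - wexp J o1) *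
  minor2 (G z) ^+ (wexp J o1 - wexp J o2) * det3 (G z) ^+ wexp J o2.
suff f0 : forall z, f z = 0 by apply/eqP; rewrite -G0 -subr_eq0; apply/eqP; exact: (f0 0).
apply: (@polyfun_generic _ f D z0) => //.
  apply: polyfunD; first exact: polyfun_coefF.
  apply: polyfunN; do 3?apply: polyfunM; try exact: polyfunX; exact: polyfun_cst.
move=> z; rewrite /D !mulf_eq0 !negb_or => /andP[/andP[d1 d2] d3].
apply/eqP; rewrite subr_eq0; apply/eqP.
apply: (mulIf (expf_neq0 (wexp J o1) d1)); apply: (mulIf (expf_neq0 (wexp J o2) d2)).
rewrite coefF_big_cell//.
have := subnK wexp10; have := subnK wexp21; move: (_ - _)%N (_ - _)%N => a b <- <-.
rewrite !exprD; ring.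
Qed.

(** On SU(3) the determinant is 1 and the leading 2 x 2 minor is the conjugate of the opposite
    entry, so the leading minors reduce to two entries of [g]. *)
Lemma matrix_coef g : SU3 g ->
  let v : 'cV[C]_d := \col_i (t J i)^* in
  dotc v (rho g *m v) = (nsq v)%:C%C *
    (g o0 o0 ^+ (wexp J o0 - wexp J o1) * (g o2 o2)^* ^+ (wexp J o1 - wexp J o2)).
Proof.
move=> Sg v.
have -> : (nsq v)%:C%C = Pi J J.
  by rewrite -dotcvv dotcE /Pi; apply: eq_bigr => i _; rewrite !mxE conjCK.
have -> : dotc v (rho g *m v) = coefF g.
  rewrite dotcE; transitivity (\sum_i \sum_j t J i * rho g i j * (t J j)^*).
    by apply: eq_bigr => i _; rewrite !mxE conjCK mulr_sumr; apply: eq_bigr => j _; rewrite !mxE mulrA.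
  rewrite exchange_big /=; transitivity (\sum_j \sum_K tens s g J K * t K j * (t J j)^*).
    by apply: eq_bigr => j _; rewrite -!mulr_suml t_intertw.
  by rewrite exchange_big /=; apply: eq_bigr => K _; rewrite /Pi mulr_sumr; apply: eq_bigr => j _; rewrite mulrA.
rewrite coefFE -det3E; have -> : \det g = 1 by case: Sg.
have -> : minor2 g = (g o2 o2)^*.
  have := cof_SU3 Sg => /matrixP/(_ o2 o2); rewrite cofE3 !mxE /= => <-.
  by rewrite /minor2.
by rewrite expr1n mulr1 -mulrA.
Qed.
End HighestWeight.

(** * Classification of the irreducible representations *)

Section Orbits.
Variable R : realType.
Local Notation C := R[i].
Implicit Types g h : 'M[C]_3.

Definition colsmx N (x : 'M[C]_3 -> 'cV[C]_N) (l : seq 'M[C]_3) : 'M[C]_(N, size l) :=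
  \matrix_(i, j) x (nth 0 l j) i 0.

Lemma col_colsmx N (x : 'M[C]_3 -> 'cV[C]_N) l j : col j (colsmx x l) = x (nth 0 l j).
Proof. by apply/colP => i; rewrite !mxE. Qed.

(** If no nonzero row vector annihilates all [x g], these vectors span, and finitely many of them
    suffice; [B] expresses every vector through them. *)
Lemma span_list N (x : 'M[C]_3 -> 'cV[C]_N) (S : set 'M[C]_3) :
  (forall u : 'rV_N, (forall g, S g -> u *m x g = 0) -> u = 0) ->
  exists2 l : seq 'M[C]_3, (forall g, g \in l -> S g) & exists B, colsmx x l *m B = 1%:M.
Proof.
move=> x0; pose M (l : seq 'M[C]_3) := (\sum_(g <- l) <<(x g)^T>>)%MS.
have [l lS lmax] := max_rank_list S M.
have Mfull : row_full (M l).
  rewrite -cokermx_eq0; apply/eqP/matrixP => i j; rewrite mxE.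
  suff : (col j (cokermx (M l)))^T = 0 by move/rowP/(_ i); rewrite !mxE.
  apply: x0 => g Sg.
  have sub : ((x g)^T <= M l)%MS.
    have Mc : M (g :: l) = (<<(x g)^T>> + M l)%MS by rewrite /M big_cons.
    have le : (M l <= M (g :: l))%MS by rewrite Mc addsmxSr.
    have := mxrank_leqif_sup le; case=> le1 eq1.
    have gl : forall h, h \in g :: l -> S h by move=> h; rewrite inE => /predU1P[->|/lS].
    have := lmax _ gl => le2.
    have : (M (g :: l) <= M l)%MS by rewrite -eq1 eqn_leq le1 le2.
    by apply: submx_trans; rewrite Mc (submx_trans _ (addsmxSl _ _))// genmxE.
  apply: trmx_inj; rewrite trmx_mul trmxK trmx0; move/submxP: sub => [u ->].
  by rewrite colE mulmxA -(mulmxA u) mulmx_coker mulmx0 mul0mx.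
exists l => //.
have : (1%:M <= (colsmx x l)^T)%MS.
  apply: (@submx_trans _ _ _ _ _ _ (M l)); first by rewrite sub1mx.
  rewrite /M (big_nth 0) big_mkord; apply/sumsmx_subP => j _; rewrite genmxE.
  by rewrite -col_colsmx tr_col row_sub.
move=> /submxP[B BE]; exists B^T; apply: trmx_inj.
by rewrite trmx_mul trmxK trmx1 BE.
Qed.

Lemma gram_ker m n (A : 'M[C]_(m, n)) p (B : 'M[C]_(n, p)) : A^t* *m A *m B = 0 -> A *m B = 0.
Proof.
move=> h; apply/matrixP => i j; rewrite [RHS]mxE.
suff h0 : A *m col j B = 0.
  have := congr1 (fun M : 'cV_m => M i 0) h0; rewrite [RHS]mxE => <-.
  by rewrite !mxE; apply: eq_bigr => k _; rewrite mxE.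
apply/nsq0P; rewrite nsqE dotcMl mulmxA.
suff -> : A ^t* *m A *m col j B = 0 by rewrite dotc0r.
by rewrite colE mulmxA h mul0mx.
Qed.

(** The Gram matrix has the same kernel as [A], because v^* A^* A v is the squared norm of A v. *)
Lemma gram_rank m n (A : 'M[C]_(m, n)) : \rank (A^t* *m A) = \rank A.
Proof.
apply/eqP; rewrite eqn_leq mxrankM_maxr /=; apply: mxrankS.
rewrite submxE; apply/eqP; apply: gram_ker; exact: mulmx_coker.
Qed.

Lemma gram_rank_eq N1 N2 (x : 'M[C]_3 -> 'cV[C]_N1) (y : 'M[C]_3 -> 'cV[C]_N2) l :
  (forall g h, g \in l -> h \in l -> dotc (x h) (x g) = dotc (y h) (y g)) ->
  (colsmx x l)^t* *m colsmx x l = (colsmx y l)^t* *m colsmx y l.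
Proof.
move=> xy; apply/matrixP => i j; rewrite !mxE.
have := xy (nth 0 l j) (nth 0 l i) (mem_nth _ (ltn_ord _)) (mem_nth _ (ltn_ord _)).
rewrite !dotcE => e; under eq_bigr do rewrite !mxE; rewrite e.
by apply: eq_bigr => k _; rewrite !mxE.
Qed.

Section Rep.
Variables (D : nat) (E : 'M[C]_3 -> 'M[C]_D).
Hypothesis EU : unitary_rep E.
Let EM := unitary_repM EU.
Let Eunit := unitary_rep_unitary EU.

Lemma orbit_dotc w g h : SU3 g -> SU3 h ->
  dotc (E h *m w) (E g *m w) = dotc w (E (h^t* *m g) *m w).
Proof.
move=> Sg Sh; rewrite dotcMl mulmxA (EM (SU3V Sh) Sg).
by rewrite (unit_EV EM Eunit Sh).
Qed.

(** The span of the orbit is reached by a finite list of maximal dimension. Its last property says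
    that the orbit spans it, in the dual form that is used later. *)
Lemma orbit_vspace w : exists W : {vspace 'cV[C]_D},
  [/\ w \in W, forall g v, SU3 g -> v \in W -> E g *m v \in W &
   forall u : 'rV_D, (forall g, SU3 g -> u *m (E g *m w) = 0) -> forall v, v \in W -> u *m v = 0].
Proof.
pose X (l : seq 'M[C]_3) := [seq E g *m w | g <- l].
pose P k := `[< exists2 l : seq 'M[C]_3, (forall g, g \in l -> SU3 g) & \dim <<X l>> = k >].
have exP : exists k, P k by exists (\dim <<X [::]>>); apply/asboolP; exists [::].
have ubP k : P k -> (k <= \dim {: 'cV[C]_D})%N.
  by move=> /asboolP[l _ <-]; apply: dimvS; exact: subvf.
have [k /asboolP[l lS lk] kmax] := ex_maxnP exP ubP.
have inW g : SU3 g -> E g *m w \in <<X l>>%VS.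
  move=> Sg; have sub : (<<X l>> <= <<X (g :: l)>>)%VS.
    by apply: sub_span => v vl; rewrite /= inE vl orbT.
  have : (<<X l>> == <<X (g :: l)>>)%VS.
    rewrite eqEdim sub /= lk; apply: kmax; apply/asboolP; exists (g :: l) => // h.
    by rewrite inE => /predU1P[->|/lS].
  by move=> /eqP ->; apply: memv_span; rewrite /= mem_head.
exists <<X l>>%VS; split.
- by have := inW _ (@SU3_1 R); rewrite (unit_E1 EM Eunit) mul1mx.
- move=> g v Sg vl; rewrite (coord_span (X := in_tuple (X l)) vl) mulmx_sumr; apply: memv_suml => i _.
  rewrite -scalemxAr; apply: memvZ.
  have : (X l)`_i \in X l by apply: mem_nth.
  by move=> /mapP[h /lS Sh ->]; rewrite mulmxA -EM//; apply: inW; exact: SU3M.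
- move=> u u0 v vl; rewrite (coord_span (X := in_tuple (X l)) vl) mulmx_sumr big1// => i _.
  rewrite -scalemxAr; have : (X l)`_i \in X l by apply: mem_nth.
  by move=> /mapP[h /lS Sh ->]; rewrite u0// scaler0.
Qed.

Lemma irreducible_orbit (w : 'cV[C]_D) : irreducible_rep E -> w != 0 ->
  forall u : 'rV[C]_D, (forall g, SU3 g -> u *m (E g *m w) = 0) -> u = 0.
Proof.
move=> [D0 irr] w0 u u0; have [W [wW Winv Wu]] := orbit_vspace w.
have Wf : W = fullv.
  by case: (irr W Winv) => // W0; move: wW w0; rewrite W0 memv0 => ->.
apply/rowP => j; rewrite mxE; have := Wu u u0 (delta_mx j 0); rewrite Wf memvf => /(_ isT).
by move/matrixP/(_ 0 0); rewrite -colE !mxE.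
Qed.

End Rep.

(** Uniqueness in the Gelfand-Naimark-Segal construction: equal coefficients mean equal inner
    products along the two orbits, so sending g v1 to g v2 extends to a linear map. Irreducibility
    makes both orbits spanning. *)
Lemma irrep_equiv_coef (r1 r2 : irrep C) v1 v2 : v1 != 0 ->
  (forall g, SU3 g -> dotc v1 (r1 g *m v1) = dotc v2 (r2 g *m v2)) -> irrep_equiv r1 r2.
Proof.
move=> v10 ff.
have U1 := irrep_unitary r1; have U2 := irrep_unitary r2.
have v20 : v2 != 0.
  apply: contraNneq v10 => v20; apply/eqP/nsq0P; have := ff _ (@SU3_1 R).
  rewrite (unit_E1 (unitary_repM U1) (unitary_rep_unitary U1)) mul1mx v20 mulmx0 dotc0r.
  by rewrite dotcvv => -[].
pose x g := r1 g *m v1; pose y g := r2 g *m v2.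
have xy g h : SU3 g -> SU3 h -> dotc (x h) (x g) = dotc (y h) (y g).
  by move=> Sg Sh; rewrite /x /y !orbit_dotc// ff//; apply: SU3M => //; exact: SU3V.
(* A combination [c] of finitely many [a h] that equals [a g] must give [b g] as the same
   combination of the [b h]: the squared norm of the difference depends on inner products alone, and
   it is 0 on the side of [a]. *)
have intertwiner d1 d2 (a : 'M[C]_3 -> 'cV[C]_d1) (b : 'M[C]_3 -> 'cV[C]_d2) :
    (forall g h, SU3 g -> SU3 h -> dotc (a h) (a g) = dotc (b h) (b g)) ->
    (forall u : 'rV_d1, (forall g, SU3 g -> u *m a g = 0) -> u = 0) ->
    exists P : 'M[C]_(d2, d1), forall g, SU3 g -> P *m a g = b g.
  move=> ab /(span_list)[l lS [B AB]].
  exists (colsmx b l *m B) => g Sg; rewrite -mulmxA; set c := B *m a g.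
  have ac : colsmx a l *m c = a g by rewrite /c mulmxA AB mul1mx.
  apply/eqP; rewrite -subr_eq0; apply/eqP/nsq0P.
  have : nsq (colsmx a l *m c - a g) = 0 by rewrite ac subrr nsq0.
  suff -> : nsq (colsmx b l *m c - b g) = nsq (colsmx a l *m c - a g) by [].
  have G : (colsmx a l)^t* *m colsmx a l = (colsmx b l)^t* *m colsmx b l.
    by apply: gram_rank_eq => h k /lS ? /lS ?; exact: ab.
  have G2 : (colsmx a l)^t* *m a g = (colsmx b l)^t* *m b g.
    apply/colP => j; rewrite !mxE.
    have := ab g (nth 0 l j) Sg (lS _ (mem_nth _ (ltn_ord j))); rewrite !dotcE => e.
    transitivity (\sum_i (a (nth 0 l j) i 0)^* * a g i 0).
      by apply: eq_bigr => i _; rewrite !mxE.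
    by rewrite e; apply: eq_bigr => i _; rewrite !mxE.
  rewrite !nsqB !nsqE; congr (complex.Re _ + complex.Re _ - 2 * complex.Re _).
  - by rewrite dotcMl [in RHS]dotcMl !(mulmxA (_^t*)) G.
  - by rewrite ab.
  - by rewrite dotcC [RHS]dotcC !dotcMl G2.
have irrx := irreducible_orbit U1 (irrep_irreducible r1) v10.
have irry := irreducible_orbit U2 (irrep_irreducible r2) v20.
have [P PE] := intertwiner _ _ x y xy irrx.
have [Q QE] := intertwiner _ _ y x (fun g h Sg Sh => esym (xy g h Sg Sh)) irry.
(* The orbit spans, so matrices that agree on it are equal. *)
have ext d d' (a : 'M[C]_3 -> 'cV[C]_d) (M N : 'M[C]_(d', d)) :
    (forall u : 'rV_d, (forall g, SU3 g -> u *m a g = 0) -> u = 0) ->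
    (forall g, SU3 g -> M *m a g = N *m a g) -> M = N.
  move=> irr MN; apply/eqP; rewrite -subr_eq0; apply/eqP/row_matrixP => i; rewrite row0.
  apply: irr => g Sg; rewrite rowE -mulmxA mulmxBl MN// subrr mulmx0//.
exists Q, P; split.
- by apply: (ext _ _ x) => // g Sg; rewrite mul1mx -mulmxA PE// QE.
- by apply: (ext _ _ y) => // g Sg; rewrite mul1mx -mulmxA QE// PE.
- move=> g Sg; apply: (ext _ _ y) => // h Sh.
  rewrite -!mulmxA QE// /x /y !mulmxA -(unitary_repM U1 Sg Sh) -(mulmxA Q) -(unitary_repM U2 Sg Sh).
  by rewrite -(mulmxA Q) (QE _ (SU3M Sg Sh)).
Qed.

Lemma orthonormal_basis D (U : {vspace 'cV[C]_D}) : exists t : 'M[C]_(D, \dim U),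
  t^t* *m t = 1%:M /\ forall v, v \in U <-> exists c, v = t *m c.
Proof.
pose B : 'M[C]_(\dim U, D) := \matrix_(i < \dim U) ((vbasis U)`_i)^T.
have rB i : row i B = ((vbasis U)`_i)^T by rewrite rowK.
have Bfree : row_free B.
  rewrite -kermx_eq0; apply/eqP/row_matrixP => i; rewrite row0.
  have h : row i (kermx B) *m B = 0 by rewrite -row_mul mulmx_ker row0.
  apply/rowP => j; rewrite [RHS]mxE.
  have /freeP := basis_free (vbasisP U); apply.
  move: h; rewrite mulmx_sum_row => /(congr1 trmx); rewrite raddf_sum trmx0 => h.
  by rewrite -[RHS]h; apply: eq_bigr => k _; rewrite /= rB -[in RHS]linearZ /= trmxK.
have kD : (\dim U <= D)%N.
  by have := rank_leq_col B; rewrite (eqP Bfree).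
have Qu := schmidt_unitarymx B kD.
have QB := eqmx_schmidt_free Bfree.
exists (schmidt B)^T; split.
  have := elimT unitarymxP Qu => /(congr1 (map_mx Num.conj)).
  by rewrite map_mxM map_mx1 trmxK -map_mx_comp => <-; congr (_ *m _);
    apply/matrixP => i j; rewrite !mxE /= ?conjCK.
move=> v; split.
  move=> /coord_vbasis vE.
  have : (v^T <= schmidt B)%MS.
    rewrite QB vE raddf_sum /=; apply: summx_sub => i _.
    by rewrite linearZ /= scalemx_sub// -rB row_sub.
  by move=> /submxP[c cE]; exists c^T; rewrite -trmx_mul -cE trmxK.
move=> [c ->].
have : ((( schmidt B)^T *m c)^T <= B)%MS by rewrite -QB trmx_mul trmxK submxMl.
move=> /submxP[e eE]; rewrite -[_ *m c]trmxK eE mulmx_sum_row raddf_sum /=.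
apply: memv_suml => i _; rewrite linearZ /= rB trmxK; apply: memvZ.
by apply: vbasis_mem; apply: mem_nth; rewrite size_tuple.
Qed.

End Orbits.

Section Continuity.
Variable K : numFieldType.

Lemma continuous_entries m n (T : topologicalType) (f : T -> 'M[K]_(m, n)) :
  (forall i j, continuous (fun x => f x i j)) -> continuous f.
Proof.
move=> fc x A [P nP PA]; apply: (@filterS _ _ _ [set y | forall i j, P i j (f y i j)]).
  by move=> y yP; apply: PA.
apply: filter_forall => i; apply: filter_forall => j; exact: fc (nP i j).
Qed.

Lemma continuous_sum (T : topologicalType) (I : Type) (r : seq I) (f : I -> T -> K) :
  (forall i, continuous (f i)) -> continuous (fun x => \sum_(i <- r) f i x).
Proof.
move=> fc; elim: r => [|i r IH] x.
  under eq_fun do rewrite big_nil; exact: cvg_cst.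
under eq_fun do rewrite big_cons.
apply: cvgD; [exact: fc|exact: IH].
Qed.

Lemma continuous_prod (T : topologicalType) (I : Type) (r : seq I) (f : I -> T -> K) :
  (forall i, continuous (f i)) -> continuous (fun x => \prod_(i <- r) f i x).
Proof.
move=> fc; elim: r => [|i r IH] x.
  under eq_fun do rewrite big_nil; exact: cvg_cst.
under eq_fun do rewrite big_cons.
apply: cvgM; [exact: fc|exact: IH].
Qed.

Lemma continuous_entry m n (T : topologicalType) (f : T -> 'M[K]_(m, n)) i j :
  continuous f -> continuous (fun x => f x i j).
Proof. by move=> fc x; apply: (@continuous_comp _ _ _ f (fun M => M i j)); [exact: fc|exact: coord_continuous]. Qed.

Lemma continuous_mulmx m n p (T : topologicalType) (f : T -> 'M[K]_(m, n)) (g : T -> 'M[K]_(n, p)) :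
  continuous f -> continuous g -> continuous (fun x => f x *m g x).
Proof.
move=> fc gc; apply: continuous_entries => i j x.
under eq_fun do rewrite mxE; apply: continuous_sum => k {}x.
apply: cvgM; exact: continuous_entry.
Qed.

End Continuity.

Lemma trmxC_mul (K : numClosedFieldType) m n p (A : 'M[K]_(m, n)) (B : 'M[K]_(n, p)) :
  (A *m B)^t* = (B^t*) *m (A^t*).
Proof. by rewrite trmx_mul map_mxM. Qed.

(** * Irreducible constituents *)

Section SubIrrep.
Variable R : realType.
Local Notation C := R[i].
Variables (D : nat) (E : 'M[C]_3 -> 'M[C]_D).
Hypothesis EU : unitary_rep E.
Let EM := unitary_repM EU.
Let Eunit := unitary_rep_unitary EU.

Definition compress k (t : 'M[C]_(D, k)) g := t^t* *m E g *m t.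

(** An isometry onto an invariant subspace; subrepresentations are handled through such frames so
    that they are again given by unitary matrices. *)
Definition invariant_frame k (t : 'M[C]_(D, k)) :=
  t^t* *m t = 1%:M /\ forall g, SU3 g -> E g *m t = t *m compress t g.

Lemma compress_rep k (t : 'M[C]_(D, k)) : invariant_frame t -> unitary_rep (compress t).
Proof.
move=> [tt tE].
have cM g h : SU3 g -> SU3 h -> compress t (g *m h) = compress t g *m compress t h.
  move=> Sg Sh; rewrite {1}/compress (EM Sg Sh) mulmxA -(mulmxA _ (E h)) (tE _ Sh).
  by rewrite -!mulmxA.
split=> //.
- move=> g Sg; apply/unitarymxP.
  have -> : (compress t g)^t* = compress t (g^t*).
    by rewrite /compress (unit_EV EM Eunit Sg) !trmxC_mul trmxCK mulmxA.
  rewrite -(cM _ _ Sg (SU3V Sg)) (SU3_mulV Sg) /compress.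
  by rewrite (unit_E1 EM Eunit) mulmx1.
- apply: continuous_mulmx; last by move=> x; exact: cvg_cst.
  apply: continuous_mulmx; first by move=> x; exact: cvg_cst.
  exact: unitary_rep_continuous EU.
Qed.

Lemma frame_split k (t : 'M[C]_(D, k)) (W : {vspace 'cV[C]_k}) : invariant_frame t ->
  (forall g v, SU3 g -> v \in W -> compress t g *m v \in W) ->
  exists s : 'M[C]_(k, \dim W), [/\ s^t* *m s = 1%:M, forall v, v \in W <-> exists c, v = s *m c &
    invariant_frame (t *m s)].
Proof.
move=> [tt tE] Winv; have [s [ss sW]] := orthonormal_basis W.
have ts : (t *m s)^t* *m (t *m s) = 1%:M.
  by rewrite trmxC_mul -mulmxA (mulmxA _ t) tt mul1mx.
exists s; split => //; split=> // g Sg.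
have sI : compress t g *m s = s *m (s^t* *m compress t g *m s).
  apply/matrixP => i j.
  have /sW[c cE] : compress t g *m col j s \in W.
    by apply: Winv => //; apply/sW; exists (delta_mx j 0); rewrite colE.
  have : compress t g *m col j s = s *m (s^t* *m compress t g *m col j s).
    by rewrite -(mulmxA (s^t*)) cE (mulmxA (s^t*)) ss mul1mx.
  move: (compress t g) (s^t* *m compress t g) => X Y; rewrite !colE !mulmxA -!colE.
  by move=> /(congr1 (fun v : 'cV_k => v i 0)); rewrite [in LHS]mxE [in RHS]mxE => ->.
rewrite mulmxA (tE _ Sg) -mulmxA sI mulmxA; congr (_ *m _).
by rewrite /compress trmxC_mul !mulmxA.
Qed.

(** Among the invariant frames on which [w] has a nonzero projection, one of minimal width is
    irreducible. By minimality the projection of [w] is orthogonal to every proper invariant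
    subspace, which cannot hold for both a subspace and its complement when both are proper. *)
Lemma sub_irrep (w : 'cV[C]_D) : w != 0 -> exists r : irrep C, exists t : 'M[C]_(D, degree r),
  [/\ t^t* *m t = 1%:M, forall g, SU3 g -> E g *m t = t *m r g & t^t* *m w != 0].
Proof.
move=> w0.
pose P k := `[< exists t : 'M[C]_(D, k), invariant_frame t /\ t^t* *m w != 0 >].
have exP : exists k, P k.
  exists D; apply/asboolP; exists 1%:M.
  have -> : (1%:M : 'M[C]_D)^t* = 1%:M by rewrite trmx1 map_mx1.
  rewrite mul1mx; split=> //; split; first by rewrite trmx1 map_mx1 mulmx1.
  by move=> g _; rewrite /compress trmx1 map_mx1 !mulmx1 !mul1mx.
have [k /asboolP[t [tf tw]] kmin] := ex_minnP exP.
have [tt tE] := tf.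
have small (W : {vspace 'cV[C]_k}) : (forall g v, SU3 g -> v \in W -> compress t g *m v \in W) ->
    W != fullv -> forall v, v \in W -> dotc v (t^t* *m w) = 0.
  move=> Winv Wf v; have [s [ss sW sf]] := frame_split tf Winv.
  move=> /sW[c ->]; rewrite dotcMl; apply/eqP; apply: contraNT Wf => nz.
  have : (k <= \dim W)%N.
    apply: kmin; apply/asboolP; exists (t *m s); split=> //.
    by apply: contraNneq nz; rewrite trmxC_mul -mulmxA => ->; rewrite dotc0r.
  by rewrite eqEdim subvf dimvf /dim /= muln1.
have irr : irreducible_rep (compress t).
  split.
    by rewrite lt0n; apply: contraNneq tw => k0; apply/eqP/colP; move: t {tf tt tE small}; rewrite k0 => t [].
  move=> W Winv; have [W0|Wn0] := eqVneq W 0%VS; first by left.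
  right; apply/eqP; apply: contraNT tw => Wf.
  have [s [ss sW sf]] := frame_split tf Winv.
  (* The orthogonal complement of [W]. It contains the projection of [w]; were it proper, that
     vector would be orthogonal to itself. *)
  pose W' : {vspace 'cV[C]_k} := lker (linfun (mulmx (s^t*))).
  have W'E v : (v \in W') = (s^t* *m v == 0) by rewrite memv_ker lfunE.
  have uW' : t^t* *m w \in W'.
    rewrite W'E; apply/eqP/colP => i; rewrite [RHS]mxE.
    have := small W Winv Wf (s *m delta_mx i 0); rewrite dotcMl dotc_delta; apply.
    by apply/sW; exists (delta_mx i 0).
  have W'f : W' != fullv.
    apply: contraNneq Wn0 => W'f; rewrite -subv0; apply/subvP => v /sW[c ->].
    have : s *m c \in W' by rewrite W'f memvf.
    by rewrite W'E mulmxA ss mul1mx => /eqP ->; rewrite mulmx0 mem0v.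
  have W'inv g v : SU3 g -> v \in W' -> compress t g *m v \in W'.
    move=> Sg; rewrite !W'E => /eqP sv; apply/eqP/colP => i; rewrite [RHS]mxE -dotc_delta -dotcMl.
    have rU := compress_rep tf.
    have -> : compress t g = (compress t (g^t*))^t*.
      by rewrite (unit_EV (unitary_repM rU) (unitary_rep_unitary rU) Sg) trmxCK.
    rewrite -dotcMl.
    have /sW[c ->] : compress t (g^t*) *m (s *m delta_mx i 0) \in W.
      by apply: Winv; [exact: SU3V|apply/sW; exists (delta_mx i 0)].
    by rewrite dotcMl sv dotc0r.
  by apply/eqP/nsq0P; rewrite nsqE (small W').
exists (Irrep (compress_rep tf) irr), t; split=> // g Sg; exact: tE.
Qed.

End SubIrrep.

Lemma continuous_cof3 (K : numFieldType) i j : continuous (fun g : 'M[K]_3 => cof3 g i j).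
Proof.
have cc a b : continuous (fun g : 'M[K]_3 => g a b) by exact: coord_continuous.
have cm (T : topologicalType) (f1 f2 f3 f4 : T -> K) : continuous f1 -> continuous f2 ->
    continuous f3 -> continuous f4 -> continuous (fun x => f1 x * f2 x - f3 x * f4 x).
  by move=> h1 h2 h3 h4 x; apply: cvgB; apply: cvgM; [exact: h1|exact: h2|exact: h3|exact: h4].
have cm' a b c d a' b' c' d' :
    continuous (fun g : 'M[K]_3 => g a b * g c d - g a' b' * g c' d').
  exact: (cm _ _ _ _ _ (cc a b) (cc c d) (cc a' b') (cc c' d')).
under eq_fun do rewrite mxE; move: i j.
by apply: ord3P; apply: ord3P; exact: cm'.
Qed.

(** * Models with prescribed weights *)

Section Models.
Variable R : realType.
Local Notation C := R[i].
Implicit Types g h : 'M[C]_3.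

Lemma fmx_delta (X : finType) (A : X -> X -> C) (x y : X) :
  (fmx A *m delta_mx (enum_rank y) 0 : 'cV_#|X|) (enum_rank x) 0 = A x y.
Proof. by rewrite -colE !mxE !enum_rankK. Qed.

Lemma tens_rep m (s : pattern m) : unitary_rep (fun g => fmx (tens s g)).
Proof.
have TM g h : SU3 g -> SU3 h -> fmx (tens s (g *m h)) = fmx (tens s g) *m fmx (tens s h).
  move=> /SU3_unit gU /SU3_unit hU; rewrite fmxM; apply: eq_fmx => I J; exact: tens_mul.
split=> //.
- move=> g Sg; apply/unitarymxP.
  have -> : (fmx (tens s g))^t* = fmx (tens s (g^t*)).
    by apply/matrixP => i j; rewrite !mxE tens_tr.
  rewrite -(TM _ _ Sg (SU3V Sg)) (SU3_mulV Sg) -fmx1; apply: eq_fmx => I J; exact: tens1.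
- apply: continuous_subspaceT; apply: continuous_entries => i j.
  under eq_fun do rewrite mxE.
  apply: continuous_prod => k; rewrite /slot; case: (s k); last exact: coord_continuous.
  under eq_fun do rewrite cofE3; exact: continuous_cof3.
Qed.

Variables p q : nat.
(** Together with [hw_word] this describes the vector with [p] factors e_0 in C^3 and [q] dual
    factors e_2, the only basis vector of height 0. *)
Definition hw_pattern : pattern (p + q) := [ffun k : 'I_(p + q) => (p <= k)%N].
Definition hw_word : word (p + q) := [ffun k : 'I_(p + q) => if (p <= k)%N then o2 else o0].
Local Notation s0 := hw_pattern.
Local Notation J0 := hw_word.

Lemma card_slots (a b : nat) :
  (\sum_(k < p + q) (if hw_pattern k then b else a) = p * a + q * b)%N.
Proof.
rewrite big_split_ord /=; congr (_ + _)%N.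
  under eq_bigr => i _ do rewrite ffunE /= leqNgt ltn_ord /=.
  by rewrite sum_nat_const card_ord.
under eq_bigr => i _ do rewrite ffunE /= leq_addr /=.
by rewrite sum_nat_const card_ord.
Qed.

Lemma hgt_hw : hgt s0 J0 = 0%N.
Proof. by rewrite /hgt big1// => k _; rewrite !ffunE; case: ifP. Qed.

Lemma wexp_hw : [/\ wexp s0 J0 o0 = (p + q)%N, wexp s0 J0 o1 = q & wexp s0 J0 o2 = 0%N].
Proof.
split; rewrite /wexp.
- transitivity (\sum_(k < p + q) (if hw_pattern k then 1 else 1))%N; last by rewrite card_slots !muln1.
  by apply: eq_bigr => k _; rewrite !ffunE; case: (p <= k)%N.
- transitivity (\sum_(k < p + q) (if hw_pattern k then 1 else 0))%N; last by rewrite card_slots muln0 muln1.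
  by apply: eq_bigr => k _; rewrite !ffunE; case: (p <= k)%N.
- transitivity (\sum_(k < p + q) (if hw_pattern k then 0 else 0))%N; last by rewrite card_slots !muln0.
  by apply: eq_bigr => k _; rewrite !ffunE; case: (p <= k)%N.
Qed.

Lemma tens_hw g : SU3 g -> tens s0 g J0 J0 = g o0 o0 ^+ p * (g o2 o2)^* ^+ q.
Proof.
move=> Sg; rewrite /tens big_split_ord /=; congr (_ * _).
  under eq_bigr => i _ do rewrite !ffunE /= leqNgt ltn_ord /=.
  by rewrite prodr_const card_ord.
under eq_bigr => i _ do rewrite !ffunE /= leq_addr /= /slot (cof_SU3 Sg) mxE.
by rewrite prodr_const card_ord.
Qed.

(** Any irreducible constituent onto which the vector of height 0 projects nontrivially. No
    constituent is singled out, since its matrix coefficient will determine it up to equivalence. *)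
Definition tensor_model (r : irrep C) := exists t : 'M[C]_(#|{: word (p + q)}|, degree r),
  [/\ t^t* *m t = 1%:M, forall g, SU3 g -> fmx (tens s0 g) *m t = t *m r g &
      t^t* *m delta_mx (enum_rank J0) 0 != 0 :> 'cV[C]_(degree r)].

Definition highest_coef (r : irrep C) := exists v : 'cV[C]_(degree r),
  forall g, SU3 g -> dotc v (r g *m v) = g o0 o0 ^+ p * (g o2 o2)^* ^+ q.

Lemma tensor_model_exists : exists r, tensor_model r.
Proof.
have d0 : delta_mx (enum_rank J0) 0 != 0 :> 'cV[C]_#|{: word (p + q)}|.
  by apply/eqP => /matrixP/(_ (enum_rank J0) 0)/eqP; rewrite !mxE !eqxx oner_eq0.
have [r [t [tt tE td]]] := sub_irrep (tens_rep s0) d0.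
by exists r, t.
Qed.

End Models.

Section Scale.
Variable R : realType.
Local Notation C := R[i].

Lemma scaled_coef (r : irrep C) (v : 'cV[C]_(degree r)) p q : v != 0 ->
  (forall g, SU3 g -> dotc v (r g *m v) = (nsq v)%:C%C * (g o0 o0 ^+ p * (g o2 o2)^* ^+ q)) ->
  highest_coef p q r.
Proof.
move=> v0 vE; have n0 : 0 < nsq v.
  by rewrite lt_neqAle nsq_ge0 andbT eq_sym; apply: contra v0 => /eqP/nsq0P ->.
exists (((Num.sqrt (nsq v))^-1)%:C%C *: v) => g Sg.
rewrite -scalemxAr dotcZl dotcZr vE// !mulrA -[RHS]mul1r mulrA; congr (_ * _ * _).
rewrite conj_Creal; last by rewrite complex_real.
rewrite -!rmorphM /= -invfM -expr2 sqr_sqrtr ?(ltW n0)// mulVf ?gt_eqF//.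
Qed.

(** A word of minimal height on which the intertwiner does not vanish satisfies the hypotheses of
    [matrix_coef]. *)
Lemma irrep_highest (r : irrep C) : exists p q, highest_coef p q r.
Proof.
have rU := irrep_unitary r; have d0 : (0 < degree r)%N by case: (irrep_irreducible r).
have [m [s [t ti [I [i tIi]]]]] := irrep_occurs d0 rU.
pose P k := `[< exists I, hgt s I = k /\ exists i, t I i != 0 >].
have exP : exists k, P k by exists (hgt s I); apply/asboolP; exists I; split=> //; exists i.
have [k /asboolP[J [Jk [j tJj]]] kmin] := ex_minnP exP.
have Jlow K : (hgt s K < hgt s J)%N -> forall i, t K i = 0.
  move=> lt a; apply/eqP; apply: contraTT lt => ne; rewrite -leqNgt Jk; apply: kmin.
  by apply/asboolP; exists K; split=> //; exists a.
pose v : 'cV[C]_(degree r) := \col_i (t J i)^*.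
have v0 : v != 0.
  by apply: contraNneq tJj => /colP/(_ j)/eqP; rewrite !mxE conjC_eq0.
have Jnz : Pi t J J != 0.
  have -> : Pi t J J = (nsq v)%:C%C.
    by rewrite -dotcvv dotcE /Pi; apply: eq_bigr => a _; rewrite !mxE conjCK.
  by apply: contra v0 => /eqP[] /nsq0P ->.
exists (wexp s J o0 - wexp s J o1)%N, (wexp s J o1 - wexp s J o2)%N.
by apply: (scaled_coef v0) => g Sg; exact: (matrix_coef rU ti Jlow Jnz Sg).
Qed.

Lemma tensor_model_highest p q (r : irrep C) : tensor_model p q r -> highest_coef p q r.
Proof.
move=> [t [tt tE t0]]; have rU := irrep_unitary r.
pose T (I : word (p + q)) i := t (enum_rank I) i.
have ti : intertw r (hw_pattern p q) T.
  move=> g Sg I i; have := tE g Sg => /matrixP/(_ (enum_rank I) i); rewrite !mxE => <-.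
  rewrite [RHS](reindex (@enum_rank _)) /=; last exact: onW_bij (@enum_rank_bij _).
  by apply: eq_bigr => k _; rewrite !mxE !enum_rankK.
pose v : 'cV[C]_(degree r) := \col_i (T (hw_word p q) i)^*.
have vE : v = t^t* *m delta_mx (enum_rank (hw_word p q)) 0.
  by rewrite -colE; apply/colP => i; rewrite !mxE.
have v0 : v != 0 by rewrite vE.
have [w0 w1 w2] := wexp_hw p q.
apply: (scaled_coef v0) => g Sg.
have := @matrix_coef R _ _ _ _ _ rU ti (hw_word p q); rewrite w0 w1 w2 addnK subn0 => h.
apply: h => //; first by move=> K; rewrite hgt_hw.
have -> : Pi T (hw_word p q) (hw_word p q) = (nsq v)%:C%C.
  by rewrite -dotcvv dotcE /Pi; apply: eq_bigr => a _; rewrite !mxE conjCK.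
by apply: contra v0 => /eqP[] /nsq0P ->.
Qed.
End Scale.

(** * Different pairs (p, q) give inequivalent representations *)

Section Uniqueness.
Variable R : realType.
Local Notation C := R[i].

Lemma highest_coef_equiv p q (r1 r2 : irrep C) :
  highest_coef p q r1 -> highest_coef p q r2 -> irrep_equiv r1 r2.
Proof.
move=> [v1 h1] [v2 h2]; apply: (@irrep_equiv_coef _ _ _ v1 v2) => [|g Sg].
  apply: contra_eqN (h1 _ (@SU3_1 R)) => /eqP ->.
  by rewrite mulmx0 dotc0r !mxE !eqxx conjC1 !expr1n mulr1 eq_sym oner_eq0.
by rewrite h1// h2.
Qed.

(** An identity on the unit circle is one between polynomials; if [n] exceeded [K], nothing on the
    right could match X^n. *)
Lemma circle_exp_le (n K : nat) (I : finType) (c : I -> C) (k : I -> nat) :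
  (forall i, (k i <= K)%N) ->
  (forall x : C, `|x| = 1 -> x ^+ n = \sum_i c i * x ^+ k i) -> (n <= K)%N.
Proof.
move=> kK h; rewrite leqNgt; apply/negP => Kn.
have : 'X^n - \sum_i c i *: 'X^(k i) = 0 :> {poly C}.
  apply: circle_poly => x x1; rewrite hornerD hornerN hornerXn horner_sum h//.
  by apply/eqP; rewrite subr_eq0; apply/eqP/eq_bigr => i _; rewrite hornerZ hornerXn.
move=> /polyP/(_ n)/eqP; rewrite coefB coefXn eqxx coef0 coef_sum big1 ?subr0 ?oner_eq0// => i _.
by rewrite coefZ coefXn gtn_eqF ?mulr0// (leq_ltn_trans (kK i)).
Qed.

Variables (e : 'I_3 -> nat).
Hypothesis e3 : (e o0 + e o1 + e o2 = 3)%N.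
Hypothesis e01 : (e o1 <= e o0)%N.
Hypothesis e12 : (e o2 <= e o1)%N.

(** The conjugate of [x] is its inverse and brings the determinant to x^(e0 + e1 + e2 - 3) = 1,
    while the exponents [e] remain natural numbers. *)
Lemma torus_SU3 (x : C) : `|x| = 1 -> SU3 (dgmx (fun l => x ^+ e l * x^*)).
Proof.
move=> x1; have xx : x * x^* = 1 by rewrite -normCK x1 expr1n.
split.
  apply/unitarymxP; rewrite tr_diag_mx map_diag_mx mulmx_diag.
  pose z l := x ^+ e l * x^*.
  have zn i : z i * (z i)^* = 1.
    rewrite /z rmorphM rmorphXn /= conjCK.
    have -> : x ^+ e i * x^* * (x^* ^+ e i * x) = (x * x^*) ^+ e i * (x * x^*) by rewrite exprMn; ring.
    by rewrite xx expr1n mulr1.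
  by apply/matrixP => i j; rewrite !mxE zn.
rewrite det_diag big_ord3 /= !mxE.
have -> : x ^+ e o0 * x^* * (x ^+ e o1 * x^*) * (x ^+ e o2 * x^*) = x ^+ (e o0 + e o1 + e o2) * x^* ^+ 3.
  by rewrite !exprD; ring.
by rewrite e3 -exprMn xx expr1n.
Qed.

(** For decreasing [e] an ordinary slot contributes at most [e o0] and a dual slot at most
    [e o0 + e o1]. *)
Lemma wexp_le p q (I : word (p + q)) :
  (e o0 * wexp (hw_pattern p q) I o0 + e o1 * wexp (hw_pattern p q) I o1 +
   e o2 * wexp (hw_pattern p q) I o2 <= p * e o0 + q * (e o0 + e o1))%N.
Proof.
rewrite -[leqRHS]card_slots /wexp !big_distrr -!big_split /=; apply: leq_sum => k _.
by case: (hw_pattern p q k); move: (I k); apply: ord3P => /=; lia.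
Qed.

Lemma wexp_total p q (I : word (p + q)) :
  (wexp (hw_pattern p q) I o0 + wexp (hw_pattern p q) I o1 + wexp (hw_pattern p q) I o2 = p * 1 + q * 2)%N.
Proof.
rewrite -card_slots /wexp -!big_split /=; apply: eq_bigr => k _.
by case: (hw_pattern p q k); move: (I k); apply: ord3P.
Qed.

(** The coefficient with exponents (p, q) is also a matrix coefficient of the (p', q') model.
    Restricted to a one-parameter torus, its exponent cannot exceed the largest one that occurs
    there. The added terms p' + 2 q' and p + 2 q clear the negative powers of [x]. *)
Lemma weight_le p q p' q' (r r' : irrep C) :
  highest_coef p q r -> tensor_model p' q' r' -> irrep_equiv r r' ->
  (p * e o0 + q * (e o0 + e o1) + (p' + q' * 2) <= p' * e o0 + q' * (e o0 + e o1) + (p + q * 2))%N.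
Proof.
move=> [v vE] [t [tt tE _]] [P [Q [PQ QP PE]]].
pose a : 'rV[C]_#|{: word (p' + q')}| := v^t* *m P *m t^t*.
pose b : 'cV[C]_#|{: word (p' + q')}| := t *m Q *m v.
have fE g : SU3 g -> g o0 o0 ^+ p * (g o2 o2)^* ^+ q =
    \sum_i \sum_j a 0 i * tens (hw_pattern p' q') g (enum_val i) (enum_val j) * b j 0.
  move=> Sg; rewrite -(vE g Sg) /dotc.
  have -> : r g = P *m (t^t* *m fmx (tens (hw_pattern p' q') g) *m t) *m Q.
    by rewrite -[t^t* *m _ *m _]mulmxA (tE g Sg) (mulmxA (t^t*)) tt mul1mx -(PE g Sg) -mulmxA PQ mulmx1.
  have -> : v^t* *m (P *m (t^t* *m fmx (tens (hw_pattern p' q') g) *m t) *m Q *m v) =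
    a *m fmx (tens (hw_pattern p' q') g) *m b by rewrite /a /b !mulmxA.
  rewrite mxE exchange_big; apply: eq_bigr => j _ /=; rewrite mxE mulr_suml.
  by apply: eq_bigr => i _; rewrite [fmx _ _ _]mxE.
pose c (i : 'I_#|{: word (p' + q')}|) := a 0 i * b i 0.
pose w (i : 'I_#|{: word (p' + q')}|) := wexp (hw_pattern p' q') (enum_val i).
apply: (@circle_exp_le _ _ _ c (fun i => e o0 * w i o0 + e o1 * w i o1 + e o2 * w i o2 + (p + q * 2))%N).
  by move=> i; rewrite leq_add2r wexp_le.
move=> x x1; have xx : x * x^* = 1 by rewrite -normCK x1 expr1n.
have x0 : x != 0 by rewrite -normr_gt0 x1.
have y0 : x^* != 0 by rewrite conjC_eq0.
have := fE _ (torus_SU3 x1); rewrite !mxE !eqxx !mulr1n => h.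
have {h} : (x ^+ e o0 * x^*) ^+ p * ((x ^+ e o2 * x^*)^*) ^+ q =
    \sum_i c i * ((x ^+ e o0 * x^*) ^+ w i o0 * (x ^+ e o1 * x^*) ^+ w i o1 * (x ^+ e o2 * x^*) ^+ w i o2).
  rewrite h; apply: eq_bigr => i _; rewrite (bigD1 i)//= big1 ?addr0 => [|j ji].
    rewrite tens_diag => [|l]; last by rewrite mulf_neq0// expf_neq0.
    by rewrite eqxx mul1r big_ord3 /c mulrAC.
  rewrite tens_diag => [|l]; last by rewrite mulf_neq0// expf_neq0.
  by rewrite (inj_eq enum_val_inj) eq_sym (negbTE ji) !mul0r mulr0 mul0r.
move=> /(congr1 (fun y => x ^+ (p + q * 2) * x ^+ (p' + q' * 2) * y)) h.
have lhs : x ^+ (p + q * 2) * x ^+ (p' + q' * 2) * ((x ^+ e o0 * x^*) ^+ p * ((x ^+ e o2 * x^*)^*) ^+ q) =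
   x ^+ (p * e o0 + q * (e o0 + e o1) + (p' + q' * 2)).
  have -> : (x ^+ e o2 * x^*)^* = x^* ^+ e o2 * x by rewrite rmorphM rmorphXn /= conjCK.
  have h1 : x ^+ p * (x ^+ e o0 * x^*) ^+ p = x ^+ (p * e o0).
    by rewrite -exprMn mulrCA xx mulr1 -exprM mulnC.
  have h2 : x ^+ (q * 2) * (x^* ^+ e o2 * x) ^+ q = x ^+ (q * (e o0 + e o1)).
    rewrite mulnC exprM -exprMn [in RHS]mulnC exprM; congr (_ ^+ _).
    have -> : x ^+ 2 * (x^* ^+ e o2 * x) = x ^+ 3 * x^* ^+ e o2 by ring.
    by rewrite -[X in x ^+ X * _]e3 exprD -mulrA -exprMn xx expr1n mulr1.
  rewrite !exprD -h1 -h2; move: (x ^+ p) (x ^+ (q * 2)) (x ^+ p') (x ^+ (q' * 2)) (_ ^+ p) (_ ^+ q).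
  by move=> *; ring.
move: h; rewrite lhs => ->; rewrite mulr_sumr; apply: eq_bigr => i _.
have -> : (p' + q' * 2 = w i o0 + w i o1 + w i o2)%N by rewrite wexp_total muln1.
rewrite !exprD !exprM !exprMn.
have k1 n : x ^+ n * x^* ^+ n = 1 by rewrite -exprMn xx expr1n.
move: (k1 (w i o0)) (k1 (w i o1)) (k1 (w i o2)).
move: (x ^+ w i o0) (x ^+ w i o1) (x ^+ w i o2) (x^* ^+ w i o0) (x^* ^+ w i o1) (x^* ^+ w i o2) => u0 u1 u2 d0 d1 d2 k0 {}k1 k2.
move: ((x ^+ e o0) ^+ w i o0) ((x ^+ e o1) ^+ w i o1) ((x ^+ e o2) ^+ w i o2) (x ^+ p) ((x ^+ q) ^+ 2) (c i) => y0' y1 y2 y3 y4 y5.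
transitivity ((u0 * d0) * (u1 * d1) * (u2 * d2) * (y5 * (y0' * y1 * y2 * (y3 * y4)))); last by rewrite k0 k1 k2 !mul1r.
by ring.
Qed.

End Uniqueness.

Lemma tensor_model_inj (R : realType) p q p' q' (r r' : irrep R[i]) :
  tensor_model p q r -> tensor_model p' q' r' -> irrep_equiv r r' -> (p, q) = (p', q').
Proof.
move=> m m' rr'; have h := tensor_model_highest m; have h' := tensor_model_highest m'.
have r'r := irrep_equiv_sym rr'.
pose e (a b c : nat) (i : 'I_3) := nth 0%N [:: a; b; c] i.
(* The exponents (2, 1, 0) compare p + q with p' + q', and (3, 0, 0) compare 2p + q with 2p' + q';
   equality in both gives equality of the pairs. *)
have l1 := weight_le (e := e 2 1 0) erefl isT isT h m' rr'.
have l2 := weight_le (e := e 2 1 0) erefl isT isT h' m r'r.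
have l3 := weight_le (e := e 3 0 0) erefl isT isT h m' rr'.
have l4 := weight_le (e := e 3 0 0) erefl isT isT h' m r'r.
rewrite /e /= in l1 l2 l3 l4.
by congr (_, _); lia.
Qed.

(** * Degrees *)

Section Monomials.
Variable R : realType.
Local Notation C := R[i].
Implicit Types x y : 'I_3 -> C.

Definition mono x a b c := x o0 ^+ a * x o1 ^+ b * x o2 ^+ c.

Lemma mono_scale (l : C) x a b c : mono (fun i => l * x i) a b c = l ^+ (a + b + c) * mono x a b c.
Proof. by rewrite /mono !exprMn !exprD; ring. Qed.

Lemma word_mono p (I : 'I_p -> 'I_3) : exists a b c, (a + b + c = p)%N /\
  forall x : 'I_3 -> C, \prod_k x (I k) = mono x a b c.
Proof.
exists #|[pred k | I k == o0]|, #|[pred k | I k == o1]|, #|[pred k | I k == o2]|; split.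
  rewrite -[RHS]card_ord -[RHS]sum1_card (partition_big I predT)//= big_ord3 /=.
  by rewrite -!sum1_card.
move=> x; rewrite (partition_big I predT)//= big_ord3 /mono /=.
have h l : \prod_(i | I i == l) x (I i) = x l ^+ #|[pred k | I k == l]|.
  by rewrite -prodr_const; apply: eq_big => // i /eqP ->.
by rewrite !h.
Qed.

Lemma mono_word p a b c : (a + b + c = p)%N ->
  exists I : 'I_p -> 'I_3, forall x : 'I_3 -> C, \prod_k x (I k) = mono x a b c.
Proof.
move=> <-; pose f k := if (k < a)%N then o0 else if (k < a + b)%N then o1 else o2.
exists (fun k => f k) => x; rewrite -(big_mkord predT (fun k => x (f k))).
rewrite (@big_cat_nat _ _ _ (a + b)%N) ?leq_addr//= (@big_cat_nat _ _ _ a _ (a + b)%N) ?leq_addr//=.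
rewrite /mono; congr (_ * _ * _).
- rewrite -[X in _ ^+ X]subn0 -prodr_const_nat; apply: eq_big_nat => k /andP[_ ka].
  by rewrite /f ka.
- rewrite -[X in _ ^+ X](addKn a) -prodr_const_nat; apply: eq_big_nat => k /andP[ka kb].
  by rewrite /f ltnNge ka kb.
- rewrite -[X in _ ^+ X](addKn (a + b)) -prodr_const_nat; apply: eq_big_nat => k /andP[ka kb].
  by rewrite /f !ltnNge ka (leq_trans (leq_addr b a) ka).
Qed.

Section Reduced.
Variables p q : nat.

(** The entries are the exponents of x0, x2 and of y0, y2; those of x1 and y1 follow from the
    degrees. The last condition says that x2 y2 does not divide the monomial. *)
Definition reduced (v : 'I_p.+1 * 'I_p.+1 * ('I_q.+1 * 'I_q.+1)) : bool :=
  [&& v.1.1 + v.1.2 <= p, v.2.1 + v.2.2 <= q & (v.1.2 == 0 :> nat) || (v.2.2 == 0 :> nat)]%N.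

(* Normal forms, modulo x0 y0 + x1 y1 + x2 y2, of the bihomogeneous monomials of degree (p, q). *)
Definition redmon := {v | reduced v}.

Definition rmon x y (v : redmon) :=
  let: ((a, c), (a', c')) := val v in mono x a (p - (a + c)) c * mono y a' (q - (a' + c')) c'.

Lemma rmon_scale (l m : C) x y v :
  rmon (fun i => l * x i) (fun i => m * y i) v = l ^+ p * m ^+ q * rmon x y v.
Proof.
rewrite /rmon; case: v => -[[a c] [a' c']] /= /and3P[/= h h' _].
rewrite !mono_scale; have -> : (a + (p - (a + c)) + c = p)%N by lia.
have -> : (a' + (q - (a' + c')) + c' = q)%N by lia.
by move: (l ^+ p) (m ^+ q) => L M; ring.
Qed.

Lemma rmon_eq a b c a' b' c' : (a + b + c = p)%N -> (a' + b' + c' = q)%N -> (c == 0)%N || (c' == 0)%N ->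
  exists v : redmon, forall x y, rmon x y v = mono x a b c * mono y a' b' c'.
Proof.
move=> ep eq cc.
have [ap cp a'q c'q] : [/\ a < p.+1, c < p.+1, a' < q.+1 & c' < q.+1]%N by split; lia.
pose w : 'I_p.+1 * 'I_p.+1 * ('I_q.+1 * 'I_q.+1) := ((Ordinal ap, Ordinal cp), (Ordinal a'q, Ordinal c'q)).
have rw : reduced w by apply/and3P; split=> //=; lia.
exists (exist _ w rw) => x y; rewrite /rmon /=.
by congr (mono _ _ _ _ * mono _ _ _ _); lia.
Qed.

(** A factor x2 y2 is traded for -(x0 y0 + x1 y1), which lowers both third exponents; hence the
    induction on [c]. *)
Lemma reduce c : forall a b a' b' c', (a + b + c = p)%N -> (a' + b' + c' = q)%N ->
  exists u : redmon -> C, forall x y, x o0 * y o0 + x o1 * y o1 + x o2 * y o2 = 0 ->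
    mono x a b c * mono y a' b' c' = \sum_v u v * rmon x y v.
Proof.
have direct a b d a' b' c' : (a + b + d = p)%N -> (a' + b' + c' = q)%N -> (d == 0)%N || (c' == 0)%N ->
  exists u : redmon -> C, forall x y, x o0 * y o0 + x o1 * y o1 + x o2 * y o2 = 0 ->
    mono x a b d * mono y a' b' c' = \sum_v u v * rmon x y v.
  move=> ep eq dc; have [v vE] := rmon_eq ep eq dc.
  exists (fun w => (w == v)%:R) => x y _; rewrite (bigD1 v)//= eqxx mul1r vE big1 ?addr0// => w.
  by move=> /negbTE ->; rewrite mul0r.
elim: c => [|c IH] a b a' b' [|c'] ep eq; try by apply: direct => //; rewrite orbT.
have [||u1 h1] := IH a.+1 b a'.+1 b' c'; try lia.
have [||u2 h2] := IH a b.+1 a' b'.+1 c'; try lia.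
exists (fun v => - (u1 v + u2 v)) => x y xy.
transitivity (- (mono x a.+1 b c * mono y a'.+1 b' c' + mono x a b.+1 c * mono y a' b'.+1 c')).
  have e : x o2 * y o2 = - (x o0 * y o0 + x o1 * y o1) by apply/eqP; rewrite -addr_eq0 addrC xy.
  transitivity ((x o2 * y o2) * (mono x a b c * mono y a' b' c')); first by rewrite /mono !exprS; ring.
  by rewrite e /mono !exprS; ring.
rewrite h1// h2// -big_split -sumrN; apply: eq_bigr => v _ /=; ring.
Qed.

Lemma weighted_coef (W : finType) (F : W -> C) (k : W -> nat) :
  (forall n : nat, \sum_w F w * n.+1%:R ^+ k w = 0) -> forall e, \sum_(w | k w == e) F w = 0.
Proof.
(* The factor ['X] supplies the root 0, as the hypothesis speaks of positive integers only. *)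
move=> h e; have : 'X * \sum_w F w *: 'X^(k w) = 0 :> {poly C}.
  apply: poly_vanish => -[|n]; first by rewrite hornerM hornerX mul0r.
  rewrite hornerM hornerX horner_sum; under eq_bigr do rewrite hornerZ hornerXn.
  by rewrite h mulr0.
move=> /eqP; rewrite mulf_eq0 polyX_eq0 /= => /eqP/polyP/(_ e).
rewrite coef0 coef_sum => {}h; rewrite -[RHS]h big_mkcond; apply: eq_bigr => w _.
by rewrite coefZ coefXn eq_sym; case: eqP; rewrite ?mulr1 ?mulr0.
Qed.

(** The relation is tested at x = (A, 1, k), y = (B, 1, -(A B + 1) / k) with positive integers A, B,
    k. Powers of k separate the differences of third exponents, then those of A and B the first
    exponents. *)
Lemma redmon_indep (u : redmon -> C) :
  (forall x y, x o1 != 0 -> y o1 != 0 -> x o0 * y o0 + x o1 * y o1 + x o2 * y o2 = 0 ->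
     \sum_v u v * rmon x y v = 0) -> forall v, u v = 0.
Proof.
move=> h.
pose U (w : 'I_p.+1 * 'I_p.+1 * ('I_q.+1 * 'I_q.+1)) : C := if insub w is Some v then u v else 0.
have Uv v : U (val v) = u v by rewrite /U valK.
have sumU A B k : \sum_w U w * (A.+1%:R ^+ w.1.1 * B.+1%:R ^+ w.2.1 * (- (A.+1 * B.+1 + 1)%:R) ^+ w.2.2) * k.+1%:R ^+ (q + w.1.2 - w.2.2) = 0.
  have t0 : k.+1%:R != 0 :> C by rewrite pnatr_eq0.
  pose x (i : 'I_3) : C := nth 0 [:: A.+1%:R; 1; k.+1%:R] i.
  pose y (i : 'I_3) : C := nth 0 [:: B.+1%:R; 1; - (A.+1 * B.+1 + 1)%:R / k.+1%:R] i.
  have := h x y (oner_neq0 _) (oner_neq0 _); rewrite /= -natrM => /(_ _)/wrap[].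
    rewrite /x /y /= mulr1 mulrC mulrVK ?unitfE//; rewrite natrD natrM; ring.
  move=> /(congr1 (fun z => z * k.+1%:R ^+ q)); rewrite mul0r mulr_suml => e; rewrite -[RHS]e.
  rewrite (bigID reduced) /= [X in _ + X]big1 ?addr0 => [|w /negbTE nw]; last first.
    by rewrite /U insubF// !mul0r.
  rewrite (reindex_omap (fun v : redmon => val v) (fun w => insub w : option redmon)) /=; last by move=> w rw; rewrite insubT.
  apply: eq_big => [v|v _]; first by rewrite valK (valP v) eqxx.
  rewrite Uv -!mulrA; congr (_ * _).
  rewrite /rmon; case: v => -[[a c] [a' c']] /= /and3P[/= e1 e2 e3].
  rewrite /mono /x /y /= !expr1n !mulr1.
  have -> : (q + c - c' = c + (q - c'))%N by lia.
  have -> : k.+1%:R ^+ q = k.+1%:R ^+ c' * k.+1%:R ^+ (q - c') :> C by rewrite -exprD; congr (_ ^+ _); lia.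
  rewrite exprD exprMn exprVn.
  have := expf_neq0 c' t0; move: (k.+1%:R ^+ c') (k.+1%:R ^+ c) (k.+1%:R ^+ (q - c')) => z1 z2 z3 z0.
  by field.
move=> v; pose e := (q + (val v).1.2 - (val v).2.2)%N.
(* One of the two third exponents is 0, so their difference determines both. *)
have diffE w : U w != 0 -> (q + w.1.2 - w.2.2 == e)%N -> w.1.2 = (val v).1.2 /\ w.2.2 = (val v).2.2.
  rewrite /U; case: insubP => [w' rw _ _|]; last by rewrite eqxx.
  case/and3P: rw => h1 h2 h3; case/and3P: (valP v) => h4 h5 h6.
  rewrite {}/e; move: h1 h2 h3 h4 h5 h6; case: (val v) => [[b d] [b' d']]; case: (w) => [[a c] [a' c']] /=.
  move=> h1 h2 h3 h4 h5 h6 /eqP e1.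
  by split; apply: val_inj; move: h1 h2 h3 h4 h5 h6 e1 => /=; clear; lia.
have coefT A B : \sum_w (if (w.1.2 == (val v).1.2) && (w.2.2 == (val v).2.2) then U w else 0) *
    B.+1%:R ^+ w.2.1 * A.+1%:R ^+ w.1.1 = 0.
  have := weighted_coef (sumU A B) e; rewrite big_mkcond => e1.
  have z0 : (- (A.+1 * B.+1 + 1)%:R) ^+ (val v).2.2 != 0 :> C.
    by rewrite expf_neq0// oppr_eq0 pnatr_eq0 addn1.
  apply: (mulIf z0); rewrite mul0r -[RHS]e1 mulr_suml; apply: eq_bigr => w _.
  have [U0|Un] := eqVneq (U w) 0; first by rewrite U0; case: ifP; case: ifP; rewrite !mul0r.
  case: ifP => [/andP[/eqP c1 /eqP c2]|/negP ne].
    by rewrite /e c1 c2 eqxx -!mulrA; congr (_ * _); rewrite mulrCA.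
  case: ifP => [e2|]; last by rewrite !mul0r.
  by have [c1 c2] := diffE _ Un e2; case: ne; rewrite c1 c2 !eqxx.
have coefA B : \sum_(w : 'I_p.+1 * 'I_p.+1 * ('I_q.+1 * 'I_q.+1) | w.1.1 == (val v).1.1 :> nat)
    (if (w.1.2 == (val v).1.2) && (w.2.2 == (val v).2.2) then U w else 0) * B.+1%:R ^+ w.2.1 = 0.
  exact: (weighted_coef (fun A => coefT A B) (val v).1.1).
pose F (w : 'I_p.+1 * 'I_p.+1 * ('I_q.+1 * 'I_q.+1)) := if [&& w.1.1 == (val v).1.1, w.1.2 == (val v).1.2 & w.2.2 == (val v).2.2] then U w else 0.
have := @weighted_coef _ F (fun w => nat_of_ord w.2.1) _ (val v).2.1.
rewrite (bigD1 (val v))//= big1 ?addr0 => [|w /andP[/eqP w1 wv]]; last first.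
  rewrite /F; case: ifP => // /and3P[/eqP w2 /eqP w3 /eqP w4]; case/eqP: wv.
  move: w1 w2 w3 w4 => {e diffE coefT coefA F}; case: v => -[[? ?] [? ?]] /= _.
  by case: w => [[? ?] [? ?]] /= /val_inj -> -> -> ->.
rewrite /F !eqxx /= Uv; apply => B.
rewrite -[RHS](coefA B) [RHS]big_mkcond; apply: eq_bigr => w _.
have -> : (w.1.1 == (val v).1.1 :> nat) = (w.1.1 == (sval v).1.1) by rewrite -val_eqE.
by case: (w.1.1 == _); rewrite /= ?mul0r.
Qed.

(** For third exponents c and c' there are (p + 1 - c)(q + 1 - c') monomials; the pairs with c = 0
    or c' = 0 give two triangular sums. *)
Lemma card_redmon : (#|{: redmon}| * 2 = p.+1 * q.+1 * (p + q + 2))%N.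
Proof.
have summin n k : (\sum_(a < n) (a < k)%N = minn n k)%N.
  elim: n => [|n IH]; first by rewrite big_ord0 min0n.
  by rewrite big_ord_recr /= IH; case: ltnP; lia.
have sumlt n k : (k <= n)%N -> (\sum_(a < n) (a < k)%N = k)%N.
  by move=> kn; rewrite summin; apply/minn_idPr.
have tri n : (\sum_(c < n.+1) (n.+1 - c) * 2 = n.+1 * n.+2)%N.
  elim: n => [|n IH]; first by rewrite big_ord1.
  rewrite big_ord_recl (eq_bigr (fun i : 'I_n.+1 => (n.+1 - i) * 2))%N; first by rewrite IH /=; lia.
  by move=> i _; rewrite /= /bump leq0n add1n subSS.
rewrite card_sig -sum1_card big_mkcond /=.
transitivity ((\sum_(c < p.+1) \sum_(c' < q.+1) ((c == 0 :> nat) || (c' == 0 :> nat)) * ((p.+1 - c) * (q.+1 - c'))) * 2)%N.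
  congr (_ * 2)%N; rewrite -(pair_bigA _ (fun s t => if reduced (s, t) then 1 else 0))%N /=.
  rewrite -(pair_bigA _ (fun a c => \sum_t if reduced ((a, c), t) then 1 else 0))%N /= exchange_big /=.
  apply: eq_bigr => c _.
  rewrite (eq_bigr (fun a : 'I_p.+1 => \sum_(c' < q.+1) (a < p.+1 - c) * (((c == 0 :> nat) || (c' == 0 :> nat)) * (q.+1 - c')))%N); last first.
    move=> a _; rewrite -(pair_bigA _ (fun a' c' => if reduced ((a, c), (a', c')) then 1 else 0))%N /= exchange_big /=.
    apply: eq_bigr => c' _.
    rewrite -[X in (_ * (_ * X))%N](sumlt q.+1)// ?leq_subr// !big_distrr /=; apply: eq_bigr => a' _.
    rewrite /reduced /=; have -> : (a < p.+1 - c)%N = (a + c <= p)%N by lia.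
    have -> : (a' < q.+1 - c')%N = (a' + c' <= q)%N by lia.
    by case: (_ <= p)%N; case: (_ <= q)%N; case: (_ || _).
  rewrite exchange_big /=; apply: eq_bigr => c' _.
  rewrite -big_distrl /= sumlt ?leq_subr//; lia.
rewrite big_ord_recl /=.
rewrite (eq_bigr (fun c : 'I_q.+1 => (p.+1 * (q.+1 - c))%N)) => [|c' _]; last by rewrite mul1n subn0.
rewrite [X in (_ + X)%N](eq_bigr (fun c : 'I_p => ((p - c) * q.+1)%N)) => [|c _]; last first.
  rewrite big_ord_recl /= big1 ?addn0 => [|c' _]; last by [].
  by rewrite mul1n subn0 /bump /= add1n subSS.
have s1 : ((\sum_(i < q.+1) p.+1 * (q.+1 - i)) * 2 = p.+1 * (q.+1 * q.+2))%N.
  by rewrite -big_distrr /= -mulnA -tri big_distrl.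
have s2 : ((\sum_(i < p) (p - i) * q.+1) * 2 = (p * p.+1) * q.+1)%N.
  rewrite -big_distrl /= mulnAC; congr (_ * _)%N; case: (p) => [|n]; first by rewrite big_ord0.
  by rewrite -tri big_distrl.
by rewrite mulnDl s1 s2; lia.
Qed.

End Reduced.
Definition cross x y (i : 'I_3) : C :=
  nth 0 [:: x o1 * y o2 - x o2 * y o1; x o2 * y o0 - x o0 * y o2; x o0 * y o1 - x o1 * y o0] i.

(** Every nonzero point of the quadric used for testing arises, up to scaling, from a group element:
    [x] and the conjugate of [y] are orthogonal, and the conjugated cross product completes them,
    with determinant 1, as the middle column. *)
Lemma SU3_from_pair x y : x o1 != 0 -> y o1 != 0 -> x o0 * y o0 + x o1 * y o1 + x o2 * y o2 = 0 ->
  exists g : 'M[C]_3, SU3 g /\ exists l m, [/\ l != 0, m != 0, forall i, g i o0 = l * x i &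
    forall i, (g i o2)^* = m * y i].
Proof.
have normalize z : z o1 != 0 -> exists l : C, [/\ l != 0, l^* = l &
    l ^+ 2 * (z o0 * (z o0)^* + z o1 * (z o1)^* + z o2 * (z o2)^*) = 1].
  move=> z1; set n := _ + _ + _.
  have n0 : 0 < n.
    rewrite /n -!normCK ltr_wpDr ?exprn_ge0// ltr_wpDl ?exprn_ge0// exprn_gt0// normr_gt0//.
  exists (sqrtC n)^-1; split.
  - by rewrite invr_eq0 sqrtC_eq0 gt_eqF.
  - by rewrite conj_Creal// rpredV ger0_real// sqrtC_ge0 ltW.
  - by rewrite exprVn sqrtCK mulVf// gt_eqF.
move=> /normalize[l [l0 lJ ln]] /normalize[m [m0 mJ mn]] xy.
pose a i := l * x i; pose b i := (m * y i)^*.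
pose c i := (cross b a i)^*.
have bJ i : (b i)^* = m * y i by rewrite /b conjCK.
have cJ i : (c i)^* = cross b a i by rewrite /c conjCK.
have dJ (u v : 'I_3 -> C) : (u o0)^* * v o0 + (u o1)^* * v o1 + (u o2)^* * v o2 =
    ((v o0)^* * u o0 + (v o1)^* * u o1 + (v o2)^* * u o2)^*.
  by rewrite !rmorphD !rmorphM /= !conjCK; ring.
have aa : (a o0)^* * a o0 + (a o1)^* * a o1 + (a o2)^* * a o2 = 1.
  by rewrite -ln /a !rmorphM /= lJ; ring.
have bb : (b o0)^* * b o0 + (b o1)^* * b o1 + (b o2)^* * b o2 = 1.
  by rewrite -mn !bJ /b !rmorphM /= mJ; ring.
have ba : (b o0)^* * a o0 + (b o1)^* * a o1 + (b o2)^* * a o2 = 0.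
  by rewrite !bJ /a; transitivity (m * l * (x o0 * y o0 + x o1 * y o1 + x o2 * y o2)); [ring|rewrite xy mulr0].
have ab : (a o0)^* * b o0 + (a o1)^* * b o1 + (a o2)^* * b o2 = 0. by rewrite dJ ba conjC0.
have ca : (c o0)^* * a o0 + (c o1)^* * a o1 + (c o2)^* * a o2 = 0 by rewrite !cJ /cross /=; ring.
have cb : (c o0)^* * b o0 + (c o1)^* * b o1 + (c o2)^* * b o2 = 0 by rewrite !cJ /cross /=; ring.
have ac : (a o0)^* * c o0 + (a o1)^* * c o1 + (a o2)^* * c o2 = 0. by rewrite dJ ca conjC0.
have bc : (b o0)^* * c o0 + (b o1)^* * c o1 + (b o2)^* * c o2 = 0. by rewrite dJ cb conjC0.
(* By Lagrange's identity the cross product of two orthonormal vectors is a unit vector. *)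
have cc : (c o0)^* * c o0 + (c o1)^* * c o1 + (c o2)^* * c o2 = 1.
  have -> : 1 = 1 * 1 - 0 * 0 :> C by rewrite mulr1 mulr0 subr0.
  rewrite -{1}aa -{1}bb -{1}ba -ab !cJ /c /cross /= !rmorphB !rmorphM /=.
  move: (a o0) (a o1) (a o2) (b o0) (b o1) (b o2) => a0 a1 a2 b0 b1 b2; ring.
pose g : 'M[C]_3 := \matrix_(i, j) nth 0 [:: a i; c i; b i] j.
have gg : g^t* *m g = 1%:M.
  by apply/matrixP => i j; move: i j; apply: ord3P; apply: ord3P;
    rewrite !mxE big_ord3 !mxE /= ?aa ?bb ?ba ?ab ?ca ?cb ?ac ?bc ?cc.
exists g; split.
  split; first by apply/unitarymxP; exact: mulmx1C.
  rewrite det3E /det3 !mxE /= -cc !cJ /cross /=; ring.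
exists l, m; split=> // i; first by rewrite !mxE.
by rewrite !mxE /= bJ.
Qed.

End Monomials.

(** * The degree of a model *)

Section Degree.
Variable R : realType.
Local Notation C := R[i].
Variables p q : nat.

Definition top_col (g : 'M[C]_3) i := g i o0.
Definition low_col (g : 'M[C]_3) i := (g i o2)^*.

Lemma tens_hw_col (g : 'M[C]_3) (I : word (p + q)) : SU3 g ->
  tens (hw_pattern p q) g I (hw_word p q) =
  (\prod_(k < p) top_col g (I (lshift q k))) * \prod_(k < q) low_col g (I (rshift p k)).
Proof.
move=> Sg; rewrite /tens big_split_ord /=; congr (_ * _); apply: eq_bigr => k _.
  by rewrite !ffunE /= leqNgt ltn_ord.
by rewrite !ffunE /= leq_addr /slot (cof_SU3 Sg) mxE.
Qed.

Lemma cols_orth (g : 'M[C]_3) : SU3 g ->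
  top_col g o0 * low_col g o0 + top_col g o1 * low_col g o1 + top_col g o2 * low_col g o2 = 0.
Proof.
move=> Sg; have := SU3_Vmul Sg => /matrixP/(_ o2 o0); rewrite !mxE big_ord3 !mxE /= => h.
by rewrite -[RHS]h /top_col /low_col; ring.
Qed.

Definition redvec (g : 'M[C]_3) : 'cV[C]_#|{: redmon p q}| :=
  \col_i rmon (top_col g) (low_col g) (enum_val i).

(** The orbit of the vector of height 0. By [tens_hw_col] its coordinates are monomials in the first
    column of [g] and the conjugate of the last. *)
Definition hwvec (g : 'M[C]_3) : 'cV[C]_#|{: word (p + q)}| :=
  fmx (tens (hw_pattern p q) g) *m delta_mx (enum_rank (hw_word p q)) 0.

Lemma hwvecE g i : hwvec g i 0 = tens (hw_pattern p q) g (enum_val i) (hw_word p q).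
Proof. by rewrite /hwvec -colE !mxE enum_rankK. Qed.

Lemma hwvec_redvec : exists A, forall g, SU3 g -> hwvec g = A *m redvec g.
Proof.
have h (I : word (p + q)) : exists u : redmon p q -> C, forall g, SU3 g ->
    tens (hw_pattern p q) g I (hw_word p q) = \sum_v u v * rmon (top_col g) (low_col g) v.
  have [a [b [c [e1 h1]]]] := word_mono R (fun k => I (lshift q k)).
  have [a' [b' [c' [e2 h2]]]] := word_mono R (fun k => I (rshift p k)).
  have [u uE] := @reduce R p q _ _ _ _ _ _ e1 e2.
  by exists u => g Sg; rewrite tens_hw_col// h1 h2 uE//; exact: cols_orth.
have [U UE] := choice h.
exists (\matrix_(i, j) U (enum_val i) (enum_val j)) => g Sg; apply/colP => i.
rewrite hwvecE UE// mxE (reindex (@enum_val {: redmon p q} {: redmon p q})) /=; last exact: onW_bij (@enum_val_bij _).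
by apply: eq_bigr => j _; rewrite !mxE.
Qed.

Lemma redvec_hwvec : exists B, forall g, SU3 g -> redvec g = B *m hwvec g.
Proof.
have h (v : redmon p q) : exists I : word (p + q), forall g, SU3 g ->
    rmon (top_col g) (low_col g) v = tens (hw_pattern p q) g I (hw_word p q).
  rewrite /rmon; case: v => -[[a c] [a' c']] /= /and3P[/= h1 h2 _].
  have [|I1 IE1] := @mono_word R p a (p - (a + c)) c; first lia.
  have [|I2 IE2] := @mono_word R q a' (q - (a' + c')) c'; first lia.
  exists ([ffun k => match fintype.split k with inl k => I1 k | inr k => I2 k end] : word (p + q)) => g Sg.
  rewrite tens_hw_col// -IE1 -IE2; congr (_ * _); apply: eq_bigr => k _; rewrite ffunE.
    by rewrite (unsplitK (inl k)).
  by rewrite (unsplitK (inr k)).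
have [W WE] := choice h.
exists (\matrix_(i, j) (j == enum_rank (W (enum_val i)))%:R) => g Sg; apply/colP => i.
rewrite !mxE WE// (bigD1 (enum_rank (W (enum_val i))))//= big1 ?addr0 => [|j /negbTE jW].
  by rewrite hwvecE !mxE eqxx mul1r enum_rankK.
by rewrite mxE jW mul0r.
Qed.

Lemma colsmx_mul N N' (x : 'M[C]_3 -> 'cV[C]_N) (y : 'M[C]_3 -> 'cV[C]_N') A l :
  (forall g, g \in l -> x g = A *m y g) -> colsmx x l = A *m colsmx y l.
Proof.
move=> h; apply/matrixP => i j; rewrite !mxE h ?mem_nth// mxE.
by apply: eq_bigr => k _; rewrite mxE.
Qed.

Lemma redvec_span (u : 'rV[C]_#|{: redmon p q}|) :
  (forall g, SU3 g -> u *m redvec g = 0) -> u = 0.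
Proof.
move=> h; apply/rowP => i; rewrite [RHS]mxE.
rewrite -(enum_valK i); apply: (@redmon_indep R p q (fun v => u 0 (enum_rank v))) => x y x0 y0 xy.
have [g [Sg [l [m [l0 m0 gx gy]]]]] := SU3_from_pair x0 y0 xy.
have := h g Sg => /matrixP/(_ 0 0); rewrite [RHS]mxE mxE => e.
have n0 : l ^+ p * m ^+ q != 0 by rewrite mulf_neq0// expf_neq0.
apply: (mulfI n0); rewrite mulr0 -[RHS]e mulr_sumr.
rewrite [RHS](reindex (@enum_rank {: redmon p q})) /=; last exact: onW_bij (@enum_rank_bij _).
apply: eq_bigr => v _; rewrite mxE enum_rankK mulrCA -rmon_scale; congr (_ * rmon _ _ _).
  by apply/funext => j; rewrite /top_col gx.
by apply/funext => j; rewrite /low_col gy.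
Qed.

(** The orbit of [v] spans, so its rank is the degree. It has the same Gram matrices as the orbit
    [hwvec], and the latter and [redvec] are linear images of each other; [redvec] has full rank by
    independence of the reduced monomials. *)
Lemma tensor_model_degree (r : irrep C) : tensor_model p q r -> degree r = #|{: redmon p q}|.
Proof.
move=> m; have [v vE] := tensor_model_highest m; have U := irrep_unitary r.
have v0 : v != 0.
  apply: contra_eqN (vE _ (@SU3_1 R)) => /eqP ->.
  by rewrite mulmx0 dotc0r !mxE !eqxx conjC1 !expr1n mulr1 eq_sym oner_eq0.
have rkE l : (forall g, g \in l -> SU3 g) ->
    \rank (colsmx (fun g => r g *m v) l) = \rank (colsmx redvec l).
  move=> lS; have -> : \rank (colsmx redvec l) = \rank (colsmx hwvec l).
    have [A AE] := hwvec_redvec; have [B BE] := redvec_hwvec.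
    apply/eqP; rewrite eqn_leq.
    rewrite {1}(colsmx_mul (fun g gl => BE g (lS g gl))) mxrankM_maxr /=.
    by rewrite (colsmx_mul (fun g gl => AE g (lS g gl))) mxrankM_maxr.
  rewrite -gram_rank -[RHS]gram_rank; congr (\rank _); apply: gram_rank_eq => g h /lS Sg /lS Sh.
  rewrite /hwvec (orbit_dotc (tens_rep _ _) _ Sg Sh) (orbit_dotc U _ Sg Sh).
  have Shg := SU3M (SU3V Sh) Sg.
  by rewrite (vE _ Shg) -(tens_hw p q Shg) dotc_delta fmx_delta.
apply/eqP; rewrite eqn_leq; apply/andP; split.
- have [l lS [B BE]] := span_list (irreducible_orbit U (irrep_irreducible r) v0).
  have : \rank (colsmx (fun g => r g *m v) l) = degree r.
    by apply/eqP/row_freeP; exists B.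
  by move=> <-; rewrite (rkE _ lS) rank_leq_row.
- have [l lS [B BE]] := span_list redvec_span.
  have : \rank (colsmx redvec l) = #|{: redmon p q}|.
    by apply/eqP/row_freeP; exists B.
  by move=> <-; rewrite -(rkE _ lS) rank_leq_row.
Qed.

End Degree.

Lemma SU3_dual_param (R : realType) : exists f : nat * nat -> SU3_dual R[i],
  [/\ injective f, forall c, exists k, f k = c &
   forall p q, (deg (f (p, q)) * 2 = p.+1 * q.+1 * (p.+1 + q.+1))%N].
Proof.
pose r (k : nat * nat) := sval (cid (tensor_model_exists R k.1 k.2)).
have rP k : tensor_model k.1 k.2 (r k) by rewrite /r; case: cid.
exists (fun k => \pi_(SU3_dual R[i]) (r k)); split.
- move=> [p q] [p' q'] /eqmodP/asboolP; exact: tensor_model_inj (rP (p, q)) (rP (p', q')).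
- move=> c; have [p [q h]] := irrep_highest (repr c).
  exists (p, q); rewrite -[RHS]reprK; apply/eqmodP/asboolP.
  exact: highest_coef_equiv (tensor_model_highest (rP (p, q))) h.
- move=> p q; rewrite deg_pi (tensor_model_degree (rP (p, q))) card_redmon.
  by rewrite /=; lia.
Qed.

(** * Unordered sums *)

Section Sums.
Variable R : realType.
Local Notation C := R[i].
Local Notation Re := (@complex.Re R).
Local Notation Im := (@complex.Im R).

Lemma Im_le_normc (z : C) : `|Im z| <= normc z.
Proof. by case: z => a b /=; rewrite -sqrtr_sqr ler_wsqrtr// lerDr sqr_ge0. Qed.

Definition sbound (I : choiceType) (m : I -> R) (B : R) :=
  forall A : {fset I}, \sum_(i <- A) m i <= B.

Definition csummable (I : choiceType) (u : I -> C) := exists B, sbound (fun i => normc (u i)) B.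

Lemma has_sumP (I : choiceType) (u : I -> C) l : has_sum u l <->
  forall e : R, 0 < e -> exists A0 : {fset I},
    forall A : {fset I}, (A0 `<=` A)%fset -> normc (\sum_(i <- A) u i - l) < e.
Proof.
split=> [h e e0|h e e0].
  have [|A0 A0P] := h e%:C%C; first by rewrite ltcR.
  by exists A0 => A /A0P; rewrite normcE' ltcR.
have eE : e = (Re e)%:C%C by rewrite RRe_real// gtr0_real.
have [|A0 A0P] := h (Re e); first by rewrite -ltcR -eE.
by exists A0 => A /A0P; rewrite normcE' eE ltcR.
Qed.

Section OneFamily.
Variable I : choiceType.
Implicit Types (u w : I -> C) (m : I -> R) (A : {fset I}).

Lemma sum_le_fset m A A' : (forall i, 0 <= m i) -> (A `<=` A')%fset ->
  \sum_(i <- A) m i <= \sum_(i <- A') m i.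
Proof.
move=> m0 AA'; rewrite (big_fsetID _ (mem A) A') /=.
have -> : [fset x in A' | x \in A]%fset = A.
  by apply/fsetP => x; rewrite !inE /= andbC; case: (boolP (x \in A)) => // /(fsubsetP AA') ->.
by rewrite lerDl sumr_ge0.
Qed.

Lemma sum_fsetU m A A' : (forall i, 0 <= m i) ->
  (forall x, x \in A -> x \notin A') ->
  \sum_(i <- (A `|` A')%fset) m i = \sum_(i <- A) m i + \sum_(i <- A') m i.
Proof.
move=> m0 d; rewrite (big_fsetID _ (mem A)) /=; congr (_ + _); apply: eq_fbigl => x.
  by rewrite !inE /=; case: (x \in A); rewrite ?andbF.
rewrite !inE /=; case: (boolP (x \in A)) => //= xA.
  by rewrite (negbTE (d _ xA)).
by rewrite andbT.
Qed.

Lemma sbound_ge0 m B : sbound m B -> 0 <= B.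
Proof. by move=> /(_ fset0); rewrite big_seq_fset0. Qed.

Lemma sbound_le m m' B : (forall i, m i <= m' i) -> sbound m' B -> sbound m B.
Proof. by move=> mm h A; apply: le_trans (h A); apply: ler_sum. Qed.

Lemma csummable_le u m B : (forall i, normc (u i) <= m i) -> sbound m B -> csummable u.
Proof. by move=> um h; exists B; apply: sbound_le h. Qed.

(** For nonnegative terms the limit is the supremum of the finite sums, approached from below. *)
Lemma real_has_sum m B : (forall i, 0 <= m i) -> sbound m B ->
  exists l : R, forall e, 0 < e -> exists A0 : {fset I},
    forall A, (A0 `<=` A)%fset -> l - e < \sum_(i <- A) m i <= l.
Proof.
move=> m0 mB; pose S := [set \sum_(i <- A) m i | A in [set: {fset I}]].
have hS : has_sup S.
  by split; [exists (\sum_(i <- fset0) m i), fset0|exists B => _ [A _ <-]; exact: mB].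
exists (sup S) => e e0; have [_ [A0 _ <-] lt] := sup_adherent e0 hS.
exists A0 => A AA; rewrite (lt_le_trans lt) ?sum_le_fset//=.
by apply: ub_le_sup; [case: hS|exists A].
Qed.

Lemma has_sum_uniq u l l' : has_sum u l -> has_sum u l' -> l = l'.
Proof.
move=> /has_sumP h /has_sumP h'; apply/eqP; rewrite -subr_eq0 -normc_eq0; apply/eqP.
apply/eqP; rewrite eq_le normc_ge0 andbT; apply/ler_addgt0Pl => e e0; rewrite addr0.
have [|A1 A1P] := h (e / 2); first by rewrite divr_gt0.
have [|A2 A2P] := h' (e / 2); first by rewrite divr_gt0.
have := A1P (A1 `|` A2)%fset (fsubsetUl _ _); have := A2P (A1 `|` A2)%fset (fsubsetUr _ _).
set S := \sum_(_ <- _) _ => e2 e1.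
have -> : l - l' = (S - l') - (S - l) by ring.
have := normcD (S - l') (- (S - l)); rewrite normcN'; move: e1 e2; lra.
Qed.

Lemma has_sumD u w l k : has_sum u l -> has_sum w k -> has_sum (fun i => u i + w i) (l + k).
Proof.
move=> /has_sumP h /has_sumP h'; apply/has_sumP => e e0.
have [|A1 A1P] := h (e / 2); first by rewrite divr_gt0.
have [|A2 A2P] := h' (e / 2); first by rewrite divr_gt0.
exists (A1 `|` A2)%fset => A; rewrite fsubUset => /andP[/A1P e1 /A2P e2].
rewrite big_split /= opprD addrACA.
by have := normcD (\sum_(i <- A) u i - l) (\sum_(i <- A) w i - k); move: e1 e2; lra.
Qed.

Lemma has_sum_ext u w l : (forall i, u i = w i) -> has_sum u l -> has_sum w l.
Proof. by move=> uw; congr has_sum; apply/funext. Qed.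

Lemma has_sum0 : has_sum (fun=> 0 : C) (0 : C) (I := I).
Proof.
apply/has_sumP => e e0; exists fset0 => A _.
by rewrite big1// subrr normc0.
Qed.

Lemma has_sumZ c u l : has_sum u l -> has_sum (fun i => c * u i) (c * l).
Proof.
move=> /has_sumP h; apply/has_sumP => e e0.
have c0 : 0 < normc c + 1 by rewrite ltr_wpDl// normc_ge0.
have [|A1 A1P] := h (e / (normc c + 1)); first by rewrite divr_gt0.
exists A1 => A /A1P; rewrite -mulr_sumr -mulrBr normcM ltr_pdivlMr// => lt.
by apply: le_lt_trans lt; rewrite mulrC ler_wpM2l ?normc_ge0// lerDl.
Qed.

Lemma has_sumB u w l k : has_sum u l -> has_sum w k -> has_sum (fun i => u i - w i) (l - k).
Proof.
move=> hu /(has_sumZ (-1)) hw; rewrite -mulN1r.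
by apply: has_sum_ext (has_sumD hu hw) => i; rewrite mulN1r.
Qed.

Lemma has_sum_big (J : Type) (r : seq J) (u : J -> I -> C) (l : J -> C) :
  (forall j, has_sum (u j) (l j)) -> has_sum (fun i => \sum_(j <- r) u j i) (\sum_(j <- r) l j).
Proof.
move=> h; elim: r => [|j r IH].
  by rewrite big_nil; apply: has_sum_ext has_sum0 => i; rewrite big_nil.
by rewrite big_cons; apply: has_sum_ext (has_sumD (h j) IH) => i; rewrite big_cons.
Qed.

Lemma has_sum_fset u A : (forall i, i \notin A -> u i = 0) -> has_sum u (\sum_(i <- A) u i).
Proof.
move=> uA; apply/has_sumP => e e0; exists A => A' AA'.
by rewrite -(big_fset_incl _ AA') ?subrr ?normc0// => x _ /uA.
Qed.

Lemma has_sum_1 u i : (forall j, j != i -> u j = 0) -> has_sum u (u i).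
Proof.
move=> h; have := @has_sum_fset u [fset i]%fset; rewrite big_seq_fset1; apply => j.
by rewrite inE; exact: h.
Qed.

Lemma has_sum_real m l : (forall e, 0 < e -> exists A0 : {fset I},
    forall A, (A0 `<=` A)%fset -> l - e < \sum_(i <- A) m i <= l) ->
  has_sum (fun i => (m i)%:C%C) l%:C%C.
Proof.
move=> h; apply/has_sumP => e e0; have [A0 A0P] := h e e0; exists A0 => A /A0P.
rewrite -rmorph_sum -rmorphB normc_real /= => /andP[h1 h2].
by rewrite ler0_norm ?subr_le0// opprB ltrBlDr -ltrBlDl.
Qed.

Lemma csummable_has_sum u : csummable u -> exists l, has_sum u l.
Proof.
move=> [B uB].
have part (f : C -> R) : (forall z, `|f z| <= normc z) ->
    exists l : R, has_sum (fun i => (f (u i))%:C%C) l%:C%C.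
  move=> fle.
  (* Adding the norm makes the terms nonnegative, and the sum of the norms is subtracted again
     afterwards. *)
  have [||l1 h1] := @real_has_sum (fun i => normc (u i) + f (u i)) (B + B).
  - by move=> i; have := fle (u i); rewrite ler_norml => /andP[h _]; rewrite -lerBlDr sub0r lerNl; lra.
  - move=> A; rewrite big_split /= lerD//; apply: le_trans (uB A).
    by apply: ler_sum => i _; have := fle (u i); rewrite ler_norml => /andP[].
  have [||l2 h2] := @real_has_sum (fun i => normc (u i)) B.
  - by move=> i; exact: normc_ge0.
  - by [].
  exists (l1 - l2); have := has_sumB (has_sum_real h1) (has_sum_real h2); rewrite -rmorphB.
  by apply: has_sum_ext => i; rewrite -rmorphB /= [_ + f _]addrC addrK.
have [lr hr] := part Re (@Re_le_normc R).
have [li hi] := part Im Im_le_normc.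
exists (lr%:C%C + 'i%C * li%:C%C); apply: has_sum_ext (has_sumD hr (has_sumZ 'i%C hi)) => i.
by rewrite [RHS]complexE.
Qed.

(** The default 0 is taken when there is no sum, so this total function has to be accompanied by a
    proof of summability. *)
Definition tsum u : C := xget 0 [set l | has_sum u l].

Lemma tsumE u l : has_sum u l -> tsum u = l.
Proof.
by move=> h; rewrite /tsum; case: xgetP => [x _ hx|/(_ l)//]; exact: has_sum_uniq hx h.
Qed.

Lemma has_tsum u : csummable u -> has_sum u (tsum u).
Proof. by move=> /csummable_has_sum[l h]; rewrite (tsumE h). Qed.

Lemma has_sum_le u m l k : (forall i, normc (u i) <= m i) ->
  has_sum u l -> has_sum (fun i => (m i)%:C%C) k -> normc l <= Re k.
Proof.
move=> um /has_sumP h /has_sumP h'; apply/ler_addgt0Pl => e e0.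
have [|A1 A1P] := h (e / 2); first by rewrite divr_gt0.
have [|A2 A2P] := h' (e / 2); first by rewrite divr_gt0.
have := A1P (A1 `|` A2)%fset (fsubsetUl _ _); have := A2P (A1 `|` A2)%fset (fsubsetUr _ _).
rewrite -rmorph_sum /=; set S := \sum_(_ <- _) u _; set M := \sum_(_ <- _) m _ => e2 e1.
have SM : normc S <= M by apply: le_trans (normc_sum _ _ _) _; apply: ler_sum.
have e3 : M - Re k <= normc (M%:C%C - k).
  have := Re_le_normc (M%:C%C - k); case: (k) => a b /=.
  by rewrite -/(normc ((M - a) +i* (0 - b))%C) => /(le_trans (ler_norm _)).
have : normc l <= normc S + normc (S - l).
  by rewrite -(normcN' (S - l)) opprB; have := normcD S (l - S); rewrite addrCA subrr addr0.
move: e1 e2 e3 SM; lra.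
Qed.

Lemma normc_has_sum u l B : has_sum u l -> sbound (fun i => normc (u i)) B -> normc l <= B.
Proof.
move=> /has_sumP h uB; apply/ler_addgt0Pl => e e0; have [A0 A0P] := h e e0.
have {}A0P := A0P A0 (fsubset_refl _); have := uB A0; move: A0P; set S := \sum_(_ <- _) u _ => A0P SB.
have h1 : normc S <= B by apply: le_trans (normc_sum _ _ _) _.
have : normc l <= normc S + normc (S - l).
  by rewrite -(normcN' (S - l)) opprB; have := normcD S (l - S); rewrite addrCA subrr addr0.
by move: A0P h1; lra.
Qed.

Lemma csummableD u w : csummable u -> csummable w -> csummable (fun i => u i + w i).
Proof.
move=> [B uB] [B' wB]; exists (B + B') => A.
apply: le_trans (lerD (uB A) (wB A)); rewrite -big_split /=; apply: ler_sum => i _; exact: normcD.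
Qed.

Lemma csummableZ c u : csummable u -> csummable (fun i => c * u i).
Proof.
move=> [B uB]; exists (normc c * B) => A; under eq_bigr do rewrite normcM.
by rewrite -mulr_sumr ler_wpM2l ?normc_ge0.
Qed.

Lemma csummable_tail u : csummable u -> forall e, 0 < e -> exists A0 : {fset I},
  forall A, (forall x, x \in A -> x \notin A0) -> \sum_(i <- A) normc (u i) < e.
Proof.
move=> [B uB] e e0.
have [l h] := real_has_sum (fun i => normc_ge0 (u i)) uB.
have [A0 A0P] := h e e0; exists A0 => A AA0.
have /andP[lo _] := A0P A0 (fsubset_refl _).
have /andP[_ hi] := A0P (A0 `|` A)%fset (fsubsetUl _ _).
move: hi; rewrite fsetUC sum_fsetU//; first by move: lo; lra.
by move=> i; exact: normc_ge0.
Qed.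

End OneFamily.
Section Reindex.
Variables (I J : choiceType) (u : I -> C) (w : J -> C) (f : I -> J) (g : J -> I).
Hypothesis fP : forall i, u i != 0 -> g (f i) = i /\ w (f i) = u i.
Hypothesis gP : forall j, w j != 0 -> f (g j) = j /\ u (g j) = w j.

(** The maps need to be inverse to each other on the supports only, which allows reindexing between
    sets where one side carries additional zero terms. *)
Lemma has_sum_reindex l : has_sum u l -> has_sum w l.
Proof.
move=> /has_sumP h; apply/has_sumP => e e0; have [A0 A0P] := h e e0.
exists (f @` A0)%fset => B AB.
(* Indices of [A0] with a zero term have no image to rely on; they are added by hand, without
   changing the sum. *)
pose B' := [fset j in B | w j != 0]%fset; pose A := (g @` B' `|` [fset i in A0 | u i == 0])%fset.
have A0A : (A0 `<=` A)%fset.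
  apply/fsubsetP => i iA; rewrite !inE /= iA /=; have [//|un] := eqVneq (u i) 0.
    by rewrite orbT.
  have [gf wf] := fP un; rewrite orbF -gf in_imfset//= !inE /= wf un andbT.
  by apply: (fsubsetP AB); rewrite in_imfset.
have := A0P A A0A; congr (normc (_ - _) < _).
rewrite /A -(@big_fset_incl _ _ _ _ (g @` B')%fset) ?fsubsetUl//; last first.
  by move=> i; rewrite !inE /= => /orP[->//|/andP[_ /eqP ->]].
rewrite big_imfset /=; last first.
  move=> j k; rewrite !inE /= => /andP[_ wj] /andP[_ wk] gjk.
  by have [<- _] := gP wj; have [<- _] := gP wk; rewrite gjk.
transitivity (\sum_(i <- B') w i).
  rewrite big_seq [RHS]big_seq; apply: eq_bigr => j; rewrite !inE /= => /andP[_ wj].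
  by have [_ ->] := gP wj.
apply: big_fset_incl; first by apply/fsubsetP => j; rewrite !inE => /andP[].
by move=> j jB; rewrite !inE jB /= negbK => /eqP.
Qed.

Lemma csummable_reindex : csummable u -> csummable w.
Proof.
move=> [B uB]; exists B => A; pose A' := [fset j in A | w j != 0]%fset.
rewrite -(@big_fset_incl _ _ _ _ A'); last 2 first.
- by apply/fsubsetP => j; rewrite !inE => /andP[].
- by move=> j jA; rewrite !inE jA /= negbK => /eqP ->; rewrite normc0.
apply: le_trans (uB (g @` A')%fset); rewrite [leRHS]big_imfset /=; last first.
  move=> j k; rewrite !inE /= => /andP[_ wj] /andP[_ wk] gjk.
  by have [<- _] := gP wj; have [<- _] := gP wk; rewrite gjk.
rewrite big_seq [leRHS]big_seq; apply: ler_sum => j; rewrite !inE /= => /andP[_ wj].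
by have [_ ->] := gP wj.
Qed.
End Reindex.

Lemma has_sum_bij (I J : choiceType) (u : I -> C) (f : J -> I) (g : I -> J) l :
  cancel f g -> cancel g f -> has_sum u l -> has_sum (u \o f) l.
Proof.
move=> fK gK; apply: (@has_sum_reindex _ _ u (u \o f) g f) => [i _|j _] /=.
  by rewrite gK.
by rewrite fK.
Qed.

Section Fibers.
Variables (X I : choiceType) (p : X -> I) (u : X -> C).
Hypothesis us : csummable u.
Definition fiber i x := if p x == i then u x else 0.

Lemma csummable_sub (w : X -> C) : (forall x, w x = u x \/ w x = 0) -> csummable w.
Proof.
move=> h; case: us => B uB; exists B; apply: sbound_le uB => x.
by case: (h x) => ->; rewrite ?normc0 ?normc_ge0.
Qed.

Lemma has_sum_fiber i : has_sum (fiber i) (tsum (fiber i)).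
Proof.
by apply: has_tsum; apply: csummable_sub => x; rewrite /fiber; case: ifP; [left|right].
Qed.

Lemma sum_fibers (A : {fset I}) x : \sum_(i <- A) fiber i x = if p x \in A then u x else 0.
Proof.
rewrite /fiber; case: ifP => pA; last first.
  rewrite big_seq big1// => i iA; case: eqP => // e; by rewrite e iA in pA.
rewrite (big_fsetD1 (p x))//= eqxx big_seq big1 ?addr0// => i; rewrite !inE eq_sym.
by case/andP => /negbTE ->.
Qed.

(** Once [A] contains the images of a large finite [B0], the difference of the two sums involves
    only terms outside [B0], whose norms have a small sum. *)
Lemma has_sum_fibers : has_sum (fun i => tsum (fiber i)) (tsum u).
Proof.
apply/has_sumP => e e0; have e20 : 0 < e / 2 by rewrite divr_gt0.
have [B0 B0P] := csummable_tail us e20.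
exists (p @` B0)%fset => A BA.
have h1 := has_sum_big (A : seq I) has_sum_fiber.
have := has_sumB h1 (has_tsum us) => {}h1.
apply: (@le_lt_trans _ _ (e / 2)); last by rewrite ltr_pdivrMr// mulr_natr mulr2n ltrDl.
apply: normc_has_sum h1 _ => B.
pose B' := [fset x in B | p x \notin A]%fset.
rewrite -(@big_fset_incl _ _ _ _ B'); last 2 first.
- by apply/fsubsetP => j; rewrite !inE => /andP[].
- by move=> x xB; rewrite !inE xB /= negbK sum_fibers => ->; rewrite subrr normc0.
apply: le_trans (ltW (B0P B' _)).
  rewrite big_seq [leRHS]big_seq; apply: ler_sum => x; rewrite !inE /= => /andP[_ /negbTE nA].
  by rewrite sum_fibers nA sub0r normcN'.
move=> x; rewrite !inE => /andP[_]; apply: contra => xB.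
by apply: (fsubsetP BA); rewrite in_imfset.
Qed.
End Fibers.

Lemma csummable_fibers (X I : choiceType) (p : X -> I) (u : X -> C) :
  csummable u -> csummable (fun i => tsum (fiber p u i)).
Proof.
move=> us; pose m x := (normc (u x))%:C%C.
have mE x : normc (m x) = normc (u x) by rewrite normc_real ger0_norm ?normc_ge0.
have ms : csummable m by case: us => B uB; exists B; apply: sbound_le uB => x; rewrite mE.
case: (us) => B uB; exists B => A.
have h1 i := has_sum_fiber p us i; have h2 i := has_sum_fiber p ms i.
apply: (@le_trans _ _ (\sum_(i <- A) Re (tsum (fiber p m i)))).
  apply: ler_sum => i _; apply: (@has_sum_le _ _ (fun x => if p x == i then normc (u x) else 0)) (h1 i) _.
    by move=> x; rewrite /fiber; case: ifP; rewrite ?normc0.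
  by apply: has_sum_ext (h2 i) => x; rewrite /fiber; case: ifP.
have := has_sum_big (A : seq I) h2.
have -> : \sum_(i <- A) Re (tsum (fiber p m i)) = Re (\sum_(i <- A) tsum (fiber p m i)).
  by elim/big_rec2: _ => // i [a b] c _ -> /=; case: (tsum _).
set S := \sum_(_ <- _) tsum _ => h3; apply: le_trans (ler_norm _) _; apply: le_trans (Re_le_normc _) _.
apply: normc_has_sum h3 _; apply: sbound_le uB => x.
by rewrite sum_fibers; case: ifP; rewrite ?mE ?normc0 ?normc_ge0.
Qed.

Section Product.
Variables (I J : choiceType).

Lemma sbound_iter (m : I * J -> R) (B : I -> R) T : (forall x, 0 <= m x) ->
  (forall i, sbound (fun j => m (i, j)) (B i)) -> sbound B T -> sbound m T.
Proof.
move=> m0 mB BT A.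
pose A1 := [fset x.1 | x in A]%fset; pose A2 := [fset x.2 | x in A]%fset.
pose P := [fset ((i, j) : (I * J)%type) | i in A1, j in A2]%fset.
have AP : (A `<=` P)%fset.
  by apply/fsubsetP => -[i j] xA; rewrite in_imfset2//=;
    [rewrite (in_imfset _ (fun x : I * J => x.1) xA)|rewrite (in_imfset _ (fun x : I * J => x.2) xA)].
apply: le_trans (sum_le_fset m0 AP) _.
rewrite big_imfset2 /=; last by move=> [? ?] [? ?] _ _ /= [-> ->].
by apply: le_trans (BT A1); apply: ler_sum => i _; exact: mB.
Qed.

Lemma sbound_prod (m : I -> R) (n : J -> R) B B' : (forall i, 0 <= m i) -> (forall j, 0 <= n j) ->
  sbound m B -> sbound n B' -> sbound (fun x : I * J => m x.1 * n x.2) (B * B').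
Proof.
move=> m0 n0 mB nB; apply: (@sbound_iter _ (fun i => m i * B')) => [x|i A|A].
- by rewrite mulr_ge0.
- by rewrite /= -mulr_sumr ler_wpM2l.
- by rewrite -mulr_suml ler_wpM2r//; exact: sbound_ge0 nB.
Qed.

Lemma csummable_prod (u : I -> C) (w : J -> C) : csummable u -> csummable w ->
  csummable (fun x : I * J => u x.1 * w x.2).
Proof.
move=> [B uB] [B' wB]; exists (B * B').
apply: sbound_le (sbound_prod (fun i => normc_ge0 (u i)) (fun j => normc_ge0 (w j)) uB wB) => x.
by rewrite normcM.
Qed.

Lemma tsum_row (F : I * J -> C) i l : has_sum (fun j => F (i, j)) l ->
  has_sum (fiber fst F i) l.
Proof.
apply: (@has_sum_reindex _ _ _ _ (fun j => (i, j)) snd) => [j _|[k j]]; rewrite /fiber /=.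
  by rewrite eqxx.
by case: (k =P i) => [->|_]; rewrite ?eqxx.
Qed.

Lemma has_sum_iterated (F : I * J -> C) (row : I -> C) : csummable F ->
  (forall i, has_sum (fun j => F (i, j)) (row i)) -> has_sum row (tsum F).
Proof.
move=> Fs h; apply: has_sum_ext (has_sum_fibers fst Fs) => i.
by apply: tsumE; exact: tsum_row.
Qed.

Lemma has_sum_prod (u : I -> C) (w : J -> C) l k : csummable u -> csummable w ->
  has_sum u l -> has_sum w k -> has_sum (fun x : I * J => u x.1 * w x.2) (l * k).
Proof.
move=> us ws ul wk; have ps := csummable_prod us ws.
suff -> : l * k = tsum (fun x : I * J => u x.1 * w x.2) by exact: has_tsum.
apply: has_sum_uniq (has_sum_iterated (row := fun i => u i * k) ps _).
  by rewrite mulrC; apply: has_sum_ext (has_sumZ k ul) => i; rewrite mulrC.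
by move=> i; exact: (has_sumZ (u i) wk).
Qed.

End Product.

Lemma has_sum_swap (I J : choiceType) (F : I * J -> C) l :
  has_sum F l -> has_sum (fun x : J * I => F (x.2, x.1)) l.
Proof.
by apply: (@has_sum_bij _ _ _ (fun x : J * I => (x.2, x.1)) (fun x => (x.2, x.1))) => -[].
Qed.

Lemma csummable_swap (I J : choiceType) (F : I * J -> C) :
  csummable F -> csummable (fun x : J * I => F (x.2, x.1)).
Proof.
by apply: (@csummable_reindex _ _ _ _ (fun x => (x.2, x.1)) (fun x => (x.2, x.1))) => -[].
Qed.

Definition conv (a b : nat -> C) k := \sum_(i < k.+1) a i * b (k - i)%N.

(** The Cauchy product, as summation over the fibers of (i, j) -> i + j. *)
Lemma has_sum_conv (a b : nat -> C) l k : csummable a -> csummable b ->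
  has_sum a l -> has_sum b k -> csummable (conv a b) /\ has_sum (conv a b) (l * k).
Proof.
move=> as_ bs al bk; have ps := csummable_prod as_ bs.
pose p (x : nat * nat) := (x.1 + x.2)%N.
have E n : tsum (fiber p (fun x => a x.1 * b x.2) n) = conv a b n.
  apply: tsumE; pose A := [fset (nat_of_ord i, (n - i)%N) | i in 'I_n.+1]%fset.
  have -> : conv a b n = \sum_(x <- A) fiber p (fun x => a x.1 * b x.2) n x.
    rewrite big_imfset /=; last by move=> i j _ _ [/val_inj].
    rewrite /conv big_enum /=; apply: eq_bigr => i _.
    by rewrite /fiber /p /= subnKC ?eqxx// -ltnS.
  apply: has_sum_fset => -[i j] nA; rewrite /fiber /p /=; case: eqP => // e.
  case/negP: nA; have lt : (i < n.+1)%N by rewrite -e ltnS leq_addr.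
  have -> : (i, j) = (nat_of_ord (Ordinal lt), (n - Ordinal lt)%N) by rewrite /= -e addKn.
  by rewrite in_imfset.
have Ef : (fun n => tsum (fiber p (fun x => a x.1 * b x.2) n)) = conv a b by apply/funext.
rewrite -Ef; split; first exact: csummable_fibers.
by rewrite -(tsumE (has_sum_prod as_ bs al bk)); exact: has_sum_fibers.
Qed.

End Sums.

(** * Exponential and binomial series *)

Section ExpC.
Variable R : realType.
Local Notation C := R[i].
Local Notation Re := (@complex.Re R).
Implicit Types z w : C.

Lemma expCD z w : expC (z + w) = expC z * expC w.
Proof.
case: z => a b; case: w => c d; rewrite /expC /= expRD cosD sinD.
by apply/eqP; rewrite eq_complex /=; apply/andP; split; apply/eqP; ring.
Qed.

Lemma expC0 : expC (0 : C) = 1.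
Proof. by rewrite /expC /= expR0 cos0 sin0 mulr1 mulr0. Qed.

Lemma expC_real (x : R) : expC x%:C%C = (expR x)%:C%C.
Proof. by rewrite /expC /= cos0 sin0 mulr1 mulr0. Qed.

Lemma normc_expC z : normc (expC z) = expR (Re z).
Proof.
case: z => a b /=; by rewrite !exprMn -mulrDr cos2Dsin2 mulr1 sqrtr_sqr ger0_norm ?expR_ge0.
Qed.

Lemma expC_neq0 z : expC z != 0.
Proof. by rewrite -normc_eq0 normc_expC expR_eq0. Qed.

Lemma expCN z : expC (- z) = (expC z)^-1.
Proof. by apply: (mulfI (expC_neq0 z)); rewrite -expCD subrr expC0 divff// expC_neq0. Qed.

Lemma expC_natmul n z : expC (n%:R * z) = expC z ^+ n.
Proof.
elim: n => [|n IH]; first by rewrite mul0r expC0.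
by rewrite -addn1 natrD mulrDl mul1r expCD IH addn1 exprSr.
Qed.

Lemma sin_abs_le (y : R) : `|sin y| <= `|y|.
Proof.
have pos (x : R) : 0 <= x -> `|sin x| <= x.
  move=> x0; have [c _] := @MVT_segment R sin cos 0 x x0 (fun c _ => is_derive_sin c)
    (continuous_subspaceT (@continuous_sin R)).
  rewrite sin0 !subr0 => ->; rewrite normrM (ger0_norm x0).
  by rewrite ler_piMl// cos_max.
have [y0|y0] := leP 0 y; first by rewrite (ger0_norm y0) pos.
by rewrite -normrN -sinN (ltr0_norm y0) pos// oppr_ge0 ltW.
Qed.

Lemma cos_abs_le (y : R) : `|cos y - 1| <= y ^+ 2.
Proof.
have pos (x : R) : 0 <= x -> `|cos x - 1| <= x ^+ 2.
  move=> x0; have [c] := @MVT_segment R cos (fun x => - sin x) 0 x x0 (fun c _ => is_derive_cos c)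
    (continuous_subspaceT (@continuous_cos R)).
  rewrite cos0 subr0 in_itv /= => /andP[c0 cx] ->; rewrite normrM normrN (ger0_norm x0) expr2.
  rewrite ler_wpM2r//; apply: le_trans (sin_abs_le c) _; by rewrite ger0_norm.
have [y0|y0] := leP 0 y; first by rewrite pos.
by rewrite -cosN -sqrrN pos// oppr_ge0 ltW.
Qed.

Lemma sin_sub_abs_le (y : R) : `|sin y - y| <= `|y| ^+ 3.
Proof.
have pos (x : R) : 0 <= x -> `|sin x - x| <= x ^+ 3.
  move=> x0; have [c] := @MVT_segment R sin cos 0 x x0 (fun c _ => is_derive_sin c)
    (continuous_subspaceT (@continuous_sin R)).
  rewrite sin0 !subr0 in_itv /= => /andP[c0 cx] ->.
  rewrite -{2}[x]mul1r -mulrBl normrM (ger0_norm x0) exprSr ler_wpM2r//.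
  apply: le_trans (cos_abs_le c) _; by rewrite ler_pXn2r ?nnegrE.
have [y0|y0] := leP 0 y; first by rewrite (ger0_norm y0) pos.
have := pos (- y); rewrite sinN -opprD normrN oppr_ge0 (ltW y0) (ltr0_norm y0); exact.
Qed.

(** From e^x >= 1 + x below and e^x (1 - x) <= 1 above. *)
Lemma expR_sub_le (x : R) : `|x| <= 1 / 2 -> `|expR x - 1 - x| <= 2 * x ^+ 2.
Proof.
rewrite ler_norml => /andP[x1 x2]; have e1 := expR_ge1Dx x; have e2 := expR_ge1Dx (- x).
have e3 : expR x * expR (- x) = 1 by rewrite expRxMexpNx_1.
have e4 : expR x * (1 - x) <= 1 by rewrite -[leRHS]e3 ler_wpM2l ?expR_ge0.
rewrite ger0_norm; last by lra.
have x3 : 0 < 1 - x by lra.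
rewrite -(ler_pM2r x3); nra.
Qed.

Lemma normc_le_abs (a b : R) : normc (a +i* b)%C <= `|a| + `|b|.
Proof.
have -> : (a +i* b)%C = a%:C%C + 'i%C * b%:C%C by rewrite [LHS]complexE.
apply: le_trans (normcD _ _) _; rewrite normcM !normc_real lerD2l /=.
by rewrite expr0n expr1n add0r sqrtr1 mul1r.
Qed.

Lemma expC_sub_le z : normc z <= 1 / 2 -> normc (expC z - 1 - z) <= 8 * normc z ^+ 2.
Proof.
suff main (x y : R) : `|x| <= 1 / 2 -> `|y| <= 1 / 2 ->
    normc ((expR x * cos y - 1 - x) +i* (expR x * sin y - y))%C <= 8 * (x ^+ 2 + y ^+ 2).
  move=> z12; have zr := le_trans (Re_le_normc z) z12; have zi := le_trans (Im_le_normc z) z12.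
  case: z z12 zr zi => x y _ x1 y1; have := main x y x1 y1.
  have -> : expC (x +i* y)%C - 1 - (x +i* y)%C = ((expR x * cos y - 1 - x) +i* (expR x * sin y - y))%C.
    by apply/eqP; rewrite eq_complex /= subr0 !eqxx.
  by rewrite {2}/normc sqr_sqrtr ?addr_ge0 ?sqr_ge0.
move=> x1 y1.
have -> : ((expR x * cos y - 1 - x) +i* (expR x * sin y - y))%C =
  ((expR x - 1 - x + expR x * (cos y - 1)) +i* ((expR x - 1) * sin y + (sin y - y)))%C.
  by congr Complex; ring.
apply: le_trans (normc_le_abs _ _) _.
have h1 := expR_sub_le x1; have h2 := cos_abs_le y; have h3 := sin_sub_abs_le y; have h4 := sin_abs_le y.
have eR : expR x <= 2 by move: h1 x1; rewrite !ler_norml => /andP[_ ?] /andP[? ?]; nra.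
have h5 : `|expR x - 1| <= 2 * `|x|.
  have -> : expR x - 1 = (expR x - 1 - x) + x by ring.
  have x2 : x ^+ 2 <= `|x| / 2.
    by rewrite -(real_normK (num_real x)) expr2 ler_wpM2l// -[2^-1]mul1r.
  by apply: le_trans (ler_normD _ _) _; move: h1 x2; lra.
have h6 : `|expR x * (cos y - 1)| <= 2 * y ^+ 2.
  by rewrite normrM ger0_norm ?expR_ge0// ler_pM ?expR_ge0.
have h7 : `|(expR x - 1) * sin y| <= 2 * `|x| * `|y| by rewrite normrM ler_pM.
have h8 : `|y| ^+ 3 <= `|y| ^+ 2.
  by rewrite exprSr ler_piMr ?exprn_ge0//; lra.
have h9 : `|x| ^+ 2 = x ^+ 2 by rewrite real_normK ?num_real.
have h10 : `|y| ^+ 2 = y ^+ 2 by rewrite real_normK ?num_real.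
have h11 : 2 * `|x| * `|y| <= x ^+ 2 + y ^+ 2.
  by have := sqr_ge0 (`|x| - `|y|); rewrite -h9 -h10; nra.
have := ler_normD (expR x - 1 - x) (expR x * (cos y - 1)).
have := ler_normD ((expR x - 1) * sin y) (sin y - y).
have := sqr_ge0 x; have := sqr_ge0 y; rewrite h10 in h8; lra.
Qed.

(* q(s) = q(s / N) ^ N is within (1 + D |s|^2 / N^2) ^ N - 1 of 1. *)
Lemma multiplicative_eq1 (q : C -> C) (d D : R) : 0 < d -> (forall s t, q (s + t) = q s * q t) ->
  (forall h, normc h <= d -> normc (q h - 1) <= D * normc h ^+ 2) -> forall s, q s = 1.
Proof.
move=> d0 qM qD s; apply/eqP; rewrite -subr_eq0 -normc_eq0 eq_le normc_ge0 andbT.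
have D0 : 0 <= D.
  have := qD d%:C%C; rewrite normc_real gtr0_norm// lexx => /(_ isT); move/(le_trans (normc_ge0 _)).
  by rewrite pmulr_lge0// exprn_gt0.
have q1 n t : q (n.+1%:R * t) = q t ^+ n.+1.
  elim: n => [|n IH]; first by rewrite mul1r expr1.
  by rewrite -[n.+2%:R]natr1 mulrDl mul1r qM IH -exprSr.
have pow (a : C) n : normc (a ^+ n - 1) <= (1 + normc (a - 1)) ^+ n - 1.
  elim: n => [|n IH]; first by rewrite !expr0 !subrr normc0.
  have -> : a ^+ n.+1 - 1 = a * (a ^+ n - 1) + (a - 1) by rewrite exprS; ring.
  apply: le_trans (normcD _ _) _; rewrite normcM.
  have na : normc a <= 1 + normc (a - 1) by have := normcD 1 (a - 1); rewrite addrCA subrr addr0 normc1.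
  rewrite exprS; have := ler_pM (normc_ge0 a) (normc_ge0 _) na IH; nra.
apply/ler_addgt0Pl => e e0; rewrite addr0.
pose S := D * normc s ^+ 2; have S0 : 0 <= S by rewrite mulr_ge0// exprn_ge0 ?normc_ge0.
(* The three terms ensure |s| / N <= d, S / N <= 1/2 and 2 S / N <= e in turn. *)
pose N := (Num.truncn (normc s / d + 2 * S + 2 * S / e)).+1.
have N1 : normc s / d + 2 * S + 2 * S / e < N%:R.
  by rewrite truncnS_gt.
have sd : 0 <= normc s / d by rewrite divr_ge0 ?normc_ge0// ltW.
have Se : 0 <= 2 * S / e by rewrite divr_ge0 ?(ltW e0)// mulr_ge0.
have N0 : 0 < N%:R :> R by rewrite ltr0n.
have sE : s = N%:R * (s / N%:R) by rewrite mulrC divfK// pnatr_eq0.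
have nsN : normc (s / N%:R) = normc s / N%:R by rewrite normcM normcV normc_nat.
have h : normc (q (s / N%:R) - 1) <= S / N%:R ^+ 2.
  apply: le_trans (qD _ _) _; rewrite nsN.
    by rewrite ler_pdivrMr// -ler_pdivrMl// mulrC; lra.
  by rewrite expr_div_n mulrA.
rewrite sE q1; apply: le_trans (pow _ _) _.
have h2 : (1 + normc (q (s / N%:R) - 1)) ^+ N <= expR (S / N%:R).
  have -> : S / N%:R = N%:R * (S / N%:R ^+ 2) by field; rewrite pnatr_eq0.
  rewrite expRM_natl lerXn2r ?nnegrE ?expR_ge0 ?addr_ge0 ?normc_ge0//.
  by apply: le_trans (expR_ge1Dx _); rewrite lerD2l.
have SN0 : 0 <= S / N%:R by rewrite divr_ge0// ltW.
have SN : S / N%:R <= 1 / 2 by rewrite ler_pdivrMr//; lra.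
have SNe : 2 * (S / N%:R) <= e by rewrite mulrA ler_pdivrMr// -ler_pdivrMl// [leLHS]mulrC; lra.
have := @expR_sub_le (S / N%:R); rewrite (ger0_norm SN0) => /(_ SN); rewrite ler_norml => /andP[_ h3].
by move: h2 h3 SN SNe SN0; move: (S / N%:R) (expR _) => a b; nra.
Qed.

End ExpC.

Section NatSums.
Variable R : realType.
Local Notation C := R[i].

Lemma sbound_nat (m : nat -> R) B : (forall k, 0 <= m k) ->
  (forall n, \sum_(k < n) m k <= B) -> sbound m B.
Proof.
move=> m0 h A; pose n := (\max_(k <- A) k).+1.
apply: le_trans (h n); pose A' := [fset nat_of_ord k | k in 'I_n]%fset.
have AA : (A `<=` A')%fset.
  apply/fsubsetP => k kA; have lt : (k < n)%N by rewrite ltnS; exact: leq_bigmax_seq.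
  by have -> : k = nat_of_ord (Ordinal lt) by []; rewrite in_imfset.
apply: le_trans (sum_le_fset m0 AA) _.
by rewrite big_imfset /= => [|i j _ _ /val_inj//]; rewrite big_enum.
Qed.

Lemma sbound_geometric : sbound (fun k : nat => 2 ^- k : R) 2.
Proof.
apply: sbound_nat => [k|n]; first by rewrite invr_ge0 exprn_ge0.
have -> : \sum_(k < n) 2 ^- k = 2 - 2 / 2 ^+ n :> R.
  elim: n => [|n IH]; first by rewrite big_ord0 expr0 divr1 subrr.
  rewrite big_ord_recr /= IH exprS; field; by rewrite expf_neq0.
by rewrite gerBl divr_ge0// exprn_ge0.
Qed.

Lemma sboundZ (I : choiceType) (m : I -> R) B c : 0 <= c -> sbound m B -> sbound (fun i => c * m i) (c * B).
Proof. by move=> c0 h A; rewrite -mulr_sumr ler_wpM2l. Qed.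

Lemma has_sum_succ (u : nat -> C) l : has_sum (fun k => u k.+1) l -> has_sum u (u 0%N + l).
Proof.
move=> h; pose u0 k := if k is 0 then u 0%N else 0; pose u1 k := if k is k'.+1 then u k else 0.
have h0 : has_sum u0 (u 0%N) by apply: (@has_sum_1 _ _ u0 0%N) => -[].
have h1 : has_sum u1 l.
  by apply: (@has_sum_reindex _ _ _ (fun k => u k.+1) u1 S predn) h => // -[]//=; rewrite eqxx.
by apply: has_sum_ext (has_sumD h0 h1) => -[|k]; rewrite /= ?addr0 ?add0r.
Qed.

End NatSums.

(** * The binomial series *)

Section BinomialSeries.
Variable R : realType.
Local Notation C := R[i].

(* Coefficients of the solution f = sum_k bco k x^k, f(0) = 1, of (1 - ka x) f' = al f. *)
Definition bco (F : fieldType) (al ka : F) k := \prod_(j < k) ((al + ka * j%:R) / j.+1%:R).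

Lemma bco0 (F : fieldType) (al ka : F) : bco al ka 0 = 1.
Proof. by rewrite /bco big_ord0. Qed.

Lemma bcoS (F : fieldType) (al ka : F) k : bco al ka k.+1 = bco al ka k * ((al + ka * k%:R) / k.+1%:R).
Proof. by rewrite /bco big_ord_recr. Qed.

Lemma bco_scale (F : fieldType) (s u : F) k : bco (s * u) u k = bco s 1 k * u ^+ k.
Proof.
elim: k => [|k IH]; first by rewrite !bco0 mulr1.
by rewrite !bcoS IH exprSr mul1r; ring.
Qed.

Lemma bco_ge0 (a c : R) k : 0 <= a -> 0 <= c -> 0 <= bco a c k.
Proof. by move=> a0 c0; apply: prodr_ge0 => j _; rewrite divr_ge0// addr_ge0// mulr_ge0. Qed.

Lemma normc_bco_le (al ka : C) (a c : R) k : normc al <= a -> normc ka <= c ->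
  normc (bco al ka k) <= bco a c k.
Proof.
move=> ha hc; have a0 := le_trans (normc_ge0 _) ha; have c0 := le_trans (normc_ge0 _) hc.
elim: k => [|k IH]; first by rewrite !bco0 normc1.
rewrite !bcoS normcM ler_pM ?normc_ge0// normcM normcV normc_nat ler_wpM2r ?invr_ge0//.
by apply: le_trans (normcD _ _) _; rewrite lerD// normcM normc_nat ler_wpM2r.
Qed.

Lemma bin_le_exp2 n k : ('C(n, k) <= 2 ^ n)%N.
Proof.
elim: n k => [|n IH] [|k] //; first by rewrite bin0 expn_gt0.
by rewrite binS expnS mul2n -addnn leq_add.
Qed.

(** For the parameter (n + 1) / 4 the coefficient is the binomial of n + k over k divided by 4^k,
    and the binomial is at most 2^(n + k). *)
Lemma bco_le_geometric (a : R) n k : 0 <= a -> a <= n.+1%:R / 4 -> bco a (1 / 4) k <= 2 ^+ n / 2 ^+ k.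
Proof.
move=> a0 an; have q0 : 0 <= 1 / 4 :> R by [].
have {}an : bco a (1 / 4) k <= bco (n.+1%:R / 4) (1 / 4) k.
  elim: k => [|k IH]; first by rewrite !bco0.
  rewrite !bcoS ler_pM ?bco_ge0 ?divr_ge0 ?addr_ge0 ?mulr_ge0//.
  by rewrite ler_wpM2r ?invr_ge0// lerD2r.
apply: le_trans an _.
have -> : bco (n.+1%:R / 4) (1 / 4) k = 'C(n + k, k)%:R / 4 ^+ k :> R.
  elim: k => [|k IH]; first by rewrite bco0 bin0 expr0 divr1.
  rewrite bcoS IH; have := mul_bin_diag (n + k.+1) k; rewrite addnS /= => /(congr1 (fun m => m%:R : R)).
  rewrite !natrM => e; have k0 : k.+1%:R != 0 :> R by rewrite pnatr_eq0.
  apply: (mulfI k0); rewrite [RHS]mulrA -e exprS.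
  have -> : (n + k).+1%:R = n.+1%:R + k%:R :> R by rewrite -natrD addSn.
  have p0 : 4 ^+ k != 0 :> R by rewrite expf_neq0.
  move: k0 p0; move: (k.+1%:R) (4 ^+ k) => x y x0 y0; field; by apply/andP.
rewrite ler_pdivrMr ?exprn_gt0// mulrAC ler_pdivlMr ?exprn_gt0//.
apply: (@le_trans _ _ (2 ^+ (n + k) * 2 ^+ k)).
  by rewrite ler_wpM2r ?exprn_ge0// -natrX ler_nat bin_le_exp2.
have -> : 4 = 2 ^+ 2 :> R by rewrite -natrX.
by rewrite -!exprM -!exprD ler_weXn2l ?ler1n//; lia.
Qed.

Lemma nat_bound (a : R) : exists n : nat, a <= n.+1%:R / 4.
Proof.
exists (Num.truncn (4 * a)); rewrite ler_pdivlMr// mulrC ltW//; exact: truncnS_gt.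
Qed.

Lemma bco_sbound (a : R) : 0 <= a -> exists B, sbound (fun k => bco a (1 / 4) k) B.
Proof.
move=> a0; have [n an] := nat_bound a; exists (2 ^+ n * 2) => A.
by apply: sbound_le (sboundZ _ (@sbound_geometric R)) A => [k|]; rewrite ?exprn_ge0// bco_le_geometric.
Qed.

Lemma bco_summable (al ka : C) : normc ka <= 1 / 4 -> csummable (bco al ka).
Proof.
move=> hk; have [B hB] := bco_sbound (normc_ge0 al).
by apply: csummable_le hB => k; exact: normc_bco_le.
Qed.

(** The product of two solutions of (1 - ka x) f' = al f, with parameters al and be, solves the
    equation with al + be; the proof compares the recurrences for the coefficients. *)
Lemma conv_bco (al be ka : C) : conv (bco al ka) (bco be ka) = bco (al + be) ka.
Proof.
apply/funext; elim => [|k IH]; first by rewrite /conv big_ord1 !bco0 mulr1.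
have k0 n : n.+1%:R != 0 :> C by rewrite pnatr_eq0.
apply: (mulfI (k0 k)).
have rec (x : C) n : n.+1%:R * bco x ka n.+1 = (x + ka * n%:R) * bco x ka n.
  by rewrite bcoS; field.
rewrite rec -IH /conv.
have -> : k.+1%:R * \sum_(i < k.+2) bco al ka i * bco be ka (k.+1 - i) =
   \sum_(i < k.+2) (i%:R * bco al ka i) * bco be ka (k.+1 - i) +
   \sum_(i < k.+2) bco al ka i * ((k.+1 - i)%:R * bco be ka (k.+1 - i)).
  rewrite mulr_sumr -big_split; apply: eq_bigr => i _ /=.
  have -> : k.+1%:R = i%:R + (k.+1 - i)%:R :> C by rewrite -natrD subnKC// -ltnS.
  ring.
rewrite big_ord_recl /= !mul0r add0r [X in _ + X]big_ord_recr /= subnn mul0r mulr0 addr0.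
rewrite mulr_sumr -big_split; apply: eq_bigr => i _ /=.
have ik : (i <= k)%N by rewrite -ltnS.
rewrite /bump add1n subSS subSn// !rec.
have -> : k%:R = i%:R + (k - i)%:R :> C by rewrite -natrD subnKC.
ring.
Qed.

Variables (ka : C) (ka_le : normc ka <= 1 / 4).

Definition bsum (al : C) := tsum (bco al ka).

Lemma has_sum_bsum al : has_sum (bco al ka) (bsum al).
Proof. exact: has_tsum (bco_summable _ ka_le). Qed.

Lemma bsumD al be : bsum (al + be) = bsum al * bsum be.
Proof.
have [_ h] := has_sum_conv (bco_summable al ka_le) (bco_summable be ka_le) (has_sum_bsum al) (has_sum_bsum be).
by apply: tsumE; rewrite -conv_bco.
Qed.

(** The series of -log(1 - ka) / ka, with value 1 at ka = 0. *)
Definition blam := tsum (fun k => ka ^+ k / k.+1%:R).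

Lemma blam_bound k : normc (ka ^+ k / k.+1%:R) <= 2 ^- k.
Proof.
rewrite normcM normcV normcX normc_nat.
apply: (@le_trans _ _ ((1 / 2) ^+ k * 1)).
  rewrite ler_pM ?exprn_ge0 ?normc_ge0 ?invr_ge0//.
    rewrite lerXn2r ?nnegrE ?normc_ge0 ?divr_ge0//; apply: le_trans ka_le _; lra.
  by rewrite invf_le1 ?ler1n// ltr0n.
by rewrite mulr1 mul1r exprVn.
Qed.

Lemma has_sum_blam : has_sum (fun k => ka ^+ k / k.+1%:R) blam.
Proof. apply: has_tsum; exact: csummable_le blam_bound (@sbound_geometric R). Qed.

Lemma normc_blam : normc blam <= 2.
Proof.
apply: normc_has_sum has_sum_blam _; exact: sbound_le blam_bound (@sbound_geometric R).
Qed.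

(** The derivative at 0 of [bsum] in the parameter [al] is [blam]. Each coefficient of index k + 1
    is h / (k + 1) times [P k], and [P k] differs from ka^k by O(h). The majorant [Q k] telescopes
    to (k + 1) / 4^k. *)
Lemma bsum_near0 h : normc h <= 1 / 4 -> normc (bsum h - 1 - blam * h) <= 8 * normc h ^+ 2.
Proof.
move=> h4; pose P k := \prod_(j < k) (ka + h / j.+1%:R); pose Q k : R := \prod_(j < k) (1 / 4 + 1 / 4 / j.+1%:R).
have PQ k : normc (P k) <= Q k.
  elim: k => [|k IH]; first by rewrite /P /Q !big_ord0 normc1.
  rewrite /P /Q !big_ord_recr normcM ler_pM ?normc_ge0//.
  apply: le_trans (normcD _ _) _; rewrite lerD// normcM normcV normc_nat ler_wpM2r ?invr_ge0//.
have Q0 k : 0 <= Q k by apply: le_trans (PQ k); exact: normc_ge0.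
have PB k : normc (P k - ka ^+ k) <= 4 * normc h * Q k.
  elim: k => [|k IH].
    by rewrite /P big_ord0 expr0 subrr normc0 !mulr_ge0 ?normc_ge0.
  have -> : P k.+1 - ka ^+ k.+1 = (P k - ka ^+ k) * ka + P k * (h / k.+1%:R).
    by rewrite /P big_ord_recr exprSr /=; ring.
  apply: le_trans (normcD _ _) _; rewrite 3!normcM normcV normc_nat.
  have -> : Q k.+1 = Q k * (1 / 4 + 1 / 4 / k.+1%:R) by rewrite /Q big_ord_recr.
  have k0 : 0 <= k.+1%:R^-1 :> R by rewrite invr_ge0.
  have l1 := ler_pM (normc_ge0 _) (normc_ge0 ka) IH ka_le.
  have l2 : normc (P k) * (normc h / k.+1%:R) <= Q k * (normc h / k.+1%:R).
    by rewrite ler_wpM2r// mulr_ge0 ?normc_ge0.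
  apply: le_trans (lerD l1 l2) _; rewrite le_eqVlt; apply/orP; left; apply/eqP; field.
  by rewrite nat1r pnatr_eq0.
have QE k : Q k = k.+1%:R / 4 ^+ k.
  elim: k => [|k IH]; first by rewrite /Q big_ord0 expr0 divr1.
  rewrite /Q big_ord_recr -/(Q k) /= IH exprS; have k0 : k.+1%:R != 0 :> R by rewrite pnatr_eq0.
  have -> : k.+2%:R = k.+1%:R + 1 :> R by rewrite natr1.
  have p0 : 4 ^+ k != 0 :> R by rewrite expf_neq0.
  move: k0 p0; move: (k.+1%:R) (4 ^+ k) => x y x0 y0; field; by apply/andP.
have bE k : bco h ka k.+1 = h / k.+1%:R * P k.
  elim: k => [|k IH]; first by rewrite bcoS bco0 /P big_ord0; field.
  rewrite bcoS IH /P big_ord_recr /=.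
  have k0 : k.+1%:R != 0 :> C by rewrite pnatr_eq0.
  have k1 : k.+2%:R != 0 :> C by rewrite pnatr_eq0.
  move: (\prod_(_ < _) _) k0 k1; move: (k.+1%:R) (k.+2%:R) => x y p x0 y0; field; by apply/andP.
have s1 : has_sum (fun k => bco h ka k.+1) (bsum h - 1).
  pose e0 (k : nat) : C := if k is 0 then 1 else 0.
  have he0 : has_sum e0 1 by apply: (@has_sum_1 _ _ e0 0%N) => -[].
  have := has_sumB (has_sum_bsum h) he0.
  apply: (@has_sum_reindex _ _ _ _ _ predn S) => [[|k]|k] //=; rewrite ?subr0//.
  by rewrite bco0 subrr eqxx.
have := has_sumB s1 (has_sumZ h has_sum_blam); rewrite [h * blam]mulrC => s2.
have -> : 8 * normc h ^+ 2 = (4 * normc h ^+ 2) * 2 by ring.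
apply: normc_has_sum s2 _; apply: sbound_le (sboundZ _ (@sbound_geometric R)); last first.
  by rewrite mulr_ge0// exprn_ge0 ?normc_ge0.
move=> k; have -> : bco h ka k.+1 - h * (ka ^+ k / k.+1%:R) = h / k.+1%:R * (P k - ka ^+ k).
  by rewrite bE; ring.
rewrite 2!normcM normcV normc_nat.
have h0 : 0 <= normc h / k.+1%:R by rewrite mulr_ge0 ?normc_ge0 ?invr_ge0.
apply: le_trans (ler_wpM2l h0 (PB k)) _; rewrite QE.
have k0 : k.+1%:R != 0 :> R by rewrite pnatr_eq0.
have -> : normc h / k.+1%:R * (4 * normc h * (k.+1%:R / 4 ^+ k)) = 4 * normc h ^+ 2 * (4 ^+ k)^-1.
  have p0 : 4 ^+ k != 0 :> R by rewrite expf_neq0.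
  by move: k0 p0; move: (k.+1%:R) (4 ^+ k) (normc h) => x y z x0 y0; field; apply/andP.
rewrite ler_wpM2l ?mulr_ge0 ?exprn_ge0 ?normc_ge0//.
by rewrite lef_pV2 ?posrE ?exprn_gt0// lerXn2r ?nnegrE// ler_nat.
Qed.

(** Both sides are multiplicative in [al] and agree to first order at 0, so their quotient is
    multiplicative with quadratic error, hence 1. No complex logarithm is involved. *)
Lemma bsumE al : bsum al = expC (blam * al).
Proof.
pose q s := bsum s * expC (- (blam * s)).
have : q al = 1.
  (* The constant is 84 = 4 + 64 + 16, one summand for each term of the decomposition [alg]. *)
  apply: (@multiplicative_eq1 _ q (1 / 8) 84); first by [].
    move=> s t; have e : - (blam * (s + t)) = - (blam * s) + - (blam * t) by ring.
    rewrite /q (bsumD s t) e (expCD (- (blam * s)) (- (blam * t))); exact: mulrACA.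
  move=> h h8; have h4 : normc h <= 1 / 4 by lra.
  pose x := blam * h; pose r1 := bsum h - 1 - x; pose E := expC (- x); pose r2 := E - 1 + x.
  have alg (b y e : C) : b * e - 1 = - y ^+ 2 + (1 + y) * (e - 1 + y) + (b - 1 - y) * e by ring.
  have -> : q h - 1 = - x ^+ 2 + (1 + x) * r2 + r1 * E by exact: (alg (bsum h) x E).
  have h1 : normc r1 <= 8 * normc h ^+ 2 by exact: bsum_near0.
  have hx : normc x <= 2 * normc h by rewrite /x normcM ler_wpM2r ?normc_ge0 ?normc_blam.
  have h2 : normc r2 <= 8 * normc x ^+ 2.
    have -> : r2 = expC (- x) - 1 - (- x) by rewrite /r2 opprK.
    by rewrite -(normcN' x) expC_sub_le// normcN'; lra.
  have n0 := normc_ge0 x; have m0 := normc_ge0 h.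
  have hx2 : normc x ^+ 2 <= 4 * normc h ^+ 2.
    have -> : 4 * normc h ^+ 2 = (2 * normc h) ^+ 2 by ring.
    by rewrite lerXn2r ?nnegrE// mulr_ge0.
  have hE : normc E <= 2.
    have -> : E = 1 + (- x) + r2 by rewrite /r2; ring.
    apply: le_trans (normcD _ _) _; have := normcD 1 (- x); rewrite normc1 normcN'; nra.
  have t1 := normcD (- x ^+ 2 + (1 + x) * r2) (r1 * E); have t2 := normcD (- x ^+ 2) ((1 + x) * r2).
  have t3 : normc ((1 + x) * r2) <= 2 * (32 * normc h ^+ 2).
    rewrite normcM ler_pM ?normc_ge0//; last by lra.
    by apply: le_trans (normcD _ _) _; rewrite normc1; lra.
  have t4 : normc (r1 * E) <= 8 * normc h ^+ 2 * 2 by rewrite normcM ler_pM ?normc_ge0.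
  have t5 : normc (- x ^+ 2) <= 4 * normc h ^+ 2 by rewrite normcN' normcX.
  by move: t1 t2 t3 t4 t5; lra.
by rewrite /q expCN => /(canRL (mulfVK (expC_neq0 _))); rewrite mul1r.
Qed.

End BinomialSeries.

Lemma exp_series (R : realType) (z : R[i]) : has_sum (fun k => z ^+ k / k`!%:R) (expC z).
Proof.
have k0 : normc (0 : R[i]) <= 1 / 4 by rewrite normc0.
have -> : expC z = bsum 0 z.
  rewrite (bsumE k0); congr expC; have -> : blam 0 = 1 :> R[i]; last by rewrite mul1r.
  apply: tsumE; have := @has_sum_1 R _ (fun k : nat => (0 : R[i]) ^+ k / k.+1%:R) 0%N.
  by rewrite expr0 divr1; apply => -[|k] // _; rewrite expr0n mul0r.
apply: has_sum_ext (has_sum_bsum k0 z) => k.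
elim: k => [|k IH]; first by rewrite bco0 expr0 fact0 divr1.
rewrite bcoS IH mul0r addr0 exprSr factS natrM invfM; ring.
Qed.

(** The expansion of (1 - u)^(-s). It remains to identify [blam u] with -ln(1 - u) / u. *)
Lemma binomial_series (R : realType) (s : R[i]) (u : R) : `|u| <= 1 / 4 ->
  has_sum (fun k => bco s 1 k * u%:C%C ^+ k) (expC (- s * (ln (1 - u))%:C%C)).
Proof.
move=> u4; have k0 : normc u%:C%C <= 1 / 4 by rewrite normc_real.
have real_lam : exists l : R, blam u%:C%C = l%:C%C.
  exists (complex.Re (blam u%:C%C)).
  have h := has_sum_blam k0.
  suff : Num.conj (blam u%:C%C) = blam u%:C%C by case: (blam _) => a b [] /eqP; rewrite -subr_eq0 -opprD oppr_eq0 -mulr2n mulrn_eq0 /= => /eqP ->.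
  apply: has_sum_uniq (h).
  have E k : Num.conj (u%:C%C ^+ k / k.+1%:R) = u%:C%C ^+ k / k.+1%:R :> R[i].
    by rewrite rmorphM rmorphXn fmorphV rmorph_nat /= conj_Creal// complex_real.
  apply/has_sumP => e e0; have /has_sumP/(_ e e0)[A0 A0P] := h; exists A0 => A /A0P.
  rewrite -normc_conj rmorphB rmorph_sum /=; congr (normc (_ - _) < _).
  by apply: eq_bigr => k _.
have [l lE] := real_lam.
(* For al = -ka the series stops after two terms. As [blam] is real here, exp(-l u) = 1 - u
   identifies l u with -ln(1 - u). *)
have e1 : bsum u%:C%C (- u%:C%C) = 1 - u%:C%C.
  apply: tsumE; pose A := [fset 0%N; 1%N]%fset.
  have -> : 1 - u%:C%C = \sum_(k <- A) bco (- u%:C%C) u%:C%C k.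
    have n0 : 0%N \notin [fset 1%N]%fset by rewrite inE.
    by rewrite (big_fsetU1 _ _ n0) /= big_seq_fset1 bcoS bco0; field.
  apply: has_sum_fset => k; rewrite !inE negb_or; case: k => [|[|k]]//= _.
  by rewrite /bco (bigD1 (Ordinal (isT : (1 < k.+2)%N)))//= mulr1 addNr !mul0r.
have lnE : ln (1 - u) = - (l * u).
  have : (expR (- (l * u)))%:C%C = (1 - u)%:C%C.
    rewrite rmorphB /= -e1 (bsumE k0) lE -expC_real; congr expC.
    by rewrite rmorphN rmorphM /= mulrN.
  by move=> /complexI <-; rewrite expRK.
have -> : expC (- s * (ln (1 - u))%:C%C) = bsum u%:C%C (s * u%:C%C).
  by rewrite (bsumE k0) lE lnE rmorphN rmorphM /= mulrNN; congr expC; ring.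
by apply: has_sum_ext (has_sum_bsum k0 _) => k; rewrite bco_scale.
Qed.

(** * Power series on a disc *)

Section ComplexDerivative.
Variable K : numFieldType.
Implicit Types (f g : K -> K) (z w : K).

Definition cderivable f z := derivable f z 1.

Lemma cderivableM f g z : cderivable f z -> cderivable g z -> cderivable (fun s => f s * g s) z.
Proof. by move=> hf hg; exact: derivableM. Qed.

Lemma cderivableD f g z : cderivable f z -> cderivable g z -> cderivable (fun s => f s + g s) z.
Proof. by move=> hf hg; exact: derivableD. Qed.

Lemma cderivableV f z : f z != 0 -> cderivable f z -> cderivable (fun s => (f s)^-1) z.
Proof. by move=> h0 hf; exact: derivableV. Qed.

Lemma cderivable_cst c z : cderivable (fun=> c) z.
Proof. exact: derivable_cst. Qed.

Lemma cderivable_id z : cderivable id z.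
Proof. exact: derivable_id. Qed.

Lemma cderivable_continuous f z : cderivable f z -> {for z, continuous f}.
Proof. by move=> h; apply: differentiable_continuous; exact/derivable1_diffP. Qed.

Lemma cderivable_comp f g z : cderivable g z -> cderivable f (g z) -> cderivable (f \o g) z.
Proof.
move=> /derivable1_diffP hg /derivable1_diffP hf; apply/derivable1_diffP.
exact: differentiable_comp.
Qed.

Lemma cderivable_quad f z D (B d : K) : 0 < d -> 0 < B ->
  (forall h, `|h| < d -> `|f (z + h) - f z - h * D| <= B * `|h| ^+ 2) -> cderivable f z.
Proof.
move=> d0 B0 fh; apply/cvg_ex; exists D; apply/cvgrPdist_lt => e e0; near=> h.
have h0 : h != 0 by near: h; exact: nbhs_dnbhs_neq.
have h00 : 0 < `|h| by rewrite normr_gt0.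
have hd : `|h| < d by near: h; apply: dnbhs0_lt.
have he : `|h| < e / B by near: h; apply: dnbhs0_lt; rewrite divr_gt0.
rewrite /= /GRing.scale /= mulr1.
have -> : D - h^-1 * (f (h + z) - f z) = - (h^-1 * (f (z + h) - f z - h * D)).
  by rewrite [h + z]addrC; field.
rewrite normrN normrM normfV ltr_pdivrMl//; apply: le_lt_trans (fh _ hd) _.
by rewrite expr2 mulrCA ltr_pM2l// mulrC -ltr_pdivlMr.
Unshelve. all: by end_near. Qed.

Lemma near_dist z (P : K -> Prop) : (\forall w \near z, P w) <->
  exists2 d : K, 0 < d & forall w, `|w - z| < d -> P w.
Proof.
split=> [/nbhs_ballP[d d0 h]|[d d0 h]].
  by exists d => // w wd; apply: h; rewrite /ball /= distrC.
by apply/nbhs_ballP; exists d => //= w; rewrite /ball /= distrC; exact: h.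
Qed.

End ComplexDerivative.

Lemma prim_root_exists (C : numClosedFieldType) n : (n > 0)%N -> exists z : C, n.-primitive_root z.
Proof.
move=> n_gt0; pose p : {poly C} := 'X^n - 1; have [r Dp] := closed_field_poly_normal p.
rewrite (monicP _) ?monicXnsubC // scale1r in Dp.
have rn1: all n.-unity_root r by apply/allP=> z; rewrite -root_prod_XsubC -Dp.
have sz_r: (n < (size r).+1)%N by rewrite -(size_prod_XsubC r id) -Dp size_XnsubC.
have [|z] := hasP (has_prim_root n_gt0 rn1 _ sz_r); last by exists z.
by rewrite -separable_prod_XsubC -Dp separable_Xn_sub_1 // pnatr_eq0 -lt0n.
Qed.

Section DiscSeries.
Variable R : realType.
Local Notation C := R[i].
Implicit Types (r : R) (f g : C -> C).

(** Analyticity is carried as an explicit power series, so that uniform limits can be treated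
    coefficient by coefficient. *)
Definition series_on r (a : nat -> C) f := forall s, normc s < r ->
  csummable (fun k => a k * s ^+ k) /\ has_sum (fun k => a k * s ^+ k) (f s).

Definition disc_series r f := exists a, series_on r a f.

Lemma disc_series_ext r f g : (forall s, normc s < r -> f s = g s) ->
  disc_series r f -> disc_series r g.
Proof. by move=> fg [a h]; exists a => s sr; rewrite -fg//; exact: h. Qed.

Lemma disc_series_cst r c : disc_series r (fun=> c).
Proof.
exists (fun k => if k is 0 then c else 0) => s sr; split.
  exists (normc c) => A; have [A0|A0] := boolP (0%N \in A).
    rewrite (big_fsetD1 0%N A0) /= mulr1 big_seq big1 ?addr0// => -[|k]; rewrite !inE//= mul0r.
    by rewrite normc0.
  rewrite big_seq big1 ?normc_ge0// => -[|k]; first by rewrite (negbTE A0).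
  by rewrite mul0r normc0.
have := @has_sum_1 R _ (fun k : nat => (if k is 0 then c else 0) * s ^+ k) 0%N.
by rewrite mulr1; apply => -[|k] // _; rewrite mul0r.
Qed.

Lemma disc_seriesD r f g : disc_series r f -> disc_series r g -> disc_series r (fun s => f s + g s).
Proof.
move=> [a ha] [b hb]; exists (fun k => a k + b k) => s sr.
have [as_ af] := ha s sr; have [bs bf] := hb s sr.
have E : (fun k => (a k + b k) * s ^+ k) = (fun k => a k * s ^+ k + b k * s ^+ k).
  by apply/funext => k; rewrite mulrDl.
by rewrite E; split; [exact: csummableD|exact: has_sumD].
Qed.

Lemma disc_seriesM r f g : disc_series r f -> disc_series r g -> disc_series r (fun s => f s * g s).
Proof.
move=> [a ha] [b hb]; exists (conv a b) => s sr.
have [as_ af] := ha s sr; have [bs bf] := hb s sr.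
have E : (fun k => conv a b k * s ^+ k) = conv (fun k => a k * s ^+ k) (fun k => b k * s ^+ k).
  apply/funext => k; rewrite /conv mulr_suml; apply: eq_bigr => i _.
  have -> : s ^+ k = s ^+ i * s ^+ (k - i) by rewrite -exprD subnKC// -ltnS.
  by rewrite mulrACA.
by rewrite E; exact: has_sum_conv.
Qed.

Lemma disc_series_id r : disc_series r id.
Proof.
exists (fun k => (k == 1%N)%:R) => s sr.
have E k : k != 1%N -> (k == 1%N)%:R * s ^+ k = 0 by move=> /negbTE ->; rewrite mul0r.
split.
  exists (normc s) => A; have [A1|A1] := boolP (1%N \in A).
    rewrite (big_fsetD1 1%N A1) /= mul1r big_seq big1 ?addr0// => k; rewrite !inE => /andP[k1 _].
    by rewrite E ?normc0.
  rewrite big_seq big1 ?normc_ge0// => k kA; rewrite E ?normc0//.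
  by apply: contraNneq A1 => <-.
have := @has_sum_1 R _ (fun k : nat => (k == 1%N)%:R * s ^+ k) 1%N; rewrite mul1r expr1; apply.
exact: E.
Qed.

Lemma series_on_exp r c : series_on r (fun k => c ^+ k / k`!%:R) (fun s => expC (c * s)).
Proof.
move=> s sr.
have E : (fun k => c ^+ k / k`!%:R * s ^+ k) = (fun k => (c * s) ^+ k / k`!%:R).
  by apply/funext => k; rewrite exprMn mulrAC.
rewrite E; split; last exact: exp_series.
have k0 : normc (0 : C) <= 1 / 4 by rewrite normc0.
have [B hB] := bco_summable (c * s) k0; exists B; apply: sbound_le hB => k.
have -> : (c * s) ^+ k / k`!%:R = bco (c * s) 0 k; last by [].
elim: k => [|k IH]; first by rewrite bco0 expr0 fact0 divr1.
by rewrite bcoS -IH mul0r addr0 exprSr factS natrM invfM; ring.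
Qed.

Lemma disc_series_exp r c : disc_series r (fun s => expC (c * s)).
Proof. by eexists; exact: series_on_exp. Qed.

Lemma disc_series_sum r (I : Type) (l : seq I) (f : I -> C -> C) :
  (forall i, disc_series r (f i)) -> disc_series r (fun s => \sum_(i <- l) f i s).
Proof.
move=> h; elim: l => [|i l IH].
  by apply: disc_series_ext (disc_series_cst r 0) => s _; rewrite big_nil.
by apply: disc_series_ext (disc_seriesD (h i) IH) => s _; rewrite big_cons.
Qed.

Lemma disc_series_prod r (I : Type) (l : seq I) (f : I -> C -> C) :
  (forall i, disc_series r (f i)) -> disc_series r (fun s => \prod_(i <- l) f i s).
Proof.
move=> h; elim: l => [|i l IH].
  by apply: disc_series_ext (disc_series_cst r 1) => s _; rewrite big_nil.
by apply: disc_series_ext (disc_seriesM (h i) IH) => s _; rewrite big_cons.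
Qed.

Lemma normc_root_unity n (z : C) : (0 < n)%N -> z ^+ n = 1 -> normc z = 1.
Proof.
move=> n0 zn; apply/eqP; rewrite -(@pexpr_eq1 _ _ n)// ?normc_ge0//.
by rewrite -normcX zn normc1.
Qed.

(* Averaging s^-k f(s) over the N-th roots of unity isolates a_k up to the coefficients a_m, m >= N. *)
Lemma cauchy_coef r (a : nat -> C) f (rho M : R) k : series_on r a f -> 0 <= rho -> rho < r ->
  (forall s, normc s < r -> normc (f s) <= M) -> normc (a k) * rho ^+ k <= M.
Proof.
move=> ha rho0 rhor fM; apply/ler_addgt0Pr => e e0.
have nrho : normc rho%:C%C = rho by rewrite normc_real ger0_norm.
have [|as_ _] := ha rho%:C%C; first by rewrite nrho.
have [B0 B0P] := csummable_tail as_ e0.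
(* [N] exceeds [k] and every index in [B0], so the coefficients that averaging fails to remove have
   a small sum. *)
pose N := (maxn k (\max_(m <- B0) m)).+1.
have kN : (k < N)%N by rewrite ltnS leq_maxl.
have BN m : (N <= m)%N -> m \notin B0.
  apply: contraTN => mB; rewrite -ltnNge ltnS leq_max; apply/orP; right.
  exact: leq_bigmax_seq.
have [z zP] := prim_root_exists C (ltn0Sn N.-1 : (0 < N)%N).
have zN := prim_expr_order zP; have nz := normc_root_unity (ltn0Sn _) zN.
have z0 : z != 0 by rewrite -normc_eq0 nz oner_eq0.
pose w m := N%:R^-1 * \sum_(j < N) z ^+ (j * m) * z ^- (j * k).
have N0 : N%:R != 0 :> C by rewrite pnatr_eq0.
have w1 : w k = 1.
  rewrite /w (eq_bigr (fun=> 1)) => [|j _]; last by rewrite divff// expf_neq0.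
  by rewrite sumr_const card_ord -mulr_natr mul1r mulVf.
have w0 m : (m < N)%N -> m != k -> w m = 0.
  move=> mN mk; rewrite /w; pose x := z ^+ m / z ^+ k.
  have xE j : z ^+ (j * m) * z ^- (j * k) = x ^+ j.
    by rewrite expr_div_n -!exprM ![(_ * j)%N]mulnC.
  have x1 : x != 1.
    apply: contraNneq mk => /(congr1 (fun y => y * z ^+ k)); rewrite /x divfK ?expf_neq0// mul1r.
    by move/eqP; rewrite (eq_prim_root_expr zP) !modn_small.
  have : (x - 1) * \sum_(j < N) x ^+ j = 0.
    rewrite -subrX1 expr_div_n -!exprM ![(_ * N)%N]mulnC !exprM zN !expr1n divr1 subrr//.
  move/eqP; rewrite mulf_eq0 subr_eq0 (negbTE x1) /= => /eqP xs.
  by rewrite (eq_bigr (fun j : 'I_N => x ^+ j)) ?xs ?mulr0.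
have wle m : normc (w m) <= 1.
  rewrite /w normcM normcV normc_nat ler_pdivrMl ?ltr0n// mulr1.
  apply: le_trans (normc_sum _ _ _) _; rewrite (eq_bigr (fun=> 1)) ?sumr_const ?card_ord//.
  by move=> j _; rewrite normcM normcV !normcX nz !expr1n invr1 mulr1.
pose S := N%:R^-1 * \sum_(j < N) z ^- (j * k) * f (rho%:C%C * z ^+ j).
have hS : has_sum (fun m => w m * (a m * rho%:C%C ^+ m)) S.
  have hj (j : 'I_N) : has_sum (fun m => z ^- (j * k) * (a m * (rho%:C%C * z ^+ j) ^+ m))
      (z ^- (j * k) * f (rho%:C%C * z ^+ j)).
    apply: has_sumZ; have [|//] := ha (rho%:C%C * z ^+ j).
    by rewrite normcM nrho normcX nz expr1n mulr1.
  have := has_sumZ N%:R^-1 (has_sum_big (index_enum 'I_N) hj).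
  apply: has_sum_ext => m; rewrite /w -mulrA mulr_suml; congr (_ * _); apply: eq_bigr => j _.
  by rewrite exprMn -exprM; ring.
have SM : normc S <= M.
  rewrite /S normcM normcV normc_nat ler_pdivrMl ?ltr0n//.
  apply: le_trans (normc_sum _ _ _) _; apply: (@le_trans _ _ (\sum_(j < N) M)).
    apply: ler_sum => j _; rewrite normcM normcV normcX nz expr1n invr1 mul1r fM//.
    by rewrite normcM nrho normcX nz expr1n mulr1.
  by rewrite sumr_const card_ord mulr_natl.
have hk : has_sum (fun m => if m == k then a k * rho%:C%C ^+ k else 0) (a k * rho%:C%C ^+ k).
  have := @has_sum_1 R _ (fun m : nat => if m == k then a k * rho%:C%C ^+ k else 0) k.
  by rewrite eqxx; apply => m /negbTE ->.
have h := has_sumB hS hk.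
have le : normc (S - a k * rho%:C%C ^+ k) <= e.
  apply: normc_has_sum h _ => A; pose A' := [fset m in A | (N <= m)%N]%fset.
  rewrite -(@big_fset_incl _ _ _ _ A'); last 2 first.
  - by apply/fsubsetP => m; rewrite !inE => /andP[].
  - move=> m mA; rewrite !inE mA /= -ltnNge => mN; have [->|mk] := eqVneq m k.
      by rewrite w1 mul1r subrr normc0.
    by rewrite w0// mul0r subrr normc0.
  apply: le_trans (ltW (B0P A' _)); last by move=> m; rewrite !inE => /andP[_]; exact: BN.
  rewrite big_seq [leRHS]big_seq; apply: ler_sum => m; rewrite !inE => /andP[_ mN].
  rewrite (gtn_eqF (leq_trans kN mN)) subr0 normcM ler_piMl ?normc_ge0//.
have -> : normc (a k) * rho ^+ k = normc (a k * rho%:C%C ^+ k) by rewrite normcM normcX nrho.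
have := normcD S (a k * rho%:C%C ^+ k - S); rewrite addrCA subrr addr0.
by rewrite -(normcN' (_ - S)) opprB; lra.
Qed.

Lemma sbound_powers (q : R) : 0 <= q -> q < 1 -> sbound (fun k : nat => q ^+ k) (1 - q)^-1.
Proof.
move=> q0 q1; have p0 : 0 < 1 - q by rewrite subr_gt0.
apply: sbound_nat => [k|n]; first exact: exprn_ge0.
rewrite -[_^-1]mul1r ler_pdivlMr// mulrC -opprB mulNr -subrX1 opprB.
by rewrite gerBl exprn_ge0.
Qed.

(** Cauchy's estimate on a circle of radius [rho] between |s| and r bounds the k-th coefficient of
    [f i] by M_i / rho^k. The double series is then absolutely summable and may be summed in the
    other order. *)
Lemma weierstrass (I : choiceType) (f : I -> C -> C) (M : I -> R) B r :
  (forall i, disc_series r (f i)) -> (forall i s, normc s < r -> normc (f i s) <= M i) ->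
  sbound M B -> disc_series r (fun s => tsum (fun i => f i s)).
Proof.
move=> /choice[a ha] fM MB.
have M0 i s : normc s < r -> 0 <= M i by move=> /(fM i); apply: le_trans; exact: normc_ge0.
exists (fun k => tsum (fun i => a i k)) => s sr.
pose rho := (normc s + r) / 2; have n0 := normc_ge0 s.
have rho0 : 0 < rho by rewrite /rho; lra.
have rhor : rho < r by rewrite /rho; lra.
have aM i k : normc (a i k) <= M i / rho ^+ k.
  rewrite ler_pdivlMr ?exprn_gt0//; exact: cauchy_coef (ha i) (ltW rho0) rhor (fM i).
have q1 : normc s / rho < 1 by rewrite ltr_pdivrMr// mul1r /rho; lra.
have q0 : 0 <= normc s / rho by rewrite divr_ge0// ltW.
pose F (x : I * nat) := a x.1 x.2 * s ^+ x.2.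
have Fs : csummable F.
  apply: csummable_le (sbound_prod (fun i => M0 i s sr) (fun k => exprn_ge0 k q0) MB (sbound_powers q0 q1)) => -[i k].
  have -> : M (i, k).1 * (normc s / rho) ^+ (i, k).2 = M i / rho ^+ k * normc s ^+ k.
    by rewrite expr_div_n mulrCA mulrC.
  by rewrite /F /= normcM normcX ler_wpM2r ?exprn_ge0.
have as_ k : csummable (fun i => a i k).
  apply: (csummable_le (m := fun i => rho ^- k * M i)) (sboundZ _ MB); last first.
    by rewrite invr_ge0 exprn_ge0// ltW.
  by move=> i; rewrite mulrC; exact: aM.
have hrow := has_sum_iterated Fs (fun i => (ha i s sr).2).
have hcol k : has_sum (fun i => F (i, k)) (tsum (fun i => a i k) * s ^+ k).
  rewrite mulrC; apply: has_sum_ext (has_sumZ (s ^+ k) (has_tsum (as_ k))) => i.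
  by rewrite mulrC.
have Fs' := csummable_swap Fs.
have tF : tsum (fun x : nat * I => F (x.2, x.1)) = tsum F.
  by apply: tsumE; exact: has_sum_swap (has_tsum Fs).
split; last by rewrite (tsumE hrow) -tF; exact: has_sum_iterated Fs' hcol.
have := csummable_fibers fst Fs'; congr csummable; apply/funext => k.
by apply: tsumE; apply: tsum_row; exact: hcol.
Qed.

(** Only the terms of order at least 2 in [h] remain, and |h|^i <= (|h| / d)^2 d^i for those. *)
Lemma binomial_quad (s h : C) (d : R) k : 0 < d -> normc h <= d ->
  normc ((s + h) ^+ k - s ^+ k - h * (s ^+ k.-1 *+ k)) <= (normc h / d) ^+ 2 * (normc s + d) ^+ k.
Proof.
move=> d0 hd; have d1 : d != 0 by rewrite gt_eqF.
have hd1 : normc h / d <= 1 by rewrite ler_pdivrMr// mul1r.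
have hd0 : 0 <= normc h / d by rewrite divr_ge0 ?normc_ge0// ltW.
have -> : (s + h) ^+ k - s ^+ k - h * (s ^+ k.-1 *+ k) =
   \sum_(i < k.+1 | (1 < i)%N) (s ^+ (k - i) * h ^+ i) *+ 'C(k, i).
  case: k => [|k].
    by rewrite big_mkcond big_ord1 /= mulr0n mulr0 subr0 subrr.
  rewrite exprDn [RHS]big_mkcond /= !big_ord_recl /= subn0 bin0 bin1 subn1 /= mulr1 mulr1n.
  rewrite !add0r expr1 mulrnAr [h * _]mulrC.
  have alg x y z : x + (y + z) - x - y = z :> C by ring.
  by rewrite alg.
rewrite exprDn mulr_sumr; apply: le_trans (normc_sum _ _ _) _; rewrite big_mkcond.
apply: ler_sum => i _; case: ifP => i1; last first.
  by rewrite mulr_ge0 ?exprn_ge0// mulrn_wge0// mulr_ge0 ?exprn_ge0 ?normc_ge0// ltW.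
rewrite -mulr_natr normcM normc_nat normcM !normcX -[X in _ <= _ * X]mulr_natr [leRHS]mulrA ler_wpM2r//.
have -> : normc h ^+ i = (normc h / d) ^+ i * d ^+ i by rewrite expr_div_n divfK// expf_neq0.
rewrite [leRHS]mulrCA ler_wpM2l ?exprn_ge0 ?normc_ge0// ler_wpM2r ?exprn_ge0 ?(ltW d0)//.
by rewrite ler_wiXn2l.
Qed.

Lemma disc_series_derivable r f s : disc_series r f -> normc s < r -> cderivable f s.
Proof.
move=> [a ha] sr; pose d := (r - normc s) / 2; have n0 := normc_ge0 s.
have d0 : 0 < d by rewrite /d; lra.
have sd : normc s + d < r by rewrite /d; lra.
have nsd : normc (normc s + d)%:C%C = normc s + d by rewrite normc_real ger0_norm// addr_ge0// ltW.
have [|[B hB] _] := ha (normc s + d)%:C%C; first by rewrite nsd.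
have B0 := sbound_ge0 hB.
have {}hB : sbound (fun k => normc (a k) * (normc s + d) ^+ k) B.
  by apply: sbound_le hB => k; rewrite normcM normcX nsd.
have Ds : csummable (fun k => a k * (s ^+ k.-1 *+ k)).
  apply: (csummable_le (m := fun k => d^-1 * (normc (a k) * (normc s + d) ^+ k))) (sboundZ _ hB); last first.
    by rewrite invr_ge0 ltW.
  case=> [|k].
    by rewrite mulr0n mulr0 normc0 mulr_ge0 ?invr_ge0 ?(ltW d0)// mulr_ge0 ?normc_ge0// exprn_ge0// addr_ge0// ltW.
  rewrite /= normcM mulrCA ler_wpM2l ?normc_ge0// ler_pdivlMl// -mulr_natr normcM normcX normc_nat.
  rewrite exprDn (bigD1 (Ordinal (isT : (1 < k.+2)%N)))//= bin1 subn1 /= expr1.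
  rewrite mulrC -mulrnAl mulr_natr lerDl sumr_ge0// => i _.
  by rewrite mulrn_wge0// mulr_ge0 ?exprn_ge0// ltW.
pose B1 := B / d ^+ 2 + 1.
have B10 : 0 < B1 by rewrite ltr_wpDl// divr_ge0// exprn_ge0// ltW.
apply: (@cderivable_quad _ f s (tsum (fun k => a k * (s ^+ k.-1 *+ k))) B1%:C%C d%:C%C).
- by rewrite ltcR.
- by rewrite ltcR.
move=> h; rewrite !normcE' ltcR => hd; rewrite -rmorphXn -rmorphM lecR.
have shr : normc (s + h) < r by apply: le_lt_trans (normcD _ _) _; lra.
have := has_sumB (has_sumB (ha _ shr).2 (ha _ sr).2) (has_sumZ h (has_tsum Ds)).
move=> hs; apply: le_trans (normc_has_sum hs (B := (normc h / d) ^+ 2 * B) _) _.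
  apply: sbound_le (sboundZ _ hB); last by rewrite exprn_ge0// divr_ge0 ?normc_ge0// ltW.
  move=> k; rewrite mulrCA -!mulrBr normcM [leRHS]mulrCA ler_wpM2l ?normc_ge0//.
  exact: binomial_quad d0 (ltW hd).
have -> : (normc h / d) ^+ 2 * B = B / d ^+ 2 * normc h ^+ 2 by rewrite expr_div_n; ring.
by rewrite /B1 mulrDl mul1r lerDl exprn_ge0 ?normc_ge0.
Qed.

End DiscSeries.

(** * Differences of functions on the integers *)

Section Differences.
Variable R : realType.
Local Notation C := R[i].
Implicit Types (f g : int -> C) (x v : int).

Lemma normc_int v : normc (v%:~R : C) = `|v|%N%:R.
Proof. by rewrite -(rmorph_int (real_complex R)) normc_real natr_absz intr_norm. Qed.

Definition dlt f x := f (x + 1) - f x *+ 2 + f (x - 1).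

Lemma iter_dlt_lin (c : C) f g l x :
  iter l dlt (fun y => c * f y + g y) x = c * iter l dlt f x + iter l dlt g x.
Proof.
elim: l x => [//|l IH] x /=; rewrite /dlt !IH; ring.
Qed.

Lemma iter_dltS l f x : iter l.+1 dlt f x =
  iter l dlt f (x + 1) - iter l dlt f x *+ 2 + iter l dlt f (x - 1).
Proof. by []. Qed.

Lemma iter_dlt_le l f x (M : R) : (forall v, (`|v| <= l)%N -> normc (f (x + v)) <= M) ->
  normc (iter l dlt f x) <= 4 ^+ l * M.
Proof.
elim: l x => [|l IH] x h; first by have := h 0; rewrite addr0 expr0 mul1r; exact.
have hs y : (`|y| <= 1)%N -> normc (iter l dlt f (x + y)) <= 4 ^+ l * M.
  by move=> y1; apply: IH => v vl; rewrite -addrA; apply: h; lia.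
rewrite iter_dltS; have h1 := hs 1 isT; have h2 := hs (-1) isT; have h3 := hs 0 isT.
rewrite addr0 in h3; apply: le_trans (normcD _ _) _; have := normcD (iter l dlt f (x + 1)) (- (iter l dlt f x *+ 2)).
rewrite normcN' mulr2n; have := normcD (iter l dlt f x) (iter l dlt f x).
by rewrite exprS -mulrA; move: h1 h2 h3; lra.
Qed.

Lemma iter_dlt_local l f g x : (forall v, (`|v| <= l)%N -> f (x + v) = g (x + v)) ->
  iter l dlt f x = iter l dlt g x.
Proof.
move=> h; apply/eqP; rewrite -subr_eq0 -normc_eq0 eq_le normc_ge0 andbT.
have := @iter_dlt_le l (fun y => -1 * g y + f y) x 0; rewrite mulr0 iter_dlt_lin mulN1r addrC; apply.
by move=> v vl; rewrite h// mulN1r addNr normc0.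
Qed.

Lemma iter_dlt_shift l f x v : iter l dlt (fun y => f (x + y)) v = iter l dlt f (x + v).
Proof. by elim: l v => [//|l IH] v /=; rewrite /dlt !IH !addrA. Qed.

Lemma iter_dlt_reflect l f n x : iter l dlt (fun y => f (n - y)) x = iter l dlt f (n - x).
Proof.
elim: l x => [//|l IH] x /=; rewrite /dlt !IH.
have -> : n - (x + 1) = n - x - 1 by ring.
have -> : n - (x - 1) = n - x + 1 by ring.
ring.
Qed.

Lemma iter_dltD l f g x : iter l dlt (fun y => f y + g y) x = iter l dlt f x + iter l dlt g x.
Proof.
rewrite -[iter l dlt f x]mul1r -iter_dlt_lin; apply: iter_dlt_local => v _; by rewrite mul1r.
Qed.

Lemma iter_dltZ l c f x : iter l dlt (fun y => c * f y) x = c * iter l dlt f x.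
Proof.
have z0 : iter l dlt (fun=> 0 : C) x = 0.
  by elim: l x => [//|l IH] x /=; rewrite /dlt !IH mul0rn subrr addr0.
rewrite -[RHS]addr0 -z0 -iter_dlt_lin; apply: iter_dlt_local => v _; by rewrite addr0.
Qed.

Lemma iter_dltB l f g x : iter l dlt (fun y => f y - g y) x = iter l dlt f x - iter l dlt g x.
Proof. by rewrite iter_dltD -[in RHS]mulN1r -iter_dltZ; congr (_ + _); apply: iter_dlt_local => v _; rewrite mulN1r. Qed.

Lemma iter_dlt_sum l (I : Type) (r : seq I) (f : I -> int -> C) x :
  iter l dlt (fun y => \sum_(i <- r) f i y) x = \sum_(i <- r) iter l dlt (f i) x.
Proof.
elim: r => [|i r IH].
  rewrite big_nil -[RHS](mul0r (iter l dlt (fun=> 0) x)) -iter_dltZ.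
  by apply: iter_dlt_local => v _; rewrite big_nil mul0r.
rewrite big_cons -IH -iter_dltD; apply: iter_dlt_local => v _; by rewrite big_cons.
Qed.

Definition polyint m f := exists2 p : {poly C}, (size p <= m)%N & forall x, f x = p.[x%:~R].

Lemma polyint_diff m f : polyint m f -> polyint m.-1 (fun x => f (x + 1) - f x).
Proof.
move=> [p pm fp]; have sX : size ('X + 1%:P : {poly C}) = 2 by rewrite size_XaddC.
exists (p \Po ('X + 1%:P) - p); last first.
  by move=> x; rewrite !fp hornerD hornerN horner_comp hornerD hornerX hornerC rmorphD.
case: m pm => [|m] pm.
  by rewrite leqn0 size_poly_eq0 in pm; rewrite (eqP pm) comp_poly0 subrr size_poly0.
apply/leq_sizeP => j /= mj; rewrite coefB.
have sc := size_comp_poly2 p sX.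
have [pj|pj] := leqP (size p) j; first by rewrite !nth_default ?subrr// sc.
have jE : j = (size p).-1 by lia.
have := @lead_coef_comp _ p ('X + 1%:P); rewrite sX => /(_ isT).
by rewrite lead_coefXaddC expr1n mulr1 !lead_coefE sc -jE => ->; rewrite subrr.
Qed.

Lemma polyint_shift m f c : polyint m f -> polyint m (fun x => f (x + c)).
Proof.
move=> [p pm fp]; exists (p \Po ('X + (c%:~R)%:P)).
  by rewrite size_comp_poly2 ?size_XaddC.
by move=> x; rewrite fp horner_comp hornerD hornerX hornerC rmorphD.
Qed.

Lemma polyint_ext m f g : (forall x, f x = g x) -> polyint m f -> polyint m g.
Proof. by move=> fg [p pm fp]; exists p => // x; rewrite -fg. Qed.

Lemma polyint_dlt m f : polyint m f -> polyint m.-2 (dlt f).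
Proof.
move=> /polyint_diff/polyint_diff/(@polyint_shift _ _ (-1)); apply: polyint_ext => x.
by rewrite /dlt subrK; ring.
Qed.

Lemma polyint_iter l f x : polyint l.*2 f -> iter l dlt f x = 0.
Proof.
elim: l f x => [|l IH] f x h; last by rewrite iterSr; apply: IH; exact: polyint_dlt h.
case: h => p; rewrite leqn0 size_poly_eq0 => /eqP -> /(_ x) /= ->; exact: horner0.
Qed.

Lemma polyint_monomial k l : (k < l)%N -> polyint l (fun x => x%:~R ^+ k).
Proof. by move=> kl; exists 'X^k; rewrite ?size_polyXn// => x; rewrite hornerXn. Qed.

(* The differences of order 2l of such a g at 0 are of size (l / rho)^(2l) M. *)
Definition nice (rho M : R) (g : int -> C) := exists (I : choiceType) (a : I -> C) (k : I -> nat),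
  sbound (fun i => normc (a i) * rho ^+ k i) M /\
  forall v : int, (`|v|%N%:R <= rho) -> has_sum (fun i => a i * v%:~R ^+ k i) (g v).

(** The differences annihilate the monomials of degree below 2l; on the others l^k = (l / rho)^k
    rho^k with k >= 2l. *)
Lemma nice_dlt rho M g l : (0 < l)%N -> l%:R <= rho -> nice rho M g ->
  normc (iter l dlt g 0) <= 4 ^+ l * (l%:R / rho) ^+ l.*2 * M.
Proof.
move=> l0 lr [I [a [k [aM ag]]]].
have rho0 : 0 < rho by apply: lt_le_trans lr; rewrite ltr0n.
have q0 : 0 <= l%:R / rho by rewrite divr_ge0// ltW.
have q1 : l%:R / rho <= 1 by rewrite ler_pdivrMr// mul1r.
pose u i (v : int) := a i * v%:~R ^+ k i.
have hs m x : (m + `|x| <= l)%N -> has_sum (fun i => iter m dlt (u i) x) (iter m dlt g x).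
  elim: m x => [|m IH] x mx.
    by apply: ag; apply: le_trans lr; rewrite ler_nat.
  have h1 := IH (x + 1) ltac:(lia); have h2 := IH x ltac:(lia); have h3 := IH (x - 1) ltac:(lia).
  rewrite iter_dltS; apply: has_sum_ext (has_sumD (has_sumB h1 (has_sumD h2 h2)) h3) => i.
  by rewrite iter_dltS mulr2n.
apply: normc_has_sum (hs l 0 _) _; first by rewrite addn0.
apply: sbound_le (sboundZ _ aM); last by rewrite mulr_ge0 ?exprn_ge0.
move=> i; rewrite iter_dltZ normcM mulrCA ler_wpM2l ?normc_ge0//.
have [kl|kl] := ltnP (k i) l.*2.
  rewrite polyint_iter ?normc0; last exact: polyint_monomial.
  by rewrite !mulr_ge0 ?exprn_ge0// ltW.
rewrite -mulrA; apply: iter_dlt_le => v vl; rewrite add0r normcX.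
rewrite normc_int.
apply: (@le_trans _ _ (l%:R ^+ k i)); first by rewrite lerXn2r ?nnegrE// ler_nat.
have {1}-> : l%:R = (l%:R / rho) * rho by rewrite divfK// gt_eqF.
rewrite exprMn ler_wpM2r ?exprn_ge0 ?(ltW rho0)//.
by rewrite ler_wiXn2l.
Qed.

Lemma nice_dlt_at rho M f l x : (0 < l)%N -> l%:R <= rho -> nice rho M (fun v => f (x + v)) ->
  normc (iter l dlt f x) <= 4 ^+ l * (l%:R / rho) ^+ l.*2 * M.
Proof. by move=> l0 lr /(nice_dlt l0 lr); rewrite iter_dlt_shift addr0. Qed.

Lemma nice_ext rho M f g : (forall v : int, `|v|%N%:R <= rho -> f v = g v) -> nice rho M f -> nice rho M g.
Proof.
by move=> fg [I [a [k [aM ag]]]]; exists I, a, k; split=> // v vr; rewrite -fg//; exact: ag.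
Qed.

Lemma nice_sub rho rho' M f : 0 <= rho' -> rho' <= rho -> nice rho M f -> nice rho' M f.
Proof.
move=> r0 rr [I [a [k [aM ag]]]]; exists I, a, k; split; last first.
  by move=> v vr; apply: ag; exact: le_trans vr rr.
apply: sbound_le aM => i; rewrite ler_wpM2l ?normc_ge0// lerXn2r ?nnegrE//.
exact: le_trans r0 rr.
Qed.

Lemma niceZ rho M c f : nice rho M f -> nice rho (normc c * M) (fun v => c * f v).
Proof.
move=> [I [a [k [aM ag]]]]; exists I, (fun i => c * a i), k; split.
  by apply: sbound_le (sboundZ (normc_ge0 c) aM) => i; rewrite normcM mulrA.
by move=> v vr; apply: has_sum_ext (has_sumZ c (ag v vr)) => i; rewrite mulrA.
Qed.

Lemma nice_opp rho M f : nice rho M f -> nice rho M (fun v => f (- v)).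
Proof.
move=> [I [a [k [aM ag]]]]; exists I, (fun i => a i * (-1) ^+ k i), k; split.
  by apply: sbound_le aM => i; rewrite normcM normcX normcN' normc1 expr1n mulr1.
move=> v vr; have := ag (- v); rewrite abszN => /(_ vr); apply: has_sum_ext => i.
by rewrite mulrNz [in LHS]exprNn mulrA.
Qed.

Lemma niceM rho M M' f g : 0 <= rho -> nice rho M f -> nice rho M' g ->
  nice rho (M * M') (fun v => f v * g v).
Proof.
move=> r0 [I [a [k [aM ag]]]] [J [b [k' [bM bg]]]].
exists (I * J)%type, (fun y : I * J => a y.1 * b y.2), (fun y : I * J => (k y.1 + k' y.2)%N).
have a0 i : 0 <= normc (a i) * rho ^+ k i by rewrite mulr_ge0 ?normc_ge0 ?exprn_ge0.
have b0 i : 0 <= normc (b i) * rho ^+ k' i by rewrite mulr_ge0 ?normc_ge0 ?exprn_ge0.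
split; first by apply: sbound_le (sbound_prod a0 b0 aM bM) => -[i j]; rewrite /= normcM exprD mulrACA.
have vs (v : int) : `|v|%N%:R <= rho -> normc (v%:~R : C) <= rho.
  by rewrite normc_int.
move=> v vr.
have as_ : csummable (fun i => a i * v%:~R ^+ k i).
  apply: csummable_le aM => i; rewrite normcM normcX ler_wpM2l ?normc_ge0//.
  by rewrite lerXn2r ?nnegrE ?normc_ge0// vs.
have bs : csummable (fun j => b j * v%:~R ^+ k' j).
  apply: csummable_le bM => i; rewrite normcM normcX ler_wpM2l ?normc_ge0//.
  by rewrite lerXn2r ?nnegrE ?normc_ge0// vs.
by apply: has_sum_ext (has_sum_prod as_ bs (ag v vr) (bg v vr)) => -[i j]; rewrite /= exprD mulrACA.
Qed.

Lemma sum_nat_support (a : nat -> R) n : (forall i, (n < i)%N -> a i = 0) -> (forall i, 0 <= a i) ->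
  sbound a (\sum_(i < n.+1) a i).
Proof.
move=> an a0; apply: sbound_nat => // m; have [mn|nm] := leqP m n.+1.
  rewrite -(subnK mn) addnC big_split_ord /= lerDl; exact: sumr_ge0.
rewrite -(subnK (ltnW nm)) addnC big_split_ord /= gerDl big1// => i _.
by rewrite an// ltnS leq_addr.
Qed.

Lemma has_sum_support (u : nat -> C) n : (forall i, (n < i)%N -> u i = 0) ->
  has_sum u (\sum_(i < n.+1) u i).
Proof.
move=> h; pose A := [fset nat_of_ord i | i in 'I_n.+1]%fset.
have -> : \sum_(i < n.+1) u i = \sum_(i <- A) u i.
  by rewrite big_imfset /= => [|i j _ _ /val_inj//]; rewrite big_enum.
apply: has_sum_fset => i iA; apply: h; rewrite ltnNge; apply: contra iA => lt.
by have -> : i = nat_of_ord (Ordinal (lt : (i < n.+1)%N)) by []; rewrite in_imfset.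
Qed.

Lemma binomial_sbound (b rho : R) k : 0 <= b -> 0 <= rho ->
  sbound (fun i => b ^+ (k - i) * 'C(k, i)%:R * rho ^+ i) ((b + rho) ^+ k).
Proof.
move=> b0 r0; rewrite exprDn.
rewrite (eq_bigr (fun i : 'I_k.+1 => b ^+ (k - i) * 'C(k, i)%:R * rho ^+ i)); last first.
  by move=> i _; rewrite -mulr_natr mulrAC.
apply: (sum_nat_support (a := fun i => b ^+ (k - i) * 'C(k, i)%:R * rho ^+ i)) => i.
  by move=> ki; rewrite bin_small// mulr0 mul0r.
by rewrite !mulr_ge0 ?exprn_ge0.
Qed.

Lemma has_sum_binomial (b v : C) k :
  has_sum (fun i => b ^+ (k - i) * 'C(k, i)%:R * v ^+ i) ((b + v) ^+ k).
Proof.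
rewrite exprDn (eq_bigr (fun i : 'I_k.+1 => b ^+ (k - i) * 'C(k, i)%:R * v ^+ i)); last first.
  by move=> i _; rewrite -mulr_natr mulrAC.
apply: (@has_sum_support (fun i => b ^+ (k - i) * 'C(k, i)%:R * v ^+ i)) => i ki.
by rewrite bin_small// mulr0 mul0r.
Qed.

Lemma nice_pow rho x k : 0 <= rho -> nice rho ((`|x|%N%:R + rho) ^+ k) (fun v => (x + v)%:~R ^+ k).
Proof.
move=> r0; exists nat, (fun i => x%:~R ^+ (k - i) * 'C(k, i)%:R), id; split.
  apply: sbound_le (binomial_sbound k (ler0n _ _) r0) => i; rewrite normcM normcX normc_nat.
  by rewrite normc_int.
move=> v _; rewrite rmorphD; exact: has_sum_binomial.
Qed.

End Differences.
Arguments dlt {R} f x.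

(** * Powers of integers and their local expansions *)

Section Powers.
Variable R : realType.
Local Notation C := R[i].
Implicit Types (s : C) (x v y : int).

Lemma natpowC_norm (n r : nat) s : (0 < n)%N -> normc s <= r%:R -> normc (natpowC n s) <= n%:R ^+ r.
Proof.
move=> n0 sr; rewrite /natpowC normc_expC.
have -> : complex.Re (s * (ln n%:R)%:C%C) = complex.Re s * ln n%:R by case: s {sr} => a b /=; rewrite mulr0 subr0.
have -> : (n%:R : R) ^+ r = expR (r%:R * ln n%:R) by rewrite expRM_natl lnK// posrE ltr0n.
rewrite ler_expR ler_wpM2r ?ln_ge0 ?ler1n//.
exact: le_trans (ler_norm _) (le_trans (Re_le_normc s) sr).
Qed.

Lemma natpowCM m n s : (0 < m)%N -> (0 < n)%N -> natpowC (m * n) s = natpowC m s * natpowC n s.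
Proof.
move=> m0 n0; rewrite /natpowC -expCD natrM lnM ?posrE ?ltr0n//.
by rewrite rmorphD mulrDr.
Qed.

Lemma natpowCD n s t : natpowC n (s + t) = natpowC n s * natpowC n t.
Proof. by rewrite /natpowC mulrDl expCD. Qed.

Lemma natpowCN n s : natpowC n (- s) = (natpowC n s)^-1.
Proof. by rewrite /natpowC mulNr expCN. Qed.

Lemma natpowC_neq0 n s : natpowC n s != 0.
Proof. exact: expC_neq0. Qed.

Lemma natpowC_nat n k : (0 < n)%N -> natpowC n (k%:R : C) = n%:R ^+ k.
Proof.
move=> n0; rewrite /natpowC expC_natmul expC_real lnK ?posrE ?ltr0n//.
by rewrite rmorph_nat.
Qed.

Definition ipow s x : C := if x == 0 then 0 else natpowC `|x|%N (- s).

Lemma ipow_opp s x : ipow s (- x) = ipow s x.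
Proof. by rewrite /ipow oppr_eq0 abszN. Qed.

Lemma ipow_norm s x r : normc s <= r%:R -> normc (ipow s x) <= `|x|%N%:R ^+ r.
Proof.
rewrite /ipow => sr; case: eqP => [->|/eqP x0]; first by rewrite normc0 exprn_ge0.
by rewrite natpowC_norm ?absz_gt0// normcN'.
Qed.

Definition binB (r : nat) : R := sval (cid (@bco_sbound R (r%:R / 4) (divr_ge0 (ler0n _ _) (ler0n _ _)))).

Lemma binB_sbound r : sbound (fun k => bco r%:R 1 k * (1 / 4) ^+ k) (binB r).
Proof.
rewrite /binB; case: cid => B /= hB; apply: sbound_le hB => k.
by rewrite -bco_scale mul1r.
Qed.

Lemma binB_ge0 r : 0 <= binB r.
Proof. exact: sbound_ge0 (@binB_sbound r). Qed.

Lemma bco_norm_le s r k : normc s <= r%:R -> normc (bco s 1 k) <= bco r%:R 1 k.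
Proof. by move=> sr; apply: normc_bco_le => //; rewrite normc1. Qed.

Lemma ipow_factor s x (u : R) : x != 0 -> `|u| <= 1 / 4 -> forall y, y%:~R = x%:~R * (1 - u) ->
  ipow s y = ipow s x * expC (- s * (ln (1 - u))%:C%C).
Proof.
move=> x0 u4 y yE; have u1 : 0 < 1 - u by move: u4; rewrite ler_norml => /andP[]; lra.
have y0 : y != 0 by rewrite -(intr_eq0 R) yE mulf_neq0 ?intr_eq0// gt_eqF.
rewrite /ipow (negbTE x0) (negbTE y0) /natpowC -expCD -mulrDr -rmorphD -lnM ?posrE//; last first.
  by rewrite ltr0n absz_gt0.
congr (expC (_ * (ln _)%:C%C)).
by rewrite !natr_absz !intr_norm yE normrM (gtr0_norm u1).
Qed.

(** Factoring out |x|^-s leaves the binomial series in -v / x, which converges on the scale |x| /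
    4. *)
Lemma nice_ipow s x r (rho : R) : normc s <= r%:R -> x != 0 -> 0 <= rho -> rho <= `|x|%N%:R / 4 ->
  nice rho (`|x|%N%:R ^+ r * binB r) (fun v => ipow s (x + v)).
Proof.
move=> sr x0 r0 rx; have X0 : 0 < `|x|%N%:R :> R by rewrite ltr0n absz_gt0.
have xR : x%:~R != 0 :> R by rewrite intr_eq0.
apply: nice_sub r0 rx _.
exists nat, (fun k => ipow s x * (bco s 1 k * (- (x%:~R)^-1) ^+ k)), id; split.
  apply: sbound_le (sboundZ _ (@binB_sbound r)); last by rewrite exprn_ge0.
  move=> k; rewrite !normcM normcX normcN' normcV normc_int -mulrA ler_pM ?normc_ge0 ?ipow_norm//.
    by rewrite mulr_ge0 ?mulr_ge0 ?normc_ge0 ?exprn_ge0 ?invr_ge0 ?divr_ge0.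
  rewrite -mulrA -exprMn mulrA mulVf ?gt_eqF// mul1r -[4^-1]mul1r ler_wpM2r ?exprn_ge0 ?divr_ge0//.
  exact: bco_norm_le.
move=> v vr; pose u : R := - v%:~R / x%:~R.
have u4 : `|u| <= 1 / 4.
  by rewrite normrM normrN normfV -!intr_norm -!natr_absz ler_pdivrMr// mulrC mul1r.
rewrite (@ipow_factor s x u x0 u4 (x + v)); last by rewrite rmorphD /u; field.
apply: has_sum_ext (has_sumZ (ipow s x) (binomial_series s u4)) => k.
rewrite -!mulrA; congr (_ * (_ * _)); rewrite -exprMn; congr (_ ^+ _).
by rewrite /u !rmorphM rmorphN /= fmorphV !rmorph_int mulrC mulNr mulrN mulrC.
Qed.

Definition btail s K (u : R) : C :=
  expC (- s * (ln (1 - u))%:C%C) - \sum_(k < K) bco s 1 k * u%:C%C ^+ k.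

Lemma has_sum_btail s K (u : R) : `|u| <= 1 / 4 ->
  has_sum (fun k => if (k < K)%N then 0 else bco s 1 k * u%:C%C ^+ k) (btail s K u).
Proof.
move=> u4; pose w k := if (k < K)%N then bco s 1 k * u%:C%C ^+ k else 0.
have hw : has_sum w (\sum_(k < K) bco s 1 k * u%:C%C ^+ k).
  have -> : \sum_(k < K) bco s 1 k * u%:C%C ^+ k = \sum_(k < K.+1) w k.
    by rewrite big_ord_recr /= /w ltnn addr0; apply: eq_bigr => k _; rewrite ltn_ord.
  by apply: has_sum_support => k kK; rewrite /w ltnNge ltnW.
apply: has_sum_ext (has_sumB (binomial_series s u4) hw) => k.
by rewrite /w; case: ifP; rewrite ?subrr ?subr0.
Qed.

Lemma btail_sbound s r K (th : R) : normc s <= r%:R -> 0 <= th -> th <= 1 / 4 ->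
  sbound (fun k => if (k < K)%N then 0 else normc (bco s 1 k) * th ^+ k) ((4 * th) ^+ K * binB r).
Proof.
move=> sr t0 t4; have q0 : 0 <= 4 * th by rewrite mulr_ge0.
have q1 : 4 * th <= 1 by lra.
apply: sbound_le (sboundZ (exprn_ge0 K q0) (@binB_sbound r)) => k.
have b0 : 0 <= bco r%:R 1 k :> R by apply: bco_ge0.
case: ltnP => kK; first by rewrite !mulr_ge0 ?exprn_ge0 ?divr_ge0.
rewrite mulrCA ler_pM ?normc_ge0 ?exprn_ge0 ?bco_norm_le//.
have -> : th ^+ k = (4 * th) ^+ k * (1 / 4) ^+ k by rewrite -exprMn; congr (_ ^+ _); field.
by rewrite ler_wpM2r ?exprn_ge0 ?divr_ge0// ler_wiXn2l.
Qed.

Lemma btail_norm s r K (u : R) : normc s <= r%:R -> `|u| <= 1 / 4 ->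
  normc (btail s K u) <= (4 * `|u|) ^+ K * binB r.
Proof.
move=> sr u4; apply: normc_has_sum (has_sum_btail s K u4) _.
apply: sbound_le (btail_sbound K sr (normr_ge0 u) u4) => k.
by case: ifP; rewrite ?normc0// normcM normcX normc_real.
Qed.

(** Each power of (x + v) / n in the remainder is expanded once more in [v]; the resulting double
    series has the majorant of the remainder at [th]. *)
Lemma nice_btail s r K (n : nat) x (rho : R) : normc s <= r%:R -> (0 < n)%N -> 0 <= rho ->
  (`|x|%N%:R + rho) / n%:R <= 1 / 4 ->
  nice rho ((4 * ((`|x|%N%:R + rho) / n%:R)) ^+ K * binB r)
    (fun v => btail s K ((x + v)%:~R / n%:R)).
Proof.
move=> sr n0 r0; set th := (_ + rho) / _ => th4.
have n0R : 0 < n%:R :> R by rewrite ltr0n.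
have xr : 0 <= `|x|%N%:R + rho by rewrite addr_ge0.
have t0 : 0 <= th by rewrite /th divr_ge0// ltW.
pose b (y : nat * nat) := x%:~R ^+ (y.1 - y.2) * 'C(y.1, y.2)%:R : C.
pose a (y : nat * nat) := (if (y.1 < K)%N then 0 else bco s 1 y.1 / n%:R ^+ y.1) * b y.
have aB : sbound (fun y : nat * nat => normc (a y) * rho ^+ y.2) ((4 * th) ^+ K * binB r).
  apply: (@sbound_iter _ _ _ _ (fun k => if (k < K)%N then 0 else normc (bco s 1 k) * th ^+ k)).
  - by move=> y; rewrite mulr_ge0 ?normc_ge0 ?exprn_ge0.
  - move=> k; have := binomial_sbound k (ler0n R `|x|%N) r0.
    rewrite /a /=; case: ifP => kK.
      by move=> _ A; rewrite big1// => i _; rewrite mul0r normc0 mul0r.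
    have c0 : 0 <= normc (bco s 1 k) / n%:R ^+ k by rewrite divr_ge0 ?normc_ge0 ?exprn_ge0.
    move=> /(sboundZ c0); rewrite /th expr_div_n mulrA [in X in sbound _ X]mulrAC -[in X in sbound _ X]mulrA => h.
    rewrite -mulrA; apply: sbound_le h => i.
    by rewrite !normcM normcV !normcX !normc_nat normc_int !mulrA.
  - exact: btail_sbound.
exists (nat * nat)%type, a, snd; split=> // v vr.
have u4 : `|(x + v)%:~R / n%:R| <= 1 / 4 :> R.
  apply: le_trans th4; rewrite normrM normfV (ger0_norm (ler0n R n)) ler_wpM2r ?invr_ge0 ?ler0n//.
  rewrite -intr_norm -natr_absz; apply: (@le_trans _ _ (`|x|%N%:R + `|v|%N%:R)); last by rewrite lerD2l.
  by rewrite -natrD ler_nat; lia.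
have Fs : csummable (fun y : nat * nat => a y * v%:~R ^+ y.2).
  apply: csummable_le aB => y; rewrite normcM normcX normc_int ler_wpM2l ?normc_ge0//.
  by rewrite lerXn2r ?nnegrE.
suff -> : btail s K ((x + v)%:~R / n%:R) = tsum (fun y : nat * nat => a y * v%:~R ^+ y.2) by exact: has_tsum.
apply: has_sum_uniq (has_sum_btail s K u4) _.
apply: (has_sum_iterated Fs) => k; rewrite /a /=; case: ifP => kK.
  by apply: has_sum_ext (@has_sum0 R _) => i; rewrite !mul0r.
have -> : bco s 1 k * ((x + v)%:~R / n%:R)%:C%C ^+ k = bco s 1 k / n%:R ^+ k * (x%:~R + v%:~R) ^+ k.
  by rewrite rmorphM fmorphV rmorph_nat rmorph_int rmorphD /= expr_div_n; ring.
by apply: has_sum_ext (has_sumZ _ (has_sum_binomial x%:~R v%:~R k)) => i; rewrite /b /= !mulrA.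
Qed.

End Powers.

(** * Estimates of the summands *)

Section Estimates.
Variable R : realType.
Local Notation C := R[i].
Implicit Types (s : C) (x y : int) (n : nat).

Definition phi s n x : C := ipow s x * ipow s (n%:Z - x).

(* The expansion of [phi] around x = 0, up to order K in x / n. *)
Definition psi s n K x : C :=
  natpowC n (- s) * (\sum_(k < K) bco s 1 k * (x%:~R / n%:R) ^+ k) * ipow s x.

Definition theta s n K x : C := phi s n x - psi s n K x - psi s n K (n%:Z - x).

Lemma theta_reflect s n K x : theta s n K (n%:Z - x) = theta s n K x.
Proof.
have e : n%:Z - (n%:Z - x) = x by ring.
by rewrite /theta /phi e mulrC; ring.
Qed.

(** Near x = 0 the factor |n - x|^-s is n^-s (1 - x / n)^-s, and [psi] is its truncated
    expansion. *)
Lemma phi_sub_psi s n K y : (0 < n)%N -> (4 * `|y| <= n)%N ->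
  phi s n y - psi s n K y = ipow s y * (natpowC n (- s) * btail s K (y%:~R / n%:R)).
Proof.
move=> n0 yn; have n0R : 0 < n%:R :> R by rewrite ltr0n.
have u4 : `|y%:~R / n%:R| <= 1 / 4 :> R.
  rewrite normrM normfV (ger0_norm (ler0n R n)) ler_pdivrMr// -intr_norm -natr_absz.
  by have : (4 * `|y|)%N%:R <= n%:R :> R; [rewrite ler_nat|rewrite natrM; lra].
have nz : n%:Z != 0 by lia.
rewrite /phi (@ipow_factor _ s n%:Z _ nz u4 (n%:Z - y)); last first.
  by rewrite rmorphB /=; field; rewrite gt_eqF.
have -> : ipow s n%:Z = natpowC n (- s) by rewrite /ipow (negbTE nz).
rewrite /psi /btail mulrBr mulrBr; congr (_ - _).
rewrite mulrC; congr (_ * (_ * _)); apply: eq_bigr => k _.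
by rewrite rmorphM fmorphV rmorph_nat rmorph_int.
Qed.

Lemma exp_quotient_le (X : R) a b c : 1 <= X -> (a + b <= c)%N -> X ^+ a / X ^+ c <= X ^- b.
Proof.
move=> X1 abc; have X0 : 0 < X by apply: lt_le_trans X1.
rewrite ler_pdivrMr ?exprn_gt0// mulrC -ler_pdivrMr ?invr_gt0 ?exprn_gt0// invrK -exprD.
by rewrite ler_weXn2l.
Qed.

Variables (r K l : nat).
Hypothesis l0 : (0 < l)%N.

Let B := @binB R r.
Let beta := \sum_(k < K) bco (r%:R : R) 1 k.

Lemma beta_ge0 : 0 <= beta.
Proof. by apply: sumr_ge0 => k _; apply: bco_ge0. Qed.

(* Gain from 2l differences of a function analytic at scale X / 8. *)
Lemma gain (X M : R) : 0 < X -> 4 ^+ l * (l%:R / (X / 8)) ^+ l.*2 * M =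
   (4 ^+ l * (8 * l%:R) ^+ l.*2) * (M / X ^+ l.*2).
Proof.
move=> X0; have -> : l%:R / (X / 8) = (8 * l%:R) / X by field; rewrite gt_eqF.
by rewrite expr_div_n; ring.
Qed.

Definition gainC : R := 4 ^+ l * (8 * l%:R) ^+ l.*2.

Lemma gainC_ge0 : 0 <= gainC.
Proof. by rewrite mulr_ge0 ?exprn_ge0// mulr_ge0. Qed.

Lemma absz_scale y : (8 * l <= `|y|)%N -> y != 0 /\ 1 <= `|y|%N%:R :> R.
Proof. by move=> ly; split; [|rewrite ler1n]; lia. Qed.

Lemma scale_ge y : (8 * l <= `|y|)%N -> l%:R <= `|y|%N%:R / 8 :> R.
Proof. by move=> ly; rewrite ler_pdivlMr// -natrM ler_nat mulnC. Qed.

Lemma power_dlt_le s k y : normc s <= r%:R -> (8 * l <= `|y|)%N ->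
  normc (iter l dlt (fun z => z%:~R ^+ k * ipow s z) y) <=
  gainC * (2 ^+ k * B) * (`|y|%N%:R ^+ (k + r) / `|y|%N%:R ^+ l.*2).
Proof.
move=> sr ly; have [y0 Y1] := absz_scale ly; set Y : R := `|y|%N%:R in Y1 *.
have Y0 : 0 < Y by lra.
have r0 : 0 <= Y / 8 by lra.
have h := niceM r0 (nice_pow y k r0) (nice_ipow sr y0 r0 _).
apply: le_trans (nice_dlt_at (f := fun z => z%:~R ^+ k * ipow s z) l0 (scale_ge ly) (h _)) _; first by rewrite -/Y; lra.
rewrite -/Y gain// -/gainC -[leRHS]mulrA ler_wpM2l ?gainC_ge0// [leRHS]mulrA ler_wpM2r ?invr_ge0 ?exprn_ge0//.
rewrite exprD -/B; have -> : 2 ^+ k * B * (Y ^+ k * Y ^+ r) = (2 * Y) ^+ k * (Y ^+ r * B) by rewrite exprMn; ring.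
by rewrite ler_wpM2r ?mulr_ge0 ?exprn_ge0 ?binB_ge0// lerXn2r ?nnegrE ?addr_ge0 ?mulr_ge0//; lra.
Qed.

Lemma psi_dlt_le s n y : normc s <= r%:R -> (0 < n)%N -> (8 * l <= `|y|)%N ->
  normc (iter l dlt (psi s n K) y) <=
  n%:R ^+ r * (beta * (gainC * (2 ^+ K * B)) * (`|y|%N%:R ^+ (K + r) / `|y|%N%:R ^+ l.*2)).
Proof.
move=> sr n0 ly; have [y0 Y1] := absz_scale ly; set Y : R := `|y|%N%:R in Y1 *.
have -> : iter l dlt (psi s n K) y = natpowC n (- s) *
    \sum_(k < K) bco s 1 k / n%:R ^+ k * iter l dlt (fun z => z%:~R ^+ k * ipow s z) y.
  under eq_bigr do rewrite -iter_dltZ.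
  rewrite -iter_dlt_sum -iter_dltZ; apply: iter_dlt_local => v _; rewrite /psi -mulrA mulr_suml.
  by congr (_ * _); apply: eq_bigr => k _; rewrite expr_div_n; ring.
rewrite normcM ler_pM ?normc_ge0//; first by rewrite natpowC_norm// normcN'.
apply: le_trans (normc_sum _ _ _) _; rewrite /beta mulr_suml mulr_suml; apply: ler_sum => k _.
rewrite 2!normcM normcV normcX normc_nat.
have h1 : normc (bco s 1 k) / n%:R ^+ k <= bco r%:R 1 k.
  rewrite ler_pdivrMr ?exprn_gt0 ?ltr0n//; apply: le_trans (bco_norm_le k sr) _.
  by rewrite ler_peMr ?bco_ge0// exprn_ege1// ler1n.
rewrite -[leRHS]mulrA ler_pM ?normc_ge0 ?mulr_ge0 ?invr_ge0 ?exprn_ge0 ?normc_ge0//.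
apply: le_trans (power_dlt_le k sr ly) _.
have kK : (k <= K)%N by rewrite ltnW.
have b0 : 0 <= B by exact: binB_ge0.
have q0 m : 0 <= B * (Y ^+ m / Y ^+ l.*2) by rewrite mulr_ge0 ?divr_ge0 ?exprn_ge0.
have key : 2 ^+ k * (B * (Y ^+ (k + r) / Y ^+ l.*2)) <= 2 ^+ K * (B * (Y ^+ (K + r) / Y ^+ l.*2)).
  apply: ler_pM (exprn_ge0 _ _) (q0 _) _ _ => //; first by rewrite ler_weXn2l ?ler1n.
  by rewrite ler_wpM2l// ler_wpM2r ?invr_ge0 ?exprn_ge0// ler_weXn2l// leq_add2r.
by move/(ler_wpM2l gainC_ge0): key; rewrite -/Y !mulrA.
Qed.

(** In this range |n - x| lies between |x| and 9 |x|, so both factors are analytic at the scale |x|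
    / 8. *)
Lemma phi_dlt_le s n x : normc s <= r%:R -> (8 * l <= `|x|)%N -> x <= n%:Z - x -> (n <= 8 * `|x|)%N ->
  normc (iter l dlt (phi s n) x) <=
  gainC * (9 ^+ r * B ^+ 2) * (`|x|%N%:R ^+ (r + r) / `|x|%N%:R ^+ l.*2).
Proof.
move=> sr lx xn nx; have [x0 X1] := absz_scale lx; set X : R := `|x|%N%:R in X1 *.
have X0 : 0 < X by lra.
have r0 : 0 <= X / 8 by lra.
have N0 : n%:Z - x != 0 by lia.
have NX : X <= `|n%:Z - x|%N%:R by rewrite ler_nat; lia.
have N9 : `|n%:Z - x|%N%:R <= 9 * X by rewrite -natrM ler_nat; lia.
have X84 : X / 8 <= X / 4 by lra.
have N84 : X / 8 <= `|n%:Z - x|%N%:R / 4 by lra.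
have h := niceM r0 (nice_ipow sr x0 r0 X84) (nice_opp (nice_ipow sr N0 r0 N84)).
have {}h : nice (X / 8) (X ^+ r * binB R r * (`|n%:Z - x|%N%:R ^+ r * binB R r)) (fun v => phi s n (x + v)).
  by apply: nice_ext h => v _; rewrite /phi; congr (_ * ipow _ _); ring.
apply: le_trans (nice_dlt_at l0 (scale_ge lx) h) _.
rewrite -/X gain// -/gainC -[leRHS]mulrA ler_wpM2l ?gainC_ge0// [leRHS]mulrA ler_wpM2r ?invr_ge0 ?exprn_ge0//.
rewrite -/B exprD [B ^+ 2]expr2.
have -> : X ^+ r * B * (`|n%:Z - x|%N%:R ^+ r * B) = (B * B) * (X ^+ r * `|n%:Z - x|%N%:R ^+ r) by ring.
have -> : 9 ^+ r * (B * B) * (X ^+ r * X ^+ r) = (B * B) * (X ^+ r * (9 ^+ r * X ^+ r)) by ring.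
rewrite ler_wpM2l ?mulr_ge0 ?binB_ge0// ler_wpM2l ?exprn_ge0// -exprMn.
by rewrite lerXn2r ?nnegrE ?mulr_ge0.
Qed.

(** Truncation gains (|x| / n)^K, and the differences pay for the growth in |x|. The constant is 9/2
    = 4 (1 + 1/8). *)
Lemma near_dlt_le s n x : normc s <= r%:R -> (8 * l <= `|x|)%N -> (8 * `|x| <= n)%N ->
  normc (iter l dlt (fun y => phi s n y - psi s n K y) x) <=
  gainC * ((9 / 2) ^+ K * B ^+ 2) * n%:R ^+ r *
  (`|x|%N%:R ^+ (r + K) / `|x|%N%:R ^+ l.*2) / n%:R ^+ K.
Proof.
move=> sr lx xn; have [x0 X1] := absz_scale lx; set X : R := `|x|%N%:R in X1 *.
have X0 : 0 < X by lra.
have r0 : 0 <= X / 8 by lra.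
have n0 : (0 < n)%N by lia.
have nR : 0 < n%:R :> R by rewrite ltr0n.
have Xn : 8 * X <= n%:R by rewrite -natrM ler_nat.
have X84 : X / 8 <= X / 4 by lra.
have th : (X + X / 8) / n%:R <= 1 / 4 by rewrite ler_pdivrMr//; lra.
pose g y := ipow s y * (natpowC n (- s) * btail s K (y%:~R / n%:R)).
have -> : iter l dlt (fun y => phi s n y - psi s n K y) x = iter l dlt g x.
  by apply: iter_dlt_local => v vl; rewrite phi_sub_psi//; lia.
have h : nice (X / 8) _ (fun v => g (x + v)) :=
  niceM r0 (nice_ipow sr x0 r0 X84) (niceZ (natpowC n (- s)) (nice_btail K sr n0 r0 th)).
apply: le_trans (nice_dlt_at l0 (scale_ge lx) h) _; rewrite -/X gain// -/gainC -/B.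
have thE : 4 * ((X + X / 8) / n%:R) = (9 / 2) * (X / n%:R) by field; rewrite gt_eqF.
rewrite thE [(9 / 2 * _) ^+ K]exprMn [(X / _) ^+ K]expr_div_n.
have -> : gainC * ((9 / 2) ^+ K * B ^+ 2) * n%:R ^+ r * (X ^+ (r + K) / X ^+ l.*2) / n%:R ^+ K =
  gainC * (X ^+ r * B * (n%:R ^+ r * ((9 / 2) ^+ K * (X ^+ K / n%:R ^+ K) * B)) / X ^+ l.*2).
  by rewrite [X ^+ (r + K)]exprD; move: (gainC) ((9 / 2) ^+ K) (n%:R ^+ r) (X ^+ l.*2)^-1 (n%:R ^+ K)^-1 (X ^+ K) => *; ring.
rewrite ler_wpM2l ?gainC_ge0// ler_wpM2r ?invr_ge0 ?exprn_ge0// ler_wpM2l ?mulr_ge0 ?exprn_ge0 ?binB_ge0//.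
rewrite ler_wpM2r ?natpowC_norm ?normcN'//.
by rewrite !mulr_ge0 ?exprn_ge0 ?binB_ge0 ?invr_ge0 ?divr_ge0 ?exprn_ge0.
Qed.

(** So close to 0 differencing gains nothing and the bound comes from the truncation alone. The
    arguments stay below 9 l = 8 l + l, and 36 = 4 * 9. *)
Lemma origin_dlt_le s n x : normc s <= r%:R -> (`|x| < 8 * l)%N -> (128 * l <= n)%N ->
  normc (iter l dlt (fun y => phi s n y - psi s n K y) x) <=
  4 ^+ l * ((9 * l)%N%:R ^+ r * ((36 * l)%N%:R ^+ K * B)) * n%:R ^+ r / n%:R ^+ K.
Proof.
move=> sr lx ln; have n0 : (0 < n)%N by lia.
have nR : 0 < n%:R :> R by rewrite ltr0n.
rewrite -!mulrA; apply: iter_dlt_le => v vl.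
rewrite phi_sub_psi//; last by lia.
have yl : (`|(x + v)%R| <= 9 * l)%N by lia.
have u4 : `|(x + v)%:~R / n%:R| <= 1 / 4 :> R.
  rewrite normrM normfV (ger0_norm (ler0n R n)) ler_pdivrMr// -intr_norm -natr_absz.
  by have : (4 * `|(x + v)%R|)%N%:R <= n%:R :> R; [rewrite ler_nat; lia|rewrite natrM; lra].
rewrite 2!normcM.
have h1 : normc (ipow s (x + v)) <= (9 * l)%N%:R ^+ r.
  by apply: le_trans (ipow_norm _ sr) _; rewrite lerXn2r ?nnegrE// ler_nat.
have h2 : normc (natpowC n (- s)) <= n%:R ^+ r by rewrite natpowC_norm// normcN'.
have h3 : normc (btail s K ((x + v)%:~R / n%:R)) <= ((36 * l)%N%:R / n%:R) ^+ K * B.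
  apply: le_trans (btail_norm K sr u4) _; rewrite ler_wpM2r ?binB_ge0// lerXn2r ?nnegrE ?mulr_ge0 ?invr_ge0//.
  rewrite normrM normfV (ger0_norm (ler0n R n)) mulrA ler_wpM2r ?invr_ge0// -intr_norm -natr_absz -natrM ler_nat; lia.
have -> : (9 * l)%N%:R ^+ r * ((36 * l)%N%:R ^+ K * (B * (n%:R ^+ r * (n%:R ^+ K)^-1))) =
  (9 * l)%N%:R ^+ r * (n%:R ^+ r * (((36 * l)%N%:R / n%:R) ^+ K * B)).
  by rewrite expr_div_n; move: (n%:R ^+ K)^-1 (n%:R ^+ r) ((36 * l)%N%:R ^+ K) => *; ring.
by rewrite ler_pM ?mulr_ge0 ?normc_ge0// ler_pM ?normc_ge0.
Qed.

(** With [n] and [x] bounded any constant will do; all arguments stay within 137 l = 128 l + 8 l +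
    l. *)
Lemma small_dlt_le s n x : normc s <= r%:R -> (0 < n)%N -> (`|x| < 8 * l)%N -> (n < 128 * l)%N ->
  normc (iter l dlt (theta s n K) x) <= 4 ^+ l * ((137 * l)%N%:R ^+ (r + r) +
    2 * ((137 * l)%N%:R ^+ r * (beta * (137 * l)%N%:R ^+ K) * (137 * l)%N%:R ^+ r)).
Proof.
move=> sr n0 lx ln; apply: iter_dlt_le => v vl; set L : R := (137 * l)%N%:R.
have L1 : 1 <= L by rewrite ler1n; lia.
have y1 : (`|(x + v)%R| <= 137 * l)%N by lia.
have y2 : (`|(n%:Z - (x + v))%R| <= 137 * l)%N by lia.
have pB (z : int) : (`|z| <= 137 * l)%N -> normc (ipow s z) <= L ^+ r.
  by move=> zl; apply: le_trans (ipow_norm _ sr) _; rewrite lerXn2r ?nnegrE// ler_nat.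
have psB (z : int) : (`|z| <= 137 * l)%N -> normc (psi s n K z) <= L ^+ r * (beta * L ^+ K) * L ^+ r.
  move=> zl; rewrite /psi 2!normcM ler_pM ?mulr_ge0 ?normc_ge0 ?pB// ler_pM ?normc_ge0//.
    have h : normc (natpowC n (- s)) <= n%:R ^+ r by rewrite natpowC_norm// normcN'.
    apply: le_trans h _; rewrite lerXn2r ?nnegrE// ler_nat; lia.
  apply: le_trans (normc_sum _ _ _) _; rewrite /beta mulr_suml; apply: ler_sum => k _.
  rewrite normcM normcX normcM normcV normc_nat normc_int ler_pM ?normc_ge0 ?exprn_ge0 ?mulr_ge0 ?invr_ge0 ?bco_norm_le//.
  apply: (@le_trans _ _ (L ^+ k)); last by rewrite ler_weXn2l// ltnW.
  rewrite lerXn2r ?nnegrE ?mulr_ge0 ?invr_ge0// ler_pdivrMr ?ltr0n//.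
  apply: (@le_trans _ _ L); first by rewrite ler_nat.
  by rewrite ler_peMr ?ler1n// (le_trans ler01).
have h1 := psB _ y1; have h2 := psB _ y2.
have h3 : normc (phi s n (x + v)) <= L ^+ (r + r) by rewrite exprD normcM ler_pM ?normc_ge0 ?pB.
rewrite /theta; apply: le_trans (normcD _ _) _; have := normcD (phi s n (x + v)) (- psi s n K (x + v)).
by rewrite !normcN'; lra.
Qed.

(** [K] absorbs the two factors n^r and leaves n^-2; [l.*2] absorbs the growth X^(K + r) and leaves
    X^-(2r + 4). *)
Hypothesis K_ge : (r + r + 2 <= K)%N.
Hypothesis l_ge : (r + r + r + K + 4 <= l.*2)%N.

Lemma one_plus_le (X : R) : 1 <= X -> (2 * X) ^- 2 <= (1 + X) ^- 2.
Proof.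
move=> X1; rewrite lef_pV2 ?posrE ?exprn_gt0//; [|lra|lra].
by rewrite lerXn2r ?nnegrE; lra.
Qed.

(** The reflected subtraction is evaluated at distance at least n / 2 from its singularity, where
    differencing alone makes it small. *)
Lemma reflected_dlt_le s n x : normc s <= r%:R -> (8 * `|x| <= n)%N -> (16 * l <= n)%N -> (0 < n)%N ->
  normc (iter l dlt (psi s n K) (n%:Z - x)) <=
    n%:R ^+ r * (beta * (gainC * (2 ^+ K * B)) * (2 ^+ (r + r + 4) / n%:R ^+ (r + r + 4))).
Proof.
move=> sr xn ln n0; have lN : (8 * l <= `|(n%:Z - x)%R|)%N by lia.
have nR : 0 < n%:R :> R by rewrite ltr0n.
apply: le_trans (psi_dlt_le sr n0 lN) _; rewrite ler_wpM2l ?exprn_ge0//.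
rewrite ler_wpM2l ?mulr_ge0 ?beta_ge0 ?gainC_ge0 ?binB_ge0 ?exprn_ge0//.
have [_ N1] := absz_scale lN; set N : R := `|_|%N%:R in N1 *.
apply: (@le_trans _ _ (N ^- (r + r + 4))); first by apply: exp_quotient_le => //; lia.
have nN : n%:R / 2 <= N by rewrite ler_pdivrMr// -natrM ler_nat; lia.
have -> : 2 ^+ (r + r + 4) / n%:R ^+ (r + r + 4) = (n%:R / 2) ^- (r + r + 4) :> R.
  by rewrite expr_div_n invf_div.
rewrite lef_pV2 ?posrE ?exprn_gt0 ?divr_gt0//; last by lra.
by rewrite lerXn2r ?nnegrE ?divr_ge0 ?ler0n//.
Qed.

Lemma one_plus_natr_le (m n : nat) : (m < n)%N -> 1 + m%:R <= n%:R :> R.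
Proof. by move=> mn; rewrite nat1r ler_nat. Qed.

Lemma sum_bound (a b c d e p : R) : a * b <= d * p -> a * c <= e * p ->
  a * (b + c + c) <= (e *+ 2 + d) * p.
Proof. by rewrite !mulrDr mulrDl mulrnAl mulr2n; lra. Qed.

(** The bound is summable over both [n] and [x], which is what the continuation requires. Points
    beyond n / 2 follow from the symmetry of [theta]. *)
Lemma theta_half_le : exists2 D : R, 0 <= D & forall s n x, normc s <= r%:R -> (0 < n)%N -> x <= n%:Z - x ->
  normc (natpowC n (- s) * iter l dlt (theta s n K) x) <= D / n%:R ^+ 2 * (1 + `|x|%N%:R) ^- 2.
Proof.
pose D1 := beta * (gainC * (2 ^+ K * B)).
have D10 : 0 <= D1 by rewrite !mulr_ge0 ?beta_ge0 ?gainC_ge0 ?binB_ge0 ?exprn_ge0.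
pose D2 := gainC * (9 ^+ r * B ^+ 2).
have D20 : 0 <= D2 by rewrite !mulr_ge0 ?gainC_ge0 ?exprn_ge0 ?binB_ge0.
pose D3 := gainC * ((9 / 2) ^+ K * B ^+ 2).
have D30 : 0 <= D3 by rewrite !mulr_ge0 ?gainC_ge0 ?exprn_ge0 ?binB_ge0 ?divr_ge0.
pose D4 := 4 ^+ l * ((9 * l)%N%:R ^+ r * ((36 * l)%N%:R ^+ K * B)).
have D40 : 0 <= D4 by rewrite !mulr_ge0 ?exprn_ge0 ?binB_ge0.
pose D5 := 4 ^+ l * ((137 * l)%N%:R ^+ (r + r) +
    2 * ((137 * l)%N%:R ^+ r * (beta * (137 * l)%N%:R ^+ K) * (137 * l)%N%:R ^+ r)) : R.
have e0 (a m : nat) : 0 <= a%:R ^+ m :> R by rewrite exprn_ge0.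
have D50 : 0 <= D5.
  apply: (mulr_ge0 (e0 4%N _)); apply: (addr_ge0 (e0 _ _)); apply: (mulr_ge0 (ler0n _ 2)).
  by apply: (mulr_ge0 (mulr_ge0 (e0 _ _) (mulr_ge0 beta_ge0 (e0 _ _))) (e0 _ _)).
(* 256 comes from X^-4 = 256 (8 X)^-2 (2 X)^-2, with n <= 8 X and 1 + X <= 2 X. *)
pose DA := (8 ^+ (r + r) * D1 *+ 2 + 8 ^+ r * D2) * 256.
have DA1 : 0 <= 8 ^+ (r + r) * D1 *+ 2 + 8 ^+ r * D2.
  exact: (addr_ge0 (mulrn_wge0 _ (mulr_ge0 (e0 8%N _) D10)) (mulr_ge0 (e0 8%N _) D20)).
have DA0 : 0 <= DA by exact: (mulr_ge0 DA1 (ler0n _ 256)).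
pose DR := D1 * 2 ^+ (r + r + 4).
have DR0 : 0 <= DR by rewrite mulr_ge0 ?exprn_ge0.
pose DB := DR + 4 * D3; have DB0 : 0 <= DB := addr_ge0 DR0 (mulr_ge0 (ler0n _ 4) D30).
pose DC := DR + D4 * (1 + (8 * l)%N%:R) ^+ 2.
have l10 : 0 <= (1 + (8 * l)%N%:R) ^+ 2 :> R by rewrite exprn_ge0// addr_ge0.
have DC0 : 0 <= DC := addr_ge0 DR0 (mulr_ge0 D40 l10).
pose DD := (128 * l)%N%:R ^+ r * D5 * ((128 * l)%N%:R ^+ 2 * (1 + (8 * l)%N%:R) ^+ 2).
have DD0 : 0 <= DD by exact: (mulr_ge0 (mulr_ge0 (e0 _ _) D50) (mulr_ge0 (e0 _ _) l10)).
exists (DA + DB + DC + DD); first exact: (addr_ge0 (addr_ge0 (addr_ge0 DA0 DB0) DC0) DD0).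
move=> s n x sr n0 xn; have nR : 0 < n%:R :> R by rewrite ltr0n.
have n1 : 1 <= n%:R :> R by rewrite ler1n.
set X : R := `|x|%N%:R; have X0 : 0 <= X by rewrite /X.
have X1p : 0 < (1 + X) ^- 2 by rewrite invr_gt0 exprn_gt0//; lra.
suff h : exists2 D, normc (natpowC n (- s) * iter l dlt (theta s n K) x) <= D / n%:R ^+ 2 * (1 + X) ^- 2 &
    D <= DA + DB + DC + DD.
  have [D h1 h2] := h; apply: le_trans h1 _.
  by rewrite ler_wpM2r ?(ltW X1p)// ler_wpM2r ?invr_ge0 ?exprn_ge0.
have hp : normc (natpowC n (- s)) <= n%:R ^+ r by rewrite natpowC_norm// normcN'.
have split1 M : normc (iter l dlt (theta s n K) x) <= M ->
    normc (natpowC n (- s) * iter l dlt (theta s n K) x) <= n%:R ^+ r * M.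
  by move=> hM; rewrite normcM ler_pM ?normc_ge0.
have refl : iter l dlt (fun y => psi s n K (n%:Z - y)) x = iter l dlt (psi s n K) (n%:Z - x).
  exact: iter_dlt_reflect.
have split2 M M' : normc (iter l dlt (fun y => phi s n y - psi s n K y) x) <= M ->
    normc (iter l dlt (psi s n K) (n%:Z - x)) <= M' ->
    normc (natpowC n (- s) * iter l dlt (theta s n K) x) <= n%:R ^+ r * (M + M').
  move=> h1 h2; apply: split1; rewrite /theta iter_dltB refl.
  by apply: le_trans (normcD _ _) _; rewrite normcN' lerD.
have near_n : (8 * `|x| <= n)%N -> n%:R ^+ r * (n%:R ^+ r * (D1 * (2 ^+ (r + r + 4) / n%:R ^+ (r + r + 4)))) <=
    DR / n%:R ^+ 2 * (1 + X) ^- 2.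
  move=> x8; have -> : n%:R ^+ r * (n%:R ^+ r * (D1 * (2 ^+ (r + r + 4) / n%:R ^+ (r + r + 4)))) = DR * n%:R ^- 4 :> R.
    rewrite /DR [n%:R ^+ (r + r + 4)]exprD [n%:R ^+ (r + r)]exprD.
    have p0 : n%:R ^+ r != 0 :> R by rewrite expf_neq0// gt_eqF.
    have p1 : n%:R != 0 :> R by rewrite gt_eqF.
    have aux (a b c d : R) : a != 0 -> b != 0 -> a * (a * (d * (c / (a * a * b ^+ 4)))) = d * c / b ^+ 4.
      by move=> a0 b0; field; rewrite a0 b0.
    exact: aux.
  rewrite -mulrA ler_wpM2l// (exprD _ 2 2) invfM ler_wpM2l ?invr_ge0 ?exprn_ge0//.
  have Xn : 1 + X <= n%:R by apply: one_plus_natr_le; clear -x8 n0; lia.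
  rewrite lef_pV2 ?posrE ?exprn_gt0//; last by lra.
  by rewrite lerXn2r ?nnegrE//; lra.
(* Four ranges: |x| >= n / 8, where neither expansion is used; 8 l <= |x| < n / 8; |x| < 8 l with n
   large; and both bounded. They give [DA], [DB], [DC], [DD]. *)
have [lx|lx] := leqP (8 * l) `|x|%N; last have [ln|ln] := leqP (128 * l) n.
- have [_ X1] := absz_scale lx; rewrite -/X in X1.
  have X2 : 0 < X by lra.
  have [nx|nx] := leqP n (8 * `|x|).
  + exists DA; last by lra.
    have lN : (8 * l <= `|(n%:Z - x)%R|)%N by clear -lx xn; lia.
    have NX : X <= `|(n%:Z - x)%R|%N%:R by rewrite ler_nat; clear -lx xn; lia.
    have [_ N1] := absz_scale lN; set N : R := `|(n%:Z - x)%R|%N%:R in NX N1 *.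
    have h1 := phi_dlt_le sr lx xn nx; have h2 := psi_dlt_le sr n0 lx; have h3 := psi_dlt_le sr n0 lN.
    rewrite -/X -/N -/D1 -/D2 in h1 h2 h3.
    have nX : n%:R <= 8 * X by rewrite -natrM ler_nat.
    have e1 : X ^+ (r + r) / X ^+ l.*2 <= X ^- (r + 4) by apply: exp_quotient_le => //; clear -l_ge K_ge; lia.
    have e2 : X ^+ (K + r) / X ^+ l.*2 <= X ^- (r + r + 4) by apply: exp_quotient_le => //; clear -l_ge K_ge; lia.
    have e3 : N ^+ (K + r) / N ^+ l.*2 <= X ^- (r + r + 4).
      apply: (@le_trans _ _ (N ^- (r + r + 4))); first by apply: exp_quotient_le => //; clear -l_ge K_ge; lia.
      rewrite lef_pV2 ?posrE ?exprn_gt0//; last by lra.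
      by rewrite lerXn2r ?nnegrE//; lra.
    have tot : normc (natpowC n (- s) * iter l dlt (theta s n K) x) <=
        n%:R ^+ r * (D2 * X ^- (r + 4) + n%:R ^+ r * (D1 * X ^- (r + r + 4)) + n%:R ^+ r * (D1 * X ^- (r + r + 4))).
      apply: split2; last by apply: le_trans h3 _; rewrite ler_wpM2l ?exprn_ge0// ler_wpM2l.
      rewrite iter_dltB; apply: le_trans (normcD _ _) _; rewrite normcN' lerD//.
        by apply: le_trans h1 _; rewrite ler_wpM2l.
      by apply: le_trans h2 _; rewrite ler_wpM2l ?exprn_ge0// ler_wpM2l.
    apply: le_trans tot _.
    have nr : n%:R ^+ r <= 8 ^+ r * X ^+ r by rewrite -exprMn lerXn2r ?nnegrE ?mulr_ge0.
    have nr0 : 0 <= n%:R ^+ r :> R by rewrite exprn_ge0.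
    have i0 m : 0 <= X ^- m by rewrite invr_ge0 exprn_ge0.
    have t1 : n%:R ^+ r * (D2 * X ^- (r + 4)) <= 8 ^+ r * D2 * X ^- 4.
      apply: (@le_trans _ _ (8 ^+ r * X ^+ r * (D2 * X ^- (r + 4)))); first exact: (ler_wpM2r (mulr_ge0 D20 (i0 _)) nr).
      rewrite le_eqVlt; apply/orP; left; apply/eqP; rewrite exprD.
      have p0 : X ^+ r != 0 by rewrite expf_neq0// gt_eqF.
      have p1 : X != 0 by rewrite gt_eqF.
      have aux (a b c d : R) : a != 0 -> b != 0 -> c * a * (d / (a * b ^+ 4)) = c * d / b ^+ 4.
        by move=> a0 b0; field; rewrite a0 b0.
      exact: aux.
    have t2 : n%:R ^+ r * (n%:R ^+ r * (D1 * X ^- (r + r + 4))) <= 8 ^+ (r + r) * D1 * X ^- 4.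
      apply: (@le_trans _ _ ((8 ^+ r * X ^+ r) * ((8 ^+ r * X ^+ r) * (D1 * X ^- (r + r + 4))))).
        have q0 : 0 <= D1 * X ^- (r + r + 4) by rewrite mulr_ge0.
        exact: (ler_pM nr0 (mulr_ge0 nr0 q0) nr (ler_wpM2r q0 nr)).
      rewrite le_eqVlt; apply/orP; left; apply/eqP; rewrite !exprD.
      have p0 : X ^+ r != 0 by rewrite expf_neq0// gt_eqF.
      have p1 : X != 0 by rewrite gt_eqF.
      have aux (a b c d : R) : a != 0 -> b != 0 ->
          (c * a) * ((c * a) * (d / (a * a * b ^+ 4))) = c * c * d / b ^+ 4.
        by move=> a0 b0; field; rewrite a0 b0.
      exact: aux.
    have X4 : X ^- 4 <= 256 * (n%:R ^- 2 * (1 + X) ^- 2).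
      have f1 : (8 * X) ^- 2 <= n%:R ^- 2 :> R.
        rewrite lef_pV2 ?posrE ?exprn_gt0//; last by lra.
        by rewrite lerXn2r ?nnegrE//; lra.
      have f2 := one_plus_le X1.
      have -> : X ^- 4 = 256 * ((8 * X) ^- 2 * (2 * X) ^- 2) by field; rewrite gt_eqF.
      have i8 (a : R) : 0 <= a ^- 2 by rewrite invr_ge0 sqr_ge0.
      exact: (ler_wpM2l (ler0n _ 256) (ler_pM (i8 _) (i8 _) f1 f2)).
    apply: (@le_trans _ _ ((8 ^+ (r + r) * D1 *+ 2 + 8 ^+ r * D2) * X ^- 4)).
      exact: sum_bound t1 t2.
    by rewrite /DA -!mulrA (ler_wpM2l DA1).
  + exists DB; last by lra.
    have x8 : (8 * `|x| <= n)%N by clear -nx; lia.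
    have ln16 : (16 * l <= n)%N by clear -lx x8; lia.
    apply: le_trans (split2 _ _ (near_dlt_le sr lx x8) (reflected_dlt_le sr x8 ln16 n0)) _.
    rewrite -/D1 -/D3 -/X mulrDr /DB mulrDl mulrDl addrC lerD ?near_n//.
    have e1 : X ^+ (r + K) / X ^+ l.*2 <= X ^- 2 by apply: exp_quotient_le => //; clear -l_ge K_ge; lia.
    have e2 : n%:R ^+ (r + r) / n%:R ^+ K <= n%:R ^- 2 :> R by apply: exp_quotient_le.
    have f2 := one_plus_le X1.
    have -> : n%:R ^+ r * (D3 * n%:R ^+ r * (X ^+ (r + K) / X ^+ l.*2) / n%:R ^+ K) =
      D3 * ((n%:R ^+ (r + r) / n%:R ^+ K) * (X ^+ (r + K) / X ^+ l.*2)) by rewrite [n%:R ^+ (r + r)]exprD; ring.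
    have -> : 4 * D3 / n%:R ^+ 2 * (1 + X) ^- 2 = D3 * (n%:R ^- 2 * (4 * (1 + X) ^- 2)) by ring.
    rewrite ler_wpM2l// ler_pM ?divr_ge0 ?exprn_ge0//; apply: le_trans e1 _.
    have -> : X ^- 2 = 4 * (2 * X) ^- 2 by field; rewrite gt_eqF.
    by rewrite ler_wpM2l.
- exists DC; last by lra.
  have x8 : (8 * `|x| <= n)%N by clear -ln lx; lia.
  have ln16 : (16 * l <= n)%N by clear -ln; lia.
  apply: le_trans (split2 _ _ (origin_dlt_le sr lx ln) (reflected_dlt_le sr x8 ln16 n0)) _.
  rewrite -/D1 -/D4 mulrDr /DC mulrDl mulrDl addrC lerD ?near_n//.
  have e2 : n%:R ^+ (r + r) / n%:R ^+ K <= n%:R ^- 2 :> R by apply: exp_quotient_le.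
  have -> : n%:R ^+ r * (D4 * n%:R ^+ r / n%:R ^+ K) = D4 * (n%:R ^+ (r + r) / n%:R ^+ K).
    by rewrite [n%:R ^+ (r + r)]exprD; ring.
  apply: (@le_trans _ _ (D4 * n%:R ^- 2)); first by rewrite ler_wpM2l.
  have -> : D4 * (1 + (8 * l)%N%:R) ^+ 2 / n%:R ^+ 2 * (1 + X) ^- 2 = D4 * n%:R ^- 2 * ((1 + (8 * l)%N%:R) ^+ 2 * (1 + X) ^- 2) by ring.
  have q0 : 0 <= n%:R ^- 2 :> R by rewrite invr_ge0 exprn_ge0.
  apply: (ler_peMr (mulr_ge0 D40 q0)).
  have Xl : X <= (8 * l)%N%:R by rewrite ler_nat ltnW.
  rewrite ler_pdivlMr ?exprn_gt0//; last by lra.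
  by rewrite mul1r lerXn2r ?nnegrE//; lra.
- exists DD; last by lra.
  apply: le_trans (split1 _ (small_dlt_le sr n0 lx ln)) _; rewrite -/D5.
  have Xl : X <= (8 * l)%N%:R by rewrite ler_nat ltnW.
  have nl : n%:R <= (128 * l)%N%:R :> R by rewrite ler_nat ltnW.
  have h1 : n%:R ^+ r <= (128 * l)%N%:R ^+ r :> R by rewrite lerXn2r ?nnegrE.
  have h2 : 1 <= (128 * l)%N%:R ^+ 2 * n%:R ^- 2 :> R.
    by rewrite ler_pdivlMr ?exprn_gt0// mul1r lerXn2r ?nnegrE.
  have h3 : 1 <= (1 + (8 * l)%N%:R) ^+ 2 * (1 + X) ^- 2.
    rewrite ler_pdivlMr ?exprn_gt0//; last by lra.
    by rewrite mul1r lerXn2r ?nnegrE//; lra.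
  have -> : DD / n%:R ^+ 2 * (1 + X) ^- 2 = (128 * l)%N%:R ^+ r * D5 *
     (((128 * l)%N%:R ^+ 2 * n%:R ^- 2) * ((1 + (8 * l)%N%:R) ^+ 2 * (1 + X) ^- 2)) by rewrite /DD; ring.
  apply: (@le_trans _ _ ((128 * l)%N%:R ^+ r * D5)); first by rewrite ler_wpM2r.
  apply: (ler_peMr (mulr_ge0 (e0 _ _) D50)).
  exact: (le_trans h2 (ler_peMr (le_trans ler01 h2) h3)).
Qed.

Lemma theta_dlt_le : exists2 D : R, 0 <= D & forall s n x, normc s <= r%:R -> (0 < n)%N ->
  normc (natpowC n (- s) * iter l dlt (theta s n K) x) <=
    D / n%:R ^+ 2 * ((1 + `|x|%N%:R) ^- 2 + (1 + `|(n%:Z - x)%R|%N%:R) ^- 2).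
Proof.
have [D D0 h] := theta_half_le; exists D => // s n x sr n0.
have c0 : 0 <= D / n%:R ^+ 2 by rewrite divr_ge0 ?exprn_ge0.
have i0 y : 0 <= (1 + `|y|%N%:R) ^- 2 :> R by rewrite invr_ge0 exprn_ge0 ?addr_ge0.
have [xn|xn] := lerP x (n%:Z - x).
  by apply: le_trans (h s n x sr n0 xn) _; rewrite (ler_wpM2l c0)// lerDl.
have e : n%:Z - (n%:Z - x) = x by ring.
have -> : iter l dlt (theta s n K) x = iter l dlt (theta s n K) (n%:Z - x).
  rewrite -[RHS]iter_dlt_reflect; apply: iter_dlt_local => v _; by rewrite theta_reflect.
have := h s n (n%:Z - x) sr n0; rewrite e => /(_ (ltW xn)) h1; apply: le_trans h1 _.
by rewrite (ler_wpM2l c0)// lerDr.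
Qed.

Lemma ipow_dlt_le k : (r + k + 2 <= l.*2)%N -> exists2 D : R, 0 <= D & forall s x, normc s <= r%:R ->
  normc (iter l dlt (fun y => y%:~R ^+ k * ipow s y) x) <= D * (1 + `|x|%N%:R) ^- 2.
Proof.
move=> kl; pose D1 := gainC * (2 ^+ k * B).
have D10 : 0 <= D1 by rewrite !mulr_ge0 ?gainC_ge0 ?binB_ge0 ?exprn_ge0.
have e0 (a m : nat) : 0 <= a%:R ^+ m :> R by rewrite exprn_ge0.
pose D2 := 4 ^+ l * (9 * l)%N%:R ^+ (k + r) * (1 + (8 * l)%N%:R) ^+ 2 : R.
have l10 : 0 <= (1 + (8 * l)%N%:R) ^+ 2 :> R by rewrite exprn_ge0// addr_ge0.
have D20 : 0 <= D2 := mulr_ge0 (mulr_ge0 (e0 4%N _) (e0 _ _)) l10.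
exists (4 * D1 + D2); first exact: (addr_ge0 (mulr_ge0 (ler0n _ 4) D10) D20).
move=> s x sr; set X : R := `|x|%N%:R; have X0 : 0 <= X by rewrite /X.
have X1p : 0 <= (1 + X) ^- 2 by rewrite invr_ge0 exprn_ge0// addr_ge0.
rewrite mulrDl; have [lx|lx] := leqP (8 * l) `|x|%N.
  have [_ X1] := absz_scale lx; rewrite -/X in X1.
  apply: ler_wpDr; first exact: (mulr_ge0 D20 X1p).
  apply: le_trans (power_dlt_le k sr lx) _; rewrite -/D1 -/X.
  have e1 : X ^+ (k + r) / X ^+ l.*2 <= X ^- 2 by apply: exp_quotient_le => //; clear -kl; lia.
  apply: le_trans (ler_wpM2l D10 e1) _; rewrite -[4 * D1 * _]mulrA [4 * (D1 * _)]mulrCA.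
  apply: (ler_wpM2l D10).
  have -> : X ^- 2 = 4 * (2 * X) ^- 2 by field; rewrite gt_eqF// (lt_le_trans ltr01).
  exact: (ler_wpM2l (ler0n _ 4) (one_plus_le X1)).
apply: ler_wpDl; first exact: (mulr_ge0 (mulr_ge0 (ler0n _ 4) D10) X1p).
apply: (@le_trans _ _ (4 ^+ l * (9 * l)%N%:R ^+ (k + r))).
  apply: iter_dlt_le => v vl; rewrite exprD normcM normcX normc_int.
  have y9 : `|(x + v)%R|%N%:R <= (9 * l)%N%:R :> R by rewrite ler_nat; clear -vl lx; lia.
  apply: ler_pM; rewrite ?exprn_ge0 ?normc_ge0//; first by rewrite lerXn2r ?nnegrE.
  by apply: le_trans (ipow_norm _ sr) _; rewrite lerXn2r ?nnegrE.
rewrite /D2 -mulrA; apply: (ler_peMr (mulr_ge0 (e0 4%N _) (e0 _ _))).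
have Xl : X <= (8 * l)%N%:R by rewrite ler_nat ltnW.
rewrite ler_pdivlMr ?exprn_gt0//; last by lra.
by rewrite mul1r lerXn2r ?nnegrE//; lra.
Qed.

End Estimates.

(** * Abel sums *)

Section AbelSums.
Variable R : realType.
Local Notation C := R[i].
Implicit Types (f g : int -> C) (x v : int).

Lemma sbound_inj (I J : choiceType) (h : I -> J) (m : J -> R) B : injective h ->
  sbound m B -> sbound (m \o h) B.
Proof.
move=> hi mB A; have := mB (h @` A)%fset.
by rewrite big_imfset //= => i j _ _ /hi.
Qed.

Lemma sbound_succ_inv_sq : sbound (fun k : nat => (1 + k%:R) ^- 2 : R) 2.
Proof.
(* Telescoping with 1 / (n + 1)^2 <= 1 / n - 1 / (n + 1). *)
apply: sbound_nat => [k|n]; first by rewrite invr_ge0 exprn_ge0 ?addr_ge0.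
suff : \sum_(k < n) (1 + k%:R) ^- 2 <= 2 - (if n == 0%N then 2 else n%:R^-1) :> R.
  by move/le_trans; apply; rewrite gerBl; case: ifP => // _; rewrite invr_ge0.
elim: n => [|n IH]; first by rewrite big_ord0 subrr.
rewrite big_ord_recr /=; case: n IH => [|n] IH.
  by rewrite big_ord0 addr0 expr1n invr1; lra.
have a0 : 0 < n.+1%:R :> R by rewrite ltr0n.
have b0 : 0 < n.+2%:R :> R by rewrite ltr0n.
rewrite nat1r; apply: le_trans (lerD IH (lexx _)) _; rewrite /=.
have e : n.+2%:R = n.+1%:R + 1 :> R by rewrite natr1.
have -> : n.+1%:R^-1 = n.+2%:R^-1 + (n.+1%:R * n.+2%:R)^-1 :> R.
  by move: b0 a0; rewrite e; move: (n.+1%:R : R) => a b0 a0; field; rewrite !gt_eqF.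
have : n.+2%:R ^- 2 <= (n.+1%:R * n.+2%:R)^-1 :> R.
  by rewrite lef_pV2 ?posrE ?exprn_gt0 ?mulr_gt0// expr2 ler_wpM2r ?ltW// ltr_nat.
by move: (n.+2%:R ^- 2) (n.+2%:R^-1) ((_ * _)^-1) => p q t; lra.
Qed.

Lemma sbound_int_inv_sq : exists2 B : R, 0 <= B & sbound (fun x : int => (1 + `|x|%N%:R) ^- 2) B.
Proof.
pose m (k : nat) : R := (1 + k%:R) ^- 2; have m0 k : 0 <= m k by rewrite invr_ge0 exprn_ge0 ?addr_ge0.
have nm k : normc (m k)%:C%C = m k by rewrite normc_real ger0_norm.
have s0 : csummable (fun k => (m k)%:C%C).
  by exists 2 => A; under eq_bigr do rewrite nm; exact: sbound_succ_inv_sq.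
have s1 : csummable (fun k => (m k.+1)%:C%C).
  exists 2; apply: sbound_le sbound_succ_inv_sq => k; rewrite nm lef_pV2 ?posrE ?exprn_gt0 ?ltr_pwDl//.
  by rewrite lerXn2r ?nnegrE ?addr_ge0// lerD2l ler_nat.
have t0 : csummable (fun x : int => if 0 <= x then (m `|x|%N)%:C%C else 0).
  apply: (@csummable_reindex _ _ _ (fun k => (m k)%:C%C) _ Posz absz) s0 => // x.
  by case: ifP => [x0 _|]; [rewrite gez0_abs|rewrite eqxx].
have t1 : csummable (fun x : int => if 0 <= x then 0 else (m `|x|%N)%:C%C).
  apply: (@csummable_reindex _ _ _ (fun k => (m k.+1)%:C%C) _ Negz (fun x => `|x|%N.-1)) s1 => // x.
  by case: x => [x|x] //=; rewrite eqxx.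
have [B Bm] := csummableD t0 t1; exists B; first exact: sbound_ge0 Bm.
by apply: sbound_le Bm => x; case: ifP => _; rewrite ?addr0 ?add0r nm.
Qed.

Definition alt x : C := (-1) ^+ `|x|%N.

Lemma altD x v : alt (x + v) = alt x * alt v.
Proof.
rewrite /alt -exprD -signr_odd -[RHS]signr_odd; congr (_ ^+ _); lia.
Qed.

Lemma alt1 : alt 1 = -1. Proof. by rewrite /alt expr1. Qed.

Lemma alt_sq v : alt v * alt v = 1.
Proof. by rewrite /alt -exprD addnn -signr_odd odd_double. Qed.

Lemma altN x : alt (- x) = alt x. Proof. by rewrite /alt abszN. Qed.

Lemma normc_alt x : normc (alt x) = 1.
Proof. by rewrite /alt normcX normcN' normc1 expr1n. Qed.

Definition altsum f := tsum (fun x => alt x * f x).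

Lemma csummable_alt f : csummable f -> csummable (fun x => alt x * f x).
Proof. by move=> [B fB]; exists B; apply: sbound_le fB => x; rewrite normcM normc_alt mul1r. Qed.

Lemma has_altsum f : csummable f -> has_sum (fun x => alt x * f x) (altsum f).
Proof. by move=> fs; apply/has_tsum/csummable_alt. Qed.

Lemma csummable_bij f (h k : int -> int) : cancel h k -> cancel k h -> csummable f ->
  csummable (fun x => f (h x)).
Proof.
by move=> hK kK; apply: (@csummable_reindex _ _ _ f _ k h) => x _; rewrite ?kK ?hK.
Qed.

Lemma has_altsum_shift f v : csummable f -> has_sum (fun x => alt x * f (x + v)) (alt v * altsum f).
Proof.
move=> /has_altsum/(has_sum_bij (addrK v) (subrK v))/(has_sumZ (alt v)).
apply: has_sum_ext => x /=.
rewrite altD mulrA; congr (_ * _); rewrite mulrCA alt_sq; exact: mulr1.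
Qed.

Lemma csummable_dlt f : csummable f -> csummable (dlt f).
Proof.
move=> fs; apply: csummableD; last exact: (csummable_bij (subrK 1) (addrK 1)).
apply: csummableD; first exact: (csummable_bij (addrK 1) (subrK 1)).
by under eq_fun do rewrite -mulr_natl -mulNr; exact: csummableZ.
Qed.

(** Shifting by 1 in either direction reverses the sign of the alternating sum, so the three terms
    give -1 - 2 - 1. *)
Lemma altsum_dlt f : csummable f -> altsum (dlt f) = - 4 * altsum f.
Proof.
move=> fs; apply: tsumE.
have h := has_sumD (has_sumD (has_altsum_shift 1 fs) (has_sumZ (- 2) (has_altsum fs))) (has_altsum_shift (-1) fs).
rewrite altN alt1 in h.
have -> : -4 * altsum f = -1 * altsum f + -2 * altsum f + -1 * altsum f by ring.
by apply: has_sum_ext h => x; rewrite /dlt; ring.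
Qed.

Definition asum l f : C := (- 4) ^- l * altsum (iter l dlt f).

Lemma asum_succ l f : csummable (iter l dlt f) -> asum l.+1 f = asum l f.
Proof.
move=> fs; rewrite /asum /= (altsum_dlt fs) exprS; field.
by rewrite -?natr1 ?expf_neq0 ?oppr_eq0 ?pnatr_eq0.
Qed.

Lemma csummable_iter_dlt l d f : csummable (iter l dlt f) ->
  csummable (iter (d + l) dlt f) /\ asum (d + l) f = asum l f.
Proof.
move=> fs; elim: d => [//|d [IH1 IH2]]; rewrite addSn; split; first exact: csummable_dlt.
by rewrite asum_succ.
Qed.

Definition abel_summable f := exists l, csummable (iter l dlt f).

(* Differencing multiplies a convergent alternating sum by -4, which extends alternating summation to all f
   having an absolutely summable iterated difference. *)
Definition Asum f : C := xget 0 [set a | exists2 l, csummable (iter l dlt f) & a = asum l f].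

Lemma AsumE l f : csummable (iter l dlt f) -> Asum f = asum l f.
Proof.
move=> fs; apply: xget_unique => [|a [l' fs' ->]]; first by exists l.
have [_ <-] := csummable_iter_dlt l fs'; have [_ <-] := csummable_iter_dlt l' fs.
by rewrite addnC.
Qed.

Lemma abel_pair f g : abel_summable f -> abel_summable g ->
  exists l, csummable (iter l dlt f) /\ csummable (iter l dlt g).
Proof.
move=> [l fs] [l' gs]; exists (l + l')%N; split; last by have [] := csummable_iter_dlt l gs.
by rewrite addnC; have [] := csummable_iter_dlt l' fs.
Qed.

Lemma Asum_ext f g : (forall x, f x = g x) -> Asum f = Asum g.
Proof. by move=> /funext ->. Qed.

Lemma AsumD f g : abel_summable f -> abel_summable g ->
  abel_summable (fun x => f x + g x) /\ Asum (fun x => f x + g x) = Asum f + Asum g.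
Proof.
move=> fs gs; have [l [fl gl]] := abel_pair fs gs.
have e : iter l dlt (fun x => f x + g x) = fun x => iter l dlt f x + iter l dlt g x.
  by apply/funext => x; rewrite iter_dltD.
have s : csummable (iter l dlt (fun x => f x + g x)) by rewrite e; exact: csummableD.
split; first by exists l.
rewrite (AsumE s) (AsumE fl) (AsumE gl) /asum -mulrDr e; congr (_ * _).
apply: tsumE; apply: has_sum_ext (has_sumD (has_altsum fl) (has_altsum gl)) => x.
by rewrite mulrDr.
Qed.

Lemma AsumZ c f : abel_summable f ->
  abel_summable (fun x => c * f x) /\ Asum (fun x => c * f x) = c * Asum f.
Proof.
move=> [l fl].
have e : iter l dlt (fun x => c * f x) = fun x => c * iter l dlt f x.
  by apply/funext => x; rewrite iter_dltZ.
have s : csummable (iter l dlt (fun x => c * f x)) by rewrite e; exact: csummableZ.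
split; first by exists l.
rewrite (AsumE s) (AsumE fl) /asum mulrCA e; congr (_ * _).
by apply: tsumE; apply: has_sum_ext (has_sumZ c (has_altsum fl)) => x; rewrite mulrCA.
Qed.

Lemma AsumB f g : abel_summable f -> abel_summable g ->
  abel_summable (fun x => f x - g x) /\ Asum (fun x => f x - g x) = Asum f - Asum g.
Proof.
move=> fs gs; have [ns ne] := AsumZ (-1) gs; have := AsumD fs ns; rewrite ne mulN1r.
by under eq_fun do rewrite mulN1r.
Qed.

Lemma Asum_sum n (f : 'I_n -> int -> C) : (forall i, abel_summable (f i)) ->
  abel_summable (fun x => \sum_(i < n) f i x) /\
  Asum (fun x => \sum_(i < n) f i x) = \sum_(i < n) Asum (f i).
Proof.
elim: n f => [|n IH] f fs.
  have e : (fun x => \sum_(i < 0) f i x) = fun=> 0 by apply/funext => x; rewrite big_ord0.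
  have s : csummable (iter 0 dlt (fun x : int => 0 : C)).
    by exists 0 => A; rewrite big1// => i _; rewrite normc0.
  rewrite e big_ord0; split; first by exists 0%N.
  rewrite (AsumE s) /asum /altsum (tsumE (l := 0)) ?mulr0//.
  by apply: has_sum_ext (@has_sum0 R int) => x; rewrite mulr0.
have -> : (fun x => \sum_(i < n.+1) f i x) = fun x => \sum_(i < n) f (widen_ord (leqnSn n) i) x + f ord_max x.
  by apply/funext => x; rewrite big_ord_recr.
have [s1 e1] := IH (fun i => f (widen_ord (leqnSn n) i)) (fun i => fs _).
by rewrite big_ord_recr /= -e1; apply: AsumD.
Qed.

Lemma Asum_reflect n f : abel_summable f ->
  abel_summable (fun x => f (n - x)) /\ Asum (fun x => f (n - x)) = alt n * Asum f.
Proof.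
move=> [l fl]; have nK : cancel (fun x => n - x) (fun x => n - x) by move=> x; ring.
have e : iter l dlt (fun x => f (n - x)) = fun x => iter l dlt f (n - x).
  by apply/funext => x; rewrite iter_dlt_reflect.
have s : csummable (iter l dlt (fun x => f (n - x))) by rewrite e; exact: (csummable_bij nK nK).
split; first by exists l.
rewrite (AsumE s) (AsumE fl) /asum mulrCA e; congr (_ * _); apply: tsumE.
apply: has_sum_ext (has_sumZ (alt n) (has_sum_bij nK nK (has_altsum fl))) => x /=.
by rewrite altD altN !mulrA alt_sq mul1r.
Qed.

Lemma Asum_odd f : abel_summable f -> (forall x, f (- x) = - f x) -> Asum f = 0.
Proof.
move=> fs fo; have [_] := Asum_reflect 0 fs.
have -> : (fun x => f (0 - x)) = fun x => (-1) * f x by apply/funext => x; rewrite add0r fo mulN1r.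
have [_ ->] := AsumZ (-1) fs; rewrite /alt /= expr0 mul1r mulN1r => /eqP.
by rewrite -subr_eq0 -opprD oppr_eq0 -mulr2n mulrn_eq0 /= => /eqP.
Qed.

Lemma Asum_poly m f : polyint m f -> Asum f = 0.
Proof.
move=> [p pm fp].
have z : iter m dlt f = fun=> 0.
  apply/funext => x; apply: polyint_iter; exists p => //; apply: leq_trans pm _.
  by rewrite -addnn leq_addr.
have s : csummable (iter m dlt f) by rewrite z; exists 0 => A; rewrite big1// => i _; rewrite normc0.
rewrite (AsumE s) /asum z /altsum (tsumE (l := 0)) ?mulr0//.
by apply: has_sum_ext (@has_sum0 R int) => x; rewrite mulr0.
Qed.

End AbelSums.

(** * The continued series *)

Section Continuation.
Variable R : realType.
Local Notation C := R[i].
Implicit Types (s z : C) (x y : int) (n h : nat).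

Lemma natpowC_disc r n : disc_series r (fun s : C => natpowC n (- s)).
Proof.
apply: disc_series_ext (disc_series_exp r (- (ln n%:R)%:C%C)) => s _.
by rewrite /natpowC mulNr mulrC mulNr.
Qed.

Lemma ipow_disc r x : disc_series r (fun s : C => ipow s x).
Proof.
have [x0|x0] := eqVneq x 0.
  by apply: disc_series_ext (disc_series_cst r 0) => s _; rewrite /ipow x0 eqxx.
by apply: disc_series_ext (natpowC_disc r `|x|%N) => s _; rewrite /ipow (negbTE x0).
Qed.

Lemma bco_disc r k : disc_series r (fun s : C => bco s 1 k).
Proof.
apply: disc_series_prod => i; apply: disc_seriesM; last exact: disc_series_cst.
by apply: disc_seriesD; [exact: disc_series_id|exact: disc_series_cst].
Qed.

Lemma psi_disc r n K x : disc_series r (fun s : C => psi s n K x).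
Proof.
apply: disc_seriesM; last exact: ipow_disc.
apply: disc_seriesM; first exact: natpowC_disc.
apply: disc_series_sum => k; apply: disc_seriesM; [exact: bco_disc|exact: disc_series_cst].
Qed.

Lemma disc_seriesZ r c f : disc_series r f -> disc_series r (fun s : C => c * f s).
Proof. by move=> fd; apply: disc_seriesM => //; exact: disc_series_cst. Qed.

Lemma disc_seriesB r f g : disc_series r f -> disc_series r g -> disc_series r (fun s : C => f s - g s).
Proof.
move=> fd gd; have := disc_seriesD fd (disc_seriesZ (-1) gd).
by under eq_fun do rewrite mulN1r.
Qed.

Lemma theta_disc r n K x : disc_series r (fun s : C => theta s n K x).
Proof.
apply: disc_seriesB; last exact: psi_disc; apply: disc_seriesB; last exact: psi_disc.
by apply: disc_seriesM; exact: ipow_disc.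
Qed.

Lemma iter_dlt_disc r (F : C -> int -> C) l x : (forall y, disc_series r (fun s => F s y)) ->
  disc_series r (fun s => iter l dlt (F s) x).
Proof.
move=> Fd; elim: l x => [|l IH] x; first exact: Fd.
apply: disc_seriesD; last exact: IH; apply: disc_seriesB; first exact: IH.
by under eq_fun do rewrite mulr2n; apply: disc_seriesD; exact: IH.
Qed.

Definition Hk k s := Asum (fun x => x%:~R ^+ k * ipow s x).

Lemma Hk_summable r k s : normc s <= r%:R ->
  csummable (iter (r + k + 2) dlt (fun x => x%:~R ^+ k * ipow s x)).
Proof.
move=> sr; have [] := @ipow_dlt_le R r (r + k + 2) _ k; [lia|lia|move=> D D0 h].
have [B B0 Bs] := sbound_int_inv_sq R.
exact: (csummable_le (m := fun x => D * (1 + `|x|%N%:R) ^- 2) (fun x => h s x sr) (sboundZ D0 Bs)).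
Qed.

Lemma Hk_abel k s : abel_summable (fun x => x%:~R ^+ k * ipow s x).
Proof.
have [r sr] : exists r : nat, normc s <= r%:R.
  by exists (Num.truncn (normc s)).+1; apply/ltW/truncnS_gt.
by exists (r + k + 2)%N; exact: Hk_summable.
Qed.

Lemma Hk_disc (r k : nat) : disc_series r%:R (Hk k).
Proof.
set l := (r + k + 2)%N; have [] := @ipow_dlt_le R r l _ k; [rewrite /l; lia|rewrite /l; lia|move=> D D0 h].
have [B B0 Bs] := sbound_int_inv_sq R.
have w : disc_series r%:R (fun s => tsum (fun x => alt R x * iter l dlt (fun x => x%:~R ^+ k * ipow s x) x)).
  apply: (weierstrass (M := fun x => D * (1 + `|x|%N%:R) ^- 2) _ _ (sboundZ D0 Bs)) => [x|x s sr].
    apply: disc_seriesZ; apply: iter_dlt_disc => y; apply: disc_seriesZ; exact: ipow_disc.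
  by rewrite normcM normc_alt mul1r h// ltW.
apply: disc_series_ext (disc_seriesZ ((- 4) ^- l) w) => s sr.
by rewrite /Hk (AsumE (Hk_summable k (ltW sr))).
Qed.

(** The truncation order is even, so each step in [J] adds one even term and one odd term, and the
    odd one has Abel sum 0. *)
Definition Rn J n s := natpowC n (- s) * Asum (theta s n J.*2).

Section Tail.
Variables (r J : nat).
Hypothesis rJ : (r < J)%N.
Let K := J.*2.
(** A number of differences that suffices for every s with |s| <= r; [rJ] makes K at least 2r +
    2. *)
Let l := (r + r + r + K + 4)%N.

Lemma theta_dlt_bound : exists2 D : R, 0 <= D & forall s n x, normc s <= r%:R -> (0 < n)%N ->
  normc (natpowC n (- s) * iter l dlt (theta s n K) x) <=
    D / n%:R ^+ 2 * ((1 + `|x|%N%:R) ^- 2 + (1 + `|(n%:Z - x)%R|%N%:R) ^- 2).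
Proof.
by apply: theta_dlt_le; rewrite /l /K; lia.
Qed.

Lemma theta_sbound : exists2 B : R, 0 <= B & forall n,
  sbound (fun x => (1 + `|x|%N%:R) ^- 2 + (1 + `|(n%:Z - x)%R|%N%:R) ^- 2) (B + B).
Proof.
have [B B0 Bs] := sbound_int_inv_sq R; exists B => // n A; rewrite big_split lerD//=.
apply: (sbound_inj (h := fun x => n%:Z - x) _ Bs) => x y /addrI; exact: oppr_inj.
Qed.

Lemma theta_summable s n : normc s <= r%:R -> (0 < n)%N -> csummable (iter l dlt (theta s n K)).
Proof.
move=> sr n0; have [D D0 h] := theta_dlt_bound; have [B B0 Bs] := theta_sbound.
have c0 : 0 <= D / n%:R ^+ 2 by rewrite divr_ge0 ?exprn_ge0.
have cs := csummable_le (m := fun x => D / n%:R ^+ 2 * ((1 + `|x|%N%:R) ^- 2 + (1 + `|(n%:Z - x)%R|%N%:R) ^- 2))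
  (fun x => h s n x sr n0) (sboundZ c0 (Bs n)).
have := csummableZ (natpowC n (- s))^-1 cs.
by under eq_fun do rewrite mulrA mulVf ?natpowC_neq0// mul1r.
Qed.

Lemma RnE s n : normc s <= r%:R -> (0 < n)%N ->
  Rn J n s = (- 4) ^- l * tsum (fun x => natpowC n (- s) * (alt R x * iter l dlt (theta s n K) x)).
Proof.
move=> sr n0; have cs := theta_summable sr n0; rewrite /Rn (AsumE cs) /asum mulrCA; congr (_ * _).
by symmetry; apply: tsumE; apply: has_sumZ; exact: has_altsum.
Qed.

(** The bound D / n^2 times a sum over [x] bounded independently of [n] is summable over the even
    [n], and it serves as majorant for both summations. *)
Lemma Rn_weierstrass : exists (M : nat -> R) (B : R),
  [/\ sbound M B, forall h s, normc s <= r%:R -> normc (Rn J h.+1.*2 s) <= M h &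
      forall h, disc_series r%:R (Rn J h.+1.*2)].
Proof.
have [D D0 bd] := theta_dlt_bound; have [B B0 Bs] := theta_sbound.
have c0 n : 0 <= D / n%:R ^+ 2 :> R by rewrite divr_ge0 ?exprn_ge0.
pose m n x : R := D / n%:R ^+ 2 * ((1 + `|x|%N%:R) ^- 2 + (1 + `|(n%:Z - x)%R|%N%:R) ^- 2).
have ms n : sbound (m n) (D / n%:R ^+ 2 * (B + B)) := sboundZ (c0 n) (Bs n).
have mb s n x : normc s <= r%:R -> (0 < n)%N ->
    normc (natpowC n (- s) * (alt R x * iter l dlt (theta s n K) x)) <= m n x.
  by move=> sr n0; rewrite mulrCA normcM normc_alt mul1r bd.
pose q : R := normc ((- 4) ^- l : C).
exists (fun h => q * (D * (B + B)) * (1 + h%:R) ^- 2), (q * (D * (B + B)) * 2); split.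
- apply: sboundZ; last exact: sbound_succ_inv_sq.
  by rewrite mulr_ge0 ?normc_ge0// mulr_ge0 ?addr_ge0.
- move=> h s sr; have n0 : (0 < h.+1.*2)%N by rewrite double_gt0.
  rewrite (RnE sr n0) normcM -mulrA; apply: (ler_wpM2l (normc_ge0 _)).
  have cs := csummable_le (fun x => mb s _ x sr n0) (ms _).
  apply: le_trans (normc_has_sum (has_tsum cs) _) _; first by apply: sbound_le (ms _) => x; exact: mb.
  rewrite -mulrA [_^-1 * _]mulrC mulrA; apply: ler_wpM2l; first by rewrite mulr_ge0 ?addr_ge0.
  have a0 : 0 < 1 + h%:R :> R by rewrite nat1r ltr0n.
  have b0 : 0 < h.+1.*2%:R :> R by rewrite ltr0n.
  have ab : 1 + h%:R <= h.+1.*2%:R :> R by rewrite nat1r ler_nat; lia.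
  by rewrite lef_pV2 ?posrE ?exprn_gt0// lerXn2r ?nnegrE ?(ltW a0) ?(ltW b0).
- move=> h; have n0 : (0 < h.+1.*2)%N by rewrite double_gt0.
  pose f x s := natpowC h.+1.*2 (- s) * (alt R x * iter l dlt (theta s h.+1.*2 K) x).
  have fd x : disc_series r%:R (f x).
    apply: disc_seriesM; first exact: natpowC_disc.
    by apply: disc_seriesZ; apply: iter_dlt_disc => y; exact: theta_disc.
  have fb x s : normc s < r%:R -> normc (f x s) <= m h.+1.*2 x by move=> sr; apply: mb => //; exact: ltW.
  apply: disc_series_ext (disc_seriesZ ((- 4) ^- l) (weierstrass fd fb (ms h.+1.*2))) => s sr.
  by rewrite (RnE (ltW sr) n0).
Qed.

Definition tail s := tsum (fun h => Rn J h.+1.*2 s).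

Lemma Rn_summable s : normc s <= r%:R -> csummable (fun h => Rn J h.+1.*2 s).
Proof.
move=> sr; have [M [B [MB bd _]]] := Rn_weierstrass.
exact: (csummable_le (fun h => bd h s sr) MB).
Qed.

Lemma tail_disc : disc_series r%:R tail.
Proof.
have [M [B [MB bd dd]]] := Rn_weierstrass.
by apply: (weierstrass dd _ MB) => h s sr; apply: bd; exact: ltW.
Qed.

End Tail.

End Continuation.

(** * Agreement with the convergent series *)

Section Dirichlet.
Variable R : realType.
Local Notation C := R[i].
Local Notation Re := (@complex.Re R).
Implicit Types (s z : C) (x y : int) (n h : nat).

Lemma sum_double (F : nat -> C) J : \sum_(k < J.*2) F k = \sum_(j < J) (F j.*2 + F j.*2.+1).
Proof.
elim: J => [|J IH]; first by rewrite !big_ord0.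
by rewrite doubleS !big_ord_recr /= IH addrA.
Qed.

Lemma Hk_odd k s : odd k -> Hk k s = 0.
Proof.
move=> ko; apply: Asum_odd; first exact: Hk_abel.
by move=> x; rewrite ipow_opp rmorphN /= exprNn -signr_odd ko expr1 mulN1r mulNr.
Qed.

Lemma Asum_psi s n K : abel_summable (psi s n K) /\
  Asum (psi s n K) = \sum_(k < K) natpowC n (- s) * bco s 1 k / n%:R ^+ k * Hk k s.
Proof.
have -> : psi s n K = fun x => \sum_(k < K) (natpowC n (- s) * bco s 1 k / n%:R ^+ k) * (x%:~R ^+ k * ipow s x).
  apply/funext => x; rewrite /psi mulr_sumr mulr_suml; apply: eq_bigr => k _.
  by rewrite expr_div_n; ring.
have [] := Asum_sum (f := fun k x => (natpowC n (- s) * bco s 1 k / n%:R ^+ (nat_of_ord k)) *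
   (x%:~R ^+ (nat_of_ord k) * ipow s x)) (n := K); first by move=> k; apply: (AsumZ _ (Hk_abel _ _)).1.
move=> h1 h2; split => //; rewrite h2; apply: eq_bigr => k _; exact: (AsumZ _ (Hk_abel _ _)).2.
Qed.

Lemma theta_abel s n J : normc s <= J%:R - 1 -> (0 < n)%N -> abel_summable (theta s n J.*2).
Proof.
case: J => [|J]; first by move/(le_trans (normc_ge0 _)) => h; exfalso; lra.
rewrite -natr1 addrK => sr n0; eexists; exact: (theta_summable (leqnn _) sr n0).
Qed.

Lemma phi_abel s n : (0 < n)%N -> abel_summable (phi s n).
Proof.
move=> n0; pose J := (Num.truncn (normc s)).+2.
have sJ : normc s <= J%:R - 1.
  by rewrite /J -natr1 addrK; apply/ltW/truncnS_gt.
have t := theta_abel sJ n0; have [p _] := Asum_psi s n J.*2.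
have [q _] := Asum_reflect n%:Z p; have [tp _] := AsumD t p; have [tpq _] := AsumD tp q.
have -> : phi s n = fun x => theta s n J.*2 x + psi s n J.*2 x + psi s n J.*2 (n%:Z - x) => //.
by apply/funext => x; rewrite /theta; ring.
Qed.

Definition phisum s n := natpowC n (- s) * Asum (phi s n).

(** For even [n] the reflection x -> n - x preserves the sign, so the two subtractions have equal
    Abel sums and account for the factor 2. *)
Lemma Rn_phisum J n s : (0 < n)%N -> ~~ odd n -> Rn J n s =
  phisum s n - \sum_(j < J) 2 * bco s 1 j.*2 * Hk j.*2 s * natpowC n (- (2 * s + j.*2%:R)).
Proof.
move=> n0 ne; have [p pe] := Asum_psi s n J.*2; have [q qe] := Asum_reflect n%:Z p.
have [a ae] := AsumB (phi_abel s n0) p; have [_ be] := AsumB a q.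
have an : alt R n%:Z = 1 by rewrite /alt /= -signr_odd (negbTE ne).
have thE : Asum (theta s n J.*2) = Asum (phi s n) - Asum (psi s n J.*2) *+ 2.
  apply: (etrans be (etrans (congr2 (fun u v => u - v) ae qe) _)).
  by rewrite an; move: (Asum (phi s n)) (Asum (psi s n J.*2)) => u v; ring.
rewrite /Rn thE mulrBr; congr (_ - _).
rewrite pe (sum_double (fun k => natpowC n (- s) * bco s 1 k / n%:R ^+ k * Hk k s)).
rewrite -[X in _ * X = _]mulr_natl !mulr_sumr; apply: eq_bigr => j _.
rewrite (Hk_odd (k := j.*2.+1)) /= ?odd_double// mulr0 addr0.
have -> : - (2 * s + j.*2%:R) = - s + - s + - j.*2%:R by ring.
rewrite (natpowCD n (- s - s)) (natpowCD n (- s) (- s)) (natpowCN n j.*2%:R) (natpowC_nat _ _ n0).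
by move: (natpowC n (- s)) (bco s 1 _) (n%:R ^+ _)^-1 (Hk _ _) => a' b' c' d'; ring.
Qed.

Lemma natpowC_norm_le n z : (0 < n)%N -> 2 <= Re z -> normc (natpowC n (- z)) <= n%:R ^- 2.
Proof.
move=> n0 z2; have n0R : 0 < n%:R :> R by rewrite ltr0n.
rewrite /natpowC normc_expC; case: z z2 => a b /= a2; rewrite mulr0 subr0.
have -> : n%:R ^- 2 = expR (- 2 * ln n%:R) :> R.
  by rewrite mulNr expRN expRM_natl lnK.
rewrite ler_expR ler_wpM2r ?lerN2// ln_ge0// ler1n//.
Qed.

Lemma ipow_norm_le z x : 2 <= Re z -> normc (ipow z x) <= 4 * (1 + `|x|%N%:R) ^- 2.
Proof.
move=> z2; have p0 : 0 <= 4 * (1 + `|x|%N%:R) ^- 2 :> R.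
  by apply: (mulr_ge0 (ler0n _ 4)); rewrite invr_ge0 exprn_ge0 ?addr_ge0.
rewrite /ipow; case: eqVneq => [_|x0]; first by rewrite normc0.
have m0 : (0 < `|x|)%N by rewrite absz_gt0.
apply: le_trans (natpowC_norm_le m0 z2) _.
have X1 : 1 <= `|x|%N%:R :> R by rewrite ler1n.
have -> : `|x|%N%:R ^- 2 = 4 * (2 * `|x|%N%:R) ^- 2 :> R.
  by field; rewrite gt_eqF// (lt_le_trans ltr01).
exact: (ler_wpM2l (ler0n _ 4) (one_plus_le X1)).
Qed.

Lemma ipow_norm_le1 z x : 2 <= Re z -> normc (ipow z x) <= 1.
Proof.
move=> z2; rewrite /ipow; case: eqVneq => [_|x0]; first by rewrite normc0.
have m0 : (0 < `|x|)%N by rewrite absz_gt0.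
apply: le_trans (natpowC_norm_le m0 z2) _.
by rewrite invf_le1 ?exprn_gt0 ?ltr0n// expr_ge1 ?ler0n ?ler1n.
Qed.

Lemma ipow_summable z : 2 <= Re z -> csummable (ipow z).
Proof.
move=> z2; have [B B0 Bs] := sbound_int_inv_sq R.
exact: (csummable_le (fun x => ipow_norm_le x z2) (sboundZ (ler0n _ 4) Bs)).
Qed.

(* The continuation of the sum of (2h)^-z over h > 0. *)
Definition Zf z : C := Hk 0 z / (2 * (2 - natpowC 2 z)).

Section EvenZeta.
Variable z : C.
Hypothesis z2 : 2 <= Re z.
Let p m := natpowC m.+1 (- z).
Let e h := natpowC h.+1.*2 (- z).

Lemma natpow_summable : csummable p.
Proof.
have B := sbound_succ_inv_sq R; apply: (csummable_le _ B) => m.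
by rewrite nat1r natpowC_norm_le.
Qed.

Lemma even_natpow h : e h = natpowC 2 (- z) * p h.
Proof. by rewrite /e -mul2n natpowCM. Qed.

(** Over nonzero x, the sum of (-1)^x |x|^-z is 2 (2 * 2^-z - 1) zeta(z), while the even terms alone
    sum to 2^-z zeta(z). *)
Lemma Hk0E : Hk 0 z = 2 * (2 - natpowC 2 z) * tsum e.
Proof.
have ps := natpow_summable; have T := has_tsum ps; set t := tsum p in T.
have He : has_sum e (natpowC 2 (- z) * t).
  by apply: has_sum_ext (has_sumZ _ T) => h; rewrite even_natpow.
rewrite (tsumE He).
pose ev m := if odd m then p m else 0.
have Hev : has_sum ev (natpowC 2 (- z) * t).
  apply: (@has_sum_reindex _ _ _ e ev (fun h => h.*2.+1) half) He => [h _|m].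
    by rewrite /ev /= odd_double uphalf_double /e doubleS.
  rewrite /ev; case: ifP => [mo _|]; last by rewrite eqxx.
  have mm : m./2.*2.+1 = m by rewrite -[RHS]odd_double_half mo.
  by rewrite /e doubleS mm.
pose v m := (-1) ^+ m.+1 * p m.
have Hv : has_sum v (2 * (natpowC 2 (- z) * t) - t).
  apply: has_sum_ext (has_sumB (has_sumZ 2 Hev) T) => m.
  by rewrite /v /ev -signr_odd /=; case: (odd m) => /=; ring.
pose up x := if 0 < x then alt R x * ipow z x else 0.
pose un x := if x < 0 then alt R x * ipow z x else 0.
have Hup : has_sum up (2 * (natpowC 2 (- z) * t) - t).
  apply: (@has_sum_reindex _ _ _ v up (fun m => m.+1%:Z) (fun x => `|x|%N.-1)) Hv => [m _|x].
    by rewrite /up /ipow.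
  by rewrite /up; case: x => [[|m]|m] //=; rewrite ?eqxx.
have Hun : has_sum un (2 * (natpowC 2 (- z) * t) - t).
  apply: (@has_sum_reindex _ _ _ v un Negz (fun x => `|x|%N.-1)) Hv => [m _|x].
    by rewrite /un /ipow.
  by rewrite /un; case: x => [m|m] //=; rewrite ?eqxx.
have c0 : csummable (iter 0 dlt (fun x => x%:~R ^+ 0 * ipow z x)).
  by have := ipow_summable z2; congr csummable; apply/funext => x; rewrite /= expr0 mul1r.
rewrite /Hk (AsumE c0) /asum expr0 invr1 mul1r /altsum.
rewrite (tsumE (l := 2 * (natpowC 2 (- z) * t) - t + (2 * (natpowC 2 (- z) * t) - t))).
  have := natpowC_neq0 2 z; rewrite natpowCN; move: (natpowC 2 z) => q q0; by field.
apply: has_sum_ext (has_sumD Hup Hun) => x; rewrite /up /un /= expr0 mul1r.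
case: (ltrgt0P x) => x0; rewrite ?addr0 ?add0r//.
by rewrite x0 /ipow eqxx mulr0.
Qed.

Lemma two_sub_natpowC2 : 2 - natpowC 2 z != 0.
Proof.
apply/negP => /eqP/subr0_eq h; have := natpowC_norm_le (n := 2) isT z2.
rewrite natpowCN -h normcV normc_nat lef_pV2 ?posrE ?exprn_gt0//; lra.
Qed.

Lemma has_sum_Zf : has_sum e (Zf z).
Proof.
have es : csummable e.
  by have := csummableZ (natpowC 2 (- z)) natpow_summable; congr csummable; apply/funext => h; rewrite even_natpow.
rewrite /Zf Hk0E mulrC mulKf; first exact: has_tsum.
by rewrite mulf_neq0 ?two_sub_natpowC2// pnatr_eq0.
Qed.

End EvenZeta.

(* The continuation of the sum over h > 0 of (2h)^-s times the alternating sum of [phi s (2h)]; the terms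
   subtracted from [phi] in [theta] are summed over h separately. *)
Definition EJ J s := \sum_(j < J) 2 * bco s 1 j.*2 * Hk j.*2 s * Zf (2 * s + j.*2%:R) + tail J s.

Lemma Re_double_add s a : Re (2 * s + a%:R) = 2 * Re s + a%:R.
Proof.
have -> : a%:R = (a%:R : R)%:C%C :> C by rewrite rmorph_nat.
by case: s => u v; rewrite mulr_natl mulr2n /=; lra.
Qed.

(** Passing from J to J + 1 moves one term from under the sum over h in the tail to the finite part;
    for |s| <= J - 1 its series converges and equals [Zf]. *)
Lemma EJ_succ J s : normc s <= J%:R - 1 -> EJ J.+1 s = EJ J s.
Proof.
case: J => [|r]; first by move/(le_trans (normc_ge0 _)) => h; exfalso; lra.
rewrite -natr1 addrK => sr; set J := r.+1.
(* The margin is exact: |s| <= r and J = r + 1 give -2r + 2 (r + 1) = 2. *)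
have z2 : 2 <= Re (2 * s + J.*2%:R).
  rewrite Re_double_add; have := le_trans (Re_le_normc s) sr; rewrite ler_norml => /andP[h _].
  by rewrite -muln2 natrM /J -natr1; lra.
have h1 := has_tsum (Rn_summable (ltnSn r) sr).
have h2 := has_tsum (Rn_summable (leqW (ltnSn r)) sr).
have h3 := has_sumZ (2 * bco s 1 J.*2 * Hk J.*2 s) (has_sum_Zf z2).
rewrite /EJ big_ord_recr /= -addrA; congr (_ + _); rewrite addrC; symmetry; apply: tsumE.
apply: has_sum_ext (has_sumD h2 h3) => h.
rewrite !Rn_phisum ?double_gt0 ?odd_double// big_ord_recr /=; ring.
Qed.

Lemma has_sum_EJ J s : normc s <= J%:R - 1 -> 2 <= Re s -> has_sum (fun h => phisum s h.+1.*2) (EJ J s).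
Proof.
case: J => [|r]; first by move/(le_trans (normc_ge0 _)) => h; exfalso; lra.
rewrite -natr1 addrK => sr s2; set J := r.+1.
have h1 := has_tsum (Rn_summable (ltnSn r) sr); rewrite -/J in h1.
have z2 j : 2 <= Re (2 * s + j.*2%:R).
  by rewrite Re_double_add; have : 0 <= j.*2%:R :> R by []; lra.
have h2 j := has_sumZ (2 * bco s 1 j.*2 * Hk j.*2 s) (has_sum_Zf (z2 j)).
have h3 := has_sum_big (index_enum 'I_J) (fun j : 'I_J => h2 j).
apply: has_sum_ext (has_sumD h3 h1) => h.
by rewrite Rn_phisum ?double_gt0 ?odd_double// addrC subrK.
Qed.

Lemma phisumE s n : 2 <= Re s -> phisum s n = natpowC n (- s) * altsum (phi s n).
Proof.
move=> s2; have c : csummable (iter 0 dlt (phi s n)).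
  have [B ps] := ipow_summable s2; exists B; apply: sbound_le ps => x.
  by rewrite /phi normcM ler_piMr ?normc_ge0 ?ipow_norm_le1.
by rewrite /phisum (AsumE c) /asum expr0 invr1 mul1r.
Qed.

Definition triple s (a : nat * int) : C :=
  natpowC a.1.+1.*2 (- s) * (alt R a.2 * phi s a.1.+1.*2 a.2).

Lemma triple_summable s : 2 <= Re s -> csummable (triple s).
Proof.
move=> s2; have [B B0 Bs] := sbound_int_inv_sq R.
have S := sbound_prod (m := fun h : nat => (1 + h%:R) ^- 2 : R) _ _ (sbound_succ_inv_sq R) (sboundZ (ler0n _ 4) Bs).
apply: (csummable_le _ (S _ _)) => [[h x]|h|x] /=.
- rewrite /triple /= normcM ler_pM ?normc_ge0//; last first.
    rewrite normcM normc_alt mul1r; apply: le_trans (ipow_norm_le x s2).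
    by rewrite /phi normcM ler_piMr ?normc_ge0 ?ipow_norm_le1.
  apply: le_trans (natpowC_norm_le _ s2) _; first by rewrite double_gt0.
  have a0 : 0 < 1 + h%:R :> R by rewrite nat1r ltr0n.
  have b0 : 0 < h.+1.*2%:R :> R by rewrite ltr0n.
  have ab : 1 + h%:R <= h.+1.*2%:R :> R by rewrite nat1r ler_nat; lia.
  by rewrite lef_pV2 ?posrE ?exprn_gt0// lerXn2r ?nnegrE ?(ltW a0) ?(ltW b0).
- by rewrite invr_ge0 exprn_ge0 ?addr_ge0.
- by apply: (mulr_ge0 (ler0n _ 4)); rewrite invr_ge0 exprn_ge0 ?addr_ge0.
Qed.

Lemma EJ_triple J s : normc s <= J%:R - 1 -> 2 <= Re s -> has_sum (triple s) (EJ J s).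
Proof.
move=> sJ s2; have ts := triple_summable s2.
have hr h : has_sum (fun x => triple s (h, x)) (phisum s h.+1.*2).
  rewrite phisumE// /triple /=; apply: (@has_sumZ R int (natpowC h.+1.*2 (- s))); apply/has_tsum/csummable_alt.
  have [B ps] := ipow_summable s2; exists B; apply: sbound_le ps => x.
  by rewrite /phi normcM ler_piMr ?normc_ge0 ?ipow_norm_le1.
rewrite (has_sum_uniq (has_sum_EJ sJ s2) (has_sum_iterated ts hr)); exact: has_tsum.
Qed.

End Dirichlet.

(** * Sorting by parity *)

Section Parity.
Variable R : realType.
Local Notation C := R[i].
Local Notation Re := (@complex.Re R).
Implicit Types (z : C) (x y : int).

Lemma ipow_abs z x : ipow z `|x|%N = ipow z x.
Proof. by rewrite /ipow absz_nat; case: x. Qed.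

Lemma ipow_eq0 z x : (ipow z x == 0) = (x == 0).
Proof. by rewrite /ipow; case: ifP => [|_]; rewrite ?eqxx// (negbTE (natpowC_neq0 _ _)). Qed.

Lemma ipow_double z (m : nat) : ipow z m.*2 = natpowC 2 (- z) * ipow z m.
Proof.
rewrite /ipow !eqz_nat double_eq0; case: eqVneq => [_|m0]; first by rewrite mulr0.
by rewrite !absz_nat -mul2n natpowCM// lt0n.
Qed.

Definition tornheim z (a : nat * nat) : C := ipow z a.1 * ipow z a.2 * ipow z (a.1 + a.2)%N.

Lemma tornheim_support z m n : tornheim z (m, n) != 0 -> (0 < m)%N /\ (0 < n)%N.
Proof. by rewrite !mulf_eq0 !ipow_eq0 !negb_or /= => /andP[/andP[]]; lia. Qed.

(** Checked on the four parity classes. The right side is what the three ranges of x contribute, the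
    left side 4 times the even-even part minus everything. *)
Lemma parity_weights (m n : nat) (t : C) : 4 * (if odd m || odd n then 0 else t) - t =
  (if odd (m + n) then 0 else (-1) ^+ m * t) + (if odd n then 0 else (-1) ^+ m * t) +
  (if odd m then 0 else (-1) ^+ n * t).
Proof.
have sg k : (-1) ^+ k = (-1) ^+ odd k :> C by rewrite signr_odd.
rewrite (sg m) (sg n) oddD; case: (odd m); case: (odd n) => /=; ring.
Qed.

Variables (s : C).
Hypothesis s2 : 2 <= Re s.

Lemma tornheim_summable : csummable (tornheim s).
Proof.
have B := sboundZ (ler0n R 4) (sbound_succ_inv_sq R).
have m0 k : 0 <= 4 * (1 + k%:R) ^- 2 :> R.
  by apply: (mulr_ge0 (ler0n _ 4)); rewrite invr_ge0 exprn_ge0 ?addr_ge0.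
apply: (csummable_le _ (sbound_prod m0 m0 B B)) => -[m n] /=.
rewrite /tornheim normcM; apply: le_trans (ler_piMr (normc_ge0 _) (ipow_norm_le1 _ s2)) _.
by rewrite normcM ler_pM ?normc_ge0//; exact: ipow_norm_le.
Qed.

Let q := natpowC 2 (- s).
Let w1 a := if odd (a.1 + a.2) then 0 else (-1) ^+ a.1 * tornheim s a.
Let w2 a := if odd a.1 then 0 else (-1) ^+ a.2 * tornheim s a.
Let ee a := if odd a.1 || odd a.2 then 0 else tornheim s a.

(** Halving both indices takes one factor 2^-s out of each of m, n and m + n. *)
Lemma has_sum_even_even : has_sum ee (q ^+ 3 * tsum (tornheim s)).
Proof.
apply: (@has_sum_reindex _ _ _ (fun a => q ^+ 3 * tornheim s a) _
  (fun a => (a.1.*2, a.2.*2)) (fun a => (a.1./2, a.2./2))); last first.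
- by apply: has_sumZ; apply: has_tsum; exact: tornheim_summable.
- move=> [m n]; rewrite /ee /=; case: ifP => [|/norP]; first by rewrite eqxx.
  move=> [mo no] _; rewrite !even_halfK//; split=> //.
  rewrite -{2}(even_halfK mo) -{2}(even_halfK no) /tornheim /= -doubleD !ipow_double -/q; ring.
move=> [m n] _; rewrite /ee /= !odd_double !doubleK; split=> //.
by rewrite /tornheim /= -doubleD !ipow_double -/q; ring.
Qed.

Let T (P : nat * int -> bool) a := if P a then triple s a else 0.

Lemma has_sum_region (P : nat * int -> bool) (w : nat * nat -> C) f g :
  (forall a, P a -> g (f a) = a /\ w (f a) = triple s a) ->
  (forall b, w b != 0 -> P (g b) /\ f (g b) = b) -> has_sum w (tsum (T P)).
Proof.
move=> fP gP; have Ts : csummable (T P).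
  apply: (csummable_sub (triple_summable s2)) => a;
  by rewrite /T; case: ifP; [left|right].
apply: (@has_sum_reindex _ _ _ (T P) w f g) (has_tsum Ts) => [a|b wb].
  by rewrite /T; case: ifP => [Pa _|_]; [exact: fP|rewrite eqxx].
have [Pb fb] := gP _ wb; split=> //; rewrite /T Pb; have [_ <-] := fP _ Pb; by rewrite fb.
Qed.

(** With 2h for [a.1.+1.*2], the three ranges correspond to (m, n) = (x, 2h - x), (2h, -x) and (2h,
    x - 2h); in each the factors of the summand belong to m, n and m + n. The points x = 0 and x =
    2h contribute 0. *)
Let P1 (a : nat * int) := (0 < a.2) && (a.2 < a.1.+1.*2%:Z).
Let P2 (a : nat * int) := a.2 < 0.
Let P3 (a : nat * int) := a.1.+1.*2%:Z < a.2.

Lemma tripleE h x : triple s (h, x) =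
  (-1) ^+ `|x|%N * (ipow s h.+1.*2 * ipow s `|x|%N * ipow s `|(h.+1.*2%:Z - x)%R|%N).
Proof. by rewrite /triple /phi !ipow_abs /= /alt /ipow /=; ring. Qed.

Lemma has_sum_w1 : has_sum w1 (tsum (T P1)).
Proof.
apply: (has_sum_region (f := fun a => (`|a.2|%N, `|(a.1.+1.*2%:Z - a.2)%R|%N))
  (g := fun b => ((b.1 + b.2)./2.-1, b.1%:Z))) => [[h x] /andP[/= x0 xh]|[m n]].
  have e : (`|x| + `|(h.+1.*2%:Z - x)%R|)%N = h.+1.*2 by lia.
  rewrite /w1 /= e odd_double doubleK tripleE /tornheim /= e; split; first by congr (_, _); lia.
  ring.
rewrite /w1 /=; case: ifP => [|mn]; first by rewrite eqxx.
rewrite mulf_eq0 => /norP[_ /tornheim_support[m0 n0]]; rewrite /P1 /=.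
have e : (m + n)./2.-1.+1.*2 = (m + n)%N by rewrite prednK; [rewrite even_halfK ?mn|lia].
by rewrite e; split; [lia|congr (_, _); lia].
Qed.

Lemma has_sum_w2_neg : has_sum w2 (tsum (T P2)).
Proof.
apply: (has_sum_region (f := fun a => (a.1.+1.*2, `|a.2|%N))
  (g := fun b => (b.1./2.-1, - b.2%:Z))) => [[h x] /= x0|[m n]].
  rewrite /P2 /= in x0; rewrite /w2 /= odd_double doubleK tripleE /tornheim /=.
  have -> : `|(h.+1.*2%:Z - x)%R|%N = (h.+1.*2 + `|x|)%N by lia.
  by split; [congr (_, _); lia|].
rewrite /w2 /=; case: ifP => [|mo]; first by rewrite eqxx.
rewrite mulf_eq0 => /norP[_ /tornheim_support[m0 n0]]; rewrite /P2 /=.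
have e : m./2.-1.+1.*2 = m by rewrite prednK; [rewrite even_halfK ?mo|lia].
by rewrite e abszN; split; [lia|].
Qed.

Lemma has_sum_w2_pos : has_sum w2 (tsum (T P3)).
Proof.
apply: (has_sum_region (f := fun a => (a.1.+1.*2, `|(a.2 - a.1.+1.*2%:Z)%R|%N))
  (g := fun b => (b.1./2.-1, (b.1 + b.2)%:Z))) => [[h x] /= x0|[m n]].
  rewrite /P3 /= in x0; rewrite /w2 /= odd_double doubleK tripleE /tornheim /=.
  have e : (h.+1.*2 + `|(x - h.+1.*2%:Z)%R|)%N = `|x|%N by lia.
  have -> : `|(h.+1.*2%:Z - x)%R|%N = `|(x - h.+1.*2%:Z)%R|%N by lia.
  rewrite e; split; first by congr (_, _); lia.
  by rewrite -e exprD -[X in _ = X * _ * _]signr_odd odd_double expr0 mul1r e; ring.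
rewrite /w2 /=; case: ifP => [|mo]; first by rewrite eqxx.
rewrite mulf_eq0 => /norP[_ /tornheim_support[m0 n0]]; rewrite /P3 /=.
have e : m./2.-1.+1.*2 = m by rewrite prednK; [rewrite even_halfK ?mo|lia].
by rewrite e; split; [lia|congr (_, _); lia].
Qed.

Lemma tornheimC m n : tornheim s (n, m) = tornheim s (m, n).
Proof. by rewrite /tornheim /= addnC [X in X * _]mulrC. Qed.

Lemma EJ_tornheim J : normc s <= J%:R - 1 -> EJ J s = (4 * q ^+ 3 - 1) * tsum (tornheim s).
Proof.
move=> sJ; have ts := triple_summable s2.
have hT P : has_sum (T P) (tsum (T P)).
  by apply/has_tsum/(csummable_sub ts) => a; rewrite /T; case: ifP; [left|right].
have eT : has_sum (triple s) (tsum (T P1) + tsum (T P2) + tsum (T P3)).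
  apply: has_sum_ext (has_sumD (has_sumD (hT P1) (hT P2)) (hT P3)) => -[h x].
  rewrite /T /P1 /P2 /P3 /=; have [x0|x0|->] := ltrgt0P x; last first.
  - have z : triple s (h, 0) = 0 by rewrite tripleE /ipow /= mulr0 mul0r mulr0.
    by rewrite z /= !addr0.
  - by rewrite add0r ifF ?addr0//; apply/negP; lia.
  rewrite /= addr0; have [xh|xh|xh] := ltrgtP x h.+1.*2%:Z; rewrite ?addr0 ?add0r//.
  by rewrite tripleE xh subrr /ipow /= !mulr0.
rewrite (has_sum_uniq (EJ_triple sJ s2) eT).
have h := has_sumD (has_sumD has_sum_w1 (has_sum_swap has_sum_w2_neg)) has_sum_w2_pos.
have h' := has_sumB (has_sumZ 4 has_sum_even_even) (has_tsum tornheim_summable).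
rewrite mulrBl mul1r -mulrA; apply: (has_sum_uniq h); apply: has_sum_ext h' => -[m n].
have := parity_weights m n (tornheim s (m, n)); rewrite -{4}(tornheimC m n); exact: id.
Qed.

End Parity.

(** * Meromorphic functions *)

Section Meromorphic.
Variable K : numFieldType.
Implicit Types (f g : K -> K) (z w : K).

Lemma holomorphic_cderivable f z : holomorphic_at f z -> cderivable f z.
Proof. exact: nbhs_singleton. Qed.

(* Over R[i] neighbourhoods are only reachable through its numFieldType structure. *)
Definition nearby z (P : K -> Prop) : Prop := \forall w \near z, P w.

Lemma nearby_dist z P : nearby z P <-> exists2 d : K, 0 < d & forall w, `|w - z| < d -> P w.
Proof. exact: near_dist. Qed.

Lemma holomorphic_nearby f z : nearby z (cderivable f) -> holomorphic_at f z.
Proof. exact. Qed.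

Lemma holomorphic_ext f g z : nearby z (fun w => f w = g w) ->
  holomorphic_at f z -> holomorphic_at g z.
Proof.
move=> fg fh; near=> w; apply: (@near_eq_derivable _ _ _ f).
  by near: w; exact: nbhs_interior.
by near: w; exact: fh.
Unshelve. all: by end_near. Qed.

Lemma holomorphic_entire f z : (forall w, cderivable f w) -> holomorphic_at f z.
Proof.
move=> fd; rewrite /holomorphic_at; near=> w; exact: fd.
Unshelve. all: by end_near. Qed.

Lemma holomorphicD f g z : holomorphic_at f z -> holomorphic_at g z ->
  holomorphic_at (fun w => f w + g w) z.
Proof.
by rewrite /holomorphic_at; apply: filterS2 => w; exact: cderivableD.
Qed.

Lemma holomorphicM f g z : holomorphic_at f z -> holomorphic_at g z ->
  holomorphic_at (fun w => f w * g w) z.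
Proof.
by rewrite /holomorphic_at; apply: filterS2 => w; exact: cderivableM.
Qed.

Lemma holomorphic_neq0 f z : holomorphic_at f z -> f z != 0 -> nearby z (fun w => f w != 0).
Proof.
move=> fh fz; have fc := cderivable_continuous (holomorphic_cderivable fh).
exact: (cvgr_neq0 (f z) fc fz).
Qed.

Lemma holomorphicV f z : holomorphic_at f z -> f z != 0 -> holomorphic_at (fun w => (f w)^-1) z.
Proof.
move=> fh fz; have nz := holomorphic_neq0 fh fz; near=> w.
by apply: cderivableV; near: w.
Unshelve. all: by end_near. Qed.

Lemma holomorphic_sum (I : Type) (r : seq I) (f : I -> K -> K) z :
  (forall i, holomorphic_at (f i) z) -> holomorphic_at (fun w => \sum_(i <- r) f i w) z.
Proof.
move=> fh; elim: r => [|i r IH].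
  by apply: holomorphic_entire => w; under eq_fun do rewrite big_nil; exact: cderivable_cst.
by under eq_fun do rewrite big_cons; exact: holomorphicD.
Qed.

Lemma cderivable_subr z w : cderivable (fun w => w - z) w.
Proof. by apply: cderivableD; [exact: cderivable_id|exact: cderivable_cst]. Qed.

Lemma cderivable_opp_subr g z w : cderivable g (w - z) -> cderivable (fun w => - g (w - z)) w.
Proof.
move=> gd; have := cderivable_comp (g := fun w => w - z) (@cderivable_subr z w) gd.
by move/(cderivableM (@cderivable_cst K (-1) w)); under eq_fun do rewrite mulN1r.
Qed.

Lemma holomorphic_subX z k w0 : holomorphic_at (fun w => (w - z) ^+ k) w0.
Proof.
elim: k => [|k IH].
  by apply: holomorphic_entire => w; under eq_fun do rewrite expr0; exact: cderivable_cst.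
have h : holomorphic_at (fun w => w - z) w0.
  by apply: holomorphic_entire => w; exact: cderivable_subr.
by under eq_fun do rewrite exprS; exact: (holomorphicM h IH).
Qed.

Lemma holomorphic_meromorphic f z : holomorphic_at f z -> meromorphic_at f z.
Proof. by move=> fh; exists 0%N, f => //; apply: nearW => w; rewrite expr0 divr1. Qed.

Lemma meromorphic_ext f g z : nearby z (fun w => f w = g w) ->
  meromorphic_at f z -> meromorphic_at g z.
Proof.
move=> fg [k [h hh fh]]; exists k, h => //; near=> w.
have <- : f w = g w by near: w; apply: nbhs_dnbhs.
by near: w.
Unshelve. all: by end_near. Qed.

Lemma meromorphic_simple f q z : holomorphic_at q z -> q z != 0 ->
  nearby z (fun w => f w = (w - z) * q w) -> meromorphic_at (fun w => (f w)^-1) z.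
Proof.
move=> qh qz fq; exists 1%N, (fun w => (q w)^-1); first exact: holomorphicV.
near=> w; have -> : f w = (w - z) * q w by near: w; apply: nbhs_dnbhs.
by rewrite expr1 invfM mulrC.
Unshelve. all: by end_near. Qed.

Lemma meromorphicM f g z : meromorphic_at f z -> meromorphic_at g z ->
  meromorphic_at (fun w => f w * g w) z.
Proof.
move=> [k [f' fh fe]] [l [g' gh ge]]; exists (k + l)%N, (fun w => f' w * g' w).
  exact: holomorphicM.
near=> w; have -> : f w = f' w / (w - z) ^+ k by near: w.
have -> : g w = g' w / (w - z) ^+ l by near: w.
by rewrite exprD invfM mulrACA.
Unshelve. all: by end_near. Qed.

Lemma meromorphicD f g z : meromorphic_at f z -> meromorphic_at g z ->
  meromorphic_at (fun w => f w + g w) z.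
Proof.
move=> [k [f' fh fe]] [l [g' gh ge]].
exists (k + l)%N, (fun w => f' w * (w - z) ^+ l + g' w * (w - z) ^+ k).
  exact: (holomorphicD (holomorphicM fh (holomorphic_subX _ _ _)) (holomorphicM gh (holomorphic_subX _ _ _))).
near=> w; have -> : f w = f' w / (w - z) ^+ k by near: w.
have -> : g w = g' w / (w - z) ^+ l by near: w.
have wz : w - z != 0 by rewrite subr_eq0; near: w; exact: nbhs_dnbhs_neq.
have := expf_neq0 k wz; have := expf_neq0 l wz; rewrite exprD.
by move: (_ ^+ k) (_ ^+ l) => a b b0 a0; field; rewrite a0 b0.
Unshelve. all: by end_near. Qed.

Lemma meromorphic_sum (I : Type) (r : seq I) (f : I -> K -> K) z :
  (forall i, meromorphic_at (f i) z) -> meromorphic_at (fun w => \sum_(i <- r) f i w) z.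
Proof.
move=> fh; elim: r => [|i r IH].
  apply/holomorphic_meromorphic/holomorphic_entire => w.
  by under eq_fun do rewrite big_nil; exact: cderivable_cst.
by under eq_fun do rewrite big_cons; exact: meromorphicD.
Qed.

End Meromorphic.

(** * Poles of reciprocals of exponential polynomials *)

Section ExpPoles.
Variable R : realType.
Local Notation C := R[i].
Implicit Types (z w c : C).

Lemma expC_cderivable c z : cderivable (fun w => expC (c * w)) z.
Proof.
apply: (disc_series_derivable (disc_series_exp (normc z + 1) c)).
by rewrite ltrDl.
Qed.

Lemma series_on_shift r (a : nat -> C) f : series_on r a f ->
  exists2 g, series_on r (fun k => a k.+1) g & forall s, normc s < r -> f s = a 0%N + s * g s.
Proof.
move=> fa.
have cs0 s : s != 0 -> normc s < r -> csummable (fun k => a k.+1 * s ^+ k).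
  move=> s0 sr; have [[B Bs] _] := fa s sr.
  have cs : csummable (fun k => a k.+1 * s ^+ k.+1) by exists B; exact: (sbound_inj succn_inj Bs).
  have := csummableZ s^-1 cs; congr csummable; apply/funext => k.
  by rewrite exprS mulrCA mulKf.
have cs s : normc s < r -> csummable (fun k => a k.+1 * s ^+ k).
  move=> sr; have [->|s0] := eqVneq s 0; last exact: cs0.
  have r0 : 0 < r by apply: le_lt_trans (normc_ge0 s) sr.
  have nr : normc (r / 2)%:C%C = r / 2 by rewrite normc_real ger0_norm// divr_ge0// ltW.
  have [||B Bs] := cs0 (r / 2)%:C%C.
  - by rewrite -normc_eq0 nr gt_eqF// divr_gt0.
  - by rewrite nr; lra.
  have hk k : normc (0 : C) ^+ k <= normc (r / 2)%:C%C ^+ k.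
    by rewrite lerXn2r ?nnegrE ?normc_ge0// normc0 normc_ge0.
  exists B; apply: (sbound_le _ Bs) => k.
  have e x : normc (a k.+1 * x ^+ k) = normc (a k.+1) * normc x ^+ k by rewrite normcM normcX.
  by rewrite [leLHS]e [leRHS]e; exact: (ler_wpM2l (normc_ge0 _) (hk k)).
exists (fun s => tsum (fun k => a k.+1 * s ^+ k)) => s sr; first by split; [exact: cs|exact/has_tsum/cs].
have h := has_sumZ s (has_tsum (cs s sr)).
have h' := @has_sum_succ R (fun k => a k * s ^+ k) _ (has_sum_ext _ h).
rewrite (has_sum_uniq (fa s sr).2 (h' _)) ?expr0 ?mulr1// => k.
by rewrite exprS mulrCA.
Qed.

(* Dividing the exponential series by w - z leaves a function whose value at z is -c. *)
Lemma expC_factor c z : c != 0 -> exists2 q : C -> C, holomorphic_at q z /\ q z != 0 &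
  @nearby C z (fun w => 1 - expC (c * (w - z)) = (w - z) * q w).
Proof.
move=> c0; have [g gs ge] := series_on_shift (@series_on_exp R 1 c).
have near1 (P : C -> Prop) : (forall w, normc (w - z) < 1 -> P w) -> @nearby C z P.
  by move=> h; apply/nearby_dist; exists 1 => // w; rewrite normcE' -[1]/(1%:C%C) ltcR => /h.
exists (fun w => - g (w - z)); last first.
  by apply: near1 => w w1; rewrite (ge _ w1) expr0 fact0 divr1; ring.
split.
  apply: (@holomorphic_nearby C); apply: near1 => w w1.
  have gd : cderivable g (w - z) by apply: disc_series_derivable w1; eexists; exact: gs.
  exact: (@cderivable_opp_subr C).
have n0 : normc (0 : C) < 1 by rewrite normc0.
have h := @has_sum_1 R _ (fun k => c ^+ k.+1 / k.+1`!%:R * 0 ^+ k) 0%N.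
rewrite subrr (has_sum_uniq (gs 0 n0).2 (h _)) => [|k k0]; last by rewrite expr0n (negbTE k0) mulr0.
by rewrite expr1 expr0 mulr1 factS fact0 divr1 oppr_eq0.
Qed.

Lemma meromorphic_inv_exp A c z : c != 0 -> A != 0 ->
  meromorphic_at (fun w => (1 - A * expC (c * w))^-1) z.
Proof.
move=> c0 A0; pose h w := 1 - A * expC (c * w).
have hh : holomorphic_at h z.
  apply: holomorphic_entire => w; rewrite /h.
  under eq_fun do rewrite -mulNr; apply: cderivableD; first exact: cderivable_cst.
  by apply: cderivableM; [exact: cderivable_cst|exact: expC_cderivable].
have [hz|hz] := eqVneq (h z) 0; last exact/holomorphic_meromorphic/holomorphicV.
have [q [qh qz] qe] := expC_factor z c0.
apply: (meromorphic_simple qh qz); suff e w : h w = 1 - expC (c * (w - z)).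
  by apply/nearby_dist; have /nearby_dist[d d0 hd] := qe; exists d => // w /hd <-; rewrite -e.
have -> : c * (w - z) = c * w - c * z by ring.
rewrite expCD expCN /h mulrC; congr (1 - _ * _); apply: (mulIf (expC_neq0 (c * z))).
by rewrite mulVf ?expC_neq0// -(subr0_eq hz).
Qed.

End ExpPoles.

(** * Values at negative integers *)

Section Assembly.
Variable R : realType.
Local Notation C := R[i].
Local Notation Re := (@complex.Re R).
Implicit Types (s z w : C) (x y : int) (n N J r : nat).

Lemma cderivable_affine (K : numFieldType) (f : K -> K) (a b w : K) :
  cderivable f (a * w + b) -> cderivable (fun v : K => f (a * v + b)) w.
Proof.
move=> fd; apply: (@cderivable_comp K f (fun v : K => a * v + b)) => //.
apply: cderivableD; last exact: cderivable_cst.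
by apply: cderivableM; [exact: cderivable_cst|exact: cderivable_id].
Qed.

Lemma Hk_cderivable k s : cderivable (Hk k) s.
Proof.
exact: (disc_series_derivable (@Hk_disc R (Num.truncn (normc s)).+1 k) (truncnS_gt _)).
Qed.

Lemma natpowCE n s : natpowC n s = expC ((ln n%:R)%:C%C * s).
Proof. by rewrite /natpowC mulrC. Qed.

Lemma natpowC_cderivable n s : cderivable (natpowC n) s.
Proof.
have -> : natpowC n = fun s : C => expC ((ln n%:R)%:C%C * s) by apply/funext => w; exact: natpowCE.
exact: expC_cderivable.
Qed.

Definition den s : C := 4 * natpowC 2 (- s) ^+ 3 - 1.
Definition Zden c s : C := 2 * (2 - natpowC 2 (2 * s + c)).

Lemma ln2_neq0 : (ln 2 : R)%:C%C != 0.
Proof. by rewrite -[0]/(0%:C%C) (inj_eq (@complexI R)) gt_eqF// ln_gt0// ltr1n. Qed.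

Lemma den_cderivable s : cderivable den s.
Proof.
apply: cderivableD; last exact: cderivable_cst.
apply: cderivableM; first exact: cderivable_cst.
have -> : (fun s : C => natpowC 2 (- s) ^+ 3) = fun s => natpowC 2 (-3 * s + 0).
  apply/funext => w; rewrite addr0; have -> : -3 * w = - w - w - w by ring.
  by rewrite !natpowCD !exprS expr0 mulr1 mulrA.
apply: (@cderivable_affine C (natpowC 2)); exact: natpowC_cderivable.
Qed.

Lemma Zden_cderivable c s : cderivable (Zden c) s.
Proof.
apply: cderivableM; first exact: cderivable_cst.
have e : (fun w => 2 - natpowC 2 (2 * w + c)) = fun w => 2 + (-1) * natpowC 2 (2 * w + c).
  by apply/funext => w; rewrite mulN1r.
rewrite e; apply: cderivableD; first exact: cderivable_cst.
apply: cderivableM; first exact: cderivable_cst.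
apply: (@cderivable_affine C (natpowC 2)); exact: natpowC_cderivable.
Qed.

Lemma den_meromorphic z : @meromorphic_at C (fun s => (den s)^-1) z.
Proof.
have -> : (fun s => (den s)^-1) = fun s => (-1) * (1 - 4 * expC (-3 * (ln 2)%:C%C * s))^-1.
  apply/funext => s; rewrite mulN1r -invrN opprB; congr (_ * _ - _)^-1.
  rewrite /natpowC -expC_natmul; congr expC; ring.
apply: meromorphicM; first exact/holomorphic_meromorphic/holomorphic_entire/cderivable_cst.
by apply: meromorphic_inv_exp; rewrite ?mulf_neq0 ?ln2_neq0 ?oppr_eq0 ?pnatr_eq0.
Qed.

Lemma Zden_meromorphic c z : @meromorphic_at C (fun s => (Zden c s)^-1) z.
Proof.
have -> : (fun s => (Zden c s)^-1) =
    fun s => 4^-1 * (1 - (natpowC 2 c / 2) * expC (2 * (ln 2)%:C%C * s))^-1.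
  apply/funext => s; rewrite -invfM; congr (_^-1).
  rewrite /Zden natpowCD [natpowC 2 (2 * s)]natpowCE mulrA [_ * 2]mulrC; by field.
apply: meromorphicM; first exact/holomorphic_meromorphic/holomorphic_entire/cderivable_cst.
apply: meromorphic_inv_exp; rewrite ?mulf_neq0 ?invr_eq0 ?natpowC_neq0 ?ln2_neq0 ?pnatr_eq0//.
Qed.

Lemma nearby_disc r z (P : C -> Prop) : normc z < r%:R ->
  (forall w, normc w < r%:R -> P w) -> @nearby C z P.
Proof.
move=> zr h; apply/nearby_dist; exists (r%:R - normc z)%:C%C; first by rewrite ltcR subr_gt0.
move=> w; rewrite normcE' ltcR => wz; apply: h.
have -> : w = z + (w - z) by rewrite addrC subrK.
by apply: le_lt_trans (normcD _ _) _; lra.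
Qed.

Lemma tail_holomorphic r J z : normc z < r%:R -> (r < J)%N -> @holomorphic_at C (tail J) z.
Proof.
move=> zr rJ; apply: (@holomorphic_nearby C); apply: (nearby_disc zr) => w wr.
exact: (disc_series_derivable (@tail_disc R _ _ rJ) wr).
Qed.

Lemma coef_holomorphic j z : @holomorphic_at C (fun s => 2 * bco s 1 j.*2 * Hk j.*2 s) z.
Proof.
apply: holomorphic_entire => s.
apply: cderivableM; last exact: Hk_cderivable.
apply: cderivableM; first exact: cderivable_cst.
by apply: (disc_series_derivable (bco_disc (normc s + 1) _)); rewrite ltrDl.
Qed.

Lemma Hk0_holomorphic c z : @holomorphic_at C (fun s => Hk 0 (2 * s + c)) z.
Proof. by apply: holomorphic_entire => s; apply: (@cderivable_affine C (Hk 0)); exact: Hk_cderivable. Qed.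

(** The factor 2^s reflects that the degree is half of m n (m + n). *)
Definition FJ J s : C := natpowC 2 s * EJ J s * (den s)^-1.

Lemma FJ_meromorphic r J z : normc z < r%:R -> (r < J)%N -> @meromorphic_at C (FJ J) z.
Proof.
move=> zr rJ; apply: meromorphicM; last exact: den_meromorphic.
apply: meromorphicM; first exact/holomorphic_meromorphic/holomorphic_entire/natpowC_cderivable.
apply: meromorphicD; last exact/holomorphic_meromorphic/(tail_holomorphic zr rJ).
apply: meromorphic_sum => j; apply: meromorphicM; first exact/holomorphic_meromorphic/coef_holomorphic.
apply: meromorphicM; last exact: Zden_meromorphic.
exact/holomorphic_meromorphic/Hk0_holomorphic.
Qed.

Lemma FJ_holomorphic r J z : normc z < r%:R -> (r < J)%N -> den z != 0 ->
  (forall j, Zden j.*2%:R z != 0) -> @holomorphic_at C (FJ J) z.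
Proof.
move=> zr rJ dz Zz; apply: holomorphicM; last first.
  by apply: holomorphicV => //; apply: holomorphic_entire; exact: den_cderivable.
apply: holomorphicM; first exact/holomorphic_entire/natpowC_cderivable.
apply: holomorphicD; last exact: (tail_holomorphic zr rJ).
apply: holomorphic_sum => j; apply: holomorphicM; first exact: coef_holomorphic.
apply: holomorphicM; first exact: Hk0_holomorphic.
have hZ : @holomorphic_at C (Zden j.*2%:R) z by apply: holomorphic_entire; exact: Zden_cderivable.
exact: (holomorphicV hZ (Zz j)).
Qed.

Lemma EJ_indep J J' s : normc s <= J%:R - 1 -> normc s <= J'%:R - 1 -> EJ J s = EJ J' s.
Proof.
have climb d K : normc s <= K%:R - 1 -> EJ (d + K) s = EJ K s.
  move=> sK; elim: d => [|d IH]; first by [].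
  have sd : normc s <= (d + K)%:R - 1 by apply: le_trans sK _; rewrite lerD2r ler_nat leq_addl.
  by rewrite addSn (EJ_succ sd).
by move=> h h'; rewrite -(climb J' _ h) -(climb J _ h') addnC.
Qed.

Definition Jof s := (Num.truncn (normc s)).+2.

Lemma Jof_ge s : normc s <= (Jof s)%:R - 1.
Proof. by rewrite /Jof -natr1 addrK; exact/ltW/truncnS_gt. Qed.

(** The truncation order depends on the point, but on a whole disc around any point the value is
    that of one fixed [FJ J]. *)
Definition zetaW s : C := FJ (Jof s) s.

Lemma zetaW_FJ r J s : normc s < r%:R -> (r < J)%N -> zetaW s = FJ J s.
Proof.
move=> sr rJ; rewrite /zetaW /FJ (EJ_indep (Jof_ge s) (J' := J))//.
by apply: le_trans (ltW sr) _; rewrite lerBrDr natr1 ler_nat.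
Qed.

Lemma zetaW_nearby r J z : normc z < r%:R -> (r < J)%N ->
  @nearby C z (fun w => FJ J w = zetaW w).
Proof. by move=> zr rJ; apply: (nearby_disc zr) => w wr; rewrite (zetaW_FJ wr rJ). Qed.

Lemma zetaW_meromorphic : @meromorphic C zetaW.
Proof.
move=> z; have zr : normc z < (Num.truncn (normc z)).+1%:R by exact: truncnS_gt.
exact: meromorphic_ext (zetaW_nearby zr (ltnSn _)) (FJ_meromorphic zr (ltnSn _)).
Qed.

Section NegativeIntegers.
Variable N : nat.
Hypothesis N0 : (0 < N)%N.
Let s0 : C := - N%:R.

Lemma ipow_neg x : ipow s0 x = `|x|%N%:R ^+ N.
Proof.
rewrite /ipow /s0 opprK; case: eqVneq => [->|x0]; first by rewrite absz0 expr0n gtn_eqF.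
by rewrite natpowC_nat// absz_gt0.
Qed.

(** At s = -N the binomial series terminates: it is (1 - u)^N. *)
Lemma bco_neg k : bco s0 1 k = (-1) ^+ k * 'C(N, k)%:R.
Proof.
elim: k => [|k IH]; first by rewrite bco0 expr0 bin0 mulr1.
rewrite bcoS IH mul1r exprS /s0.
have k0 : k.+1%:R != 0 :> C by rewrite pnatr_eq0.
apply: (mulIf k0); rewrite mulrA divfK//.
have : (k.+1 * 'C(N, k.+1))%:R = ((N - k) * 'C(N, k))%:R :> C by rewrite mul_bin_left.
rewrite !natrM -!mulrA [_ * k.+1%:R]mulrC => ->.
have [kN|Nk] := leqP k N; first by rewrite natrB//; ring.
by rewrite bin_small// !mulr0 mul0r !mulr0.
Qed.

Lemma bco_neg_small k : (N < k)%N -> bco s0 1 k = 0.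
Proof. by move=> Nk; rewrite bco_neg bin_small// mulr0. Qed.

Lemma psi_neg n K x : (0 < n)%N -> (N < K)%N ->
  psi s0 n K x = (n%:Z - x)%:~R ^+ N * `|x|%N%:R ^+ N.
Proof.
move=> n0 NK; rewrite /psi ipow_neg; congr (_ * _).
rewrite /s0 opprK natpowC_nat//; have n0C : n%:R != 0 :> C by rewrite pnatr_eq0 -lt0n.
have -> : \sum_(k < K) bco s0 1 k * (x%:~R / n%:R) ^+ k = (1 - x%:~R / n%:R) ^+ N.
  rewrite -[(1 - _) ^+ N]/((1 + - (x%:~R / n%:R)) ^+ N) exprDn.
  rewrite -(subnK NK) addnC big_split_ord /= [X in _ + X]big1 ?addr0.
    apply: eq_bigr => k _; rewrite bco_neg expr1n mul1r [X in _ = X *+ _]exprNn -[RHS]mulr_natr; exact: mulrAC.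
  by move=> k _; rewrite bco_neg_small ?mul0r// addSn ltnS leq_addr.
rewrite -exprMn; congr (_ ^+ _); by rewrite rmorphB /=; field.
Qed.

(** Between 0 and n all three products coincide and one copy survives with a minus sign. Outside,
    [phi] cancels one of the two subtractions, and what remains is the same polynomial. *)
Lemma theta_neg n K x : (0 < n)%N -> (N < K)%N ->
  theta s0 n K x = - (x%:~R * (n%:Z - x)%:~R) ^+ N.
Proof.
move=> n0 NK; rewrite /theta /phi !psi_neg// !ipow_neg.
have -> : n%:Z - (n%:Z - x) = x by ring.
have pos y : 0 <= y -> `|y|%N%:R = y%:~R :> C by move=> y0; rewrite -{2}(gez0_abs y0).
have neg y : y <= 0 -> `|y|%N%:R = - y%:~R :> C.
  move=> y0; have e : y = - `|y|%N%:Z by lia.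
  by rewrite {2}e rmorphN /= opprK.
have [x0|x0] := lerP 0 x; have [xn|xn] := lerP 0 (n%:Z - x).
- by rewrite !pos// exprMn; move: (_ ^+ N) (_ ^+ N) => a b; ring.
- rewrite (pos x)// (neg (n%:Z - x)) ?ltW// exprMn [(- _) ^+ N]exprNn.
  by move: (_ ^+ N) (_ ^+ N) (_ ^+ N) => a b c; ring.
- rewrite (neg x) ?ltW// (pos (n%:Z - x))// exprMn [(- _) ^+ N]exprNn.
  by move: (_ ^+ N) (_ ^+ N) (_ ^+ N) => a b c; ring.
- by exfalso; lia.
Qed.

Lemma Rn_neg n J : (0 < n)%N -> (N < J.*2)%N -> Rn J n s0 = 0.
Proof.
move=> n0 NJ; rewrite /Rn; have -> : Asum (theta s0 n J.*2) = 0; last by rewrite mulr0.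
pose p : {poly C} := - ('X * (n%:R%:P - 'X)) ^+ N.
apply: (@Asum_poly R (size p)); exists p => // x; rewrite theta_neg// /p.
by rewrite hornerN horner_exp hornerM hornerD hornerN hornerX hornerC rmorphB.
Qed.

Lemma tail_neg J : (N < J.*2)%N -> tail J s0 = 0.
Proof.
move=> NJ; apply: tsumE; apply: has_sum_ext (@has_sum0 R nat) => h.
by rewrite Rn_neg// double_gt0.
Qed.

Lemma Asum_monomial k : Asum (fun x => x%:~R ^+ k : C) = 0.
Proof. exact: (Asum_poly (polyint_monomial R (ltnSn k))). Qed.

Lemma even_abs x k : ~~ odd k -> `|x|%N%:R ^+ k = x%:~R ^+ k :> C.
Proof.
move=> ko; have [x0|x0] := lerP 0 x; first by rewrite -{2}(gez0_abs x0).
have {2}-> : x = - `|x|%N%:Z by lia.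
by rewrite rmorphN /= exprNn -signr_odd (negbTE ko) mul1r.
Qed.

Lemma EJ_neg J : (N < J.*2)%N -> EJ J s0 = 0.
Proof.
move=> NJ; rewrite /EJ tail_neg// addr0 big1// => j _.
have [No|Ne] := boolP (odd N); last first.
  rewrite /Hk (@Asum_ext _ _ (fun x => x%:~R ^+ (j.*2 + N))) ?Asum_monomial ?mulr0 ?mul0r//.
  by move=> x; rewrite ipow_neg even_abs// exprD.
have [Nj|jN] := ltnP N j.*2; first by rewrite bco_neg_small// mulr0 !mul0r.
have e : 2 * s0 + j.*2%:R = - (N.*2 - j.*2)%N%:R.
  by rewrite natrB ?leq_double; [rewrite -[N.*2]mul2n natrM /s0; ring|lia].
suff -> : Zf (2 * s0 + j.*2%:R) = 0 by rewrite mulr0.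
rewrite /Zf /Hk (@Asum_ext _ _ (fun x => x%:~R ^+ (N.*2 - j.*2))) ?Asum_monomial ?mul0r//.
move=> x; rewrite expr0 mul1r e /ipow opprK; case: eqVneq => [->|x0].
  by rewrite expr0n; case: eqP => //; lia.
by rewrite natpowC_nat ?absz_gt0// even_abs// -doubleB odd_double.
Qed.

Lemma zetaW_neg : zetaW s0 = 0.
Proof.
have NJ : normc s0 <= N.+1%:R - 1 by rewrite -natr1 addrK /s0 normcN' normc_nat.
rewrite /zetaW /FJ (EJ_indep (Jof_ge s0) NJ) EJ_neg ?mulr0 ?mul0r//; lia.
Qed.

Lemma den_neg : den s0 != 0.
Proof.
rewrite /den /s0 opprK natpowC_nat// subr_eq0.
have -> : 4 * ((2%:R : C) ^+ N) ^+ 3 = (4 * (2 ^ N) ^ 3)%N%:R by rewrite natrM !natrX.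
rewrite -[1]/(1%:R) eqr_nat; have : (0 < (2 ^ N) ^ 3)%N by rewrite !expn_gt0.
lia.
Qed.

(** 2s + 2j is an even integer here, so its power of 2 is never 2 itself. *)
Lemma Zden_neg j : Zden j.*2%:R s0 != 0.
Proof.
rewrite /Zden mulf_neq0 ?pnatr_eq0// subr_eq0; apply/negP => /eqP.
have [Nj|jN] := leqP N j.
  have -> : 2 * s0 + j.*2%:R = (j.*2 - N.*2)%N%:R.
    by rewrite natrB ?leq_double// -[N.*2]mul2n natrM /s0; ring.
  rewrite natpowC_nat// -natrX => /eqP; rewrite -[2]/(2%:R) eqr_nat -doubleB.
  by case: (j - N)%N => [//|k]; rewrite doubleS !expnS; have : (0 < 2 ^ k.*2)%N; rewrite ?expn_gt0//; lia.
have -> : 2 * s0 + j.*2%:R = - (N.*2 - j.*2)%N%:R.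
  by rewrite natrB ?leq_double ?(ltnW jN)// -[N.*2]mul2n natrM /s0; ring.
rewrite natpowCN natpowC_nat// => h.
have : 2 * 2 ^+ (N.*2 - j.*2) = 1 :> C by rewrite {1}h mulVf// expf_neq0// pnatr_eq0.
rewrite -exprS -natrX => /eqP; rewrite -[1]/(1%:R) eqr_nat expnS; lia.
Qed.

Lemma zetaW_holomorphic_neg : @holomorphic_at C zetaW s0.
Proof.
have sr : normc s0 < N.+1%:R by rewrite /s0 normcN' normc_nat ltr_nat.
exact: holomorphic_ext (zetaW_nearby sr (ltnSn _)) (FJ_holomorphic sr (ltnSn _) den_neg Zden_neg).
Qed.

End NegativeIntegers.

(** For Re s >= 2 one has |2^-s| <= 1/4, so 4 * 2^(-3s) cannot be 1 and the factor from
    [EJ_tornheim] can be divided out. *)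
Lemma zetaW_tornheim s : 2 < Re s -> zetaW s = natpowC 2 s * tsum (tornheim s).
Proof.
move=> s2; rewrite /zetaW /FJ (EJ_tornheim (ltW s2) (Jof_ge s)) -mulrA -/(den s) [den s * _]mulrC mulfK//.
rewrite /den subr_eq0; apply/negP => /eqP/(congr1 (@normc R)).
rewrite normcM normcX normc1 normc_nat; have := natpowC_norm_le (n := 2) isT (ltW s2).
move: (normc _) (normc_ge0 (natpowC 2 (- s))) => q q0 h.
have h4 : q <= 4^-1 by apply: le_trans h _; rewrite lef_pV2 ?posrE ?exprn_gt0//; lra.
have : q ^+ 3 <= 4^-1 ^+ 3 by rewrite lerXn2r ?nnegrE ?invr_ge0.
by lra.
Qed.

Lemma has_sum_zetaW s : 2 < Re s ->
  @has_sum C (SU3_dual C) (fun rho => natpowC (deg rho) (- s)) (zetaW s).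
Proof.
move=> s2; have [f [finj fsurj fdeg]] := SU3_dual_param R.
pose g c := sval (cid (fsurj c)); have fg c : f (g c) = c by rewrite /g; case: cid.
have gf k : g (f k) = k by apply: finj; exact: fg.
have h1 : has_sum (fun k => natpowC 2 s * tornheim s k) (zetaW s).
  by rewrite zetaW_tornheim//; apply/has_sumZ/has_tsum/tornheim_summable; exact: ltW.
have term p q : natpowC (deg (f (p, q))) (- s) = natpowC 2 s * tornheim s (p.+1, q.+1).
  have d0 : (0 < deg (f (p, q)))%N by rewrite -(ltn_pmul2r (isT : (0 < 2)%N)) fdeg.
  have : natpowC (deg (f (p, q)) * 2) (- s) = natpowC (p.+1 * q.+1 * (p.+1 + q.+1)) (- s) by rewrite fdeg.
  rewrite !natpowCM// [natpowC 2 (- s)]natpowCN => e.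
  rewrite (_ : tornheim s _ = natpowC p.+1 (- s) * natpowC q.+1 (- s) * natpowC (p.+1 + q.+1) (- s))//.
  by rewrite -e mulrCA divff ?mulr1// natpowC_neq0.
(* The representation with parameters (p, q) corresponds to m = p + 1, n = q + 1; pairs with a zero
   entry have a zero term and no counterpart. *)
apply: (@has_sum_reindex _ _ _ _ _ (fun k => f (k.1.-1, k.2.-1)) (fun c => ((g c).1.+1, (g c).2.+1))) h1.
  move=> [m n]; rewrite mulf_eq0 negb_or => /andP[_ /tornheim_support[m0 n0]] /=.
  by rewrite gf /= term !prednK.
move=> c _ /=; rewrite -surjective_pairing fg; split=> //.
by rewrite -[in RHS](fg c) (surjective_pairing (g c)) term.
Qed.

End Assembly.

Theorem theorem3 (R : realType) :
  exists F : R[i] -> R[i],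
    is_witten_zeta_SU3 F /\
    forall n : nat, (0 < n)%N ->
      @holomorphic_at R[i] F (- n%:R) /\ F (- n%:R) = 0.
Proof.
exists (@zetaW R); split.
  by split; [exact: zetaW_meromorphic|exists 2 => s; exact: has_sum_zetaW].
by move=> n n0; split; [exact: zetaW_holomorphic_neg|exact: zetaW_neg].
Qed.
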